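(* Let $\Omega\subset\mathbb{R}^n$ be a domain satisfying the cone condition, and let $m\in\mathbb{N}_0$. Assume that $1<p<\infty$, $1\le r<\infty$, $0\le\alpha<n-\frac{n}{p}$ and $m>\frac{n}{p}+\alpha$. Then both $K_{p,m}^{\alpha,r}(\Omega)$ and $\dot{K}_{p,m}^{\alpha,r}(\Omega)$ are Banach algebras with respect to pointwise multiplication. That is, if $A$ denotes either of these two spaces, then $A$ is a Banach space and there is a constant $c>0$ such that for all $f,g\in A$ one has $fg\in A$ and $\|fg\|_A\le c\,\|f\|_A\,\|g\|_A$.
   Context: $\mathbb{N}=\{1,2,\dots\}$, $\mathbb{N}_0=\mathbb{N}\cup\{0\}$. A domain is a nonempty connected open set. Functions are real-valued and measurable, identified when equal almost everywhere. For $k\in\mathbb{Z}$ let $B_k=B(0,2^k)$ be the open ball in $\mathbb{R}^n$ centered at $0$ with radius $2^k$, and let $R_k=B_k\setminus B_{k-1}$. Let $\widehat{R}_k=R_k$ for $k\in\mathbb{N}$ and $\widehat{R}_0=B_0$. Write $\chi_E$ for the characteristic function of $E$, and $\|\cdot\|_p$ for the norm of $L^p(\mathbb{R}^n)$. Herz spaces. Let $\alpha\in\mathbb{R}$, $1\le p,r<\infty$. $\dot{K}_p^{\alpha,r}(\mathbb{R}^n)$ is the set of $f\in L^p_{\mathrm{loc}}(\mathbb{R}^n\setminus\{0\})$ with $\|f\|_{\dot{K}_p^{\alpha,r}(\mathbb{R}^n)}=\big(\sum_{k=-\infty}^{\infty}2^{k\alpha r}\|f\chi_{R_k}\|_p^r\big)^{1/r}<\infty$.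 $K_p^{\alpha,r}(\mathbb{R}^n)$ is the set of $f\in L^p_{\mathrm{loc}}(\mathbb{R}^n)$ with $\|f\|_{K_p^{\alpha,r}(\mathbb{R}^n)}=\|f\chi_{B_0}\|_p+\big(\sum_{k=1}^{\infty}2^{k\alpha r}\|f\chi_{R_k}\|_p^r\big)^{1/r}<\infty$. For open $\Omega$, $f:\Omega\to\mathbb{R}$ belongs to $\dot{K}_p^{\alpha,r}(\Omega)$ (resp. $K_p^{\alpha,r}(\Omega)$) if its extension by zero $f\chi_\Omega$ belongs to $\dot{K}_p^{\alpha,r}(\mathbb{R}^n)$ (resp. $K_p^{\alpha,r}(\mathbb{R}^n)$). Herz-type Sobolev spaces. For $\alpha<n-\frac{n}{p}$ (so that elements of the homogeneous space are locally integrable on $\Omega$), $\dot{K}_{p,m}^{\alpha,r}(\Omega)$ is the set of $f\in\dot{K}_p^{\alpha,r}(\Omega)$ whose weak derivatives $D^\beta f$ on $\Omega$ belong to $\dot{K}_p^{\alpha,r}(\Omega)$ for all multi-indices $|\beta|\le m$, with norm $$\|f\|_{\dot{K}_{p,m}^{\alpha,r}(\Omega)}=\Big(\sum_{k=-\infty}^{\infty}2^{k\alpha r}\Big(\sum_{|\beta|\le m}\|(D^\beta f)\chi_{R_k\cap\Omega}\|_p^p\Big)^{r/p}\Big)^{1/r}.$$ $K_{p,m}^{\alpha,r}(\Omega)$ is the set of $f\in K_p^{\alpha,r}(\Omega)$ whose weak derivatives $D^\beta f$ belong to $K_p^{\alpha,r}(\Omega)$ for all $|\beta|\le m$, with norm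 $$\|f\|_{K_{p,m}^{\alpha,r}(\Omega)}=\Big(\sum_{k=0}^{\infty}2^{k\alpha r}\Big(\sum_{|\beta|\le m}\|(D^\beta f)\chi_{\widehat{R}_k\cap\Omega}\|_p^p\Big)^{r/p}\Big)^{1/r}.$$ Banach algebra: a Banach space $A$ with an associative multiplication for which there is a constant $c>0$ with $\|fg\|_A\le c\|f\|_A\|g\|_A$ for all $f,g\in A$ (the constant need not be $1$, and no unit is required). Cone condition. A finite cone with vertex at the origin is a set $C=\{x\in\mathbb{R}^n: x=0\text{ or }0<|x|\le\delta,\ \angle(x,v)\le\kappa/2\}$, where $\delta>0$, $v\in\mathbb{R}^n\setminus\{0\}$, $0<\kappa<\pi$, and $\angle(x,v)$ is the angle between $x$ and $v$; a finite cone with vertex $x$ is a translate $x+C$ of such a set. An open set $\Omega$ satisfies the cone condition if there exists a finite cone $C$ such that every $x\in\Omega$ is the vertex of a finite cone $C_x\subset\Omega$ congruent to $C$ (i.e. obtained from $C$ by a rigid motion). *)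

(* Defs.v *)
From HB Require Import structures.
From mathcomp Require Import all_boot all_order all_algebra.
From mathcomp Require Import all_classical all_reals all_analysis.
Import Order.TTheory GRing.Theory Num.Theory.
Import numFieldNormedType.Exports.

Set Implicit Arguments.
Unset Strict Implicit.
Unset Printing Implicit Defensive.

Local Open Scope classical_set_scope.
Local Open Scope ring_scope.

(* The sigma-algebra is generated by the coordinates; for a real type this is
   the Borel sigma-algebra of R^n. *)
Section measurable_rV.
Context {d} {T : sigmaRingType d} (n : nat).

Definition rV_coord (i : 'I_n) (v : 'rV[T]_n) : T := v ord0 i.

Let rV_set0 : g_sigma_preimage rV_coord set0.
Proof. exact: sigma_algebra0. Qed.

Let rV_setC A : g_sigma_preimage rV_coord A -> g_sigma_preimage rV_coord (~` A).
Proof. exact: sigma_algebraC. Qed.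

Let rV_bigcup (F : (set 'rV[T]_n)^nat) :
  (forall i, g_sigma_preimage rV_coord (F i)) ->
  g_sigma_preimage rV_coord (\bigcup_i (F i)).
Proof. exact: sigma_algebra_bigcup. Qed.

HB.instance Definition _ := @isMeasurable.Build (measure_tuple_display d)
  'rV[T]_n (g_sigma_preimage rV_coord) rV_set0 rV_setC rV_bigcup.

End measurable_rV.

Lemma measurable_rV_coord d (T : sigmaRingType d) n (i : 'I_n) :
  measurable_fun [set: 'rV[T]_n] (rV_coord i).
Proof.
move=> _ Y mY; rewrite setTI; apply: sub_sigma_algebra => /=.
rewrite -bigcup_seq/=; exists i => /=; first by rewrite mem_index_enum.
by exists Y => //; rewrite setTI.
Qed.

Lemma measurable_fun_rVP d1 d2 (T1 : measurableType d1) (T2 : measurableType d2)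
    n (f : T1 -> 'rV[T2]_n) :
  measurable_fun [set: T1] f <->
  forall i, measurable_fun [set: T1] (rV_coord i \o f).
Proof.
split=> [mf i|mf].
  exact: measurableT_comp (@measurable_rV_coord _ T2 n i) mf.
suff H : g_sigma_preimage (fun i => rV_coord i \o f) `<=` measurable.
  rewrite g_sigma_preimage_comp in H.
  by move=> _ A mA; apply: H; exists A.
apply: smallest_sub; first exact: sigma_algebra_measurable.
rewrite -bigcup_seq => A [i _] [B mB <-]; exact: mf.
Qed.

Section lebesgue_rV.
Context {R : realType}.
Local Open Scope ereal_scope.

Definition rV_cons n (p : measurableTypeR R * 'rV[R]_n) : 'rV[R]_n.+1 :=
  row_mx (const_mx p.1 : 'rV_1) p.2.

Lemma rV_cons0 n p : @rV_cons n p ord0 ord0 = p.1.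
Proof.
rewrite /rV_cons mxE; case: splitP => j; last by [].
by rewrite mxE.
Qed.

Lemma rV_consS n p i : @rV_cons n p ord0 (lift ord0 i) = p.2 ord0 i.
Proof.
rewrite /rV_cons mxE; case: splitP => j /=; first by rewrite ord1.
by rewrite /bump/= => -[] ij; congr (p.2 _ _); apply/val_inj.
Qed.

Lemma measurable_rV_cons n : measurable_fun setT (@rV_cons n).
Proof.
apply/measurable_fun_rVP => i.
have [j ->|->] := unliftP ord0 i.
  rewrite (_ : _ \o _ = rV_coord j \o snd); last first.
    by apply/funext => p /=; rewrite /rV_coord rV_consS.
  by apply: measurableT_comp => //; exact: measurable_rV_coord.
rewrite (_ : _ \o _ = fst); first exact: measurable_fst.
by apply/funext => p /=; rewrite /rV_coord rV_cons0.
Qed.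

Definition rV_uncons n (v : 'rV[R]_n.+1) : measurableTypeR R * 'rV[R]_n :=
  (v ord0 ord0, \row_i v ord0 (lift ord0 i)).

Lemma rV_consK n : cancel (@rV_cons n) (@rV_uncons n).
Proof.
move=> [x v]; rewrite /rV_uncons rV_cons0; congr pair.
by apply/rowP => i; rewrite mxE rV_consS.
Qed.

Lemma measurable_rV_uncons n : measurable_fun setT (@rV_uncons n).
Proof.
apply/measurable_fun_pairP; split; first exact: (@measurable_rV_coord _ R).
apply/measurable_fun_rVP => i.
rewrite (_ : _ \o _ = rV_coord (lift ord0 i)); first exact: measurable_rV_coord.
by apply/funext => v /=; rewrite /rV_coord mxE.
Qed.

Section step.
Variables (n : nat) (mu : {sigma_finite_measure set 'rV[R]_n -> \bar R}).

Definition lebesgue_rV_step : set 'rV[R]_n.+1 -> \bar R :=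
  pushforward (lebesgue_measure \x mu) (@rV_cons n).

HB.instance Definition _ := Measure.copy lebesgue_rV_step
  (measure_function_pushforward__canonical__measure_function_Measure
    (lebesgue_measure \x mu) (@measurable_rV_cons n)).

Let sigma_finite_step : sigma_finite setT lebesgue_rV_step.
Proof.
have /sigma_finiteP[F [TF ndF Foo]] := sigma_finiteT (@lebesgue_measure R).
have /sigma_finiteP[G [TG ndG Goo]] := sigma_finiteT mu.
exists (fun k => @rV_uncons n @^-1` (F k `*` G k)) => [|k].
  apply/seteqP; split => // v _.
  have [i _ Fi] : (\bigcup_i F i) (v ord0 ord0) by rewrite -TF.
  have [j _ Gj] : (\bigcup_j G j) (rV_uncons v).2 by rewrite -TG.
  exists (maxn i j) => //; split.
  - by move: Fi; exact/subsetPset/ndF/leq_maxl.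
  - by move: Gj; exact/subsetPset/ndG/leq_maxr.
have [mF Fk] := Foo k; have [mG Gk] := Goo k; split.
  rewrite -[X in measurable X]setTI; apply: measurable_rV_uncons => //.
  exact: measurableX.
rewrite /lebesgue_rV_step /pushforward -comp_preimage.
rewrite (_ : _ \o _ = id); last by apply/funext => p /=; rewrite rV_consK.
by rewrite preimage_id product_measure1E// lte_mul_pinfty// ge0_fin_numE.
Qed.

HB.instance Definition _ := Measure_isSigmaFinite.Build _ _ _
  lebesgue_rV_step sigma_finite_step.

End step.

Fixpoint lebesgue_rV n : {sigma_finite_measure set 'rV[R]_n -> \bar R} :=
  if n is n'.+1 then lebesgue_rV_step (lebesgue_rV n')
  else \d_(0%R : 'rV[R]_0).

Lemma lebesgue_rV_box n (A : 'I_n -> set (measurableTypeR R)) :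
  (forall i, measurable (A i)) ->
  lebesgue_rV n [set v | forall i, A i (v ord0 i)] =
  \prod_(i < n) lebesgue_measure (A i).
Proof.
elim: n A => [|n IH] A mA.
  by rewrite big_ord0 /= diracE mem_set//= => -[].
have mB : measurable [set v : 'rV[R]_n | forall i, A (lift ord0 i) (v ord0 i)].
  rewrite (_ : mkset _ = \bigcap_(i in [set: 'I_n]) rV_coord i @^-1` A (lift ord0 i)).
    apply: fin_bigcap_measurable => // i _; rewrite -[X in measurable X]setTI.
    by apply: (@measurable_rV_coord _ R) => //; exact: mA.
  by apply/seteqP; split => v /= h i; [move=> _; exact: h|exact: (h i)].
rewrite big_ord_recl /= /lebesgue_rV_step /pushforward.
rewrite -(IH (fun i => A (lift ord0 i)))// -product_measure1E//; congr (_ _).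
apply/seteqP; split => -[x v] /=.
- by move=> h; split; [have := h ord0; rewrite rV_cons0|
    move=> i; have := h (lift ord0 i); rewrite rV_consS].
- move=> [h1 h2] i; have [j ->|->] := unliftP ord0 i; first by rewrite rV_consS.
  by rewrite rV_cons0.
Qed.

End lebesgue_rV.

Section euclidean.
Context {R : realType} {n : nat}.
Implicit Types (x y v : 'rV[R]_n) (A B C : set 'rV[R]_n).

Definition edot x y : R := \sum_(i < n) x ord0 i * y ord0 i.

(* The library norm of ['rV[R]_n] is the sup norm, hence this definition. *)
Definition enorm x : R := Num.sqrt (edot x x).

Definition angle x y : R := acos (edot x y / (enorm x * enorm y)).

(* d, v, k are the height, axis and aperture; the vertex is the origin. *)
Definition cone (d : R) v (k : R) : set 'rV[R]_n :=
  [set x | x = 0 \/ (0 < enorm x <= d /\ angle x v <= k / 2)].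

Definition finite_cone0 C : Prop :=
  exists d v k, [/\ 0 < d, v != 0, 0 < k < pi & C = cone d v k].

Definition finite_cone x C : Prop :=
  exists2 C0, finite_cone0 C0 & C = [set x + y | y in C0].

Definition congruent A B : Prop :=
  exists2 T : 'rV[R]_n -> 'rV[R]_n,
    forall x y, enorm (T x - T y) = enorm (x - y) & T @` A = B.

Definition cone_condition (Omega : set 'rV[R]_n) : Prop :=
  exists2 C, finite_cone0 C & forall x, Omega x ->
    exists Cx, [/\ finite_cone x Cx, congruent C Cx & Cx `<=` Omega].

Definition domain (Omega : set 'rV[R]_n) : Prop :=
  [/\ Omega !=set0, open Omega & connected Omega].

Definition dball (k : int) : set 'rV[R]_n := [set x | enorm x < 2 ^ k].

Definition dshell (k : int) : set 'rV[R]_n := dball k `\` dball (k - 1).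

Definition dshell_hat (k : nat) : set 'rV[R]_n :=
  if k == 0%N then dball 0 else dshell k%:Z.

End euclidean.

Section weak_derivative.
Context {R : realType} {n : nat}.
Implicit Types (Omega U : set 'rV[R]_n) (f g phi : 'rV[R]_n -> R).
Implicit Types (b : 'I_n -> nat).

Local Notation mu := (lebesgue_rV n).

Definition Lp_norm (p : R) f : \bar R := 'N[mu]_(p%:E)[EFin \o f].

Definition Lp_loc (p : R) U f : Prop :=
  measurable_fun U f /\
  forall K, compact K -> K `<=` U -> (Lp_norm p (f \_ K) < +oo)%E.

Definition partial (i : 'I_n) phi : 'rV[R]_n -> R :=
  fun x => 'D_(delta_mx ord0 i) phi x.

Definition mlength b : nat := (\sum_(i < n) b i)%N.

Definition mpartial b phi : 'rV[R]_n -> R :=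
  foldr (fun i g => iter (b i) (partial i) g) phi (enum 'I_n).

(* This is C^infty: differentiability of every iterated partial derivative
   yields their continuity. *)
Definition smooth phi : Prop :=
  forall (s : seq 'I_n) x, differentiable (foldr partial phi s) x.

Definition test_function Omega phi : Prop :=
  [/\ smooth phi, compact (closure [set x | phi x != 0]) &
      closure [set x | phi x != 0] `<=` Omega].

Definition is_weak_deriv Omega b f g : Prop :=
  [/\ Lp_loc 1 Omega f, Lp_loc 1 Omega g &
      forall phi, test_function Omega phi ->
        \int[mu]_(x in Omega) (f x * mpartial b phi x) =
        (-1) ^+ mlength b * \int[mu]_(x in Omega) (g x * phi x)].

(* A representative of the weak derivative, which is unique up to equality
   almost everywhere on Omega; meaningful only when a weak derivative exists. *)
Definition weak_deriv Omega b f : 'rV[R]_n -> R :=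
  xget (cst 0) [set g | is_weak_deriv Omega b f g].

End weak_derivative.

(* A function on Omega is represented by a total function whose values outside
   Omega are irrelevant; [f \_ Omega] is the extension by zero of its
   restriction to Omega. *)
Section herz.
Context {R : realType} {n : nat}.
Variables (alpha p r : R).
Implicit Types (f : 'rV[R]_n -> R) (Omega : set 'rV[R]_n).
Local Open Scope ereal_scope.

Definition dweight (k : int) : \bar R := (2 `^ (k%:~R * alpha * r))%:E.

Definition hherz_norm f : \bar R :=
  (\esum_(k in [set: int]) (dweight k * Lp_norm p (f \_ (dshell k)) `^ r))
    `^ r^-1.

Definition hherz f : Prop :=
  Lp_loc p (~` [set 0%R]) f /\ hherz_norm f < +oo.

Definition herz_norm f : \bar R :=
  Lp_norm p (f \_ (dball 0)) +
  (\sum_(1 <= k <oo) (dweight k%:Z * Lp_norm p (f \_ (dshell k%:Z)) `^ r))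
    `^ r^-1.

Definition herz f : Prop := Lp_loc p setT f /\ herz_norm f < +oo.

(* The multi-indices of length at most m have entries at most m, so they are
   exactly the [mindex b], b : {ffun 'I_n -> 'I_m.+1}, of length at most m. *)
Definition mindex m (b : {ffun 'I_n -> 'I_m.+1}) : 'I_n -> nat := fun i => b i.

Definition sobolev_sum (m : nat) Omega (E : set 'rV[R]_n) f : \bar R :=
  \sum_(b : {ffun 'I_n -> 'I_m.+1} | (mlength (mindex b) <= m)%N)
    Lp_norm p (weak_deriv Omega (mindex b) f \_ (E `&` Omega)) `^ p.

Definition hherz_sobolev (m : nat) Omega f : Prop :=
  hherz (f \_ Omega) /\
  forall b : 'I_n -> nat, (mlength b <= m)%N ->
    exists2 g, is_weak_deriv Omega b f g & hherz (g \_ Omega).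

Definition hherz_sobolev_norm (m : nat) Omega f : \bar R :=
  (\esum_(k in [set: int])
     (dweight k * sobolev_sum m Omega (dshell k) f `^ (r / p))) `^ r^-1.

Definition herz_sobolev (m : nat) Omega f : Prop :=
  herz (f \_ Omega) /\
  forall b : 'I_n -> nat, (mlength b <= m)%N ->
    exists2 g, is_weak_deriv Omega b f g & herz (g \_ Omega).

Definition herz_sobolev_norm (m : nat) Omega f : \bar R :=
  (\sum_(0 <= k <oo)
     (dweight k%:Z * sobolev_sum m Omega (dshell_hat k) f `^ (r / p))) `^ r^-1.

End herz.

(* [V], through the class map [cls], is the quotient of [A] by [eqv] with the
   norm induced by [N]. *)
Section banach.
Context {R : realType} {T : Type}.
Variables (A : set (T -> R)) (eqv : (T -> R) -> (T -> R) -> Prop).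
Variable N : (T -> R) -> \bar R.

Definition banach_space_of : Prop :=
  [/\ A (cst 0),
      forall (a : R) f g, A f -> A g -> A (fun x => a * f x + g x) &
      exists (V : completeNormedModType R) (cls : (T -> R) -> V),
        [/\ forall v, exists2 f, A f & cls f = v,
            forall f g, A f -> A g -> cls f = cls g <-> eqv f g,
            forall (a : R) f g, A f -> A g ->
              cls (fun x => a * f x + g x) = a *: cls f + cls g &
            forall f, A f -> N f = `|cls f|%:E]].

Definition banach_algebra_of : Prop :=
  banach_space_of /\
  exists2 c : R, 0 < c & forall f g, A f -> A g ->
    A (fun x => f x * g x) /\
    (N (fun x => (f x * g x)%R) <= c%:E * N f * N g)%E.

End banach.

(* Main.v *)
(* Let J f be the sum of the |D^b f| over |b| <= m. By the cone condition almost
   every point of Omega starts a cube's worth of segments lying in Omega, and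
   averaging the fundamental theorem of calculus over them bounds a derivative of
   order i < m by a local potential of order m - i of J f. By the Leibniz rule it
   remains to estimate, in the Herz norm, a product of potentials of orders k and
   l of F and G with k + l >= m, and the potential of order m of G uniformly.
   Potentials are decomposed into averages at the scales 2^-j. Hoelder's
   inequality with a weight |y|^beta such that beta p' < n bounds an average of F
   by a p-th root of an average of (F |y|^beta)^p, a product of two averages is
   integrated at the finer of the two scales, and m > n / p + beta makes the
   double series over the scales geometric. Away from the origin beta = 0 and
   only neighbouring shells interact. At the origin, for the homogeneous space,
   beta = alpha + eps leaves a factor 2^(k eps) on the k-th shell, which is
   summable as k tends to -oo. For completeness, the derivatives of a fast Cauchy
   sequence converge almost everywhere and locally in L^1, so that weak
   derivatives pass to the limit. *)

Require Import Defs.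
From HB Require Import structures.
From mathcomp Require Import all_boot all_order all_algebra.
From mathcomp Require Import all_classical all_reals all_analysis.
From mathcomp Require Import measurable_realfun ring lra.
Import Order.TTheory GRing.Theory Num.Theory.
Import numFieldNormedType.Exports.

Set Implicit Arguments.
Unset Strict Implicit.
Unset Printing Implicit Defensive.

Local Open Scope classical_set_scope.
Local Open Scope ring_scope.

(** * Lebesgue measure on the space of row vectors *)

(** Both spaces are handled at once: the norm [hn] is an [\ell^q] sum of weighted [L^p] norms over
    an abstract sequence of shells, and only the last sections know the actual shells. The Leibniz
    rule is obtained without mollification. A weak derivative in a direction amounts to the
    fundamental theorem of calculus on almost every segment, and that property is stable under
    products, by integration by parts for primitives of integrable functions. The radius of the
    potentials must be small, so that a translate outside the unit ball changes the shell index by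
    at most one; the cone can be shrunk at no cost. Near the origin Hoelder's inequality needs
    [|y| ^ (- beta p')] locally integrable, that is [beta < n - n / p]; the strict hypotheses leave
    room for [beta = alpha + eps]. The small measure of the shells must be exploited as well: with
    [eta = 2 eps p / n] the shell of index [k] contributes [2 ^ (2 eps k)], while the weights lose
    only [2 ^ (- eps k)]. Derivatives of order [m] have no potential bound; in a product the other
    factor then has order 0 and is bounded uniformly. *)

Section rV_measure.
Context {R : realType} {n : nat}.
Notation X := 'rV[R]_n.
Notation mu := (lebesgue_rV n).
Implicit Types (a b x v w : X).

Lemma coord_le_norm x i : `|x ord0 i| <= `|x|.
Proof.
rewrite [leRHS]/Num.norm/= mx_normrE.
exact: (le_bigmax _ (fun ij : 'I_1 * 'I_n => `|x ij.1 ij.2|) (ord0, i)).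
Qed.

Lemma norm_rV_lt x (e : R) : 0 < e -> (forall i, `|x ord0 i| < e) -> `|x| < e.
Proof.
move=> e0 xe; rewrite [ltLHS]/Num.norm/= mx_normrE.
by apply/bigmax_ltP; split=> // -[i j] _ /=; rewrite (ord1 i).
Qed.

Lemma norm_rV_le x (e : R) : 0 <= e -> (forall i, `|x ord0 i| <= e) -> `|x| <= e.
Proof.
move=> e0 xe; rewrite [leLHS]/Num.norm/= mx_normrE.
by apply/bigmax_leP; split=> // -[i j] _ /=; rewrite (ord1 i).
Qed.

Definition obox a b : set X := [set v | forall i, v ord0 i \in `]a ord0 i, b ord0 i[].

Lemma measurable_obox a b : measurable (obox a b).
Proof.
rewrite (_ : obox a b = \bigcap_(i in [set: 'I_n])
    rV_coord i @^-1` `]a ord0 i, b ord0 i[%classic); last first.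
  by apply/seteqP; split => v /= h i; [move=> _; exact: h|exact: (h i)].
apply: fin_bigcap_measurable => // i _; rewrite -[X in measurable X]setTI.
exact: (@measurable_rV_coord _ R).
Qed.

Lemma obox_setI a b c d : obox a b `&` obox c d =
  obox (\row_i Num.max (a ord0 i) (c ord0 i)) (\row_i Num.min (b ord0 i) (d ord0 i)).
Proof.
apply/seteqP; split => [v [h1 h2] i|v h].
  rewrite in_itv/= !mxE gt_max lt_min.
  have := h1 i; have := h2 i; rewrite !in_itv/= => /andP[h3 h4] /andP[h5 h6].
  by rewrite h3 h4 h5 h6.
split=> i; have := h i; rewrite !in_itv/= !mxE gt_max lt_min;
  by move=> /andP[/andP[h1 h2] /andP[h3 h4]]; rewrite ?h1 ?h2 ?h3 ?h4.
Qed.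

(** The rational corners lie within [e / 4] of [x] in each coordinate, so the box fits in the ball
    of radius [e / 2]. *)
Lemma open_rat_obox (A : set X) x : open A -> A x ->
  exists q : 'rV[rat]_n * 'rV[rat]_n,
    obox (map_mx ratr q.1) (map_mx ratr q.2) x /\
    obox (map_mx ratr q.1) (map_mx ratr q.2) `<=` A.
Proof.
move=> oA Ax; have [e /= e0 xeA] := open_subball oA Ax.
have /choice[q1 q1P] : forall i : 'I_n, exists q, ratr q \in `]x ord0 i - e / 4, x ord0 i[.
  by move=> i; apply: rat_in_itvoo; rewrite ltrBlDr ltrDl divr_gt0.
have /choice[q2 q2P] : forall i : 'I_n, exists q, ratr q \in `]x ord0 i, x ord0 i + e / 4[.
  by move=> i; apply: rat_in_itvoo; rewrite ltrDl divr_gt0.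
exists (\row_i q1 i, \row_i q2 i) => /=; split => [i|v vq].
  rewrite !mxE; have := q1P i; have := q2P i; rewrite !in_itv/=.
  by move=> /andP[-> _] /andP[_ ->].
apply: (xeA (e / 2)) => //=; rewrite ?divr_gt0//.
  by rewrite sub0r normrN gtr0_norm ?divr_gt0// ltr_pdivrMr// ltr_pMr// ltr1n.
rewrite mx_norm_ball /ball_/=; apply: norm_rV_lt; first by rewrite divr_gt0.
move=> i; have := vq i; have := q1P i; have := q2P i; rewrite !mxE !in_itv/= ltr_norml.
by move=> /andP[? ?] /andP[? ?] /andP[? ?]; apply/andP; split; lra.
Qed.

(** There are countably many boxes with rational corners, and they form a base. This ties the
    topology to the sigma-algebra, which is generated by the coordinates. *)
Lemma open_measurable_rV (A : set X) : open A -> measurable A.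
Proof.
move=> oA; pose B (q : 'rV[rat]_n * 'rV[rat]_n) :=
  obox (map_mx ratr q.1) (map_mx ratr q.2) : set X.
rewrite (_ : A = \bigcup_q (if `[< B q `<=` A >] then B q else set0)); last first.
  apply/seteqP; split => [x /(open_rat_obox oA)[q [xq qA]]|x [q _]].
    by exists q => //; rewrite asboolT.
  by case: asboolP => // + Bx; exact.
apply: countable_bigcupT_measurable; first exact: countableP.
by move=> q; case: asboolP => // _; exact: measurable_obox.
Qed.

Lemma closed_measurable_rV (A : set X) : closed A -> measurable A.
Proof. by move/closed_openC/open_measurable_rV/measurableC; rewrite setCK. Qed.

Lemma continuous_measurable_rV (f : X -> R) :
  continuous f -> measurable_fun setT f.
Proof.
move=> /continuousP cf; apply: (measurability _ (RGenOpens.measurableE R)).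
move=> _ [_ [a [b ->] <-]]; rewrite setTI; apply: open_measurable_rV.
exact/cf/interval_open.
Qed.

Definition oboxes : set (set X) := [set A | exists a b, A = obox a b].

Lemma oboxes_setI : setI_closed oboxes.
Proof. by move=> _ _ [a [b ->]] [c [d ->]]; rewrite obox_setI; do 2 eexists. Qed.

Definition cube (k : nat) : set X := obox (const_mx (- k%:R)) (const_mx k%:R).

(** The case [k = 0] is excluded because in dimension 0 every box is the whole space, while no norm
    is below 0. *)
Lemma cubeE k : (0 < k)%N -> cube k = [set x | `|x| < k%:R].
Proof.
move=> k0; apply/seteqP; split => [x xk|x xk i].
  apply: norm_rV_lt; first by rewrite ltr0n.
  by move=> i; have := xk i; rewrite in_itv/= !mxE ltr_norml.
by rewrite in_itv/= !mxE -ltr_norml; apply: le_lt_trans xk; exact: coord_le_norm.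
Qed.

Lemma cube_cover : \bigcup_k cube k = setT.
Proof.
apply/seteqP; split => // x _; exists (Num.bound `|x|).+1 => //.
rewrite cubeE//= (lt_le_trans (archi_boundP (normr_ge0 x)))// ler_nat.
exact: leqnSn.
Qed.

(** A slab in one coordinate is not a box but a countable union of boxes truncated at [k] in the
    other coordinates. *)
Lemma measurable_rVE : @measurable _ X = <<s oboxes >>.
Proof.
apply/seteqP; split; last first.
  apply: smallest_sub; first exact: sigma_algebra_measurable.
  by move=> _ [a [b ->]]; exact: measurable_obox.
apply: smallest_sub; first exact: smallest_sigma_algebra.
rewrite -bigcup_seq => A [i _] [B mB <-]; rewrite setTI.
suff mi : measurable_fun [set: g_sigma_algebraType oboxes]
    (fun v : g_sigma_algebraType oboxes => (v : X) ord0 i).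
  by have := mi measurableT B mB; rewrite setTI.
apply: (measurability _ (RGenOpens.measurableE R)).
move=> _ [_ [a [b ->] <-]]; rewrite setTI.
rewrite (_ : _ @^-1` _ = \bigcup_(k : nat)
    obox (\row_j if j == i then a else - k%:R) (\row_j if j == i then b else k%:R)).
  apply: bigcupT_measurable => k; apply: sub_sigma_algebra.
  by do 2 eexists.
apply/seteqP; split => v /=.
  move=> vab; have /= [k _ vk] : (\bigcup_k cube k) v by rewrite cube_cover.
  exists k => // j; rewrite in_itv/= !mxE; case: eqP => [->|_] //.
  by have := vk j; rewrite in_itv/= !mxE.
by move=> [k _] /(_ i); rewrite !mxE eqxx.
Qed.

Lemma cube_oboxes k : oboxes (cube k). Proof. by do 2 eexists. Qed.

(** The boxes form a pi-system exhausted by the cubes. This serves twice: for the affine change of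
    variables, and in the fundamental lemma, where two densities are compared on boxes. *)
Lemma measure_rV_unique (m1 m2 : {measure set X -> \bar R}) :
  (forall a b, m1 (obox a b) = m2 (obox a b)) ->
  (forall k, (m1 (cube k) < +oo)%E) ->
  forall A, measurable A -> m1 A = m2 A.
Proof.
move=> m12 fin; apply: (measure_unique oboxes cube) => //.
- exact: measurable_rVE.
- exact: oboxes_setI.
- exact: cube_oboxes.
- exact: cube_cover.
- by move=> _ [a [b ->]].
Qed.

Lemma lebesgue_obox a b : mu (obox a b) =
  (\prod_(i < n) Num.max 0 (b ord0 i - a ord0 i))%:E.
Proof.
rewrite (lebesgue_rV_box (A := fun i => `]a ord0 i, b ord0 i[%classic))//.
rewrite -prodEFin; apply: eq_bigr => i _; rewrite lebesgue_measure_itv/= lte_fin.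
by case: ltP => ab; rewrite -?EFinB; congr EFin;
  [rewrite max_r// subr_ge0 ltW|rewrite max_l// subr_le0].
Qed.

Lemma lebesgue_cube k : mu (cube k) = ((k%:R *+ 2) ^+ n)%:E.
Proof.
rewrite lebesgue_obox; congr EFin.
rewrite (eq_bigr (fun=> k%:R *+ 2)) ?prodr_const ?card_ord// => i _.
by rewrite !mxE opprK -mulr2n max_r// mulrn_wge0.
Qed.

Definition affine x (t : R) w : X := x + t *: w.

Lemma measurable_affine x t : measurable_fun setT (affine x t).
Proof.
apply/measurable_fun_rVP => i.
rewrite (_ : _ \o _ = fun w : X => x ord0 i + t * w ord0 i); last first.
  by apply/funext => w /=; rewrite /rV_coord /affine !mxE.
apply: measurable_funD => //; apply: measurable_funM => //.
exact: (@measurable_rV_coord _ R).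
Qed.

(** Both sides are measures in [A], and an affine preimage of a box is a box, so uniqueness reduces
    the claim to the volume of boxes. *)
Lemma lebesgue_affine x (t : R) (A : set X) : 0 < t -> measurable A ->
  (mu A = (t ^+ n)%:E * mu (affine x t @^-1` A))%E.
Proof.
move=> t0 mA.
have tn0 : 0 <= t ^+ n by rewrite exprn_ge0// ltW.
pose m2 : {measure set X -> \bar R} :=
  mscale (NngNum tn0) (measure_function_pushforward__canonical__measure_function_Measure
    mu (measurable_affine x t)).
rewrite -[RHS]/(m2 A).
apply: (@measure_rV_unique mu m2) => //; last first.
  by move=> k; apply: (@le_lt_trans _ _ (mu (cube k))) => //; rewrite lebesgue_cube ltry.
move=> a b; transitivity (mu (obox a b)) => //; rewrite /m2 /= /mscale /= /pushforward.
rewrite (_ : _ @^-1` _ = obox (t^-1 *: (a - x)) (t^-1 *: (b - x))).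
  rewrite !lebesgue_obox -EFinM; congr EFin.
  rewrite -[X in t ^+ X]card_ord -prodr_const -big_split/=; apply: eq_bigr => i _.
  rewrite !mxE -mulrBr.
  rewrite (_ : b ord0 i - x ord0 i - (a ord0 i - x ord0 i) = b ord0 i - a ord0 i); last by ring.
  rewrite -[X in t * Num.max X _](mulr0 t^-1) -maxr_pMr ?invr_ge0 ?ltW//.
  by rewrite mulrA mulfV ?gt_eqF// mul1r.
apply/seteqP; split => w /= h i; have := h i; rewrite !in_itv/= /affine !mxE.
  move=> /andP[h1 h2]; rewrite ltr_pdivrMl// ltr_pdivlMl//.
  by rewrite ltrBlDl h1 ltrBrDl h2.
by rewrite ltr_pdivrMl// ltr_pdivlMl// ltrBlDl ltrBrDl.
Qed.

Lemma ge0_integral_affine x (t : R) (f : X -> \bar R) : 0 < t ->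
  measurable_fun setT f -> (forall v, 0 <= f v)%E ->
  (\int[mu]_v f v = (t ^+ n)%:E * \int[mu]_w f (x + t *: w)%R)%E.
Proof.
move=> t0 mf f0.
have tn0 : 0 <= t ^+ n by rewrite exprn_ge0// ltW.
pose m1 : {measure set X -> \bar R} :=
  measure_function_pushforward__canonical__measure_function_Measure
    mu (measurable_affine x t).
transitivity (\int[mscale (NngNum tn0) m1]_v f v)%E.
  by apply: eq_measure_integral => A mA _; exact: (lebesgue_affine x t0).
rewrite ge0_integral_mscale//; congr (_ * _)%E.
by rewrite ge0_integral_pushforward//; exact: measurable_affine.
Qed.

Lemma ge0_integral_shift x (f : X -> \bar R) :
  measurable_fun setT f -> (forall v, 0 <= f v)%E ->
  (\int[mu]_v f (x + v)%R = \int[mu]_v f v)%E.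
Proof.
move=> mf f0; rewrite (ge0_integral_affine x ltr01 mf f0) expr1n mul1e.
by under [RHS]eq_integral do rewrite scale1r.
Qed.

Lemma measurable_shift x : measurable_fun setT (fun v : X => x + v).
Proof.
rewrite (_ : (fun _ => _) = affine x 1); first exact: measurable_affine.
by apply/funext => v; rewrite /affine scale1r.
Qed.

Lemma integrable_shift x (f : X -> \bar R) :
  mu.-integrable setT f -> mu.-integrable setT (fun v => f (x + v)).
Proof.
move=> /integrableP[mf fi]; apply/integrableP; split.
  by apply: measurableT_comp => //; exact: measurable_shift.
rewrite (ge0_integral_shift x (f := fun v => `|f v|%E))//.
exact: measurableT_comp.
Qed.

Lemma integral_shift x (f : X -> \bar R) : measurable_fun setT f ->
  (\int[mu]_v f (x + v)%R = \int[mu]_v f v)%E.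
Proof.
move=> mf; rewrite [LHS]integralE [RHS]integralE.
congr (_ - _)%E.
  rewrite -[RHS](ge0_integral_shift x (measurable_funepos mf) (funepos_ge0 f)).
  by apply: eq_integral => v _; rewrite !funeposE.
rewrite -[RHS](ge0_integral_shift x (measurable_funeneg mf) (funeneg_ge0 f)).
by apply: eq_integral => v _; rewrite !funenegE.
Qed.

End rV_measure.

(** * Minkowski inequalities *)

Section Lnorm_ge0.
Context d {T : measurableType d} {R : realType} (mu : {measure set T -> \bar R}).
Local Open Scope ereal_scope.
Implicit Types (f g : T -> \bar R) (p : R).

Lemma ge0_LnormE p f : p != 0%R -> (forall x, 0 <= f x) ->
  'N[mu]_p%:E[f] = (\int[mu]_x (f x `^ p)) `^ p^-1.
Proof.
move=> p0 f0; rewrite unlock /Lnorm; congr (_ `^ _).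
by apply: eq_integral => x _; rewrite gee0_abs.
Qed.

Lemma ge0_poweR_Lnorm p f : p != 0%R -> (forall x, 0 <= f x) ->
  'N[mu]_p%:E[f] `^ p = \int[mu]_x (f x `^ p).
Proof.
move=> p0 f0; rewrite poweR_Lnorm//.
by apply: eq_integral => x _; rewrite gee0_abs.
Qed.

Lemma measurable_poweRT f p : measurable_fun setT f ->
  measurable_fun setT (fun x => f x `^ p).
Proof. by move=> mf; exact: (measurableT_comp (measurable_poweR p) mf). Qed.

Lemma ge0_le_poweR p (x y : \bar R) : (0 <= p)%R -> 0 <= x -> x <= y -> x `^ p <= y `^ p.
Proof.
move=> p0 x0 xy; apply: gt0_ler_poweR => //; rewrite in_itv/= leey andbT//.
exact: le_trans xy.
Qed.

Lemma poweRK p (x : \bar R) : p != 0%R -> 0 <= x -> (x `^ p) `^ p^-1 = x.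
Proof. by move=> p0 x0; rewrite -poweRrM mulfV// poweRe1. Qed.

Lemma poweRVK p (x : \bar R) : p != 0%R -> 0 <= x -> (x `^ p^-1) `^ p = x.
Proof. by move=> p0 x0; rewrite -poweRrM mulVf// poweRe1. Qed.

Lemma le_of_poweR p (x y : \bar R) : (0 < p)%R -> 0 <= x -> 0 <= y ->
  x `^ p <= y `^ p -> x <= y.
Proof.
move=> p0 x0 y0 xy; rewrite -(@poweRK p x) ?gt_eqF// -(@poweRK p y) ?gt_eqF//.
apply: ge0_le_poweR => //; first by rewrite invr_ge0 ltW.
exact: poweR_ge0.
Qed.

Lemma ae_le_Lnorm p f g : (0 < p)%R ->
  measurable_fun setT f -> measurable_fun setT g ->
  (forall x, 0 <= f x) -> (forall x, 0 <= g x) ->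
  {ae mu, forall x, f x <= g x} -> 'N[mu]_p%:E[f] <= 'N[mu]_p%:E[g].
Proof.
move=> p0 mf mg f0 g0 fg; rewrite !ge0_LnormE ?gt_eqF//.
apply: ge0_le_poweR; first by rewrite invr_ge0 ltW.
  by apply: integral_ge0 => x _; exact: poweR_ge0.
apply: ae_ge0_le_integral => //.
- by move=> x _; exact: poweR_ge0.
- exact: measurable_poweRT.
- by move=> x _; exact: poweR_ge0.
- exact: measurable_poweRT.
- by apply: filterS fg => x fgx _; apply: ge0_le_poweR => //; exact: ltW.
Qed.

Lemma le_Lnorm p f g : (0 < p)%R ->
  measurable_fun setT f -> measurable_fun setT g ->
  (forall x, 0 <= f x) -> (forall x, f x <= g x) ->
  'N[mu]_p%:E[f] <= 'N[mu]_p%:E[g].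
Proof.
move=> p0 mf mg f0 fg; apply: ae_le_Lnorm => //; last exact/aeW.
by move=> x; exact: le_trans (fg x).
Qed.

Lemma ge0_LnormZ p (c : \bar R) f : (0 < p)%R -> measurable_fun setT f ->
  (forall x, 0 <= f x) -> 0 <= c ->
  'N[mu]_p%:E[(fun x => c * f x)] = c * 'N[mu]_p%:E[f].
Proof.
move=> p0 mf f0 c0; rewrite !ge0_LnormE ?gt_eqF//; last first.
  by move=> x; exact: mule_ge0.
under eq_integral do rewrite poweRM//.
rewrite ge0_integralZl//; [|exact: measurable_poweRT|by move=> x _; exact: poweR_ge0|exact: poweR_ge0].
by rewrite poweRM ?poweR_ge0 ?integral_ge0// ?poweRK ?gt_eqF// => x _; exact: poweR_ge0.
Qed.

Lemma Lnorm_lty_ae p f : (0 < p)%R -> measurable_fun setT f ->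
  (forall x, 0 <= f x) -> 'N[mu]_p%:E[f] < +oo -> {ae mu, forall x, f x < +oo}.
Proof.
move=> p0 mf f0 foo.
have iF : mu.-integrable setT (fun x => f x `^ p).
  apply/integrableP; split; first exact: measurable_poweRT.
  under eq_integral do rewrite gee0_abs ?poweR_ge0//.
  by rewrite -ge0_poweR_Lnorm ?gt_eqF// poweR_lty.
have := integrable_ae measurableT iF.
apply: filterS => x /(_ I) fx; apply: (@lty_poweRy _ _ p); rewrite ?gt_eqF//.
by rewrite -ge0_fin_numE// poweR_ge0.
Qed.

(** Reduction of extended values to the real inequality: an infinite norm makes the bound trivial,
    and otherwise both functions are finite almost everywhere and may be replaced by [fine]. *)
Lemma ge0_minkowski p f g : (1 <= p)%R ->
  measurable_fun setT f -> measurable_fun setT g ->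
  (forall x, 0 <= f x) -> (forall x, 0 <= g x) ->
  'N[mu]_p%:E[(fun x => f x + g x)] <= 'N[mu]_p%:E[f] + 'N[mu]_p%:E[g].
Proof.
move=> p1 mf mg f0 g0; have p0 : (0 < p)%R by exact: lt_le_trans p1.
have [fy|foo] := eqVneq 'N[mu]_p%:E[f] +oo.
  by rewrite fy addye ?leey// -ltNye (lt_le_trans _ (Lnorm_ge0 _ _ _)).
have [gy|goo] := eqVneq 'N[mu]_p%:E[g] +oo.
  by rewrite gy addey ?leey// -ltNye (lt_le_trans _ (Lnorm_ge0 _ _ _)).
rewrite -ltey in foo; rewrite -ltey in goo.
pose f' := fine \o f; pose g' := fine \o g.
have mf' : measurable_fun setT f' by exact: measurableT_comp.
have mg' : measurable_fun setT g' by exact: measurableT_comp.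
have mink := minkowski_EFin mu mf' mg' p1.
have aef : {ae mu, forall x, f x = (f' x)%:E}.
  apply: filterS (Lnorm_lty_ae p0 mf f0 foo) => x fx.
  by rewrite /f' /= fineK// ge0_fin_numE.
have aeg : {ae mu, forall x, g x = (g' x)%:E}.
  apply: filterS (Lnorm_lty_ae p0 mg g0 goo) => x fx.
  by rewrite /g' /= fineK// ge0_fin_numE.
have f'0 x : (0 <= f' x)%R by rewrite fine_ge0.
have g'0 x : (0 <= g' x)%R by rewrite fine_ge0.
apply: (@le_trans _ _ 'N[mu]_p%:E[EFin \o (f' \+ g')%R]).
  apply: ae_le_Lnorm => //=.
  - exact: emeasurable_funD.
  - by apply/measurable_EFinP; exact: measurable_funD.
  - by move=> x; exact: adde_ge0.
  - by move=> x; rewrite lee_fin addr_ge0.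
  - by apply: filterS2 aef aeg => x -> ->.
apply: (le_trans mink); apply: leeD.
  apply: ae_le_Lnorm => //=; [exact/measurable_EFinP|].
  by apply: filterS aef => x <-.
apply: ae_le_Lnorm => //=; [exact/measurable_EFinP|].
by apply: filterS aeg => x <-.
Qed.

Lemma measurable_nneseries (f : nat -> T -> \bar R) :
  (forall j, measurable_fun setT (f j)) -> (forall j x, 0 <= f j x) ->
  measurable_fun setT (fun x => \sum_(0 <= j <oo) f j x).
Proof. by move=> mf f0; apply: ge0_emeasurable_sum. Qed.

Lemma Lnorm_sum_le p (f : nat -> T -> \bar R) J : (1 <= p)%R ->
  (forall j, measurable_fun setT (f j)) -> (forall j x, 0 <= f j x) ->
  'N[mu]_p%:E[(fun x => \sum_(0 <= j < J) f j x)] <= \sum_(0 <= j < J) 'N[mu]_p%:E[f j].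
Proof.
move=> p1 mf f0; have p0 : (0 < p)%R by exact: lt_le_trans p1.
elim: J => [|J IH].
  rewrite big_nil; under eq_Lnorm do rewrite big_nil.
  by rewrite (Lnorm0 _ _) ?eqe ?gt_eqF.
rewrite big_nat_recr//=; under eq_Lnorm do rewrite big_nat_recr//=.
apply: le_trans (ge0_minkowski p1 _ (mf J) _ (f0 J)) _.
- exact: emeasurable_sum.
- by move=> x; exact: sume_ge0.
- exact: leeD.
Qed.

Lemma nondecreasing_nneseries (u : (\bar R)^nat) : (forall j, 0 <= u j) ->
  nondecreasing_seq (fun J => \sum_(0 <= j < J) u j).
Proof. by move=> u0; exact: ereal_nondecreasing_series. Qed.

(** The bound is moved to the partial sums by taking [p]-th roots before the limit, which avoids
    continuity of the power on the extended line. *)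
Lemma nneseries_poweR_le p (u : (\bar R)^nat) (M : \bar R) : (0 < p)%R ->
  (forall j, 0 <= u j) -> (forall J, (\sum_(0 <= j < J) u j) `^ p <= M) ->
  (\sum_(0 <= j <oo) u j) `^ p <= M.
Proof.
move=> p0 u0 uM; have M0 : 0 <= M by apply: le_trans (uM 0%N); exact: poweR_ge0.
have -> : M = (M `^ p^-1) `^ p by rewrite poweRVK// gt_eqF.
apply: ge0_le_poweR; first exact: ltW.
  exact: nneseries_ge0.
apply: lime_le; first exact: is_cvg_nneseries.
apply: nearW => J; rewrite -(@poweRK p (\sum_(0 <= j < J) u j)) ?gt_eqF ?sume_ge0//.
apply: ge0_le_poweR => //; first by rewrite invr_ge0 ltW.
exact: poweR_ge0.
Qed.

(** Monotone convergence is applied to the [p]-th powers of the partial sums, each of which obeys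
    the finite inequality. *)
Lemma Lnorm_nneseries_le p (f : nat -> T -> \bar R) : (1 <= p)%R ->
  (forall j, measurable_fun setT (f j)) -> (forall j x, 0 <= f j x) ->
  'N[mu]_p%:E[(fun x => \sum_(0 <= j <oo) f j x)] <= \sum_(0 <= j <oo) 'N[mu]_p%:E[f j].
Proof.
move=> p1 mf f0; have p0 : (0 < p)%R by exact: lt_le_trans p1.
pose S J x := \sum_(0 <= j < J) f j x.
have S0 J x : 0 <= S J x by exact: sume_ge0.
have mS J : measurable_fun setT (S J) by exact: emeasurable_sum.
have N0 J : 0 <= 'N[mu]_p%:E[f J] by exact: Lnorm_ge0.
have ndS x : nondecreasing_seq (fun J => S J x `^ p).
  move=> i j ij; apply: ge0_le_poweR => //; first exact: ltW.
  exact: nondecreasing_nneseries.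
have SE x : (\sum_(0 <= j <oo) f j x) `^ p = limn (fun J => S J x `^ p).
  apply/eqP; rewrite eq_le; apply/andP; split.
    apply: nneseries_poweR_le => // J.
    apply: lime_ge; first exact: ereal_nondecreasing_is_cvgn.
    by exists J => // k /= Jk; exact: ndS.
  apply: lime_le; first exact: ereal_nondecreasing_is_cvgn.
  apply: nearW => J; apply: ge0_le_poweR => //; first exact: ltW.
  exact: nneseries_lim_ge.
apply: (@le_of_poweR p) => //; [exact: Lnorm_ge0|exact: nneseries_ge0|].
rewrite ge0_poweR_Lnorm ?gt_eqF//; last by move=> x; exact: nneseries_ge0.
under eq_integral do rewrite SE.
rewrite monotone_convergence//; last 2 first.
- by move=> J; exact: measurable_poweRT.
- by move=> J x _; exact: poweR_ge0.
apply: lime_le.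
  apply: ereal_nondecreasing_is_cvgn => i j ij; apply: ge0_le_integral => //.
  - by move=> x _; exact: poweR_ge0.
  - exact: measurable_poweRT.
  - exact: measurable_poweRT.
  - by move=> x _; exact: ndS.
apply: nearW => J; rewrite -ge0_poweR_Lnorm ?gt_eqF//.
apply: ge0_le_poweR; [exact: ltW|exact: Lnorm_ge0|].
apply: le_trans (Lnorm_sum_le J p1 mf f0) _.
exact: nneseries_lim_ge.
Qed.

End Lnorm_ge0.

Section ell.
Context {R : realType}.
Local Open Scope ereal_scope.
Implicit Types (x y : nat -> \bar R) (s : R).

(** An explicit series, to match the shape of the Herz norms; [ellE] identifies it with the norm for
    the counting measure, whence Minkowski's inequality. *)
Definition ell s x : \bar R := (\sum_(0 <= k <oo) x k `^ s) `^ s^-1.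

Lemma ellE s x : (0 < s)%R -> (forall k, 0 <= x k) -> ell s x = 'N[counting]_s%:E[x].
Proof.
move=> s0 x0; rewrite Lnorm_counting//; congr (_ `^ _).
by apply: eq_eseriesr => k _; rewrite gee0_abs.
Qed.

Lemma ell_ge0 s x : 0 <= ell s x. Proof. exact: poweR_ge0. Qed.

Lemma poweR_ell s x : (0 < s)%R -> ell s x `^ s = \sum_(0 <= k <oo) x k `^ s.
Proof.
by move=> s0; rewrite poweRVK ?gt_eqF//; apply: nneseries_ge0 => k _ _; exact: poweR_ge0.
Qed.

Lemma le_ell s x y : (0 < s)%R -> (forall k, 0 <= x k) -> (forall k, x k <= y k) ->
  ell s x <= ell s y.
Proof.
move=> s0 x0 xy; apply: ge0_le_poweR; first by rewrite invr_ge0 ltW.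
  by apply: nneseries_ge0 => k _ _; exact: poweR_ge0.
apply: lee_nneseries => k *; first exact: poweR_ge0.
by apply: ge0_le_poweR => //; exact: ltW.
Qed.

Lemma ellZ s (c : \bar R) x : (0 < s)%R -> 0 <= c -> (forall k, 0 <= x k) ->
  ell s (fun k => c * x k) = c * ell s x.
Proof.
move=> s0 c0 x0; rewrite !ellE//; first exact: ge0_LnormZ.
by move=> k; exact: mule_ge0.
Qed.

Lemma ellD s x y : (1 <= s)%R -> (forall k, 0 <= x k) -> (forall k, 0 <= y k) ->
  ell s (fun k => x k + y k) <= ell s x + ell s y.
Proof.
move=> s1 x0 y0; have s0 : (0 < s)%R by exact: lt_le_trans s1.
rewrite !ellE//; first exact: ge0_minkowski.
by move=> k; exact: adde_ge0.
Qed.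

Lemma ell_nneseries s (x : nat -> nat -> \bar R) : (1 <= s)%R ->
  (forall j k, 0 <= x j k) ->
  ell s (fun k => \sum_(0 <= j <oo) x j k) <= \sum_(0 <= j <oo) ell s (x j).
Proof.
move=> s1 x0; have s0 : (0 < s)%R by exact: lt_le_trans s1.
rewrite ellE//; last by move=> k; exact: nneseries_ge0.
under [leRHS]eq_eseriesr do rewrite ellE//.
exact: Lnorm_nneseries_le.
Qed.

Lemma ell_ub s x k : (0 < s)%R -> (forall k, 0 <= x k) -> x k <= ell s x.
Proof.
move=> s0 x0; apply: (@le_of_poweR _ s) => //; first exact: ell_ge0.
rewrite poweR_ell//.
apply: le_trans (nneseries_lim_ge k.+1 _) => [|i _ _]; last exact: poweR_ge0.
rewrite big_nat_recr//= leeDr// sume_ge0// => i _; exact: poweR_ge0.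
Qed.

Lemma reindex_ell s x (e : nat -> nat) : bijective e -> ell s (x \o e) = ell s x.
Proof.
move=> be; rewrite /ell; congr (_ `^ _).
rewrite !nneseries_esumT; [|by move=> *; exact: poweR_ge0|by move=> *; exact: poweR_ge0].
rewrite [RHS](reindex_esum [set: nat] [set: nat] e)//.
by rewrite setTT_bijective.
Qed.

Lemma ell_finite s x N : (0 < s)%R -> (forall k, (N <= k)%N -> x k = 0) ->
  ell s x = (\sum_(k < N) x k `^ s) `^ s^-1.
Proof.
move=> s0 xN; rewrite /ell (nneseries_split 0 N); last by move=> *; exact: poweR_ge0.
rewrite add0n [X in _ + X]eseries0 ?adde0 ?big_mkord// => k Nk _.
by rewrite xN// poweR0r// gt_eqF.
Qed.

End ell.

(** * Test functions *)

Section flat_function.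
Context {R : realType}.
Implicit Types (p q : {poly R}) (s u : R).

(** Each monomial of degree [i] is at most [i] factorial times the exponential, by its Taylor
    expansion. *)
Lemma horner_le_expR q : exists2 C, 0 <= C & forall u, 0 <= u -> `|q.[u]| <= C * expR u.
Proof.
exists (\sum_(i < size q) `|q`_i| * i`!%:R).
  by apply: sumr_ge0 => i _; rewrite mulr_ge0.
move=> u u0; rewrite horner_coef mulr_suml.
apply: le_trans (ler_norm_sum _ _ _) _; apply: ler_sum => i _.
rewrite normrM normrX (ger0_norm u0) -mulrA ler_wpM2l//.
case: i => -[|i] _ /=; first by rewrite expr0 fact0 mul1r -expR0 ler_expR.
rewrite mulrC -ler_pdivrMr ?ltr0n ?fact_gt0//.
by apply: le_trans (expR_ge1Dxn i u0); rewrite lerDr.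
Qed.

(* [flat p] is a derivative of the form occurring in the iterated derivatives
   of [exp(-1/s)], extended by 0 to [s <= 0]. *)
Definition flat p s : R := if 0 < s then p.[s^-1] * expR (- s^-1) else 0.

(** The factor [s ^- 2] is absorbed into the polynomial ['X^2 * p] evaluated at [s^-1]. Flatness of
    order two is all that differentiability at 0 requires. *)
Lemma flat_le_sqr p : exists2 C, 0 <= C & forall s, `|flat p s| <= C * s ^+ 2.
Proof.
have [C C0 HC] := horner_le_expR ('X^2 * p).
exists C => // s; rewrite /flat; case: ltP => s0; last by rewrite normr0 mulr_ge0// sqr_ge0.
have si0 : 0 <= s^-1 by rewrite invr_ge0 ltW.
have := HC _ si0; rewrite hornerM hornerXn normrM [`|_ ^+ 2|]ger0_norm ?sqr_ge0// => H.
rewrite normrM (gtr0_norm (expR_gt0 _)) expRN ler_pdivrMr ?expR_gt0//.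
rewrite mulrAC -ler_pdivrMr ?exprn_gt0// mulrC -exprVn; exact: H.
Qed.

(** Since [s^-1] has derivative [- s ^- 2] and [expR (- s^-1)] is multiplied by [s ^- 2], the family
    is stable under derivation, hence smooth. *)
Lemma is_derive_flat p s :
  is_derive s 1 (flat p) (flat ('X^2 * (p - p^`())) s).
Proof.
have [s0|s0|<-] := ltgtP 0 s.
- pose g := (horner p \o (fun t : R => t^-1)) * (fun t : R => expR (- t^-1)).
  have sn0 : s != 0 by rewrite gt_eqF.
  apply: (@near_eq_is_derive _ _ _ g).
    near=> t; rewrite /flat ifT//; near: t.
    by apply: open_nbhs_nbhs; split => //; exact: open_gt.
  have dinv : is_derive s 1 (fun t : R => t^-1) (- s ^- 2).
    by have := is_deriveV sn0 (is_derive_id s 1); rewrite [_ *: _]mulr1.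
  have dN : is_derive s 1 (fun t : R => - t^-1) (s ^- 2).
    by have := is_deriveN dinv; rewrite opprK.
  have d1 := is_derive1_comp (is_derive_poly p s^-1) dinv.
  have d2 := @is_derive1_comp _ expR (fun t => - t^-1) s _ _ (is_derive_expR _) dN.
  apply: is_derive_eq (is_deriveM d1 d2) _.
  rewrite /flat s0 /= !hornerE /= ![_ *: _]mulrC -exprVn; ring.
- apply: (@near_eq_is_derive _ _ _ (cst 0)).
    near=> t; rewrite /flat ifF//; apply/negbTE; rewrite -leNgt ltW//.
    near: t.
    by apply: open_nbhs_nbhs; split => //; exact: open_lt.
  by rewrite /flat ifF ?ltNge ?(ltW s0)//; exact: is_derive_cst.
(* At 0 the difference quotient is at most [C * |h|]. *)
- have [C C0 HC] := flat_le_sqr p.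
  have lim0 : (fun h : R => h^-1 *: ((flat p \o shift 0) (h *: 1) - flat p 0)) @ 0^' --> (0 : R).
    apply/cvgrPdist_le => e e0.
    have C1 : 0 < C + 1 by rewrite ltr_wpDl.
    exists (e / (C + 1)) => /=; first by rewrite divr_gt0.
    move=> h; rewrite /ball_/= sub0r normrN => he h0.
    rewrite sub0r normrN addr0 [h *: _]mulr1 {2}/flat ltxx subr0 normrZ normfV.
    rewrite ler_pdivrMl ?normr_gt0//; apply: le_trans (HC h) _.
    rewrite -real_normK ?num_real// expr2 mulrA mulrC ler_wpM2l//.
    move: he; rewrite ltr_pdivlMr// => /ltW; apply: le_trans.
    by rewrite mulrDr mulr1 mulrC lerDl.
  rewrite {2}/flat ltxx; apply: DeriveDef; first by apply/cvg_ex; exists 0.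
  exact: cvg_lim lim0.
Unshelve. all: by end_near. Qed.

End flat_function.

(** * Smooth functions: supports, commuting partial derivatives, restriction to lines *)

Section calculus.
Context {R : realType} {n : nat}.
Notation X := 'rV[R]_n.
Implicit Types (f g phi : X -> R) (x v w : X) (i j : 'I_n).

Lemma is_derive_line f x v t : derivable f (x + t *: v) v ->
  is_derive t 1 (fun t : R => f (x + t *: v)) ('D_v f (x + t *: v)).
Proof.
move=> df.
have E : (fun h : R => h^-1 *: (((fun t : R => f (x + t *: v)) \o shift t) (h *: 1) - f (x + t *: v)))
    = (fun h : R => h^-1 *: ((f \o shift (x + t *: v)) (h *: v) - f (x + t *: v))).
  apply/funext => h /=; congr (_ *: (f _ - _)).
  by rewrite [h *: 1]mulr1 scalerDl addrCA.
by apply: DeriveDef; rewrite ?/derivable ?/derive E.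
Qed.

Lemma derive_coordsum f x w : differentiable f x ->
  'D_w f x = \sum_i w ord0 i * partial i f x.
Proof.
move=> df; rewrite deriveE// {1}(row_sum_delta w) linear_sum.
by apply: eq_bigr => i _; rewrite linearZ /partial deriveE.
Qed.

Lemma smooth_differentiable phi x : smooth phi -> differentiable phi x.
Proof. by move=> /(_ [::] x). Qed.

Lemma smooth_continuous phi : smooth phi -> continuous phi.
Proof. by move=> s x; exact/differentiable_continuous/smooth_differentiable. Qed.

Lemma smooth_partial phi i : smooth phi -> smooth (partial i phi).
Proof. by move=> sphi s x; rewrite -foldr_rcons; exact: sphi. Qed.

Lemma partial_shift f w i : partial i (fun y => f (y + w)) = (fun y => partial i f (y + w)).
Proof.
apply/funext => x; rewrite /partial /derive.
rewrite (_ : (fun h => _) = (fun h => h^-1 *: ((f \o shift (x + w))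
  (h *: delta_mx ord0 i) - f (x + w))))//.
by apply/funext => h /=; rewrite addrA.
Qed.

Lemma smooth_shift phi w : smooth phi -> smooth (fun y => phi (y + w)).
Proof.
move=> sphi s x.
have -> : foldr partial (fun y => phi (y + w)) s = (fun y => foldr partial phi s (y + w)).
  by elim: s => //= i s ->; rewrite partial_shift.
apply: (@differentiable_comp _ _ _ _ (fun y => y + w) (foldr partial phi s)); last exact: sphi.
exact: differentiableD.
Qed.

Lemma partial_support f i :
  closure [set x | partial i f x != 0] `<=` closure [set x | f x != 0].
Proof.
rewrite [X in X `<=` _]closureE; apply: smallest_sub; first exact: closed_closure.
move=> x /=; apply: contra_neqP => xf; rewrite /partial.
rewrite (@near_eq_derive _ _ _ _ (cst 0)) ?derive_cst//.
have /open_nbhs_nbhs : open_nbhs x (~` closure [set x | f x != 0]).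
  by split => //; apply: closed_openC; exact: closed_closure.
apply: filterS => y yf; apply: contra_notP yf => /eqP yf; exact: subset_closure.
Qed.

Definition supp f : set X := closure [set x | f x != 0].

Lemma supp_out f x : ~ supp f x -> f x = 0.
Proof. by apply: contra_notP => /eqP fx; exact: subset_closure. Qed.

Lemma test_partial Omega phi i : test_function Omega phi -> test_function Omega (partial i phi).
Proof.
move=> [s c sub]; split; first exact: smooth_partial.
  by apply: subclosed_compact c (@partial_support phi i); exact: closed_closure.
by apply: subset_trans sub; exact: partial_support.
Qed.

Lemma compact_bounded_fun (A : set X) f : compact A -> continuous f ->
  exists2 M : R, 0 <= M & forall x, A x -> `|f x| <= M.
Proof.
move=> cA cf.
have cfA : compact ((fun x => `|f x|) @` A).
  apply: continuous_compact => //; apply: continuous_subspaceT => x.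
  by apply: (continuous_comp (cf x)); exact: norm_continuous.
have [M [_ /(_ (`|M| + 1))HM]] := compact_bounded cfA.
exists (`|M| + 1); first by rewrite addr_ge0.
move=> x Ax; have /= := HM _ `|f x| (imageP _ Ax); rewrite normr_id; apply.
by rewrite (le_lt_trans (ler_norm M))// ltrDl.
Qed.

Lemma supp_bounded (A : set X) : compact A -> exists k, A `<=` cube k.
Proof.
move=> cA; have [M [_ /(_ (`|M| + 1))HM]] := compact_bounded cA.
have M1 : M < `|M| + 1 by rewrite (le_lt_trans (ler_norm M))// ltrDl.
have M0 : 0 <= `|M| + 1 by rewrite addr_ge0.
exists (Num.bound (`|M| + 1)).+1 => x Ax; rewrite cubeE//=.
apply: le_lt_trans (HM M1 _ Ax) _.
by apply: lt_le_trans (archi_boundP M0) _; rewrite ler_nat.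
Qed.

Lemma test_bounded Omega phi : test_function Omega phi ->
  exists2 M : R, 0 <= M & forall x, `|phi x| <= M.
Proof.
move=> [s c _]; have [M M0 HM] := compact_bounded_fun c (smooth_continuous s).
exists M => // x; have [/HM//|/supp_out ->] := pselect (supp phi x).
by rewrite normr0.
Qed.

Lemma smooth_line phi x v (t : R) : smooth phi ->
  is_derive t 1 (fun t : R => phi (x + t *: v)) ('D_v phi (x + t *: v)).
Proof. by move=> sp; apply/is_derive_line/diff_derivable/smooth_differentiable. Qed.

(** The mean value theorem twice: in direction [i] for the difference of [phi] across a step in
    direction [j], then in direction [j] for the partial derivative obtained. *)
Lemma mixed_difference phi i j x (s t : R) : smooth phi -> 0 < s -> 0 < t ->
  exists2 y, `|x - y| <= s + t &
    phi (x + t *: delta_mx ord0 j + s *: delta_mx ord0 i) - phi (x + s *: delta_mx ord0 i)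
    - (phi (x + t *: delta_mx ord0 j) - phi x) = partial j (partial i phi) y * t * s.
Proof.
move=> sphi s0 t0; set ei : X := delta_mx ord0 i; set ej : X := delta_mx ord0 j.
pose g (u : R) := phi (x + t *: ej + u *: ei) - phi (x + u *: ei).
have dg (u : R) : is_derive u 1 g (partial i phi (x + t *: ej + u *: ei) - partial i phi (x + u *: ei)).
  by apply: is_deriveB; exact: smooth_line.
have [c] : exists2 c, c \in `]0, s[%R & g s - g 0 =
    (partial i phi (x + t *: ej + c *: ei) - partial i phi (x + c *: ei)) * (s - 0).
  apply: (@MVT _ g (fun c => partial i phi (x + t *: ej + c *: ei) - partial i phi (x + c *: ei)) _ _ s0) => //.
  by apply: derivable_within_continuous => u _; exact: ex_derive.
rewrite in_itv/= => /andP[c0 cs] gE.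
pose h (u : R) := partial i phi (x + c *: ei + u *: ej).
have dh (u : R) : is_derive u 1 h (partial j (partial i phi) (x + c *: ei + u *: ej)).
  by apply: smooth_line; exact: smooth_partial.
have [d] : exists2 d, d \in `]0, t[%R & h t - h 0 =
    partial j (partial i phi) (x + c *: ei + d *: ej) * (t - 0).
  apply: (@MVT _ h (fun d => partial j (partial i phi) (x + c *: ei + d *: ej)) _ _ t0) => //.
  by apply: derivable_within_continuous => u _; exact: ex_derive.
rewrite in_itv/= => /andP[d0 dt] hE.
exists (x + c *: ei + d *: ej).
  have -> : x - (x + c *: ei + d *: ej) = - (c *: ei + d *: ej).
    by rewrite -addrA opprD addNKr.
  rewrite normrN; apply: le_trans (ler_normD _ _) _.
  have nd k : `|delta_mx ord0 k : X| <= 1.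
    by apply: norm_rV_le => // l; rewrite mxE/=; case: eqP; rewrite ?normr1 ?normr0.
  have nz (u r : R) k : 0 < u -> u < r -> `|u *: (delta_mx ord0 k : X)| <= r.
    move=> u0 ur; rewrite normrZ gtr0_norm// -[leRHS]mulr1.
    by apply: ler_pM; rewrite ?nd// ltW.
  by apply: lerD; exact: nz.
move: gE hE; rewrite /g /h !scale0r !addr0 !subr0 => -> <-.
by congr (_ * _); rewrite addrAC.
Qed.

(** Schwarz's theorem: the second difference is symmetric in the two directions, so it equals either
    mixed derivative at a point near [x], and both are continuous. *)
Lemma partial_commute phi i j : smooth phi ->
  partial i (partial j phi) = partial j (partial i phi).
Proof.
move=> sphi; apply/funext => x; apply/eqP; rewrite eq_le.
suff H k l e : 0 < e -> partial k (partial l phi) x <= partial l (partial k phi) x + e.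
  by apply/andP; split; apply/ler_addgt0Pr => e e0; exact: H.
move=> e0; have e20 : 0 < e / 2 by rewrite divr_gt0.
have cc k' l' : {for x, continuous (partial k' (partial l' phi))}.
  by apply: smooth_continuous; do 2 apply: smooth_partial.
have /cvgrPdist_lt/(_ _ e20)/nbhs_ballP[d1 /= d10 D1] := cc k l.
have /cvgrPdist_lt/(_ _ e20)/nbhs_ballP[d2 /= d20 D2] := cc l k.
have m0 : 0 < Num.min d1 d2 by rewrite lt_min d10.
(* The intermediate points are within [d + d], which must be below both moduli of continuity. *)
pose d : R := Num.min d1 d2 / 4.
have d0 : 0 < d by rewrite divr_gt0.
have d4 : d + d < Num.min d1 d2 by rewrite /d; move: (Num.min d1 d2) m0 => m m0; lra.
have [y yx E1] := mixed_difference l k x sphi d0 d0.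
have [z zx E2] := mixed_difference k l x sphi d0 d0.
have yz : partial k (partial l phi) y = partial l (partial k phi) z.
  have dn0 : d != 0 by rewrite gt_eqF.
  suff /(mulIf dn0)/(mulIf dn0) : partial k (partial l phi) y * d * d =
    partial l (partial k phi) z * d * d by [].
  refine (etrans (esym E1) (etrans _ E2)).
  have -> : x + d *: delta_mx ord0 k + d *: delta_mx ord0 l =
    x + d *: delta_mx ord0 l + d *: delta_mx ord0 k by rewrite addrAC.
  move: (phi (x + d *: delta_mx ord0 l + d *: _)) (phi (x + d *: delta_mx ord0 l)).
  by move: (phi (x + d *: delta_mx ord0 k)) (phi x) => A B C D; ring.
have := D1 y; rewrite mx_norm_ball /ball_/= => /(_ _)/wrap[].
  by apply: le_lt_trans yx _; apply: lt_le_trans d4 _; rewrite ge_min lexx.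
have := D2 z; rewrite mx_norm_ball /ball_/= => /(_ _)/wrap[].
  by apply: le_lt_trans zx _; apply: lt_le_trans d4 _; rewrite ge_min lexx orbT.
rewrite yz; move: (partial l _ x) (partial k _ x) (partial l _ z) => A B C.
rewrite !ltr_norml => /andP[h1 h2] /andP[h3 h4]; clear -e0 h1 h2 h3 h4; lra.
Qed.

Definition incr (b : 'I_n -> nat) i : 'I_n -> nat := fun j => (b j + (j == i))%N.

Lemma smooth_iter_partial phi i k : smooth phi -> smooth (iter k (partial i) phi).
Proof. by move=> sphi; elim: k => //= k IH; exact: smooth_partial. Qed.

Lemma partial_iter phi i j k : smooth phi ->
  partial i (iter k (partial j) phi) = iter k (partial j) (partial i phi).
Proof.
move=> sphi; elim: k => //= k <-; apply: partial_commute; exact: smooth_iter_partial.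
Qed.

Let mpart (b : 'I_n -> nat) phi s := foldr (fun i g => iter (b i) (partial i) g) phi s.

Lemma smooth_mpartial_seq b phi s : smooth phi -> smooth (mpart b phi s).
Proof. by move=> sphi; elim: s => //= i s IH; exact: smooth_iter_partial. Qed.

Lemma partial_mpartial_seq b phi s i : smooth phi ->
  partial i (mpart b phi s) = mpart b (partial i phi) s.
Proof.
move=> sphi; elim: s => //= j s IH; rewrite partial_iter ?IH//.
exact: smooth_mpartial_seq.
Qed.

(** [mpartial] derives in the fixed order of the enumeration, so the extra derivative appears in the
    middle; commutation carries it to the innermost place. *)
Lemma mpartial_incr b phi i : smooth phi -> mpartial (incr b i) phi = mpartial b (partial i phi).
Proof.
move=> sphi; rewrite /mpartial.
have : i \in enum 'I_n by rewrite mem_enum.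
have : uniq (enum 'I_n) by exact: enum_uniq.
elim: (enum 'I_n) => //= j s IH /andP[js us]; rewrite in_cons => /predU1P[ij|ins].
  have -> : foldr (fun i0 g => iter (incr b i i0) (partial i0) g) phi s = mpart b phi s.
    rewrite /mpart {IH us}; elim: s js => //= k s IH; rewrite in_cons negb_or => /andP[jk js].
    by rewrite IH// /incr ij (negbTE (_ : k != j)) ?addn0// eq_sym.
  rewrite /incr ij eqxx addn1 iterSr partial_mpartial_seq//.
by rewrite IH// /incr (_ : (j == i) = false) ?addn0//; apply: contraNF js => /eqP ->.
Qed.

Lemma mpartial0 phi : mpartial (fun=> 0%N) phi = phi.
Proof. by rewrite /mpartial; elim: (enum _). Qed.

Lemma test_mpartial Omega phi b : test_function Omega phi -> test_function Omega (mpartial b phi).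
Proof.
move=> tphi; rewrite /mpartial; elim: (enum _) => //= i s IH.
by elim: (b i) => //= k; exact: test_partial.
Qed.

Lemma mlength_incr b i : mlength (incr b i) = (mlength b).+1.
Proof.
rewrite /mlength /incr big_split/= -addn1; congr addn.
by rewrite (bigD1 i)//= eqxx big1 ?addn0// => j /negbTE ->.
Qed.

(** Multi-indices are functions, so the induction runs on the length and removes one unit from a
    positive entry. *)
Lemma multi_index_ind (P : ('I_n -> nat) -> Prop) :
  P (fun=> 0%N) -> (forall b i, P b -> P (incr b i)) -> forall b, P b.
Proof.
move=> P0 PS b; move E : (mlength b) => k; elim: k b E => [|k IH] b E.
  suff -> : b = fun=> 0%N by [].
  by apply/funext => i; apply/eqP; move/eqP: E; rewrite sum_nat_eq0 => /forallP/(_ i).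
have [i bi] : exists i, (0 < b i)%N.
  apply/existsP; apply: contraT => /existsPn H.
  move: E; rewrite /mlength big1// => i _; apply/eqP; rewrite -leqn0 leqNgt; exact: H.
pose b' j := (b j - (j == i))%N.
have bE : b = incr b' i.
  apply/funext => j; rewrite /incr /b'; case: eqP => [->|_]; last by rewrite subn0 addn0.
  by rewrite subnK.
rewrite bE; apply: PS; apply: IH; apply/eqP; rewrite -eqSS -(mlength_incr b' i) -bE.
exact/eqP.
Qed.

Lemma continuous_derive phi w : smooth phi -> continuous (fun x => 'D_w phi x).
Proof.
move=> sphi x.
have -> : (fun x => 'D_w phi x) = \sum_i (fun x => w ord0 i * partial i phi x).
  apply/funext => u; rewrite fct_sumE derive_coordsum//; exact: smooth_differentiable.
elim/big_ind : _ => [|f g cf cg|i _]; first exact: cst_continuous.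
  exact: continuousD.
apply: (@continuousM _ _ (cst (w ord0 i)) (partial i phi)); first exact: cst_continuous.
by apply: smooth_continuous; exact: smooth_partial.
Qed.

Lemma line_FTC phi x w (r : R) : smooth phi -> 0 <= r ->
  (\int[lebesgue_measure]_(t in `[0%R, r]) ('D_w phi (x + t *: w))%:E = (phi (x + r *: w) - phi x)%:E)%E.
Proof.
move=> sphi; rewrite le_eqVlt => /predU1P[<-|r0].
  by rewrite set_itv1 integral_set1 scale0r addr0 subrr.
pose F (t : R) := phi (x + t *: w).
have dF (t : R) : is_derive t 1 F ('D_w phi (x + t *: w)) by exact: smooth_line.
have cD : continuous (fun t : R => 'D_w phi (x + t *: w)).
  move=> t; apply: (@continuous_comp _ _ _ (fun t : R => x + t *: w) (fun x => 'D_w phi x)); last first.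
    exact: continuous_derive.
  by apply: continuousD; [exact: cst_continuous|exact: scalel_continuous].
rewrite (@continuous_FTC2 _ _ F)//.
- by rewrite /F scale0r addr0 EFinB.
- exact: continuous_subspaceT.
- have cF t : {for t, continuous F}.
    by apply/differentiable_continuous/derivable1_diffP; exact: ex_derive.
  split; [by move=> t _; exact: ex_derive| |].
    by apply: cvg_at_right_filter; exact: cF.
  by apply: cvg_at_left_filter; exact: cF.
- by move=> t _; rewrite derive1E derive_val.
Qed.

End calculus.

(** * Smooth approximation of the indicators of boxes *)

Section bump.
Context {R : realType} {n : nat}.
Notation X := 'rV[R]_n.
Implicit Types (f g : X -> R) (a b x v : X) (i j : 'I_n).

(** A class of differentiable functions stable under partial derivatives. Membership yields
    smoothness without any formula for iterated derivatives. *)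
Inductive bumpy : (X -> R) -> Prop :=
| bumpy_cst c : bumpy (cst c)
| bumpy_atom p i c d : bumpy (fun x => flat p (c * x ord0 i + d))
| bumpy_add f g : bumpy f -> bumpy g -> bumpy (f + g)
| bumpy_mul f g : bumpy f -> bumpy g -> bumpy (f * g).

Lemma differentiable_atom p i c d x : differentiable (fun x : X => flat p (c * x ord0 i + d)) x.
Proof.
apply: (@differentiable_comp _ _ _ _ (fun x : X => c * x ord0 i + d) (flat p)).
  apply: differentiableD => //; apply: differentiableM => //.
  exact: differentiable_coord.
apply/derivable1_diffP; exact: (ex_derive (is_derive := is_derive_flat p _)).
Qed.

Lemma bumpy_differentiable f x : bumpy f -> differentiable f x.
Proof.
elim=> [c|p i c d|{}f g _ df _ dg|{}f g _ df _ dg] //.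
- exact: differentiable_atom.
- exact: differentiableD.
- exact: differentiableM.
Qed.

Lemma partial_atom p i c d j : partial j (fun x : X => flat p (c * x ord0 i + d)) =
  (fun x => (c * (i == j)%:R) * flat ('X^2 * (p - p^`())) (c * x ord0 i + d)).
Proof.
apply/funext => x; set f := fun x : X => _; set v : X := delta_mx ord0 j.
have := @is_derive_line _ _ f x v 0; rewrite scale0r addr0 => /(_ _)/wrap[].
  by apply/diff_derivable/differentiable_atom.
move=> H; rewrite /partial -/v -(derive_val (is_derive := H)).
set y := c * x ord0 i + d.
have H2 : is_derive (0 : R) 1 (fun t : R => c * (x + t *: v) ord0 i + d) (c * (i == j)%:R).
  pose q : {poly R} := (c * (i == j)%:R) *: 'X + y%:P.
  have -> : (fun t : R => c * (x + t *: v) ord0 i + d) = horner q.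
    apply/funext => t; rewrite /v /q /y !mxE eqxx/=.
    rewrite hornerD hornerZ hornerX hornerC; ring.
  apply: is_derive_eq (is_derive_poly q 0) _.
  by rewrite /q derivD derivZ derivX derivC addr0 hornerZ -polyC1 hornerC mulr1.
have H3 : is_derive (c * (x + 0 *: v) ord0 i + d) 1 (flat p) (flat ('X^2 * (p - p^`())) y).
  by rewrite scale0r addr0; exact: is_derive_flat.
have H4 := @is_derive1_comp _ (flat p) (fun t => c * (x + t *: v) ord0 i + d) 0 _ _ H3 H2.
by rewrite (derive_val (is_derive := H4)) mulrC.
Qed.

Lemma bumpy_partial f i : bumpy f -> bumpy (partial i f).
Proof.
elim=> [c|p k c d|{}f g bf bf' bg bg'|{}f g bf bf' bg bg'].
- rewrite (_ : partial i (cst c) = cst 0); first exact: bumpy_cst.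
  by apply/funext => x; rewrite /partial derive_cst.
- rewrite partial_atom; exact: (bumpy_mul (bumpy_cst _) (bumpy_atom _ _ _ _)).
- rewrite (_ : partial i (f + g) = partial i f + partial i g); first exact: bumpy_add.
  by apply/funext => x; rewrite /partial deriveD//; exact/diff_derivable/bumpy_differentiable.
- rewrite (_ : partial i (f * g) = f * partial i g + g * partial i f).
    by apply: bumpy_add; exact: bumpy_mul.
  by apply/funext => x; rewrite /partial deriveM//; exact/diff_derivable/bumpy_differentiable.
Qed.

Lemma bumpy_smooth f : bumpy f -> smooth f.
Proof.
move=> bf s x; apply: bumpy_differentiable.
by elim: s => //= i s; exact: bumpy_partial.
Qed.

(** The two arguments are [k (x i - a i) - 1] and [k (b i - x i) - 1]: positive only at distance
    more than [1 / k] from the face, and tending to infinity inside the box, where [flat 1] tends to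
    1. *)
Definition bump (k : nat) a b x : R :=
  \prod_i (flat 1 (k%:R * x ord0 i + (- (k%:R * a ord0 i) - 1)) *
    flat 1 (- k%:R * x ord0 i + (k%:R * b ord0 i - 1))).

Lemma bump_smooth k a b : smooth (bump k a b).
Proof.
apply: bumpy_smooth; rewrite /bump.
elim: (index_enum _) => [|i s IH].
  by under eq_fun do rewrite big_nil; exact: bumpy_cst.
under eq_fun do rewrite big_cons.
exact: (bumpy_mul (bumpy_mul (bumpy_atom _ _ _ _) (bumpy_atom _ _ _ _)) IH).
Qed.

Lemma flat1_01 (s : R) : 0 <= flat 1 s <= 1.
Proof.
rewrite /flat; case: ltP => s0; last by rewrite lexx ler01.
rewrite -polyC1 hornerC mul1r expR_ge0/=.
by rewrite expR_le1 oppr_le0 invr_ge0 ltW.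
Qed.

Lemma bump_01 k a b x : 0 <= bump k a b x <= 1.
Proof.
rewrite /bump; elim/big_ind : _ => [|s t /andP[s0 s1] /andP[t0 t1]|i _]; first by rewrite ler01 lexx.
  by rewrite mulr_ge0//= mulr_ile1.
have /andP[s0 s1] := flat1_01 (k%:R * x ord0 i + (- (k%:R * a ord0 i) - 1)).
have /andP[t0 t1] := flat1_01 (- k%:R * x ord0 i + (k%:R * b ord0 i - 1)).
by rewrite mulr_ge0//= mulr_ile1.
Qed.

Lemma bump_support k a b : (0 < k)%N ->
  [set x | bump k a b x != 0] `<=`
  [set x | forall i, a ord0 i + k%:R^-1 <= x ord0 i <= b ord0 i - k%:R^-1].
Proof.
move=> k0 x /=; rewrite /bump => /prodf_neq0 H i.
have {H} := H i isT; rewrite mulf_eq0 negb_or => /andP[].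
rewrite /flat; case: ltP => [h1 _|_]; last by rewrite eqxx.
case: ltP => [h2 _|_]; last by rewrite eqxx.
have kr : 0 < k%:R :> R by rewrite ltr0n.
have ke : k%:R * k%:R^-1 = 1 :> R by rewrite mulfV// gt_eqF.
move: (k%:R^-1) ke => e ke; apply/andP; split; rewrite -subr_ge0 -(pmulr_rge0 _ kr).
  have -> : k%:R * (x ord0 i - (a ord0 i + e)) = k%:R * x ord0 i + (- (k%:R * a ord0 i) - k%:R * e).
    by ring.
  by rewrite ke ltW.
have -> : k%:R * (b ord0 i - e - x ord0 i) = - k%:R * x ord0 i + (k%:R * b ord0 i - k%:R * e).
  by ring.
by rewrite ke ltW.
Qed.

Lemma bump_test k a b (A : set X) : (0 < k)%N -> obox a b `<=` A -> test_function A (bump k a b).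
Proof.
move=> k0 abA.
pose C := [set x : X | forall i, a ord0 i + k%:R^-1 <= x ord0 i <= b ord0 i - k%:R^-1].
have clC : closed C.
  rewrite (_ : C = \bigcap_(i in [set: 'I_n])
      ((fun x : X => x ord0 i) @^-1` `[a ord0 i + k%:R^-1, b ord0 i - k%:R^-1]%classic)).
    apply: closed_bigI => i _; apply: preimage_closed; first by move=> x _; exact: coord_continuous.
    exact: interval_closed.
  by apply/seteqP; split => x /= h i; [move=> _ /=; rewrite in_itv/=; exact: h|have := h i I; rewrite /= in_itv].
have subC : closure [set x | bump k a b x != 0] `<=` C.
  by rewrite closureE; apply: smallest_sub => //; exact: bump_support.
split; first exact: bump_smooth.
  apply: (subclosed_compact _ _ subC); first exact: closed_closure.
  apply: bounded_closed_compact => //.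
  exists (`|a| + `|b|); split; first exact: num_real.
  move=> M HM x Cx; apply: le_trans (ltW HM); apply: norm_rV_le; first by rewrite addr_ge0.
  move=> i; have /andP[h1 h2] := Cx i.
  have k1 : 0 <= k%:R^-1 :> R by rewrite invr_ge0.
  have := coord_le_norm a i; have := coord_le_norm b i; rewrite !ler_norml.
  have := normr_ge0 a; have := normr_ge0 b.
  by move=> ? ? /andP[? ?] /andP[? ?]; apply/andP; split; lra.
apply: subset_trans subC _; apply: subset_trans abA => x Cx i.
have /andP[h1 h2] := Cx i; have k1 : 0 < k%:R^-1 :> R by rewrite invr_gt0 ltr0n.
by rewrite in_itv/=; apply/andP; split; lra.
Qed.

Lemma bump_out k a b x : ~ obox a b x -> bump k a b x = 0.
Proof.
(* For [k = 0] every factor is [flat 1 (-1) = 0]; there is a coordinate, since without one the box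
   would contain [x]. *)
case: k => [|k] nx.
  rewrite /bump; have [i _] : exists i : 'I_n, true.
    by apply/existsP; apply: contra_notT nx => /existsPn H i; have := H i.
  rewrite (bigD1 i)//= !mul0r /flat !oppr0 add0r sub0r ifF ?mul0r//.
  by apply/negbTE; rewrite -leNgt lerN10.
apply: contra_notP nx => /eqP nz i; have H := @bump_support k.+1 a b isT x nz.
have /andP[h1 h2] := H i; have k1 : 0 < k.+1%:R^-1 :> R by rewrite invr_gt0 ltr0n.
by rewrite in_itv/=; move: (k.+1%:R^-1) h1 h2 k1 => e *; apply/andP; split; lra.
Qed.

Lemma flat1_cvg (y : R) : 0 < y -> flat 1 (k%:R * y - 1) @[k --> \oo] --> (1 : R).
Proof.
move=> y0; apply/cvgrPdist_le => e e0; near=> k.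
have /andP[f0 f1] := flat1_01 (k%:R * y - 1).
rewrite ger0_norm ?subr_ge0//.
have ke : e^-1 <= k%:R * y - 1.
  rewrite lerBrDr -ler_pdivrMr//; near: k; exact: nbhs_infty_ger.
have k1 : 0 < k%:R * y - 1 by apply: lt_le_trans ke; rewrite invr_gt0.
(* [1 - exp (- u) <= u], with [u] the inverse of the argument, which is at most [e]. *)
rewrite /flat k1 -polyC1 hornerC mul1r lerBlDr -lerBlDl; apply: le_trans (expR_ge1Dx _).
by rewrite lerD2l lerN2 -[leRHS]invrK lef_pV2// posrE ?invr_gt0.
Unshelve. all: by end_near. Qed.

Lemma bump_cvg a b x : obox a b x -> bump k a b x @[k --> \oo] --> (1 : R).
Proof.
move=> xab; rewrite /bump.
pose F (k : nat) i := flat 1 (k%:R * x ord0 i + (- (k%:R * a ord0 i) - 1)) *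
    flat 1 (- k%:R * x ord0 i + (k%:R * b ord0 i - 1)).
suff : (fun k : nat => \prod_i F k i) @ \oo --> (1 : R) by [].
elim: (index_enum _) => [|i s IH].
  rewrite (_ : (fun k => _) = cst 1); first exact: cvg_cst.
  by apply/funext => k; rewrite big_nil.
rewrite (_ : (fun k => _) = (fun k => F k i * \prod_(j <- s) F k j)); last first.
  by apply/funext => k; rewrite big_cons.
have := xab i; rewrite in_itv/= => /andP[h1 h2].
have c1 : flat 1 (k%:R * x ord0 i + (- (k%:R * a ord0 i) - 1)) @[k --> \oo] --> (1 : R).
  under eq_fun do rewrite addrA -mulrBr.
  by apply: flat1_cvg; rewrite subr_gt0.
have c2 : flat 1 (- k%:R * x ord0 i + (k%:R * b ord0 i - 1)) @[k --> \oo] --> (1 : R).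
  under eq_fun do rewrite addrA mulNr [- _ + _]addrC -mulrBr.
  by apply: flat1_cvg; rewrite subr_gt0.
have := cvgM (cvgM c1 c2) IH.
have -> : 1 * 1 * 1 = 1 :> R by rewrite !mulr1.
by apply.
Qed.

End bump.

(** * Locally integrable functions *)

Section density.
Context d {T : measurableType d} {R : realType} (mu : {measure set T -> \bar R}).
Variable g : T -> \bar R.
Hypothesis mg : measurable_fun setT g.
Hypothesis g0 : forall x, (0 <= g x)%E.

(** The measure with density [g]. The two proofs are arguments so that the measure structure can be
    attached to the function itself. *)
Definition density of measurable_fun setT g & (forall x, (0 <= g x)%E) :=
  fun A : set T => (\int[mu]_(x in A) g x)%E.

Let density0 : density mg g0 set0 = 0%E.
Proof. exact: integral_set0. Qed.

Let density_ge0 A : (0 <= density mg g0 A)%E.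
Proof. exact: integral_ge0. Qed.

Let density_sigma_additive : semi_sigma_additive (density mg g0).
Proof.
move=> F mF tF mUF; rewrite /density ge0_integral_bigcup//.
  apply: is_cvg_nneseries => k _ _; exact: integral_ge0.
exact: measurable_funTS.
Qed.

HB.instance Definition _ := isMeasure.Build _ _ _ (density mg g0)
  density0 density_ge0 density_sigma_additive.

End density.

Section ae_swap.
Context d1 d2 {T1 : measurableType d1} {T2 : measurableType d2} {R : realType}.
Variables (m1 : {sigma_finite_measure set T1 -> \bar R})
  (m2 : {sigma_finite_measure set T2 -> \bar R}).

(** Tonelli for the indicator of the complement of [D]: its integral vanishes in one order, hence in
    the other. *)
Lemma ae_swap (D : set (T1 * T2)) : measurable D ->
  {ae m2, forall y, {ae m1, forall x, D (x, y)}} ->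
  {ae m1, forall x, {ae m2, forall y, D (x, y)}}.
Proof.
move=> mD H; pose N := ~` D; have mN : measurable N by exact: measurableC.
have mF : measurable_fun setT (fun z => (\1_N z)%:E : \bar R).
  by apply/measurable_EFinP; exact: measurable_indic.
have /= FT := @fubini_tonelli _ _ _ _ _ m1 m2 (fun z => (\1_N z)%:E) mF (fun z => _).
have G0 : (\int[m1]_x \int[m2]_y (\1_N (x, y))%:E = 0 :> \bar R)%E.
  rewrite FT//.
  rewrite (ae_eq_integral (cst 0%E))//; first exact: integral0.
    by apply: (measurable_fun_fubini_tonelli_G (fun z => (\1_N z)%:E)) => // z; rewrite lee_fin.
  apply: filterS H => y Hy _; apply/eqP.
  have mNy : measurable (ysection N y) by exact: measurable_ysection.
  have -> : (\int[m1]_x (\1_N (x, y))%:E = \int[m1]_x (\1_(ysection N y) x)%:E :> \bar R)%E.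
    by apply: eq_integral => x _; rewrite !indicE /ysection mem_setE.
  rewrite integral_indic// setIT; apply/eqP.
  apply/negligibleP => //; apply: negligibleS Hy.
  by move=> x; rewrite /ysection/= inE.
have mG : measurable_fun setT (fun x => \int[m2]_y (\1_N (x, y))%:E : \bar R)%E.
  by apply: (measurable_fun_fubini_tonelli_F (fun z => (\1_N z)%:E)) => // z; rewrite lee_fin.
have := (ae_eq_integral_abs m1 measurableT mG).1.
have -> : (\int[m1]_x `|\int[m2]_y (\1_N (x, y))%:E| = 0 :> \bar R)%E.
  rewrite -[RHS]G0; apply: eq_integral => x _; rewrite gee0_abs//.
  by apply: integral_ge0 => y _; rewrite lee_fin.
move=> /(_ erefl); apply: filterS => x /(_ I) /= Hx.
have mNx : measurable (xsection N x) by exact: measurable_xsection.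
exists (xsection N x); split => //.
  rewrite -[xsection N x]setIT -integral_indic// -[RHS]Hx.
  by apply: eq_integral => y _; rewrite !indicE /xsection mem_setE.
by move=> y /= Dxy; rewrite /xsection/= inE.
Qed.

End ae_swap.

Section locally_integrable.
Context {R : realType} {n : nat}.
Notation X := 'rV[R]_n.
Notation mu := (lebesgue_rV n).
Local Open Scope ereal_scope.
Implicit Types (f g phi : X -> R) (a b x v w : X) (i j : 'I_n).

Lemma measurable_cube k : measurable (cube k : set X).
Proof. exact: measurable_obox. Qed.

(** Integrability on every cube of the whole space. For an extension by zero this is stronger than
    local integrability on [Omega], since it reaches the boundary. *)
Definition locint f := measurable_fun setT f /\
  forall k, \int[mu]_(x in cube k) `|f x|%:E < +oo.

Lemma locint_integrable f k : locint f -> mu.-integrable (cube k) (EFin \o f).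
Proof.
move=> [mf fk]; apply/integrableP; split; last exact: fk.
by apply/measurable_EFinP; exact: measurable_funTS.
Qed.

Lemma locintD f g : locint f -> locint g -> locint (fun x => f x + g x)%R.
Proof.
move=> [mf fk] [mg gk]; split; first exact: measurable_funD.
move=> k; apply: (@le_lt_trans _ _ (\int[mu]_(x in cube k) (`|f x|%:E + `|g x|%:E))).
  apply: ge0_le_integral => //; [exact: measurable_cube|..].
  - by apply/measurable_EFinP; apply: measurableT_comp => //; apply: measurable_funTS; exact: measurable_funD.
  - by apply: emeasurable_funD; apply/measurable_EFinP; apply: measurableT_comp => //; exact: measurable_funTS.
  - by move=> x _; rewrite lee_fin ler_normD.
rewrite ge0_integralD//; [exact: lte_add_pinfty|exact: measurable_cube|..].
- by apply/measurable_EFinP; apply: measurableT_comp => //; exact: measurable_funTS.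
- by apply/measurable_EFinP; apply: measurableT_comp => //; exact: measurable_funTS.
Qed.

Lemma locintZ f (c : R) : locint f -> locint (fun x => c * f x)%R.
Proof.
move=> [mf fk]; split; first exact: measurable_funM.
move=> k; under eq_integral do rewrite normrM EFinM.
rewrite ge0_integralZl_EFin//; [|exact: measurable_cube|].
  by rewrite lte_mul_pinfty.
by apply/measurable_EFinP; apply: measurableT_comp => //; exact: measurable_funTS.
Qed.

Lemma locint0 : locint (cst 0%R).
Proof. by split=> // k; rewrite integral0_eq// => x _ /=; rewrite normr0. Qed.

Lemma locint_test_integrable f phi k (M : R) : locint f -> continuous phi ->
  (forall x, `|phi x| <= M)%R -> (forall x, ~ cube k x -> phi x = 0%R) ->
  mu.-integrable setT (fun x => (f x * phi x)%:E).
Proof.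
move=> [mf fk] cphi phiM phik; apply/integrableP; split.
  apply/measurable_EFinP; apply: measurable_funM => //; exact: continuous_measurable_rV.
apply: (@le_lt_trans _ _ (\int[mu]_(x in cube k) (M%:E * `|f x|%:E))); last first.
  rewrite ge0_integralZl_EFin//; [|exact: measurable_cube| |].
  - by rewrite lte_mul_pinfty// lee_fin (le_trans (normr_ge0 (phi 0%R))).
  - by apply/measurable_EFinP; apply: measurableT_comp => //; exact: measurable_funTS.
  - exact: le_trans (normr_ge0 (phi 0%R)) _.
rewrite [leRHS]integral_mkcond; apply: ge0_le_integral => //.
- apply: measurableT_comp => //; apply/measurable_EFinP; apply: measurable_funM => //.
  exact: continuous_measurable_rV.
- apply/(measurable_restrictT _ _).1; first exact: measurable_cube.
  apply: measurable_funTS; apply: emeasurable_funM => //.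
  by apply/measurable_EFinP; exact: measurableT_comp.
- move=> x _; rewrite patchE; case: ifPn => [_|]; last first.
    by rewrite notin_setE => /phik ->; rewrite mulr0 abse0.
  by rewrite lee_fin normrM mulrC ler_wpM2r.
Qed.

Lemma test_cube Omega phi : test_function Omega phi ->
  exists k, forall x, ~ cube k x -> phi x = 0%R.
Proof.
move=> [_ c _]; have [k Hk] := supp_bounded c; exists k => x xk.
by apply: supp_out => /Hk.
Qed.

Lemma test_integrable Omega f phi : locint f -> test_function Omega phi ->
  mu.-integrable setT (fun x => (f x * phi x)%:E).
Proof.
move=> lf tphi; have [k Hk] := test_cube tphi; have [M _ HM] := test_bounded tphi.
have [s _ _] := tphi.
exact: locint_test_integrable lf (smooth_continuous s) HM Hk.
Qed.

Lemma locint_shift f w : locint f -> locint (fun x => f (x + w)%R).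
Proof.
move=> [mf fk]; split.
  apply: (measurableT_comp mf); under eq_fun do rewrite addrC; exact: measurable_shift.
move=> k; pose K := (k + (Num.bound `|w|).+1)%N.
apply: le_lt_trans (fk K).
rewrite [leRHS]integral_mkcond -(ge0_integral_shift w); last 2 first.
- apply/(measurable_restrictT _ _).1; first exact: measurable_cube.
  by apply: measurable_funTS; apply/measurable_EFinP; exact: measurableT_comp.
- by move=> v; rewrite patchE; case: ifP.
rewrite integral_mkcond; apply: ge0_le_integral => //.
- by move=> x _; rewrite patchE; case: ifP.
- apply/(measurable_restrictT _ _).1; first exact: measurable_cube.
  apply: measurable_funTS; apply/measurable_EFinP; apply: measurableT_comp => //.
  apply: (measurableT_comp mf); under eq_fun do rewrite addrC; exact: measurable_shift.
- apply: (measurableT_comp (f := (fun x => `|f x|%:E) \_ (cube K))); last exact: measurable_shift.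
  apply/(measurable_restrictT _ _).1; first exact: measurable_cube.
  by apply: measurable_funTS; apply/measurable_EFinP; exact: measurableT_comp.
- move=> x _; rewrite !patchE; case: ifPn => [|_]; last by case: ifP => // _; rewrite lee_fin.
  rewrite inE => xk; rewrite ifT ?[(w + x)%R]addrC// inE => i.
  have := xk i; have := coord_le_norm w i; rewrite !in_itv/= !mxE ler_norml.
  have := archi_boundP (normr_ge0 w).
  have : ((Num.bound `|w|)%:R <= (Num.bound `|w|).+1%:R :> R)%R by rewrite ler_nat.
  rewrite /K natrD; move: ((Num.bound `|w|).+1%:R)%R (Num.bound `|w|)%:R => A B.
  by move=> ? ? /andP[? ?] /andP[? ?]; apply/andP; split; lra.
Qed.

Lemma open_oboxes (A : set X) : open A -> exists F : nat -> set X,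
  (forall k, F k = set0 \/ exists a b, F k = obox a b) /\ A = \bigcup_k F k.
Proof.
move=> oA; pose B (q : 'rV[rat]_n * 'rV[rat]_n) : set X :=
  obox (map_mx ratr q.1) (map_mx ratr q.2).
exists (fun k => if unpickle k is Some q then if `[< B q `<=` A >] then B q else set0 else set0).
split=> [k|].
  case: unpickle => [q|]; last by left.
  by case: asboolP => _; [right; do 2 eexists|left].
apply/seteqP; split => [x /(open_rat_obox oA)[q [xq qA]]|x [k _]].
  by exists (pickle q) => //; rewrite pickleK asboolT.
by case: unpickle => // q; case: asboolP => // + Bx; exact.
Qed.

Lemma obox_bounded a b : exists k, obox a b `<=` (cube k : set X).
Proof.
exists (Num.bound (`|a| + `|b|)).+1 => x xab i; have := xab i.
have := archi_boundP (addr_ge0 (normr_ge0 a) (normr_ge0 b)).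
have := coord_le_norm a i; have := coord_le_norm b i.
have : ((Num.bound (`|a| + `|b|))%:R <= (Num.bound (`|a| + `|b|)).+1%:R :> R)%R by rewrite ler_nat.
rewrite !in_itv/= !mxE !ler_norml; have := normr_ge0 a; have := normr_ge0 b.
move: ((Num.bound (`|a| + `|b|)).+1%:R)%R (Num.bound (`|a| + `|b|))%:R => A B.
by move=> ? ? ? /andP[? ?] /andP[? ?] ? /andP[? ?]; apply/andP; split; lra.
Qed.

(** Testing with bumps gives a vanishing integral of [f] over every smaller box; then the measures
    with densities the positive and negative parts of [f] coincide. *)
Lemma fundamental_obox a b f : locint f ->
  (forall phi, test_function (obox a b) phi -> \int[mu]_x (f x * phi x)%:E = 0) ->
  {ae mu, forall x, obox a b x -> f x = 0%R}.
Proof.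
move=> lf H; have [k Pk] := obox_bounded a b.
set P := obox a b in H Pk *; have mP : measurable P by exact: measurable_obox.
pose F := (EFin \o f) \_ P.
have iF : mu.-integrable setT F.
  have iP := integrableS (measurable_cube k) mP Pk (locint_integrable k lf).
  exact: (integrable_mkcond (EFin \o f) mP).1 iP.
have mF := measurable_int mu iF.
have int0 c d : \int[mu]_(x in obox c d) F x = 0.
  rewrite integral_mkcond.
  have [a' [b' PE]] : exists a' b', P `&` obox c d = obox a' b' by rewrite obox_setI; do 2 eexists.
  have subP : obox a' b' `<=` P by rewrite -PE; exact: subIsetl.
  have FE x : (F \_ (obox c d)) x = (f x * \1_(obox a' b') x)%:E.
    rewrite /F -PE indicI !patchE mulrA !indicE.
    by case: (x \in obox c d); case: (x \in P); rewrite ?mulr1 ?mulr0.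
  rewrite (eq_integral _ _ (fun x _ => FE x)).
  (* The bumps tend to the indicator of the intersected box and are dominated by 1 on [P]. The index
     starts at 1, as [bump_test] requires. *)
  have : (fun k => \int[mu]_x (f x * bump k.+1 a' b' x)%:E) @ \oo -->
      \int[mu]_x (f x * \1_(obox a' b') x)%:E.
    have := @dominated_convergence _ _ _ mu setT measurableT
      (fun k x => (f x * bump k.+1 a' b' x)%:E) (fun x => (f x * \1_(obox a' b') x)%:E)
      (fun x => `|F x|).
    case=> //.
    - move=> k'; apply/measurable_EFinP; apply: measurable_funM; first exact: lf.1.
      exact: (continuous_measurable_rV (smooth_continuous (bump_smooth _ _ _))).
    - apply/measurable_EFinP; apply: measurable_funM; first exact: lf.1.
      by apply: measurable_indic; exact: measurable_obox.
    - apply: aeW => x _; apply: cvg_EFin; first exact: nearW.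
      apply: cvgM; first exact: cvg_cst.
      rewrite indicE; case: (boolP (x \in obox a' b')); rewrite ?inE ?notin_setE => xab.
        by have := bump_cvg xab; rewrite -[X in X -> _](cvg_shiftS (fun k => bump k a' b' x)).
      under eq_fun do rewrite bump_out//; exact: cvg_cst.
    - exact: integrable_abse.
    - apply: aeW => x k' _; rewrite /F patchE; case: ifPn => [_|]; last first.
        rewrite notin_setE => xP; rewrite bump_out ?mulr0 ?abse0//.
        by move=> /subP.
      have /andP[h1 h2] := bump_01 k'.+1 a' b' x.
      by rewrite lee_fin normrM (ger0_norm h1) ler_piMr.
  move=> cv.
  have cv0 : (fun k => \int[mu]_x (f x * bump k.+1 a' b' x)%:E) @ \oo --> (0 : \bar R).
    rewrite (_ : (fun k => _) = cst 0); first exact: cvg_cst.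
    by apply/funext => k'; apply: H; exact: bump_test.
  exact: (cvg_unique (@ereal_hausdorff R) cv cv0).
have mFp := measurable_funepos mF; have mFn := measurable_funeneg mF.
have finp : \int[mu]_x F^\+ x < +oo by exact: integral_funepos_lt_pinfty.
have finn : \int[mu]_x F^\- x < +oo by exact: integral_funeneg_lt_pinfty.
pose np : {measure set X -> \bar R} := density mu mFp (funepos_ge0 F).
pose nn : {measure set X -> \bar R} := density mu mFn (funeneg_ge0 F).
(* Equality on boxes is [int0]; both measures are finite because [F] is integrable. *)
have pn A : measurable A -> np A = nn A.
  apply: measure_rV_unique => [c d|j].
    have := int0 c d; rewrite integralE => /eqP; rewrite sube_eq ?add0e => [/eqP//| |].
      apply: integrable_fin_num; first exact: measurable_obox.
      by apply: integrableS (integrable_funepos _ iF) => //; exact: measurable_obox.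
    by rewrite fin_num_adde_defr.
  apply: le_lt_trans finp; apply: ge0_subset_integral => //; exact: measurable_cube.
(* On the set where [F] is nonnegative the negative part has no mass, so neither has the positive
   part; symmetrically on the complement. *)
have intF : \int[mu]_x `|F x| = 0.
  pose A := [set x | 0 <= F x]; have mA : measurable A.
    by rewrite -[A]setTI; apply: emeasurable_fun_c_infty.
  have eqA : \int[mu]_(x in A) `|F x| = 0.
    transitivity (np A).
      apply: eq_integral => x; rewrite inE => /= Fx.
      by rewrite gee0_abs// funeposE; apply/esym/max_idPl.
    rewrite pn// /nn /= /density integral0_eq// => x Fx.
    by rewrite funenegE; apply/max_idPr; rewrite leeNl oppe0.
  have eqAc : \int[mu]_(x in ~` A) `|F x| = 0.
    transitivity (nn (~` A)).
      apply: eq_integral => x; rewrite inE => /= /negP; rewrite -ltNge => Fx.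
      by rewrite lte0_abs// funenegE; apply/esym/max_idPl; rewrite leeNr oppe0 ltW.
    rewrite -pn; last exact: measurableC.
    rewrite /np /= /density integral0_eq// => x /= /negP; rewrite -ltNge => Fx.
    by rewrite funeposE; apply/max_idPr; exact: ltW.
  rewrite -[X in integral _ X](setvU A) ge0_integral_setU ?eqA ?eqAc ?adde0//.
  - exact: measurableC.
  - by rewrite setvU; exact: measurableT_comp.
  - by rewrite disj_set2E setICl.
have := (ae_eq_integral_abs mu measurableT mF).1 intF.
apply: filterS => x /(_ I) Fx Px; move: Fx; rewrite /F patchE ifT ?inE//=.
by move=> [].
Qed.

(** An open set is a countable union of boxes, and a test function of a box is one of [Omega]. *)
Lemma fundamental_lemma Omega f : open Omega -> locint f ->
  (forall phi, test_function Omega phi -> \int[mu]_x (f x * phi x)%:E = 0) ->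
  {ae mu, forall x, Omega x -> f x = 0%R}.
Proof.
move=> oO lf H; have [F [FE OE]] := open_oboxes oO.
have N k : {ae mu, forall x, F k x -> f x = 0%R}.
  have [->|[a [b Fk]]] := FE k; first exact: aeW.
  rewrite Fk; apply: fundamental_obox => // phi [s c sub]; apply: H; split => //.
  by apply: subset_trans sub _; rewrite -Fk OE; exact: bigcup_sup.
have : mu.-negligible (\bigcup_k ~` [set x | F k x -> f x = 0%R]).
  by apply: negligible_bigcup => k; exact: N.
apply: negligibleS => x /= /not_implyP[]; rewrite OE => -[k _ Fkx] fx.
by exists k => // /(_ Fkx).
Qed.

End locally_integrable.

(** * The fundamental theorem of calculus for weak derivatives *)

Section parametric_integral.
Context {R : realType} d1 d2 (T1 : measurableType d1) (T2 : measurableType d2).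
Local Open Scope ereal_scope.

(** The positive and negative parts are integrated separately, so [h] needs neither a sign nor
    integrability. *)
Lemma measurable_integral2 (m2 : {sigma_finite_measure set T2 -> \bar R}) (h : T1 * T2 -> \bar R) :
  measurable_fun setT h -> measurable_fun setT (fun x : T1 => \int[m2]_y h (x, y)).
Proof.
move=> mh.
rewrite (_ : (fun x => _) = (fun x => \int[m2]_y h^\+ (x, y) - \int[m2]_y h^\- (x, y))).
  apply: emeasurable_funB; apply: measurable_fun_fubini_tonelli_F => //.
    exact: measurable_funepos.
  exact: measurable_funeneg.
apply/funext => x; rewrite [LHS]integralE; congr (_ - _).
  by apply: eq_integral => y _; rewrite !funeposE.
by apply: eq_integral => y _; rewrite !funenegE.
Qed.

End parametric_integral.
Arguments measurable_integral2 {R d1 d2 T1 T2} m2 h.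

Section line_integrals.
Context {R : realType} {n : nat}.
Notation X := 'rV[R]_n.
Notation mu := (lebesgue_rV n).
Notation leb := (@lebesgue_measure R).
Implicit Types (f g G phi psi : X -> R) (a b x v w : X) (i j : 'I_n).

Lemma derive_shift_rV f v w : (fun x => 'D_v (fun y => f (y + w)) x) = (fun x => 'D_v f (x + w)).
Proof.
apply/funext => x; rewrite /derive.
rewrite (_ : (fun h => _) = (fun h => h^-1 *: ((f \o shift (x + w)) (h *: v) - f (x + w))))//.
by apply/funext => h /=; rewrite addrA.
Qed.

Lemma deriveN_dir f x w : differentiable f x -> 'D_(- w) f x = - 'D_w f x.
Proof. by move=> df; rewrite !deriveE// linearN. Qed.

Lemma supp_shift f w : supp (fun y => f (y + w)) `<=` [set y | supp f (y + w)].
Proof.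
rewrite /supp [X in X `<=` _]closureE; apply: smallest_sub.
  apply: (@preimage_closed _ _ (fun y : X => y + w)); last exact: closed_closure.
  by move=> y _; apply: continuousD; [exact: id|exact: cst_continuous].
by move=> y /= fy; exact: subset_closure.
Qed.

Lemma test_shift (P Omega : set X) phi w : test_function P phi ->
  (forall x, P x -> Omega (x + w)) -> test_function Omega (fun y => phi (y - w)).
Proof.
move=> [s c sub] PO; have ss := @supp_shift phi (- w); split.
- exact: smooth_shift.
- have cc : compact ((fun x : X => x + w) @` supp phi).
    apply: continuous_compact => //; apply: continuous_subspaceT => y.
    by apply: continuousD; [exact: id|exact: cst_continuous].
  apply: (subclosed_compact (@closed_closure _ _) cc) => y /ss /= ys.
  by exists (y - w) => //; rewrite subrK.
- by move=> y /ss /= /sub /PO; rewrite subrK.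
Qed.

Lemma derive_support phi w : smooth phi ->
  [set x | 'D_w phi x != 0] `<=` supp phi.
Proof.
move=> sp x /=; apply: contra_neqP => xs; rewrite derive_coordsum; last exact: smooth_differentiable.
apply: big1 => i _; rewrite (_ : partial i phi x = 0) ?mulr0//.
apply: supp_out; apply: contra_not xs; exact: partial_support.
Qed.

Lemma supp_derive_out phi w x : smooth phi -> ~ supp phi x -> 'D_w phi x = 0.
Proof. by move=> sp xs; apply: contra_notP xs => /eqP; exact: derive_support. Qed.

Lemma derive_bounded Omega phi w : test_function Omega phi ->
  exists2 M : R, 0 <= M & forall x, `|'D_w phi x| <= M.
Proof.
move=> [s c _]; have [M M0 HM] := compact_bounded_fun c (continuous_derive (w := w) s).
exists M => // x; have [/HM//|xs] := pselect (supp phi x).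
by rewrite supp_derive_out// normr0.
Qed.

Local Open Scope ereal_scope.

Lemma measurable_line w :
  measurable_fun setT (fun z : X * measurableTypeR R => z.1 + z.2 *: w)%R.
Proof.
apply/measurable_fun_rVP => i.
rewrite (_ : _ \o _ = fun z : X * measurableTypeR R => z.1 ord0 i + z.2 * w ord0 i)%R; last first.
  by apply/funext => z /=; rewrite /rV_coord !mxE.
apply: measurable_funD; last exact: measurable_funM.
exact: measurableT_comp (@measurable_rV_coord _ R n i) measurable_fst.
Qed.

Definition seg (r : R) : set (measurableTypeR R) := `[0%R, r]%classic.

Lemma leb_seg r : (0 <= r)%R -> leb (seg r) = r%:E.
Proof.
move=> r0; rewrite /seg lebesgue_measure_itv/= lte_fin.
by case: ltP r0 => [|r0' r0]; rewrite ?sube0//; congr EFin; apply/eqP; rewrite eq_le r0.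
Qed.

Lemma measurable_seg r : measurable (seg r). Proof. exact: measurable_itv. Qed.

Lemma measurable_line' w :
  measurable_fun setT (fun z : measurableTypeR R * X => z.2 + z.1 *: w)%R.
Proof.
apply/measurable_fun_rVP => i.
rewrite (_ : _ \o _ = fun z : measurableTypeR R * X => z.2 ord0 i + z.1 * w ord0 i)%R; last first.
  by apply/funext => z /=; rewrite /rV_coord !mxE.
apply: measurable_funD; last exact: measurable_funM.
exact: measurableT_comp (@measurable_rV_coord _ R n i) measurable_snd.
Qed.

Lemma measurable_shiftr w : measurable_fun setT (fun v : X => v + w)%R.
Proof. by under eq_fun do rewrite addrC; exact: measurable_shift. Qed.

Lemma measurable_indic_fst d (T : measurableType d) (D : set (measurableTypeR R)) : measurable D ->
  measurable_fun setT (fun z : measurableTypeR R * T => \1_D z.1 : R).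
Proof.
move=> mD; rewrite (_ : (fun z => _) = \1_(fst @^-1` D)).
  by apply: measurable_indic; rewrite -[_ @^-1` _]setTI; exact: measurable_fst.
by apply/funext => z; rewrite !indicE; congr (_%:R); apply/idP/idP; rewrite !inE.
Qed.

Lemma measurable_indic_snd d (T : measurableType d) (D : set (measurableTypeR R)) : measurable D ->
  measurable_fun setT (fun z : T * measurableTypeR R => \1_D z.2 : R).
Proof.
move=> mD; rewrite (_ : (fun z => _) = \1_(snd @^-1` D)).
  by apply: measurable_indic; rewrite -[_ @^-1` _]setTI; exact: measurable_snd.
by apply/funext => z; rewrite !indicE; congr (_%:R); apply/idP/idP; rewrite !inE.
Qed.

(** After the translation by [t *: w] the cutoff lives in a larger cube, the same for all [t] in
    [[0, 1]]. This uniformity gives integrability in [x] and [t] together. *)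
Lemma lines_bound G psi w k (M t : R) : locint G -> measurable_fun setT psi ->
  (forall x, `|psi x| <= M)%R -> (forall x, ~ cube k x -> psi x = 0%R) -> (0 <= t <= 1)%R ->
  \int[mu]_x `|(G (x + t *: w) * psi x)%:E| <=
    M%:E * \int[mu]_(x in cube (k + (Num.bound `|w|).+1)) `|G x|%:E.
Proof.
move=> [mG Gk] mpsi psiM psik /andP[t0 t1]; set K := (k + _)%N.
have M0 : (0 <= M)%R by exact: le_trans (psiM 0%R).
pose F (y : X) := `|(G y * psi (y - t *: w))%:E|.
have mF : measurable_fun setT F.
  apply: measurableT_comp => //; apply/measurable_EFinP; apply: measurable_funM => //.
  exact: (measurableT_comp mpsi (measurable_shiftr _)).
have -> : \int[mu]_x `|(G (x + t *: w)%R * psi x)%:E| = \int[mu]_x F x.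
  rewrite -(ge0_integral_shift (t *: w) mF); last by move=> v; exact: abse_ge0.
  by apply: eq_integral => x _; rewrite /F [(t *: w + x)%R]addrC addrK.
have mGa : measurable_fun setT (fun x => `|G x|%:E : \bar R) by apply/measurable_EFinP; exact: measurableT_comp.
rewrite -ge0_integralZl//; [|exact: measurable_cube|exact: measurable_funTS].
rewrite [leRHS]integral_mkcond; apply: ge0_le_integral => //.
- by move=> x _; exact: abse_ge0.
- apply/(measurable_restrictT _ _).1; first exact: measurable_cube.
  by apply: measurable_funTS; exact: measurable_funeM.
- move=> y _; rewrite patchE /F; case: ifPn => [_|].
    by rewrite -EFinM lee_fin normrM mulrC ler_wpM2r.
  rewrite notin_setE => yK; rewrite psik ?mulr0 ?abse0// => yk; apply: yK => i.
  have := yk i; have := coord_le_norm w i; rewrite !in_itv/= !mxE.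
  have := archi_boundP (normr_ge0 w).
  have : ((Num.bound `|w|)%:R <= (Num.bound `|w|).+1%:R :> R)%R by rewrite ler_nat.
  rewrite /K natrD; move: ((Num.bound `|w|).+1%:R)%R (Num.bound `|w|)%:R => A B h1 h2 h3.
  have : (`|t * w ord0 i| <= `|w ord0 i|)%R by rewrite normrM ger0_norm// ler_piMl.
  by rewrite !ler_norml => /andP[? ?] /andP[? ?]; apply/andP; split; lra.
Qed.

Lemma measurable_lineG G w (g : X -> R) (D : set (measurableTypeR R)) :
  measurable_fun setT G -> measurable_fun setT g -> measurable D ->
  measurable_fun setT (fun z : X * measurableTypeR R => (G (z.1 + z.2 *: w)%R * g z.1 * \1_D z.2)%:E).
Proof.
move=> mG mg mD; apply/measurable_EFinP; apply: measurable_funM; last exact: measurable_indic_snd.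
apply: measurable_funM; first exact: measurableT_comp mG (measurable_line w).
exact: measurableT_comp mg measurable_fst.
Qed.

Lemma line_integrable G w psi k (M r : R) : locint G -> measurable_fun setT psi ->
  (forall x, `|psi x| <= M)%R -> (forall x, ~ cube k x -> psi x = 0%R) -> (r <= 1)%R ->
  (mu \x leb).-integrable setT
    (fun z : X * measurableTypeR R => (G (z.1 + z.2 *: w)%R * psi z.1 * \1_(seg r) z.2)%:E).
Proof.
move=> lG mpsi psiM psik r1; have [mG Gk] := lG.
have mH := measurable_lineG w mG mpsi (measurable_seg r).
apply/(integrable21ltyP mu leb mH).
have M0 : (0 <= M)%R by exact: le_trans (psiM 0%R).
set C := M%:E * \int[mu]_(x in cube (k + (Num.bound `|w|).+1)) `|G x|%:E.
have C0 : 0 <= C by apply: mule_ge0; rewrite ?lee_fin//; apply: integral_ge0 => x _; rewrite lee_fin.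
apply: (@le_lt_trans _ _ (\int[leb]_t (C * (\1_(seg 1) t)%:E))); last first.
  rewrite ge0_integralZl//.
  - rewrite integral_indic ?setIT//; last exact: measurable_seg.
    rewrite [X in C * X](_ : _ = 1); last exact: leb_seg.
    by rewrite mule1 lte_mul_pinfty// lee_fin.
  - by apply/measurable_EFinP; apply: measurable_indic; exact: measurable_seg.
apply: ge0_le_integral => //.
- by move=> t _; apply: integral_ge0.
- pose h (z : measurableTypeR R * X) := `|(G (z.2 + z.1 *: w)%R * psi z.2 * \1_(seg r) z.1)%:E|.
  apply: (measurable_integral2 mu h).
  apply: measurableT_comp => //; apply/measurable_EFinP; apply: measurable_funM; last first.
    by apply: measurable_indic_fst; exact: measurable_seg.
  apply: measurable_funM; first exact: measurableT_comp mG (measurable_line' w).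
  exact: measurableT_comp mpsi measurable_snd.
- apply: measurable_funeM; apply/measurable_EFinP; apply: measurable_indic; exact: measurable_seg.
- move=> t _ /=; rewrite !indicE; have [tr|tr] := boolP (t \in seg r); last first.
    rewrite integral0_eq; last by move=> x _; rewrite mulr0 /= normr0.
    exact: mule_ge0.
  have t1 : (0 <= t <= 1)%R.
    move: tr; rewrite inE /seg/= in_itv/= => /andP[-> tr]; exact: le_trans tr r1.
  rewrite mem_set ?mule1; last by rewrite /seg/= in_itv.
  by under eq_integral do rewrite mulr1; exact: lines_bound.
Qed.

(* The weak derivative in direction [w], tested over the whole space: functions
   on [Omega] are extended by zero. *)
Definition dir_weak_deriv (Omega : set X) w f G := forall phi, test_function Omega phi ->
  \int[mu]_x (f x * 'D_w phi x)%:E = - \int[mu]_x (G x * phi x)%:E.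

(** The real integral is [fine] of the extended one, so this is meaningful only on the lines along
    which [G] is integrable; by [line_ae_integrable] these are almost all for [r <= 1]. *)
Definition line_int G w (r : R) x : R := (\int[leb]_(t in seg r) G (x + t *: w)%R)%R.

Lemma seg_integral_indic (h : R -> R) (r : R) :
  \int[leb]_(t in seg r) (h t)%:E = \int[leb]_t (h t * \1_(seg r) t)%:E.
Proof.
rewrite integral_mkcond; apply: eq_integral => t _; rewrite patchE indicE.
by case: ifP => _; rewrite ?mulr1 ?mulr0.
Qed.

Lemma cube_indic_bound k x : (`|\1_(cube k : set X) x| <= 1 :> R)%R.
Proof. by rewrite indicE; case: (_ \in _); rewrite ?normr1 ?normr0. Qed.

Lemma measurable_cube_indic k : measurable_fun setT (\1_(cube k) : X -> R).
Proof. by apply: measurable_indic; exact: measurable_cube. Qed.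

Lemma line_ae_integrable G w (r : R) : locint G -> (r <= 1)%R ->
  {ae mu, forall x, leb.-integrable (seg r) (fun t => (G (x + t *: w)%R)%:E)}.
Proof.
move=> lG r1.
have ae k : {ae mu, forall x, cube k x -> leb.-integrable (seg r) (fun t => (G (x + t *: w)%R)%:E)}.
  have out x : ~ cube k x -> \1_(cube k) x = 0%R :> R by move=> xk; rewrite indicE memNset.
  have := ae_integrable1 (line_integrable w lG (measurable_cube_indic k) (cube_indic_bound k) out r1).
  apply: filterS => x /= H xk; apply/(integrable_mkcond _ (measurable_seg r)).
  move: H; apply: eq_integrable => // t _; rewrite patchE !indicE (mem_set xk) mulr1.
  by case: ifP => _; rewrite ?mulr1 ?mulr0.
have : mu.-negligible (\bigcup_k ~` [set x | cube k x -> leb.-integrable (seg r) (fun t => (G (x + t *: w)%R)%:E)]).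
  by apply: negligible_bigcup => k; exact: ae.
apply: negligibleS => x /= Hx; have [k _ xk] : (\bigcup_k cube k) x by rewrite cube_cover.
by exists k => // /(_ xk).
Qed.

Lemma measurable_line_int G w r : measurable_fun setT G ->
  measurable_fun setT (line_int G w r).
Proof.
move=> mG.
pose h (z : X * measurableTypeR R) := (G (z.1 + z.2 *: w)%R * \1_(seg r) z.2)%:E.
have mh : measurable_fun setT h.
  apply/measurable_EFinP; apply: measurable_funM; last by apply: measurable_indic_snd; exact: measurable_seg.
  exact: (measurableT_comp mG (measurable_line w)).
have mi : measurable_fun setT (fun x : X => \int[leb]_y h (x, y)) := measurable_integral2 leb h mh.
have m1 : measurable_fun setT (fine \o (fun x : X => \int[leb]_y h (x, y))).
  exact: measurableT_comp mi.
rewrite (_ : line_int G w r = fine \o (fun x : X => \int[leb]_y h (x, y))); first exact: m1.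
by apply/funext => x; rewrite /line_int /Rintegral seg_integral_indic.
Qed.

Lemma line_int_le G w r x : measurable_fun setT G ->
  `|line_int G w r x|%:E <= \int[leb]_(t in seg r) `|G (x + t *: w)%R|%:E.
Proof.
move=> mG; rewrite /line_int /Rintegral.
have mGx : measurable_fun (seg r) (fun t : measurableTypeR R => (G (x + t *: w)%R)%:E : \bar R).
  apply/measurable_EFinP; apply: measurable_funTS; apply: (measurableT_comp mG).
  exact: (measurableT_comp (measurable_line w) (measurable_pair1 x)).
apply: le_trans (le_abse_integral leb (measurable_seg r) mGx).
case: (\int[leb]_(x0 in seg r) _) => [s||] /=; rewrite ?leey//; exact: lexx.
Qed.

Lemma locint_line_int G w r : locint G -> (r <= 1)%R -> locint (line_int G w r).
Proof.
move=> lG r1; have [mG Gk] := lG; split; first exact: measurable_line_int.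
move=> k.
have out x : ~ cube k x -> \1_(cube k) x = 0%R :> R by move=> xk; rewrite indicE memNset.
have I := line_integrable w lG (measurable_cube_indic k) (cube_indic_bound k) out r1.
pose h (z : X * measurableTypeR R) := `|(G (z.1 + z.2 *: w)%R * \1_(cube k) z.1 * \1_(seg r) z.2)%:E|.
have mh : measurable_fun setT h by apply: measurableT_comp => //; exact: measurable_int I.
have := (integrable12ltyP mu leb (measurable_int _ I)).1 I.
apply: le_lt_trans; rewrite integral_mkcond; apply: ge0_le_integral => //.
- by move=> x _; rewrite patchE; case: ifP => // _; rewrite lee_fin.
- apply/(measurable_restrictT _ _).1; first exact: measurable_cube.
  by apply: measurable_funTS; apply/measurable_EFinP; apply: measurableT_comp => //; exact: measurable_line_int.
- exact: (measurable_integral2 leb h mh).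
- move=> x _; rewrite patchE; case: ifPn => [xk|_]; last exact: integral_ge0.
  apply: le_trans (line_int_le w r x mG) _; rewrite seg_integral_indic.
  apply: ge0_le_integral => //=.
  + apply/measurable_EFinP; apply: measurable_funM; last by apply: measurable_indic; exact: measurable_seg.
    apply: measurableT_comp => //; apply: (measurableT_comp mG).
    exact: (measurableT_comp (measurable_line w) (measurable_pair1 x)).
  + exact: (measurableT_comp mh (measurable_pair1 x)).
  + by move=> t _; rewrite lee_fin !normrM [\1_(cube k) x]indicE xk normr1 mulr1 indicE normr_nat.
Qed.

Lemma line_int_test G w r phi Omega : locint G -> (r <= 1)%R -> test_function Omega phi ->
  \int[mu]_x (line_int G w r x * phi x)%:E =
  \int[leb]_(t in seg r) \int[mu]_x (G (x + t *: w)%R * phi x)%:E.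
Proof.
move=> lG r1 tphi; have [s _ _] := tphi.
have [M _ HM] := test_bounded tphi; have [k Hk] := test_cube tphi.
have mphi := continuous_measurable_rV (smooth_continuous s).
have I := line_integrable w lG mphi HM Hk r1.
transitivity (\int[mu]_x \int[leb]_t (G (x + t *: w)%R * phi x * \1_(seg r) t)%:E).
  apply: ae_eq_integral => //.
  - apply/measurable_EFinP; apply: measurable_funM => //; apply: measurable_line_int; exact: lG.1.
  - exact: (measurable_integral2 leb _ (measurable_int _ I)).
  - apply: filterS (line_ae_integrable w lG r1) => x Ix _.
    rewrite -seg_integral_indic.
    under eq_integral do rewrite EFinM muleC.
    rewrite integralZl//; last exact: measurable_seg.
    rewrite EFinM muleC; congr (_ * _); rewrite fineK//.
    by apply: integrable_fin_num => //; exact: measurable_seg.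
rewrite (Fubini I) [RHS]integral_mkcond; apply: eq_integral => t _; rewrite patchE.
case: ifPn => tr; last first.
  by apply: integral0_eq => x _; rewrite indicE (negbTE tr) mulr0.
by apply: eq_integral => x _; rewrite indicE tr mulr1.
Qed.

(** The identity is tested against [phi] supported in [P]. Moving the translations onto [phi] turns
    the integral of [G] into that of [f] against the derivative of [phi (y - t *: w)] in [t], which
    the classical theorem evaluates. *)
Lemma weak_FTC (P Omega : set X) w f G r : open P -> locint f -> locint G ->
  dir_weak_deriv Omega w f G -> (0 <= r <= 1)%R ->
  (forall x t, P x -> 0 <= t <= r -> Omega (x + t *: w))%R ->
  {ae mu, forall x, P x -> f (x + r *: w)%R = (f x + line_int G w r x)%R}.
Proof.
move=> oP lf lG fG /andP[r0 r1] PO.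
pose h x := (f (x + r *: w) + (- 1 * f x + - 1 * line_int G w r x))%R.
have lh : locint h.
  apply: locintD; first exact: locint_shift.
  by apply: locintD; apply: locintZ => //; exact: locint_line_int.
suff H : {ae mu, forall x, P x -> h x = 0%R}.
  apply: filterS H => x /[apply]; rewrite /h => /eqP; rewrite addr_eq0 => /eqP ->; ring.
apply: fundamental_lemma => // phi tphi; have [s _ _] := tphi.
have lA := locint_line_int w lG r1.
have I1 := test_integrable (locint_shift (r *: w) lf) tphi.
have I2 := test_integrable lf tphi.
have I3 := test_integrable lA tphi.
transitivity (\int[mu]_x ((f (x + r *: w)%R * phi x)%:E - (f x * phi x)%:E - (line_int G w r x * phi x)%:E)).
  by apply: eq_integral => x _; rewrite -!EFinB; congr EFin; rewrite /h; ring.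
rewrite integralB//; last exact: integrableB.
rewrite integralB// (line_int_test w lG r1 tphi).
(* Here the segments from [P] must stay in [Omega]: the translates of [phi] are admissible in the
   definition of the weak derivative. *)
have tsh t : (0 <= t <= r)%R -> test_function Omega (fun y => phi (y - t *: w)%R).
  by move=> tr; apply: test_shift tphi _ => x Px; exact: PO.
have [M _ HM] := derive_bounded w tphi.
have [k sk] : exists k, supp phi `<=` cube k by have [_ c _] := tphi; exact: supp_bounded.
pose D (x : X) := 'D_w phi x.
have cD : continuous D by exact: continuous_derive.
have mD := continuous_measurable_rV cD.
have Dk x : ~ cube k x -> D x = 0%R by move=> xk; apply: supp_derive_out => // /sk.
have ID := line_integrable w lf mD HM Dk r1.
have sh t (g g' : X -> R) : measurable_fun setT g -> measurable_fun setT g' ->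
    \int[mu]_x (g (x + t *: w)%R * g' x)%:E = \int[mu]_y (g y * g' (y - t *: w)%R)%:E.
  move=> mg mg'; rewrite -(integral_shift (t *: w) (f := fun y => (g y * g' (y - t *: w)%R)%:E)).
    by apply: eq_integral => x _; rewrite [(t *: w + x)%R]addrC addrK.
  apply/measurable_EFinP; apply: measurable_funM => //.
  exact: measurableT_comp mg' (measurable_shiftr _).
have mphi := continuous_measurable_rV (smooth_continuous s).
have If t : mu.-integrable setT (fun y => (f y * D (y - t *: w)%R)%:E).
  have := integrable_shift (- (t *: w)) (locint_test_integrable (locint_shift (t *: w) lf) cD HM Dk).
  by apply: eq_integrable => // y _; rewrite [(- _ + y)%R]addrC subrK.
have E t : (0 <= t <= r)%R -> \int[mu]_x (G (x + t *: w)%R * phi x)%:E =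
    \int[mu]_y (- (f y * D (y - t *: w)%R))%:E.
  move=> tr.
  have H : \int[mu]_y (f y * D (y - t *: w)%R)%:E = - \int[mu]_y (G y * phi (y - t *: w)%R)%:E.
    rewrite -(fG _ (tsh t tr)); apply: eq_integral => y _.
    by rewrite (congr1 (@^~ y) (derive_shift_rV phi w (- (t *: w)))).
  under [RHS]eq_integral do rewrite EFinN -mulN1e.
  rewrite [RHS]integralZl// mulN1e [X in _ = - X]H oppeK sh//; exact: lG.1.
(* The integrand after translation. Each slice in [y] has the same absolute integral as before it,
   so integrability in both variables carries over and Fubini applies. *)
pose K (z : X * measurableTypeR R) := (- (f z.1 * D (z.1 - z.2 *: w)%R) * \1_(seg r) z.2)%:E.
have mDl : measurable_fun setT (fun z : X * measurableTypeR R => D (z.1 - z.2 *: w)%R).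
  under eq_fun do rewrite -scalerN; exact: measurableT_comp mD (measurable_line _).
have mK : measurable_fun setT K.
  apply/measurable_EFinP; apply: measurable_funM; last by apply: measurable_indic_snd; exact: measurable_seg.
  apply: measurableT_comp => //; apply: measurable_funM => //.
  exact: measurableT_comp lf.1 measurable_fst.
have IK : (mu \x leb).-integrable setT K.
  apply/(integrable21ltyP mu leb mK).
  apply: le_lt_trans ((integrable21ltyP mu leb (measurable_int _ ID)).1 ID).
  rewrite le_eqVlt; apply/orP; left; apply/eqP; apply: eq_integral => t _.
  rewrite -(ge0_integral_shift (t *: w) (f := fun y => `|K (y, t)|)).
  - by apply: eq_integral => x _; rewrite /K /= [(t *: w + x)%R]addrC addrK mulNr normrN.
  - by apply: measurableT_comp => //; exact: (measurableT_comp mK (measurable_pair2 t)).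
  - by move=> v; exact: abse_ge0.
have -> : \int[leb]_(t in seg r) \int[mu]_x (G (x + t *: w)%R * phi x)%:E =
    \int[leb]_t \int[mu]_y K (y, t).
  rewrite [LHS]integral_mkcond; apply: eq_integral => t _; rewrite patchE.
  case: ifPn => tr; last first.
    by apply/esym/integral0_eq => x _; rewrite /K indicE (negbTE tr) mulr0.
  rewrite E; last by move: (tr); rewrite inE /seg /= in_itv.
  by apply: eq_integral => x _; rewrite /K indicE tr mulr1.
rewrite -(Fubini IK).
(* For fixed [y] the inner integrand is [f y] times the derivative of [phi (y - t *: w)] in [t]. *)
have -> : \int[mu]_y \int[leb]_t K (y, t) =
    \int[mu]_y ((f y * phi (y - r *: w)%R)%:E - (f y * phi y)%:E).
  apply: eq_integral => y _.
  have -> : \int[leb]_t K (y, t) = \int[leb]_(t in seg r) ((f y)%:E * ('D_(- w) phi (y + t *: - w))%:E).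
    rewrite [RHS]integral_mkcond; apply: eq_integral => t _; rewrite patchE /K indicE.
    case: ifP => _; rewrite ?mulr0// mulr1 -EFinM deriveN_dir; last exact: smooth_differentiable.
    by rewrite scalerN mulrN.
  rewrite integralZl; last 2 first.
  - exact: measurable_seg.
  - apply: continuous_compact_integrable; first exact: segment_compact.
    suff cl : continuous (fun t : R => 'D_(- w) phi (y + t *: - w))%R by exact: continuous_subspaceT cl.
    move=> t; apply: (@continuous_comp _ _ _ (fun t : R => y + t *: - w)%R (fun x => 'D_(- w) phi x)); last first.
      exact: continuous_derive.
    by apply: continuousD; [exact: cst_continuous|exact: scalel_continuous].
  by rewrite line_FTC// -EFinM -EFinB scalerN mulrBr.
have [M' _ HM'] := test_bounded tphi; have [k' Hk'] := test_cube tphi.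
rewrite integralB//; last first.
  have := integrable_shift (- (r *: w)) (locint_test_integrable (locint_shift (r *: w) lf) (smooth_continuous s) HM' Hk').
  by apply: eq_integrable => // y _; rewrite [(- _ + y)%R]addrC subrK.
rewrite -(sh r f phi lf.1 mphi) subee//.
by rewrite fin_numB; apply/andP; split; exact: integrable_fin_num.
Qed.

End line_integrals.

(** * The Leibniz rule for weak derivatives *)

Section by_parts.
Context {R : realType}.
Notation leb := (@lebesgue_measure R).
Local Open Scope ereal_scope.
Implicit Types (a b h : R -> R) (r s t : R).

Lemma seg_bound h (C r : R) : (0 <= r)%R -> leb.-integrable (seg r) (EFin \o h) ->
  (forall t, seg r t -> `|h t| <= C)%R -> (`|\int[leb]_(t in seg r) h t| <= C * r)%R.
Proof.
move=> r0 ih hC; have mh := measurable_int _ ih.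
apply: le_trans (le_normr_Rintegral (measurable_seg r) ih) _.
rewrite -lee_fin fineK; last first.
  by apply: integrable_fin_num; [exact: measurable_seg|exact: integrable_norm].
apply: (@le_trans _ _ (\int[leb]_(t in seg r) C%:E)).
  apply: ge0_le_integral => //; first exact: measurable_seg.
  by apply/measurable_EFinP; apply: measurableT_comp => //; exact/measurable_EFinP.
rewrite integral_cst; last exact: measurable_seg.
by rewrite [X in _ * X](_ : _ = r%:E) ?EFinM//; exact: leb_seg.
Qed.

Lemma bounded_seg_integrable h (C r : R) : (0 <= r)%R -> measurable_fun (seg r) h ->
  (forall t, seg r t -> `|h t| <= C)%R -> leb.-integrable (seg r) (EFin \o h).
Proof.
move=> r0 mh hC; apply: (@le_integrable _ _ _ _ _ (measurable_seg r) _ (cst C%:E)).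
- exact/measurable_EFinP.
- move=> t tr /=; rewrite lee_fin; exact: le_trans (hC t tr) (ler_norm C).
- apply/integrableP; split => //.
  rewrite integral_cst; last exact: measurable_seg.
  by rewrite [X in _ * X](_ : _ = r%:E) ?ltry//; exact: leb_seg.
Qed.

(** [[0, s]] for [false] and [[0, s[] for [true]: the two triangles of the square must be disjoint,
    so that the diagonal is counted once. *)
Definition below (c : bool) (s : R) : set (measurableTypeR R) :=
  [set` Interval (BLeft 0%R) (BSide c s)].

Lemma integrable_tensor a b : leb.-integrable setT (EFin \o a) -> leb.-integrable setT (EFin \o b) ->
  (leb \x leb).-integrable setT (fun z : measurableTypeR R * measurableTypeR R => (a z.1 * b z.2)%:E) /\
  \int[leb \x leb]_z (a z.1 * b z.2)%:E = \int[leb]_s (a s)%:E * \int[leb]_s (b s)%:E.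
Proof.
move=> ia ib.
have ma : measurable_fun setT a by apply/measurable_EFinP; exact: measurable_int ia.
have mb : measurable_fun setT b by apply/measurable_EFinP; exact: measurable_int ib.
have afin := integrable_fin_num measurableT ia.
have bfin := integrable_fin_num measurableT ib.
have mK : measurable_fun setT (fun z : measurableTypeR R * measurableTypeR R => (a z.1 * b z.2)%:E).
  apply/measurable_EFinP; apply: measurable_funM.
    exact: measurableT_comp ma measurable_fst.
  exact: measurableT_comp mb measurable_snd.
have iK : (leb \x leb).-integrable setT (fun z => (a z.1 * b z.2)%:E).
  apply/(integrable12ltyP leb leb mK).
  have /integrableP[_ boo] := ib; have /integrableP[_ aoo] := ia.
  have b0 : 0 <= \int[leb]_t `|b t|%:E by apply: integral_ge0 => t _; rewrite lee_fin.
  have bf : \int[leb]_t `|b t|%:E \is a fin_num by rewrite ge0_fin_numE.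
  have -> : \int[leb]_x \int[leb]_y `|(a (x, y).1 * b (x, y).2)%:E| =
      \int[leb]_x ((fine (\int[leb]_t `|b t|%:E))%:E * `|a x|%:E).
    apply: eq_integral => s _; rewrite fineK// muleC -ge0_integralZl//.
    - by apply: eq_integral => t _; rewrite /= normrM EFinM.
    - by apply/measurable_EFinP; exact: measurableT_comp.
  rewrite ge0_integralZl_EFin//; last 2 first.
  - by apply/measurable_EFinP; exact: measurableT_comp.
  - by rewrite fine_ge0.
  by rewrite lte_mul_pinfty// lee_fin fine_ge0.
split=> //; rewrite -(integral12_prod_meas1 iK) /fubini_F -(fineK bfin) muleC -integralZl//.
apply: eq_integral => s _ /=; rewrite fineK// muleC -integralZl//.
Qed.

(** One triangle of the square [[0, r] ^ 2]: Fubini writes its double integral as [a] against a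
    primitive of [b]. *)
Lemma half_by_parts (c : bool) a b r :
  leb.-integrable (seg r) (EFin \o a) -> leb.-integrable (seg r) (EFin \o b) ->
  let H z := ((a \_ (seg r)) z.1 * (b \_ (seg r)) z.2 * \1_(below c z.1) z.2)%:E in
  [/\ (leb \x leb).-integrable setT H,
    leb.-integrable (seg r) (fun s => (a s * \int[leb]_(t in below c s) b t)%:E) &
    \int[leb]_(s in seg r) (a s * \int[leb]_(t in below c s) b t)%R%:E =
      \int[leb \x leb]_z H z].
Proof.
move=> ia ib H.
set a' := a \_ (seg r) in H *; set b' := b \_ (seg r) in H *.
have ia' : leb.-integrable setT (EFin \o a').
  by rewrite /a' -restrict_EFin; apply/(integrable_mkcond _ (measurable_seg r)).
have ib' : leb.-integrable setT (EFin \o b').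
  by rewrite /b' -restrict_EFin; apply/(integrable_mkcond _ (measurable_seg r)).
have ma' : measurable_fun setT a' by apply/measurable_EFinP; exact: measurable_int ia'.
have mb' : measurable_fun setT b' by apply/measurable_EFinP; exact: measurable_int ib'.
have [iK _] := integrable_tensor ia' ib'.
have mW : measurable_fun setT (fun z : measurableTypeR R * measurableTypeR R => \1_(below c z.1) z.2 : R).
  rewrite (_ : (fun z => _) = \1_([set z : measurableTypeR R * measurableTypeR R | below c z.1 z.2])); last first.
    by apply/funext => z; rewrite !indicE; congr (_%:R); apply/idP/idP; rewrite !inE.
  apply: measurable_indic.
  rewrite (_ : [set z | _] = (snd @^-1` `[0%R, +oo[) `&` ((fun z : measurableTypeR R * measurableTypeR R => (z.1 - z.2)%R) @^-1` [set` Interval (BSide (~~ c) 0%R) +oo%O])).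
    apply: measurableI; rewrite -[X in measurable X]setTI.
      by apply: measurable_snd => //; exact: measurable_itv.
    apply: measurable_funB => //; exact: measurable_itv.
  apply/seteqP; split => -[s t]; rewrite /below /= !in_itv/= ?andbT; case: c {H} => /=;
    rewrite ?subr_gt0 ?subr_ge0 ?lteBSide ?andbT/=; first [by move=> /andP[]|by move=> [-> ->]].
have mH : measurable_fun setT H.
  apply/measurable_EFinP; apply: measurable_funM => //; apply/measurable_EFinP; exact: measurable_int iK.
have iH : (leb \x leb).-integrable setT H.
  apply: le_integrable mH _ iK => // z _; rewrite lee_fin normrM ler_piMr//.
  by rewrite indicE; case: (_ \in _); rewrite ?normr1 ?normr0.
have inner s : \int[leb]_t H (s, t) = (fun s => (a s * \int[leb]_(t in below c s) b t)%R%:E) \_ (seg r) s.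
  rewrite patchE; case: ifPn => sr; last first.
    by apply: integral0_eq => t _; rewrite /H /a' patchE /= (negbTE sr) !mul0r.
  have sub : below c s `<=` seg r.
    move: sr; rewrite inE /seg /= in_itv/= => /andP[_ sr] t; rewrite /below/= !in_itv/=.
    by case: c {H mW mH iH} => /= /andP[-> ts] /=; [exact: le_trans (ltW ts) sr|exact: le_trans ts sr].
  have mbelow : measurable (below c s) by exact: measurable_itv.
  have ibs : leb.-integrable (below c s) (EFin \o b).
    exact: integrableS (measurable_seg r) mbelow sub ib.
  rewrite EFinM /Rintegral fineK; last exact: integrable_fin_num.
  rewrite -integralZl// [RHS]integral_mkcond; apply: eq_integral => t _.
  rewrite /H /a' /b' !patchE sr /= indicE; case: (boolP (t \in below c s)) => [tb|_]; last by rewrite mulr0.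
  have -> : t \in seg r by rewrite inE; apply: sub; rewrite -inE.
  by rewrite mulr1 EFinM.
split=> //.
  apply/(integrable_mkcond _ (measurable_seg r)).
  have := integrable_fubini_F iH; rewrite /fubini_F.
  by apply: eq_integrable => // s _; rewrite inner.
rewrite -(integral12_prod_meas1 iH) integral_mkcond /fubini_F.
by apply: eq_integral => s _; rewrite inner.
Qed.

(** The product of the integrals of [a] and [b] is an integral over a square, cut along the diagonal
    into two triangles. No pointwise differentiability of the primitives is involved. *)
Lemma seg_by_parts a b (A B r : R) : (0 <= r)%R ->
  leb.-integrable (seg r) (EFin \o a) -> leb.-integrable (seg r) (EFin \o b) ->
  let u t := (A + \int[leb]_(s in seg t) a s)%R in
  let v t := (B + \int[leb]_(s in seg t) b s)%R in
  leb.-integrable (seg r) (fun s => (a s * v s + u s * b s)%:E) /\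
  (\int[leb]_(s in seg r) (a s * v s + u s * b s) = u r * v r - A * B)%R.
Proof.
move=> r0 ia ib u v.
have [iH1 i1 E1] := half_by_parts false ia ib.
have [iH2 i2 E2] := half_by_parts true ib ia.
have d2 s : seg r s -> (\int[leb]_(t in below true s) a t = \int[leb]_(t in seg s) a t)%R.
  move=> sr; apply: Rintegral_itv_bndo_bndc; apply: integrableS ia.
  - exact: measurable_seg.
  - exact: measurable_itv.
  - move=> t; move: sr; rewrite /seg/= !in_itv/= => /andP[_ sr] /andP[-> ts].
    exact: le_trans (ltW ts) sr.
have i2' : leb.-integrable (seg r) (fun s => (b s * \int[leb]_(t in seg s) a t)%:E).
  by move: i2; apply: eq_integrable => [|s /set_mem sr]; [exact: measurable_seg|rewrite d2].
have K : (\int[leb]_(s in seg r) (a s * \int[leb]_(t in seg s) b t) +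
    \int[leb]_(s in seg r) (b s * \int[leb]_(t in seg s) a t) =
    \int[leb]_(t in seg r) a t * \int[leb]_(t in seg r) b t)%R.
  have mseg := measurable_seg r.
  pose a' := a \_ (seg r); pose b' := b \_ (seg r).
  have ia' : leb.-integrable setT (EFin \o a').
    by rewrite /a' -restrict_EFin; apply/(integrable_mkcond _ (measurable_seg r)).
  have ib' : leb.-integrable setT (EFin \o b').
    by rewrite /b' -restrict_EFin; apply/(integrable_mkcond _ (measurable_seg r)).
  have [iK EK] := integrable_tensor ia' ib'.
  pose H2 (z : measurableTypeR R * measurableTypeR R) := (b' z.1 * a' z.2 * \1_(below true z.1) z.2)%:E.
  have mH2 : measurable_fun setT (H2 \o unstable.swap) by exact: measurableT_comp (measurable_int _ iH2) (@measurable_swap _ _ _ _).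
  have iH2' : (leb \x leb).-integrable setT (H2 \o unstable.swap).
    apply: le_integrable mH2 _ iK => // z _; rewrite lee_fin /= normrM [(b' _ * _)%R]mulrC ler_piMr//.
    by rewrite indicE; case: (_ \in _); rewrite ?normr1 ?normr0.
  (* Exchanging the variables puts the second triangle above the diagonal, where it complements the
     first. *)
  have E2' : \int[leb \x leb]_z H2 z = \int[leb \x leb]_z H2 (unstable.swap z).
    by rewrite -(integral21_prod_meas1 iH2) -(integral12_prod_meas1 iH2').
  rewrite E2' in E2.
  have F c d : leb.-integrable (seg r) (EFin \o c) -> \int[leb]_(t in seg r) (c t)%:E = d ->
      (\int[leb]_(t in seg r) c t)%:E = d.
    by move=> ic <-; rewrite /Rintegral fineK//; exact: integrable_fin_num.
  apply: EFin_inj; rewrite EFinD EFinM (F _ _ i1 E1).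
  rewrite (_ : \int[leb]_(s in seg r) (b s * _) = \int[leb]_(s in seg r) (b s * \int[leb]_(t in below true s) a t))%R; last first.
    by apply: eq_Rintegral => s /set_mem /d2 ->.
  rewrite (F _ _ i2 E2) -integralD//.
  have E c : \int[leb]_(s in seg r) (c s)%:E = \int[leb]_s ((c \_ (seg r)) s)%:E.
    by rewrite [LHS]integral_mkcond restrict_EFin.
  rewrite (F _ _ ia (E a)) (F _ _ ib (E b)) -EK.
  apply: eq_integral => -[s t] _; rewrite /H2 /= -EFinD; congr EFin.
  rewrite /a' /b' !patchE; case: ifPn => sr; last by rewrite !(mul0r,mulr0,addr0).
  case: ifPn => tr; last by rewrite !(mul0r,mulr0,addr0).
  have -> : \1_(below true t) s = (s < t)%R%:R :> R.
    rewrite indicE /below; congr ((nat_of_bool _)%:R); apply/idP/idP; rewrite inE /= in_itv/=; first by move=> /andP[].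
    by move=> ->; move: sr; rewrite inE /seg/= in_itv/= => /andP[->].
  have -> : \1_(below false s) t = (t <= s)%R%:R :> R.
    rewrite indicE /below; congr ((nat_of_bool _)%:R); apply/idP/idP; rewrite inE /= in_itv/=; first by move=> /andP[].
    by move=> ->; move: tr; rewrite inE /seg/= in_itv/= => /andP[->].
  by case: leP => _; rewrite ?(mulr0,mulr1,addr0,add0r) // mulrC.
have mseg := measurable_seg r.
have i1c : leb.-integrable (seg r) (fun s => (a s * v s)%:E).
  have := integrableD mseg (integrableZl mseg B ia) i1.
  by apply: eq_integrable => // s _ /=; rewrite -EFinM -EFinD mulrDr [(a s * B)%R]mulrC.
have i2c : leb.-integrable (seg r) (fun s => (u s * b s)%:E).
  have := integrableD mseg (integrableZl mseg A ib) i2'.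
  by apply: eq_integrable => // s _ /=; rewrite -EFinM -EFinD mulrDl [(b s * _)%R]mulrC.
split; first by have := integrableD mseg i1c i2c; apply: eq_integrable => // s _ /=.
rewrite RintegralD//.
rewrite (_ : \int[leb]_(s in seg r) (a s * v s) = \int[leb]_(s in seg r) (B * a s + a s * \int[leb]_(t in seg s) b t))%R; last first.
  by apply: eq_Rintegral => s _; rewrite /v; ring.
rewrite (_ : \int[leb]_(s in seg r) (u s * b s) = \int[leb]_(s in seg r) (A * b s + b s * \int[leb]_(t in seg s) a t))%R; last first.
  by apply: eq_Rintegral => s _; rewrite /u; ring.
rewrite !RintegralD// ?RintegralZl//; last 2 first.
- by have := integrableZl mseg A ib; apply: eq_integrable.
- by have := integrableZl mseg B ia; apply: eq_integrable.
by rewrite addrACA K /u /v; ring.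
Qed.

End by_parts.

(** * The product rule through almost every line *)

Section product_rule.
Context {R : realType} {n : nat}.
Notation X := 'rV[R]_n.
Notation mu := (lebesgue_rV n).
Notation leb := (@lebesgue_measure R).
Implicit Types (f g F G H phi psi : X -> R) (a b x v w : X) (i j : 'I_n).

(** A positive distance from a compact set to the complement, by the near-covering form of
    compactness. *)
Lemma compact_tube (K Omega : set X) : compact K -> open Omega -> K `<=` Omega ->
  exists2 d : R, 0 < d & forall x y, K x -> `|y - x| < d -> Omega y.
Proof.
move=> cK oO KO.
have /compact_near_coveringP/(_ _ (0:R)^'+ (fun d x => forall y, `|y - x| < d -> Omega y)) := cK.
case.
- move=> x /KO Ox; have /nbhs_ballP[e /= e0 He] := oO _ Ox.
  exists (ball x (e / 2), [set d | d < e / 2]) => /=.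
    split; first by apply: nbhsx_ballx; rewrite divr_gt0.
    by apply: nbhs_right_lt; rewrite divr_gt0.
  move=> [z d] /= [xz de] y yz; apply: He; rewrite -ball_normE/=.
  move: xz; rewrite -ball_normE/= => xz.
  rewrite (splitr e) (_ : x - y = (x - z) + (z - y)); last by rewrite addrA subrK.
  by apply: le_lt_trans (ler_normD _ _) _; rewrite ltrD// distrC (lt_trans yz).
- move=> e /= e0 He; exists (e / 2) => [|x y Kx]; first by rewrite divr_gt0.
  apply: (He (e / 2)) => //=; last by rewrite divr_gt0.
  by rewrite sub0r normrN gtr0_norm ?divr_gt0// ltr_pdivrMr// ltr_pMr// ltr1n.
Qed.

Lemma line_lip phi x w (M r : R) : smooth phi -> 0 <= r ->
  (forall x, `|'D_w phi x| <= M) -> `|phi (x + r *: w) - phi x| <= M * r.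
Proof.
move=> sp r0 HM.
have cD : continuous (fun t : R => 'D_w phi (x + t *: w)).
  move=> t; apply: (@continuous_comp _ _ _ (fun t : R => x + t *: w) (fun x => 'D_w phi x)); last first.
    exact: continuous_derive.
  by apply: continuousD; [exact: cst_continuous|exact: scalel_continuous].
have := line_FTC x w sp r0.
have i : leb.-integrable (seg r) (EFin \o (fun t : R => 'D_w phi (x + t *: w))).
  apply: continuous_compact_integrable; first exact: segment_compact.
  exact: continuous_subspaceT.
move=> /(congr1 fine) /= <-.
by apply: seg_bound => // t _.
Qed.

(** The factor 1/2 of Taylor's formula is dropped; only the order in [r] matters below. *)
Lemma line_taylor phi x w (M r : R) : smooth phi -> smooth (fun x => 'D_w phi x) -> 0 <= r ->
  (forall x, `|'D_w (fun x => 'D_w phi x) x| <= M) ->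
  `|phi (x + r *: w) - phi x - r * 'D_w phi x| <= M * r ^+ 2.
Proof.
move=> sp sD r0 HM.
have M0 : 0 <= M by exact: le_trans (HM 0).
have cD : continuous (fun t : R => 'D_w phi (x + t *: w)).
  move=> t; apply: (@continuous_comp _ _ _ (fun t : R => x + t *: w) (fun x => 'D_w phi x)); last first.
    exact: continuous_derive.
  by apply: continuousD; [exact: cst_continuous|exact: scalel_continuous].
have i : leb.-integrable (seg r) (EFin \o (fun t : R => 'D_w phi (x + t *: w))).
  apply: continuous_compact_integrable; first exact: segment_compact.
  exact: continuous_subspaceT.
have i1 : leb.-integrable (seg r) (EFin \o (cst ('D_w phi x))).
  by apply: (bounded_seg_integrable (C := `|'D_w phi x|) r0) => //; exact: measurable_cst.
have := line_FTC x w sp r0.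
move=> /(congr1 fine) /= <-.
have -> : r * 'D_w phi x = (\int[leb]_(t in seg r) 'D_w phi x)%R.
  rewrite Rintegral_cst; last exact: measurable_seg.
  by rewrite mulrC; congr (_ * _); rewrite [X in fine X](_ : _ = r%:E)//; exact: leb_seg.
rewrite [X in `|X - _|](_ : _ = \int[leb]_(t in seg r) 'D_w phi (x + t *: w))//.
rewrite -(RintegralB (measurable_seg r) i i1).
rewrite expr2 mulrA; apply: seg_bound => //.
  have := integrableB (measurable_seg r) i i1; by apply: eq_integrable => //; exact: measurable_seg.
move=> t; rewrite /seg/= in_itv/= => /andP[t0 tr].
by apply: le_trans (line_lip x sD t0 HM) _; rewrite ler_wpM2l.
Qed.

Lemma derive_scaled (c : R) i phi : smooth phi ->
  (fun x => 'D_(c *: delta_mx ord0 i) phi x) = (fun x => c * partial i phi x).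
Proof.
move=> sp; apply/funext => x; have d : differentiable phi x by exact: smooth_differentiable.
by rewrite /partial !deriveE// linearZ.
Qed.

Lemma smoothZ (c : R) phi : smooth phi -> smooth (fun x => c * phi x).
Proof.
move=> sp s x.
suff -> : foldr partial (fun x => c * phi x) s = (fun x => c * foldr partial phi s x).
  exact: differentiableZ.
elim: s => //= i s IH; rewrite IH; apply/funext => y; rewrite /partial.
by apply: deriveZ; apply: diff_derivable; exact: sp.
Qed.

Lemma testZ Omega (c : R) phi : test_function Omega phi -> test_function Omega (fun x => c * phi x).
Proof.
move=> [sp cp sub]; have ss : supp (fun x => c * phi x) `<=` supp phi.
  by apply: closure_subset => x /=; apply: contra_neq => ->; rewrite mulr0.
split; first exact: smoothZ.
- exact: subclosed_compact (@closed_closure _ _) cp ss.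
- exact: subset_trans ss sub.
Qed.

Local Open Scope ereal_scope.

Lemma locint_test_bound f psi k (M : R) : locint f -> continuous psi ->
  (forall x, `|psi x| <= M)%R -> (forall x, ~ cube k x -> psi x = 0%R) ->
  (`|\int[mu]_x (f x * psi x)| <= M * fine (\int[mu]_(x in cube k) `|f x|%:E))%R.
Proof.
move=> lf cp pM pk; have [mf fk] := lf.
have I := locint_test_integrable lf cp pM pk.
have M0 : (0 <= M)%R by exact: le_trans (pM 0%R).
apply: le_trans (le_normr_Rintegral measurableT I) _.
have fin : \int[mu]_(x in cube k) `|f x|%:E \is a fin_num.
  by rewrite ge0_fin_numE//; apply: integral_ge0 => x _; rewrite lee_fin.
rewrite -lee_fin EFinM !fineK//; last first.
  by apply: integrable_fin_num => //; exact: integrable_norm I.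
rewrite -ge0_integralZl_EFin//; last first.
- by apply/measurable_EFinP; apply: measurableT_comp => //; exact: measurable_funTS.
- exact: measurable_cube.
rewrite [leRHS]integral_mkcond; apply: ge0_le_integral => //.
- have := measurable_int _ I => /measurable_EFinP mI.
  by apply/measurable_EFinP; exact: measurableT_comp.
- apply/(measurable_restrictT _ _).1; first exact: measurable_cube.
  apply: measurable_funTS; apply: emeasurable_funM => //.
  by apply/measurable_EFinP; exact: measurableT_comp.
- move=> x _; rewrite patchE; case: ifPn => [_|]; last first.
    by rewrite notin_setE => /pk ->; rewrite mulr0 normr0.
  by rewrite lee_fin normrM mulrC ler_wpM2r.
Qed.

Lemma ae_seg_small (Q : R -> Prop) (e : R) : (0 < e)%R ->
  {ae leb, forall r, Q r} -> exists2 r : R, (0 < r < e)%R & Q r.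
Proof.
move=> e0 [N [mN N0 QN]]; apply: contrapT => H.
have sub : (`]0%R, e[%classic : set (measurableTypeR R)) `<=` N.
  move=> r; rewrite /= in_itv/= => re; apply: QN => Qr; apply: H; by exists r.
have : leb (`]0%R, e[%classic : set (measurableTypeR R)) <= 0.
  by rewrite -[leRHS]N0; apply: le_measure => //; rewrite inE//; exact: measurable_itv.
by rewrite lebesgue_measure_itv/= lte_fin e0 -EFinB subr0 lee_fin leNgt e0.
Qed.

Lemma cube_unshift k w (t : R) x : (0 <= t <= 1)%R -> cube k (x - t *: w)%R ->
  cube (k + (Num.bound `|w|).+1) x.
Proof.
move=> /andP[t0 t1] xk j.
have := xk j; have := coord_le_norm w j; rewrite !in_itv/= !mxE.
have := archi_boundP (normr_ge0 w).
have : ((Num.bound `|w|)%:R <= (Num.bound `|w|).+1%:R :> R)%R by rewrite ler_nat.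
rewrite natrD; move: ((Num.bound `|w|).+1%:R)%R (Num.bound `|w|)%:R => A B h1 h2 h3.
have : (`|t * w ord0 j| <= `|w ord0 j|)%R by rewrite normrM ger0_norm// ler_piMl.
by rewrite !ler_norml => /andP[? ?] /andP[? ?]; apply/andP; split; lra.
Qed.

(** The converse of [weak_FTC]: a difference quotient of [H] tested against [phi] is an average over
    [[0, r]] of translates of [F] tested against [phi]. Both sides are within order [r] of their
    limits, and [r] tends to 0 through the radii where the hypothesis holds. *)
Lemma weak_deriv_of_FTC (P : set X) i (c : R) H F phi : locint H -> locint F -> test_function P phi ->
  let w := (c *: delta_mx ord0 i : X)%R in
  {ae leb, forall r, (0 <= r <= 1)%R ->
    {ae mu, forall x, P x -> H (x + r *: w)%R = (H x + line_int F w r x)%R}} ->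
  (\int[mu]_x (H x * 'D_w phi x) = - \int[mu]_x (F x * phi x))%R.
Proof.
move=> lH lF tphi w FTC; have [sphi _ subP] := tphi.
have [M _ HM] := test_bounded tphi.
have [k sk] : exists k, supp phi `<=` cube k by have [_ cp _] := tphi; exact: supp_bounded.
have Hk x : ~ cube k x -> phi x = 0%R by move=> xk; apply: supp_out => /sk.
pose k'  := (k + (Num.bound `|w|).+1)%N.
have shk (psi : X -> R) (t : R) : (forall x, ~ cube k x -> psi x = 0%R) -> (0 <= t <= 1)%R ->
    forall x, ~ cube k' x -> psi (x - t *: w)%R = 0%R.
  by move=> Hpsi t1 x xk'; apply: Hpsi; apply: contra_not xk'; exact: cube_unshift.
have k1 : (0 <= (0 : R))%R && ((0 : R) <= 1)%R by rewrite lexx ler01.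
have kk (psi : X -> R) : (forall x, ~ cube k x -> psi x = 0%R) -> forall x, ~ cube k' x -> psi x = 0%R.
  by move=> Hpsi x /(shk psi 0%R Hpsi k1); rewrite scale0r subr0.
have wN : (- w = (- c) *: delta_mx ord0 i)%R by rewrite scaleNr.
have tD : test_function P (fun x => 'D_(- w) phi x)%R.
  by rewrite wN derive_scaled//; apply: testZ; exact: test_partial.
have [sD _ _] := tD.
have [M1 M10 HM1] := derive_bounded (- w)%R tphi.
have [M2 M20 HM2] := derive_bounded (- w)%R tD.
have [M3 M30 HM3] := test_bounded tD.
have cphi := smooth_continuous sphi.
have cD := smooth_continuous sD.
have Dk x : ~ cube k x -> 'D_(- w) phi x = 0%R.
  by move=> xk; apply: supp_derive_out => // /sk.
have csh t : continuous (fun x : X => phi (x - t *: w)%R).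
  move=> x; apply: (@continuous_comp _ _ _ (fun x : X => x - t *: w)%R phi); last exact: cphi.
  by apply: continuousB; [exact: id|exact: cst_continuous].
pose CH := fine (\int[mu]_(x in cube k') `|H x|%:E).
pose CF := fine (\int[mu]_(x in cube k') `|F x|%:E).
have CF0 : (0 <= CF)%R by apply/fine_ge0/integral_ge0 => x _; rewrite lee_fin.
have CH0 : (0 <= CH)%R by apply/fine_ge0/integral_ge0 => x _; rewrite lee_fin.
have IHs t : (0 <= t <= 1)%R -> mu.-integrable setT (EFin \o (fun x => H x * phi (x - t *: w)%R)%R).
  by move=> t1; apply: (locint_test_integrable lH (csh t) (fun x => HM _) (shk _ _ Hk t1)).
have IFs t : (0 <= t <= 1)%R -> mu.-integrable setT (EFin \o (fun x => F x * phi (x - t *: w)%R)%R).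
  by move=> t1; apply: (locint_test_integrable lF (csh t) (fun x => HM _) (shk _ _ Hk t1)).
have IH0 : mu.-integrable setT (EFin \o (fun x => H x * phi x)%R) by exact: test_integrable lH tphi.
have IF0 : mu.-integrable setT (EFin \o (fun x => F x * phi x)%R) by exact: test_integrable lF tphi.
have IHD : mu.-integrable setT (EFin \o (fun x => H x * 'D_(- w) phi x)%R) by exact: test_integrable lH tD.
have shR (g : X -> R) t : measurable_fun setT g ->
    (\int[mu]_x (g (x + t *: w) * phi x) = \int[mu]_x (g x * phi (x - t *: w)))%R.
  move=> mg; congr fine.
  rewrite -(integral_shift (t *: w) (f := fun y => (g y * phi (y - t *: w)%R)%:E)).
    by apply: eq_integral => x _; rewrite [(t *: w + x)%R]addrC addrK.
  apply/measurable_EFinP; apply: measurable_funM => //.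
  exact: continuous_measurable_rV.
set B := (\int[mu]_x (F x * phi x))%R.
have -> : (\int[mu]_x (H x * 'D_w phi x) = - \int[mu]_x (H x * 'D_(- w) phi x))%R.
  rewrite -[RHS]mulN1r -RintegralZl//; apply: eq_Rintegral => x _.
  by rewrite deriveN_dir; [rewrite mulrN mulN1r opprK|exact: smooth_differentiable].
set A := (\int[mu]_x (H x * 'D_(- w) phi x))%R; congr (- _)%R.
pose q t := (\int[mu]_x (F (x + t *: w) * phi x))%R.
(* The terms of order [r] are [r * A] by Taylor's formula for [phi], and [r * B] since [q] is close
   to [B = q 0]; the rest is of order [r ^ 2]. *)
have key r : (0 <= r <= 1)%R -> {ae mu, forall x, P x -> H (x + r *: w)%R = (H x + line_int F w r x)%R} ->
    (`|r * (A - B)| <= (M2 * CH + M1 * CF) * r ^+ 2)%R.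
  move=> r01 Er; have /andP[r0 r1] := r01.
  have E1 : (\int[mu]_x (H x * phi (x - r *: w)) = \int[mu]_x (H x * phi x) + \int[leb]_(t in seg r) q t)%R.
    rewrite -(shR H r lH.1).
    have lL := locint_line_int w lF r1.
    have IL : mu.-integrable setT (EFin \o (fun x => line_int F w r x * phi x)%R) by exact: test_integrable lL tphi.
    have -> : (\int[mu]_x (H (x + r *: w) * phi x) = \int[mu]_x (H x * phi x + line_int F w r x * phi x))%R.
      congr fine; apply: ae_eq_integral => //.
      - exact: measurable_int (test_integrable (locint_shift _ lH) tphi).
      - by have := integrableD measurableT IH0 IL => /measurable_int.
      - apply: filterS Er => x Er _; congr EFin; have [Px|nPx] := pselect (P x).
          by rewrite Er// mulrDl.
        have -> : phi x = 0%R by apply: supp_out => /subP.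
        by rewrite !mulr0 addr0.
    rewrite RintegralD//; congr (_ + _)%R; congr fine.
    rewrite (line_int_test w lF r1 tphi); apply: eq_integral => t _.
    by rewrite fineK//; apply: integrable_fin_num => //; exact: test_integrable (locint_shift _ lF) tphi.
  have E2 : (`|\int[mu]_x (H x * phi (x - r *: w)) - \int[mu]_x (H x * phi x) - r * A| <= M2 * r ^+ 2 * CH)%R.
    pose T x := (phi (x - r *: w) - phi x - r * 'D_(- w) phi x)%R.
    have -> : (\int[mu]_x (H x * phi (x - r *: w)) - \int[mu]_x (H x * phi x) - r * A = \int[mu]_x (H x * T x))%R.
      have I1 := integrableB measurableT (IHs r r01) IH0.
      have I2 := integrableZl measurableT r IHD.
      rewrite -RintegralZl// -RintegralB//; last exact: IHs.
      rewrite -RintegralB//.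
      by apply: eq_Rintegral => x _; rewrite /T; ring.
    apply: locint_test_bound => //.
    - move=> x; apply: (@continuousB _ _ _ (fun x => phi (x - r *: w) - phi x)%R (fun x => r * 'D_(- w) phi x)%R).
        by apply: continuousB; [exact: csh|exact: cphi].
      by apply: (@continuousM _ _ (cst r) (fun x => 'D_(- w) phi x)%R); [exact: cst_continuous|exact: cD].
    - by move=> x; have := line_taylor x sphi sD r0 HM2; rewrite scalerN.
    - move=> x xk; rewrite /T (kk _ Hk _ xk) (kk _ Dk _ xk) mulr0 !subr0; exact: shk xk.
  have qB t : (0 <= t <= r)%R -> (`|q t - B| <= M1 * r * CF)%R.
    move=> /andP[t0 tr]; have t01 : (0 <= t <= 1)%R by rewrite t0 (le_trans tr).
    rewrite /q (shR F t lF.1) -RintegralB//; last exact: IFs.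
    rewrite (_ : \int[mu]_x _ = \int[mu]_x (F x * (phi (x - t *: w) - phi x)))%R; last first.
      by apply: eq_Rintegral => x _; ring.
    apply: le_trans (locint_test_bound (k := k') (M := (M1 * t)%R) lF _ _ _) _.
    - by move=> x; apply: continuousB; [exact: csh|exact: cphi].
    - by move=> x; have := line_lip x sphi t0 HM1; rewrite scalerN.
    - by move=> x xk; rewrite (kk _ Hk _ xk) subr0; exact: shk xk.
    - by rewrite ler_wpM2r// ler_wpM2l.
  have E3 : (`|\int[leb]_(t in seg r) q t - r * B| <= M1 * r * CF * r)%R.
    have mq : measurable_fun (setT : set (measurableTypeR R)) q.
      pose h (z : measurableTypeR R * X) := (F (z.2 + z.1 *: w)%R * phi z.2)%:E.
      have mh : measurable_fun setT h.
        apply/measurable_EFinP; apply: measurable_funM; first exact: measurableT_comp lF.1 (measurable_line' w).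
        exact: measurableT_comp (continuous_measurable_rV cphi) measurable_snd.
      exact: measurableT_comp (measurable_integral2 mu h mh).
    have iq : leb.-integrable (seg r) (EFin \o q).
      apply: (bounded_seg_integrable (C := (M1 * r * CF + `|B|)%R) r0); first exact: measurable_funTS.
      move=> t; rewrite /seg/= in_itv/= => /qB tB.
      by rewrite -[q t](subrK B); apply: le_trans (ler_normD _ _) _; rewrite lerD2r.
    have iB : leb.-integrable (seg r) (EFin \o cst B).
      by apply: (bounded_seg_integrable (C := `|B|%R) r0) => //; exact: measurable_cst.
    have -> : (r * B = \int[leb]_(t in seg r) B)%R.
      rewrite Rintegral_cst; last exact: measurable_seg.
      by rewrite mulrC; congr (_ * _)%R; rewrite [X in fine X](_ : _ = r%:E)//; exact: leb_seg.
    rewrite -(RintegralB (measurable_seg r) iq iB).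
    apply: seg_bound => //; first exact: (integrableB (measurable_seg r) iq iB).
  rewrite E1 [(\int[mu]_x (H x * phi x) + _)%R]addrC addrK in E2.
  have -> : (r * (A - B) = (\int[leb]_(t in seg r) q t - r * B) - (\int[leb]_(t in seg r) q t - r * A))%R by ring.
  apply: le_trans (ler_normB _ _) _; apply: le_trans (lerD E3 E2) _.
  by rewrite le_eqVlt; apply/orP; left; apply/eqP; ring.
apply/eqP; rewrite -subr_eq0 -normr_eq0 eq_le normr_ge0 andbT; apply/ler_addgt0Pr => e e0; rewrite add0r.
set C := (M2 * CH + M1 * CF)%R in key.
have C0 : (0 <= C)%R by rewrite /C addr_ge0// mulr_ge0.
have d0 : (0 < Num.min 1 (e / (C + 1)))%R by rewrite lt_min ltr01 divr_gt0// ltr_wpDl.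
(* The hypothesis is known for almost every [r] only, which still provides arbitrarily small
   ones. *)
have [r /andP[r0 rd] Er] := ae_seg_small d0 FTC.
move: rd; rewrite lt_min => /andP[r1 re].
have r01 : (0 <= r <= 1)%R by rewrite !ltW.
have := key r r01 (Er r01); rewrite normrM gtr0_norm// expr2 mulrA [(C * r)%R]mulrC -mulrA ler_pM2l// => h.
apply: le_trans h _; apply: (@le_trans _ _ ((C + 1) * r)%R); first by rewrite ler_wpM2r ?lerDl// ltW.
by rewrite mulrC -ler_pdivlMr ?ltr_wpDl// ltW.
Qed.

(** Void when the point is outside [P] or the length outside [[0, 1]], which makes it a set on the
    whole product to which [ae_swap] applies. *)
Definition FTC_at (P : set X) w f F : set (X * measurableTypeR R) :=
  [set z | P z.1 -> (0 <= z.2 <= 1)%R -> f (z.1 + z.2 *: w)%R = (f z.1 + line_int F w z.2 z.1)%R].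

Lemma measurable_FTC_at P w f F : open P -> measurable_fun setT f -> measurable_fun setT F ->
  measurable (FTC_at P w f F).
Proof.
move=> oP mf mF.
have mi : measurable_fun setT (fun z : X * measurableTypeR R => line_int F w z.2 z.1).
  pose h (zt : (X * measurableTypeR R) * measurableTypeR R) := (F (zt.1.1 + zt.2 *: w)%R * \1_(seg zt.1.2) zt.2)%:E.
  have mh : measurable_fun setT h.
    apply/measurable_EFinP; apply: measurable_funM.
      apply: (measurableT_comp mF).
      apply: (measurableT_comp (f := fun z : X * measurableTypeR R => (z.1 + z.2 *: w)%R) (g := fun zt : (X * measurableTypeR R) * measurableTypeR R => (zt.1.1, zt.2))); first exact: measurable_line.
      apply/measurable_fun_pairP; split; last exact: measurable_snd.
      exact: measurableT_comp measurable_fst measurable_fst.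
    rewrite (_ : (fun z => _) = \1_([set zt : (X * measurableTypeR R) * measurableTypeR R | seg zt.1.2 zt.2])); last first.
      by apply/funext => z; rewrite !indicE; congr ((nat_of_bool _)%:R); apply/idP/idP; rewrite !inE.
    apply: measurable_indic.
    rewrite (_ : [set zt | _] = (snd @^-1` `[0%R, +oo[) `&` ((fun zt : (X * measurableTypeR R) * measurableTypeR R => (zt.1.2 - zt.2)%R) @^-1` `[0%R, +oo[)).
      apply: measurableI; rewrite -[X in measurable X]setTI.
        by apply: measurable_snd => //; exact: measurable_itv.
      have m12 : measurable_fun setT (fun zt : (X * measurableTypeR R) * measurableTypeR R => zt.1.2).
        exact: measurableT_comp measurable_snd measurable_fst.
      by apply: (measurable_funB m12 measurable_snd) => //; exact: measurable_itv.
    apply/seteqP; split => -[[x s] t]; rewrite /seg /= !in_itv/= ?andbT subr_ge0; first by move=> /andP[].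
    by move=> [-> ->].
  rewrite (_ : (fun z => _) = fine \o (fun z : X * measurableTypeR R => \int[leb]_t h (z, t))); first exact: measurableT_comp (measurable_integral2 leb h mh).
  by apply/funext => z; rewrite /line_int /Rintegral seg_integral_indic.
pose q (z : X * measurableTypeR R) := (f (z.1 + z.2 *: w) - (f z.1 + line_int F w z.2 z.1))%R.
have mq : measurable_fun setT q.
  apply: measurable_funB; first exact: measurableT_comp mf (measurable_line w).
  by apply: measurable_funD => //; exact: measurableT_comp mf measurable_fst.
rewrite (_ : FTC_at P w f F = ~` (fst @^-1` P) `|` ~` (snd @^-1` (seg 1)) `|` q @^-1` [set 0%R]); last first.
  apply/seteqP; split => -[x r]; rewrite /FTC_at /seg /q /= in_itv/=.
    move=> h; have [Px|] := pselect (P x); last by left; left.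
    have [r1|/negP] := boolP (0 <= r <= 1)%R; last by left; right.
    by right; rewrite h// subrr.
  by move=> [[nP /nP//|nr _ /nr//]|/eqP]; rewrite subr_eq0 => /eqP.
apply: measurableU; first apply: measurableU; first apply: measurableC.
- by rewrite -[X in measurable X]setTI; apply: measurable_fst => //; exact: open_measurable_rV.
- by apply: measurableC; rewrite -[X in measurable X]setTI; apply: measurable_snd => //; exact: measurable_seg.
- by rewrite -[X in measurable X]setTI; apply: mq => //; exact: measurable_set1.
Qed.

(** [weak_FTC] has an exceptional null set for each length; the exchange yields almost every
    starting point, each valid for almost all lengths, as needed to integrate by parts on a fixed
    line. *)
Lemma FTC_ae (P Omega : set X) w f F : open P -> locint f -> locint F ->
  dir_weak_deriv Omega w f F ->
  (forall x t, P x -> 0 <= t <= 1 -> Omega (x + t *: w))%R ->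
  {ae mu, forall x, {ae leb, forall r, FTC_at P w f F (x, r)}}.
Proof.
move=> oP lf lF dF PO; apply: (ae_swap (m1 := mu) (m2 := leb)).
  by apply: measurable_FTC_at; [|exact: lf.1|exact: lF.1].
apply: aeW => r; have [r01|nr] := boolP (0 <= r <= 1)%R; last first.
  by apply: aeW => x _ r01; rewrite r01 in nr.
have /andP[r0 r1] := r01.
have := weak_FTC oP lf lF dF r01; move=> H; apply: filterS (H _) => [x h Px _|x t Px /andP[t0 tr]]; first exact: h.
by apply: PO => //; rewrite t0 (le_trans tr).
Qed.

Lemma dir_weak_deriv_scale Omega i (c : R) f G : locint f -> locint G ->
  dir_weak_deriv Omega (delta_mx ord0 i) f G ->
  dir_weak_deriv Omega (c *: delta_mx ord0 i) f (fun x => c * G x)%R.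
Proof.
move=> lf lG d phi tphi; have [sphi _ _] := tphi.
under eq_integral => x _ do rewrite (congr1 (@^~ x) (derive_scaled c i sphi)) mulrCA EFinM.
under [X in _ = - X]eq_integral => x _ do rewrite -mulrA EFinM.
rewrite !integralZl//; [|exact: test_integrable lG tphi|exact: test_integrable lf (test_partial i tphi)].
by rewrite /partial d// muleN.
Qed.

Lemma norm_delta i : (`|delta_mx ord0 i : X| <= 1)%R.
Proof.
by apply: norm_rV_le => // j; rewrite mxE eqxx /=; case: (_ == _); rewrite ?normr1 ?normr0.
Qed.

(** On almost every short segment near the support of [phi], both functions are primitives of their
    derivatives. Integration by parts gives the same for the product, and [weak_deriv_of_FTC] leads
    back to the weak derivative. *)
Lemma weak_product_rule Omega i f f' g g' : open Omega ->
  locint f -> locint f' -> locint g -> locint g' ->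
  locint (fun x => f x * g x)%R -> locint (fun x => f' x * g x + f x * g' x)%R ->
  dir_weak_deriv Omega (delta_mx ord0 i) f f' -> dir_weak_deriv Omega (delta_mx ord0 i) g g' ->
  dir_weak_deriv Omega (delta_mx ord0 i) (fun x => f x * g x)%R (fun x => f' x * g x + f x * g' x)%R.
Proof.
move=> oO lf lf' lg lg' lfg lfg' df dg phi tphi; have [sphi cphi sub] := tphi.
have [d d0 Hd] := compact_tube cphi oO sub.
(* Half of [d] is spent on the neighbourhood [P] of the support, half on the segments; the factor
   [c] is divided out at the end. *)
pose c := (d / 2)%R; have c0 : (0 < c)%R by rewrite /c divr_gt0.
pose w : X := (c *: delta_mx ord0 i)%R.
have w_c : (`|w| <= c)%R by rewrite normrZ gtr0_norm// ler_piMr ?norm_delta// ltW.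
pose P : set X := \bigcup_(y in supp phi) ball y c.
have oP : open P by apply: bigcup_open => y _; exact: ball_open.
have PO x t : (P x -> 0 <= t <= 1 -> Omega (x + t *: w))%R.
  move=> [y Ky]; rewrite -ball_normE/= => yx /andP[t0 t1]; apply: (Hd _ _ Ky).
  rewrite addrAC (splitr d); apply: le_lt_trans (ler_normD _ _) _.
  rewrite ltr_leD// 1?distrC// normrZ ger0_norm//.
  by apply: le_trans w_c; rewrite ler_piMl.
have tP : test_function P phi.
  by split => // x Kx; exists x => //; exact: ballxx.
have lcf' : locint (fun x => c * f' x)%R := locintZ c lf'.
have lcg' : locint (fun x => c * g' x)%R := locintZ c lg'.
have Ff := FTC_ae oP lf lcf' (dir_weak_deriv_scale c lf lf' df) PO.
have Fg := FTC_ae oP lg lcg' (dir_weak_deriv_scale c lg lg' dg) PO.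
pose H x := (f x * g x)%R; pose H' x := (c * (f' x * g x + f x * g' x))%R.
have lH' : locint H' := locintZ c lfg'.
have r11 : ((1 : R) <= 1)%R by [].
have FH : {ae mu, forall x, {ae leb, forall r, FTC_at P w H H' (x, r)}}.
  have If := line_ae_integrable w lcf' r11; have Ig := line_ae_integrable w lcg' r11.
  apply: filterS2 (filterI Ff Fg) (filterI If Ig) => x [Ffx Fgx] [Ifx Igx].
  have [Px|nP] := pselect (P x); last by apply: aeW => r.
  apply: filterS2 (Ffx) (Fgx) => r Ffr Fgr _ /= r01.
  have /andP[r0 r1] := r01.
  have sub1 : seg r `<=` seg 1.
    by move=> s; rewrite /seg/= !in_itv/= => /andP[-> sr]; exact: le_trans sr r1.
  have mr := measurable_seg r; have m1 := measurable_seg (1 : R).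
  (* The primitives agree with [f] and [g] at almost every point of this line, which suffices under
     the integral over [[0, r]]. *)
  have [iBP BP] := seg_by_parts (f x) (g x) r0 (integrableS m1 mr sub1 Ifx) (integrableS m1 mr sub1 Igx).
  have E : (\int[leb]_(s in seg r) H' (x + s *: w) =
      \int[leb]_(s in seg r) (c * f' (x + s *: w) * (g x + \int[leb]_(t in seg s) (c * g' (x + t *: w))) +
        (f x + \int[leb]_(t in seg s) (c * f' (x + t *: w))) * (c * g' (x + s *: w))))%R.
    congr fine; apply: ae_eq_integral => //.
    - apply/measurable_EFinP; apply: measurable_funTS; apply: (measurableT_comp lH'.1).
      exact: (measurableT_comp (measurable_line w) (measurable_pair1 x)).
    - exact: measurable_int iBP.
    - apply: filterS2 Ffx Fgx => s Ffs Fgs sr; congr EFin.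
      have s01 : (0 <= s <= 1)%R by have := sub1 _ sr; rewrite /seg/= in_itv.
      by have := Ffs Px s01; have := Fgs Px s01; rewrite /line_int /= => <- <-; rewrite /H'; ring.
  rewrite /line_int E//= BP /H (Ffr Px r01) (Fgr Px r01) /line_int /=; ring.
have FH' : {ae leb, forall r, {ae mu, forall x, FTC_at P w H H' (x, r)}}.
  have mD := measurable_FTC_at w oP lfg.1 lH'.1.
  apply: (ae_swap (m1 := leb) (m2 := mu) (D := unstable.swap @^-1` FTC_at P w H H')) => //.
  by rewrite -[X in measurable X]setTI; apply: measurable_swap.
have tphi' := test_partial i tphi.
have K : (\int[mu]_x (H x * 'D_w phi x) = - \int[mu]_x (H' x * phi x))%R.
  apply: (weak_deriv_of_FTC lfg lH' tP).
  by apply: filterS FH' => r h r01; apply: filterS h => x h Px; exact: h.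
have i1 := test_integrable lfg tphi'; have i2 := test_integrable lfg' tphi.
have E : (\int[mu]_x (H x * partial i phi x) = - \int[mu]_x ((f' x * g x + f x * g' x) * phi x))%R.
  apply: (mulfI (lt0r_neq0 c0)); rewrite mulrN -!RintegralZl//.
  under eq_Rintegral => x _ do rewrite mulrCA -(congr1 (@^~ x) (derive_scaled c i sphi)).
  by rewrite K; congr (- _)%R; apply: eq_Rintegral => x _; rewrite /H' mulrA.
have := congr1 EFin E; rewrite EFinN /Rintegral !fineK//; exact: integrable_fin_num.
Qed.

End product_rule.

(** * Weak derivatives of higher order and the Leibniz rule *)

Section weak_derivatives.
Context {R : realType} {n : nat}.
Notation X := 'rV[R]_n.
Notation mu := (lebesgue_rV n).
Notation mindices := ('I_n -> nat).
Implicit Types (f g h F G H phi psi : X -> R) (x v w : X) (i j : 'I_n) (b : mindices).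
Implicit Types (Omega : set X).
Local Open Scope ereal_scope.

(** [is_weak_deriv] without its integrability clauses, with extended integrals over the whole space,
    for functions extended by zero; see [is_weak_derivP]. *)
Definition wderiv Omega b f g := forall phi, test_function Omega phi ->
  \int[mu]_x (f x * mpartial b phi x)%:E = ((-1) ^+ mlength b)%:E * \int[mu]_x (g x * phi x)%:E.

Lemma mlength0 : mlength (fun _ : 'I_n => 0%N) = 0%N.
Proof. by rewrite /mlength big1. Qed.

Lemma wderiv0 Omega f : wderiv Omega (fun=> 0%N) f f.
Proof. by move=> phi _; rewrite mpartial0 mlength0 expr0 mul1e. Qed.

Lemma wderiv_incr Omega b i f g h : wderiv Omega b f g ->
  dir_weak_deriv Omega (delta_mx ord0 i) g h -> wderiv Omega (incr b i) f h.
Proof.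
move=> fg gh phi tphi; have [sphi _ _] := tphi.
rewrite mpartial_incr// (fg _ (test_partial i tphi)) mlength_incr exprS mulN1r EFinN mulNe.
by rewrite (gh _ tphi) muleN.
Qed.

Lemma wderiv_step Omega b i f g h : wderiv Omega b f g -> wderiv Omega (incr b i) f h ->
  dir_weak_deriv Omega (delta_mx ord0 i) g h.
Proof.
move=> fg fh phi tphi; have [sphi _ _] := tphi.
have := fh _ tphi; rewrite mpartial_incr// (fg _ (test_partial i tphi)) mlength_incr exprS mulN1r EFinN mulNe => E.
have s1 : ((-1) ^+ mlength b * (-1) ^+ mlength b = 1 :> R)%R by rewrite -exprMn mulrNN mulr1 expr1n.
have := congr1 (fun y => ((-1) ^+ mlength b)%:E * y) E.
by rewrite muleN !muleA -!EFinM s1 !mul1e.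
Qed.

Lemma wderivD Omega b f g f' g' : locint f -> locint g -> locint f' -> locint g' ->
  wderiv Omega b f g -> wderiv Omega b f' g' ->
  wderiv Omega b (fun x => f x + f' x)%R (fun x => g x + g' x)%R.
Proof.
move=> lf lg lf' lg' fg fg' phi tphi.
have tb := test_mpartial b tphi.
have If := test_integrable lf tb; have If' := test_integrable lf' tb.
have Ig := test_integrable lg tphi; have Ig' := test_integrable lg' tphi.
under eq_integral do rewrite mulrDl EFinD.
rewrite integralD// (fg _ tphi) (fg' _ tphi) -muleDr//; last first.
  by apply: fin_num_adde_defr; exact: integrable_fin_num.
by rewrite -integralD//; congr (_ * _); apply: eq_integral => x _; rewrite mulrDl EFinD.
Qed.

Lemma wderivZ Omega b (a : R) f g : locint f -> locint g ->
  wderiv Omega b f g -> wderiv Omega b (fun x => a * f x)%R (fun x => a * g x)%R.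
Proof.
move=> lf lg fg phi tphi.
have tb := test_mpartial b tphi.
under eq_integral do rewrite -mulrA EFinM.
under [X in _ = _ * X]eq_integral do rewrite -mulrA EFinM.
rewrite !integralZl//; [|exact: test_integrable lg tphi|exact: test_integrable lf tb].
by rewrite (fg _ tphi) muleCA.
Qed.

Lemma dir_weak_deriv_sum (I : Type) (L : seq I) (P : pred I) Omega w (F G : I -> X -> R) :
  (forall k, P k -> locint (F k)) -> (forall k, P k -> locint (G k)) ->
  (forall k, P k -> dir_weak_deriv Omega w (F k) (G k)) -> all P L ->
  (forall k phi, P k -> test_function Omega phi -> mu.-integrable setT (fun x => (F k x * 'D_w phi x)%:E)) ->
  dir_weak_deriv Omega w (fun x => \sum_(k <- L) F k x)%R (fun x => \sum_(k <- L) G k x)%R.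
Proof.
move=> lF lG d; elim: L => [|k L IH] /=.
  move=> _ _ phi tphi; rewrite !integral0_eq ?oppe0// => x _; by rewrite big_nil mul0r.
move=> /andP[Pk PL] iF phi tphi.
have lsum (E : I -> X -> R) : (forall k, P k -> locint (E k)) -> locint (fun x => \sum_(k <- L) E k x)%R.
  move=> lE; elim: L PL {IH} => [|l L IH]; first by move=> _; under eq_fun do rewrite big_nil; exact: locint0.
  move=> /= /andP[Pl PL]; under eq_fun do rewrite big_cons.
  by apply: locintD; [exact: lE|exact: IH].
under eq_integral do rewrite big_cons mulrDl EFinD.
under [X in _ = - X]eq_integral do rewrite big_cons mulrDl EFinD.
have isum : mu.-integrable setT (fun x => ((\sum_(k <- L) F k x)%R * 'D_w phi x)%:E).
  move: PL; elim: L {IH lsum} => [|l L IH] /=.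
    by move=> _; under eq_fun do rewrite big_nil mul0r; exact: integrable0.
  move=> /andP[Pl PL]; under eq_fun do rewrite big_cons mulrDl EFinD.
  by apply: integrableD => //; [exact: iF|exact: IH].
have IG := test_integrable (lG _ Pk) tphi.
have IS := test_integrable (lsum G lG) tphi.
rewrite integralD//; last exact: iF.
rewrite integralD// (d _ Pk _ tphi) IH// fin_num_oppeD//.
exact: integrable_fin_num.
Qed.

(** The terms form a list with repetitions, doubled by each derivative, instead of carrying binomial
    coefficients: only their number matters later. Local integrability of the products is assumed
    here, and comes from the bilinear estimate. *)
Lemma weak_leibniz (m : nat) Omega (Df Dg : mindices -> X -> R) : open Omega ->
  (forall b, (mlength b <= m)%N -> locint (Df b)) ->
  (forall b, (mlength b <= m)%N -> locint (Dg b)) ->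
  (forall b i, (mlength b < m)%N -> dir_weak_deriv Omega (delta_mx ord0 i) (Df b) (Df (incr b i))) ->
  (forall b i, (mlength b < m)%N -> dir_weak_deriv Omega (delta_mx ord0 i) (Dg b) (Dg (incr b i))) ->
  (forall b c, (mlength b + mlength c <= m)%N -> locint (fun x => Df b x * Dg c x)%R) ->
  forall b, (mlength b <= m)%N -> exists L : seq (mindices * mindices),
    [/\ all (fun k => mlength k.1 + mlength k.2 == mlength b)%N L, size L = (2 ^ mlength b)%N &
      wderiv Omega b (fun x => Df (fun=> 0%N) x * Dg (fun=> 0%N) x)%R
        (fun x => \sum_(k <- L) (Df k.1 x * Dg k.2 x))%R].
Proof.
move=> oO lf lg df dg lfg; apply: multi_index_ind => [|b i IH]; rewrite ?mlength0 ?mlength_incr.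
  move=> _; exists [:: (fun=> 0%N, fun=> 0%N)]; split => //=; first by rewrite mlength0.
  by under [X in wderiv _ _ _ X]eq_fun do rewrite big_seq1; exact: wderiv0.
move=> bm; have [L [AL sL dL]] := IH (ltnW bm).
exists ([seq (incr k.1 i, k.2) | k <- L] ++ [seq (k.1, incr k.2 i) | k <- L]); split.
- rewrite all_cat !all_map; apply/andP; split; apply: sub_all AL => k /=;
    by rewrite mlength_incr ?addnS ?addSn eqSS.
- by rewrite size_cat !size_map sL expnS mul2n addnn.
- apply: wderiv_incr dL _.
  rewrite [X in dir_weak_deriv _ _ _ X](_ : _ = fun x => \sum_(k <- L) (Df (incr k.1 i) x * Dg k.2 x + Df k.1 x * Dg (incr k.2 i) x))%R; last first.
    by apply/funext => x; rewrite [RHS]big_split big_cat !big_map.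
  have lprod1 b1 b2 : (mlength b1 + mlength b2 < m)%N -> locint (fun x => Df (incr b1 i) x * Dg b2 x)%R.
    by move=> h; apply: lfg; rewrite mlength_incr addSn.
  have lprod2 b1 b2 : (mlength b1 + mlength b2 < m)%N -> locint (fun x => Df b1 x * Dg (incr b2 i) x)%R.
    by move=> h; apply: lfg; rewrite mlength_incr addnS.
  apply: (@dir_weak_deriv_sum _ L (fun k : mindices * mindices => (mlength k.1 + mlength k.2)%N == mlength b) Omega _
    (fun k x => Df k.1 x * Dg k.2 x)%R (fun k x => Df (incr k.1 i) x * Dg k.2 x + Df k.1 x * Dg (incr k.2 i) x)%R) => //.
  - by move=> k /eqP kb; apply: lfg; rewrite kb ltnW.
  - by move=> k /eqP kb; apply: locintD; [apply: lprod1|apply: lprod2]; rewrite kb.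
  - move=> k /eqP kb.
    have k1 : (mlength k.1 < m)%N by rewrite (leq_ltn_trans _ bm)// -kb leq_addr.
    have k2 : (mlength k.2 < m)%N by rewrite (leq_ltn_trans _ bm)// -kb leq_addl.
    apply: weak_product_rule => //.
    + by apply: lf; exact: ltnW.
    + by apply: lf; rewrite mlength_incr.
    + by apply: lg; exact: ltnW.
    + by apply: lg; rewrite mlength_incr.
    + by apply: lfg; rewrite kb ltnW.
    + by apply: locintD; [apply: lprod1|apply: lprod2]; rewrite kb.
    + exact: df.
    + exact: dg.
  - move=> k phi /eqP kb tphi; have := test_integrable (lfg k.1 k.2 _) (test_partial i tphi).
    by apply; rewrite kb ltnW.
Qed.

Lemma locint_Lp_loc Omega f : open Omega -> locint (f \_ Omega) -> Lp_loc 1 Omega f.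
Proof.
move=> oO [mf fk]; have mO := open_measurable_rV oO; split.
  exact: (measurable_restrictT f mO).2.
move=> K cK KO; rewrite /Lp_norm Lnorm1.
have [k Kk] := supp_bounded cK; apply: le_lt_trans (fk k).
have mK : measurable K by apply: closed_measurable_rV; apply: compact_closed => //; exact: norm_hausdorff.
have mfa : measurable_fun setT (fun x => `|(f \_ Omega) x|%:E) by apply/measurable_EFinP; exact: measurableT_comp.
have E : f \_ K = (f \_ Omega) \_ K.
  apply/funext => x; rewrite !patchE; case: ifPn => // /set_mem /KO Ox.
  by rewrite mem_set.
rewrite [leRHS]integral_mkcond; apply: ge0_le_integral => //.
- apply: measurableT_comp => //; apply/measurable_EFinP; rewrite E.
  by apply: (measurable_restrictT (f \_ Omega) mK).1; exact: measurable_funTS.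
- by apply/(measurable_restrictT _ _).1; [exact: measurable_cube|exact: measurable_funTS].
- move=> x _; rewrite /= E [in leRHS]patchE; case: ifPn => [_|].
    by rewrite lee_fin patchE; case: ifPn => // _; rewrite normr0.
  rewrite notin_setE => xk; rewrite patchE; case: ifPn => [/set_mem /Kk//|_].
  by rewrite normr0.
Qed.

Lemma integral_test Omega (f psi : X -> R) : open Omega -> (forall x, ~ Omega x -> psi x = 0%R) ->
  \int[mu]_(x in Omega) (f x * psi x)%:E = \int[mu]_x ((f \_ Omega) x * psi x)%:E.
Proof.
move=> oO pO; rewrite integral_mkcond; apply: eq_integral => x _; rewrite !patchE.
by case: ifPn => //; rewrite mul0r.
Qed.

(** All the integrals involved are finite, so the real-valued and the extended identities are
    equivalent. *)
Lemma is_weak_derivP Omega b f g : open Omega -> locint (f \_ Omega) -> locint (g \_ Omega) ->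
  is_weak_deriv Omega b f g <-> wderiv Omega b (f \_ Omega) (g \_ Omega).
Proof.
move=> oO lf lg.
have K phi : test_function Omega phi -> (\int[mu]_(x in Omega) (f x * mpartial b phi x) =
    (-1) ^+ mlength b * \int[mu]_(x in Omega) (g x * phi x))%R <->
    \int[mu]_x ((f \_ Omega) x * mpartial b phi x)%:E = ((-1) ^+ mlength b)%:E * \int[mu]_x ((g \_ Omega) x * phi x)%:E.
  move=> tphi; have tb := test_mpartial b tphi.
  have If := test_integrable lf tb; have Ig := test_integrable lg tphi.
  have [_ _ sub] := tphi; have [_ _ subb] := tb.
  rewrite /Rintegral (integral_test f (psi := mpartial b phi)) ?(integral_test g (psi := phi))//; last 2 first.
  - by move=> x xO; apply: supp_out => /sub.
  - by move=> x xO; apply: supp_out => /subb.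
  - have F1 := integrable_fin_num measurableT If; have F2 := integrable_fin_num measurableT Ig.
    rewrite -[in X in _ <-> X](fineK F1) -[in X in _ <-> X](fineK F2) -EFinM.
    by split => [->//|[]].
split=> [[_ _ H] phi tphi|H]; first by apply/K => //; exact: H.
by split; [exact: locint_Lp_loc|exact: locint_Lp_loc|move=> phi tphi; apply/K => //; exact: H].
Qed.

End weak_derivatives.

(** * The cone condition *)

Section euclidean_space.
Context {R : realType} {n : nat}.
Notation X := 'rV[R]_n.
Implicit Types (x y z u v w : X) (a b c d s t : R).

Lemma edotC x y : edot x y = edot y x.
Proof. by apply: eq_bigr => i _; rewrite mulrC. Qed.

Lemma edotDl x y z : edot (x + y) z = edot x z + edot y z.
Proof. by rewrite /edot -big_split /=; apply: eq_bigr => i _; rewrite mxE mulrDl. Qed.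

Lemma edotZl a x y : edot (a *: x) y = a * edot x y.
Proof. by rewrite /edot mulr_sumr; apply: eq_bigr => i _; rewrite mxE mulrA. Qed.

Lemma edotDr x y z : edot x (y + z) = edot x y + edot x z.
Proof. by rewrite edotC edotDl !(edotC _ x). Qed.

Lemma edotZr a x y : edot x (a *: y) = a * edot x y.
Proof. by rewrite edotC edotZl edotC. Qed.

Lemma edotNl x y : edot (- x) y = - edot x y.
Proof. by rewrite -scaleN1r edotZl mulN1r. Qed.

Lemma edotNr x y : edot x (- y) = - edot x y.
Proof. by rewrite edotC edotNl edotC. Qed.

Lemma edotxx_ge0 x : 0 <= edot x x.
Proof. by apply: sumr_ge0 => i _; rewrite -expr2 sqr_ge0. Qed.

Lemma edotxx_eq0 x : (edot x x == 0) = (x == 0).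
Proof.
apply/idP/eqP => [|->]; last by rewrite /edot big1// => i _; rewrite mxE mul0r.
rewrite psumr_eq0 => [/allP h|i _]; last by rewrite -expr2 sqr_ge0.
by apply/rowP => i; have := h i (mem_index_enum _); rewrite mxE -expr2 sqrf_eq0 => /eqP.
Qed.

Lemma sqr_enorm x : enorm x ^+ 2 = edot x x.
Proof. by rewrite sqr_sqrtr// edotxx_ge0. Qed.

Lemma enorm_ge0 x : 0 <= enorm x. Proof. exact: sqrtr_ge0. Qed.

Lemma enorm_eq0 x : (enorm x == 0) = (x == 0).
Proof. by rewrite -edotxx_eq0 -sqr_enorm sqrf_eq0. Qed.

Lemma enorm_gt0 x : (0 < enorm x) = (x != 0).
Proof. by rewrite lt_neqAle enorm_ge0 andbT eq_sym enorm_eq0. Qed.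

Lemma enorm0 : enorm (0 : X) = 0. Proof. by apply/eqP; rewrite enorm_eq0. Qed.

Lemma enormZ a x : enorm (a *: x) = `|a| * enorm x.
Proof. by rewrite /enorm edotZl edotZr mulrA -expr2 sqrtrM ?sqr_ge0// sqrtr_sqr. Qed.

Lemma enormN x : enorm (- x) = enorm x.
Proof. by rewrite -scaleN1r enormZ normrN normr1 mul1r. Qed.

Lemma enormB x y : enorm (x - y) = enorm (y - x).
Proof. by rewrite -enormN opprB. Qed.

Lemma edot_le_enorm x y : edot x y <= enorm x * enorm y.
Proof.
have [->|y0] := eqVneq y 0.
  by rewrite enorm0 mulr0 -(scale0r 0) edotZr mul0r.
have yy : 0 < edot y y by rewrite lt_neqAle edotxx_ge0 eq_sym edotxx_eq0 y0.
apply: le_trans (ler_norm _) _; rewrite -ler_sqr ?nnegrE ?mulr_ge0 ?enorm_ge0//.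
rewrite real_normK ?num_real// exprMn !sqr_enorm.
have := edotxx_ge0 (edot y y *: x - edot x y *: y).
rewrite edotDl !edotDr !edotNl !edotNr !edotZl !edotZr (edotC y x).
have -> : edot y y * (edot y y * edot x x) + - (edot y y * (edot x y * edot x y)) +
  (- (edot x y * (edot y y * edot x y)) - - (edot x y * (edot x y * edot y y))) =
  edot y y * (edot x x * edot y y - edot x y ^+ 2) by ring.
by rewrite pmulr_rge0// subr_ge0.
Qed.

Lemma enormD x y : enorm (x + y) <= enorm x + enorm y.
Proof.
rewrite -ler_sqr ?nnegrE ?addr_ge0 ?enorm_ge0// sqr_enorm edotDl !edotDr (edotC y x).
have := edot_le_enorm x y; rewrite sqrrD !sqr_enorm mulr2n; lra.
Qed.

Lemma norm_le_enorm x : `|x| <= enorm x.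
Proof.
apply: norm_rV_le => [|i]; first exact: enorm_ge0.
rewrite -ler_sqr ?nnegrE ?enorm_ge0// real_normK ?num_real// sqr_enorm /edot (bigD1 i)//=.
by rewrite expr2 lerDl; apply: sumr_ge0 => j _; rewrite -expr2 sqr_ge0.
Qed.

Lemma enorm_le_norm x : enorm x <= n%:R * `|x|.
Proof.
rewrite -ler_sqr ?nnegrE ?enorm_ge0 ?mulr_ge0// sqr_enorm exprMn.
apply: (@le_trans _ _ (\sum_(i < n) `|x| ^+ 2)).
  apply: ler_sum => i _; rewrite -expr2 -real_normK ?num_real//.
  by rewrite ler_sqr ?nnegrE// coord_le_norm.
rewrite sumr_const card_ord -[leLHS]mulr_natl; apply: ler_wpM2r; first exact: sqr_ge0.
by rewrite -natrX ler_nat; case: (n) => // k; rewrite expnS expn1 leq_pmulr.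
Qed.

(** By polarization [L = T - T 0] preserves the dot product. The images of the standard basis form a
    matrix with [M *m M^T = 1], hence also [M^T *m M = 1], which inverts [L]. *)
Lemma isometry_affine (T : X -> X) : (forall x y, enorm (T x - T y) = enorm (x - y)) ->
  forall y, exists x, T x = y.
Proof.
move=> iT; pose L x := T x - T 0.
have Ldot x y : edot (L x) (L y) = edot x y.
  have P (u v : X) : edot u v = (edot u u + edot v v - enorm (u - v) ^+ 2) / 2.
    rewrite sqr_enorm edotDl !edotDr !edotNr !edotNl (edotC v u); by field.
  have Ln z : edot (L z) (L z) = edot z z by rewrite -!sqr_enorm iT subr0.
  by rewrite (P (L x)) (P x) !Ln /L opprB addrA subrK iT.
pose M : 'M[R]_n := \matrix_(i, j) L (delta_mx ord0 i) ord0 j.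
have edotE x y : edot x y = (x *m y^T) ord0 ord0.
  by rewrite mxE; apply: eq_bigr => i _; rewrite mxE.
have rM i : row i M = L (delta_mx ord0 i) by apply/rowP => j; rewrite !mxE.
have MMT : M *m M^T = 1%:M.
  apply/matrixP => i j; transitivity (edot (row i M) (row j M)).
    by rewrite mxE; apply: eq_bigr => k _; rewrite !mxE.
  rewrite !rM Ldot /edot [RHS]mxE (bigD1 i)//= [X in X * _]mxE !eqxx mul1r big1 => [|k ki].
    by rewrite addr0 mxE eqxx.
  by rewrite mxE (negbTE ki) andbF mul0r.
have MTM := mulmx1C MMT.
have LM x : L x *m M^T = x.
  apply/rowP => i; transitivity (edot (L x) (row i M)).
    by rewrite mxE; apply: eq_bigr => k _; rewrite !mxE.
  rewrite rM Ldot /edot (bigD1 i)//= mxE !eqxx mulr1 big1 ?addr0// => k ki.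
  by rewrite mxE (negbTE ki) andbF mulr0.
move=> y; exists ((y - T 0) *m M^T).
have : L ((y - T 0) *m M^T) *m M^T *m M = (y - T 0) *m M^T *m M by rewrite LM.
by rewrite -!mulmxA MTM !mulmx1 /L => /(congr1 (fun z => z + T 0)); rewrite !subrK.
Qed.

(** The centre is the point of the axis at half the height. The radius is a multiple of
    [1 - cos (k / 2)], chosen so that the cosine of the angle to the axis stays at least
    [cos (k / 2)]. *)
Lemma cone_ball d v k : 0 < d -> v != 0 -> 0 < k < pi ->
  exists z (e : R), 0 < e /\ forall x, enorm (x - z) <= e -> cone d v k x.
Proof.
move=> d0 v0 /andP[k0 kpi]; pose c := cos (k / 2).
have k2 : 0 < k / 2 < pi / 2 by rewrite divr_gt0//= ltr_pM2r.
have pi2 : pi / 2 < pi :> R by rewrite ltr_pdivrMr// ltr_pMr ?ltr1n// pi_gt0.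
have /andP[k20 k2pi] := k2.
have kin : k / 2 \in `[0, pi] by rewrite in_itv/= !ltW// (lt_trans k2pi).
have c0 : 0 < c.
  by apply: cos_gt0_pihalf; rewrite k2pi andbT (lt_trans _ k20)// oppr_lt0 divr_gt0// pi_gt0.
have c1 : c < 1.
  rewrite -cos0 /c ltr_cos//; by rewrite in_itv/= lexx pi_ge0.
have v1 : 0 < enorm v by rewrite enorm_gt0.
pose z := (d / 2 / enorm v) *: v; pose e := d / 2 * (1 - c) / 2.
have zn : enorm z = d / 2.
  by rewrite enormZ ger0_norm ?divr_ge0 ?enorm_ge0 ?ltW// ?divr_gt0// divfK// gt_eqF.
have e0 : 0 < e by rewrite /e !mulr_gt0 ?invr_gt0// subr_gt0.
have e1 : e < d / 2.
  rewrite /e -mulrA gtr_pMr ?divr_gt0//; lra.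
exists z, e; split=> // x xz; right.
have xle : enorm x <= d / 2 + e.
  by rewrite -[x](subrK z); apply: le_trans (enormD _ _) _; rewrite zn addrC lerD2l.
have xge : d / 2 - e <= enorm x.
  have : enorm z <= enorm (z - x) + enorm x by rewrite -{1}[z](subrK x); exact: enormD.
  rewrite zn enormB; lra.
have x0 : 0 < enorm x by apply: lt_le_trans xge; rewrite subr_gt0.
rewrite x0; split; first by rewrite (le_trans xle)//; move: e1; lra.
have xv : (d / 2 - e) * enorm v <= edot x v.
  have : edot (z - x) v <= e * enorm v.
    by apply: le_trans (edot_le_enorm _ _) _; rewrite ler_wpM2r ?enorm_ge0// enormB.
  have -> : edot (z - x) v = d / 2 * enorm v - edot x v.
    rewrite edotDl edotNl edotZl -sqr_enorm; congr (_ - _); field; by rewrite gt_eqF.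
  lra.
rewrite /angle; set q := edot x v / _.
have xvp : 0 < enorm x * enorm v by rewrite mulr_gt0.
(* With this radius, [(d / 2 - e) - c (d / 2 + e)] equals [d / 2 * (1 - c) * ((1 - c) / 2)]. *)
have cq : c <= q.
  rewrite /q ler_pdivlMr//; apply: le_trans xv; rewrite mulrA ler_wpM2r ?enorm_ge0//.
  apply: (@le_trans _ _ (c * (d / 2 + e))); first by rewrite ler_wpM2l// ltW.
  rewrite -subr_ge0 (_ : _ - _ = d / 2 * (1 - c) * ((1 - c) / 2)); last by rewrite /e; field.
  by rewrite !mulr_ge0// ?subr_ge0 ?ltW// invr_ge0.
have q1 : q <= 1 by rewrite /q ler_pdivrMr// mul1r edot_le_enorm.
have qm : -1 <= q by rewrite (le_trans _ cq)//; move: c0; lra.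
have qin : -1 <= q <= 1 by rewrite qm q1.
rewrite leNgt; apply/negP => lt.
have : cos (acos q) < cos (k / 2).
  by rewrite ltr_cos// in_itv/= acos_ge0// acos_lepi.
by rewrite acosK ?in_itv//= ltNge cq.
Qed.

Lemma cone_star d v k x t : cone d v k x -> 0 <= t <= 1 -> cone d v k (t *: x).
Proof.
move=> cx /andP[]; rewrite le_eqVlt => /predU1P[<- _|t0 t1]; first by left; rewrite scale0r.
case: cx => [->|[/andP[x0 xd] a]]; first by left; rewrite scaler0.
have tx : enorm (t *: x) = t * enorm x by rewrite enormZ gtr0_norm.
right; split; first rewrite tx mulr_gt0//=.
  by rewrite (le_trans _ xd)// ler_piMl// enorm_ge0.
by rewrite /angle edotZl tx -[t * enorm x * _]mulrA -mulf_div divff ?gt_eqF// mul1r.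
Qed.

(* Star-shapedness with respect to a small cube of fixed size is the only
   consequence of the cone condition that is used. *)
Lemma cone_condition_cube (Omega : set X) (e : R) : cone_condition Omega -> 0 < e ->
  exists2 rho : R, 0 < rho & forall x, Omega x -> exists2 z, `|z| <= e &
    forall y t, `|y - z| < rho -> 0 <= t <= 1 -> Omega (x + t *: y).
Proof.
move=> [C [d [v [k [d0 v0 k0 CE]]]] H] e0.
have [z0 [r [r0 Hr]]] := cone_ball d0 v0 k0.
(* Two points of [C] are at distance at most [2 * d]; the factor [s] brings this down to [e]. *)
pose s := Num.min 1 (e / (2 * d)).
have s0 : 0 < s by rewrite lt_min ltr01 divr_gt0// mulr_gt0.
have s1 : s <= 1 by rewrite ge_min lexx.
have sd : s * (2 * d) <= e by rewrite -ler_pdivlMr ?mulr_gt0// ge_min lexx orbT.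
have Cd y : C y -> enorm y <= d.
  by rewrite CE => -[->|[/andP[]]//]; rewrite enorm0 ltW.
(* [n.+1] bounds the ratio of the Euclidean norm to the sup norm and is nonzero in dimension 0
   too. *)
exists (s * (r / n.+1%:R)); first by rewrite mulr_gt0// divr_gt0.
move=> x Ox; have [Cx [[C0 [d' [v' [k' [_ _ _ C0E]]]] CxE] [T iT TC] sub]] := H _ Ox.
have star y t : C0 y -> 0 <= t <= 1 -> C0 (t *: y) by rewrite C0E; exact: cone_star.
have C00 : C0 0 by rewrite C0E; left.
(* The congruence need not send the vertex of [C] to [x]; only some point [c] of [C] goes there,
   which costs [2 * d] instead of [d]. *)
have [c Cc Tc] : (T @` C) x by rewrite TC CxE; exists 0 => //; rewrite addr0.
have zC : C z0 by rewrite CE; apply: Hr; rewrite subrr enorm0 ltW.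
exists (s *: (T z0 - x)).
  rewrite normrZ gtr0_norm//; apply: le_trans sd; rewrite ler_pM2l//.
  apply: le_trans (norm_le_enorm _) _; rewrite -Tc iT.
  apply: le_trans (enormD _ _) _; rewrite enormN mulr_natl mulr2n lerD ?Cd//.
move=> y t yz t01; apply: sub.
pose y' := s^-1 *: y.
have yE : y = s *: y' by rewrite scalerA divff ?gt_eqF// scale1r.
have y'z : `|y' - (T z0 - x)| < r / n.+1%:R.
  move: yz; rewrite yE -scalerBr normrZ gtr0_norm// ltr_pM2l//.
(* A point near [T z0] has to be an image under [T] before its distance can be measured inside
   [C]. *)
have [y0 Ty0] := isometry_affine iT (x + y').
have : C y0.
  rewrite CE; apply: Hr; rewrite -iT Ty0 (_ : _ - _ = y' - (T z0 - x)); last by rewrite opprB addrCA addrA.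
  apply: le_trans (enorm_le_norm _) _.
  apply: (@le_trans _ _ (n.+1%:R * (r / n.+1%:R))); last by rewrite mulrC divfK.
  by rewrite ler_pM// ?ler_nat// ltW.
move=> Cy0; have : Cx (x + y') by rewrite -Ty0 -TC; exists y0.
(* [C_x] is star-shaped about [x], and [t *: y] is the multiple [t * s] of a point of the cone. *)
rewrite CxE => -[y1 C0y1 /addrI y1y']; exists (t *: y) => //.
rewrite yE scalerA -y1y'; apply: star => //.
move/andP: t01 => [t0 t1]; rewrite mulr_ge0//=; last exact: ltW.
by rewrite (le_trans _ s1)// ler_piMl// ltW.
Qed.

End euclidean_space.

(** * Dyadic potentials *)

Section measurable_restr.
Context d {T : measurableType d} {R : realType}.

Lemma measurable_restr (A : set T) (f : T -> \bar R) : measurable A ->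
  measurable_fun setT f -> measurable_fun setT (f \_ A).
Proof. by move=> mA mf; apply/(measurable_restrictT f mA).1; exact: measurable_funTS. Qed.

Lemma measurable_restrR (A : set T) (f : T -> R) : measurable A ->
  measurable_fun setT f -> measurable_fun setT (f \_ A).
Proof. by move=> mA mf; apply: (measurable_restrictT f mA).1; exact: measurable_funTS. Qed.

End measurable_restr.

Section averages.
Context {R : realType} {n : nat}.
Notation X := 'rV[R]_n.
Notation mu := (lebesgue_rV n).
Implicit Types (x y z u v w : X) (r s t q : R) (j k : nat).
Local Open Scope ereal_scope.
Implicit Types (F G H : X -> \bar R).

Lemma nneseries_geometric q : (0 <= q < 1)%R -> \sum_(0 <= k <oo) (q ^+ k)%:E = ((1 - q)^-1)%:E.
Proof.
move=> /andP[q0 q1].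
have := @cvg_geometric_series R 1 q; rewrite ger0_norm// mul1r => /(_ q1) h.
apply/cvg_lim => //.
rewrite (_ : (fun k => _) = EFin \o series (geometric 1 q)%R).
  by apply: cvg_EFin; [exact: nearW|exact: h].
apply/funext => k /=; rewrite /series /= sumEFin; congr EFin.
by apply: eq_bigr => i _; rewrite mul1r.
Qed.

Lemma ge0_nneseriesZl (c : \bar R) (f : nat -> \bar R) : 0 <= c -> (forall k, 0 <= f k) ->
  \sum_(0 <= k <oo) (c * f k) = c * \sum_(0 <= k <oo) f k.
Proof.
move=> c0 f0; have mf : measurable_fun setT f by [].
have := ge0_integralZl counting measurableT mf (fun k _ => f0 k) c0.
have cf0 k : 0 <= c * f k by exact: mule_ge0.
by rewrite !ge0_integral_count.
Qed.

Lemma nneseries_geometric_tail q j : (0 <= q < 1)%R ->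
  \sum_(0 <= k <oo) (if (j <= k)%N then (q ^+ k)%:E else 0) = (q ^+ j * (1 - q)^-1)%:E.
Proof.
move=> q01; have /andP[q0 q1] := q01.
rewrite (nneseries_split 0 j) => [|k _]; last by case: ifP => // _; rewrite lee_fin exprn_ge0.
rewrite add0n big_nat big1 ?add0e => [|k /andP[_ kj]]; last by rewrite leqNgt kj.
rewrite -nneseries_addn => [|k]; last by case: ifP => // _; rewrite lee_fin exprn_ge0.
under eq_eseriesr do rewrite leq_addl exprD mulrC EFinM.
rewrite nneseriesZl => [|k _]; last by rewrite lee_fin exprn_ge0.
by rewrite nneseries_geometric.
Qed.

Definition nball r : set X := [set w | `|w| < r]%R.

Lemma nballE r : (0 < r)%R -> nball r = obox (const_mx (- r)%R) (const_mx r).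
Proof.
move=> r0; apply/seteqP; split => [x xk i|x xk].
  by rewrite in_itv/= !mxE -ltr_norml; apply: le_lt_trans xk; exact: coord_le_norm.
by apply: norm_rV_lt => // i; have := xk i; rewrite in_itv/= !mxE ltr_norml.
Qed.

Lemma measurable_nball r : measurable (nball r).
Proof.
have [r0|r0] := ltP 0%R r; first by rewrite nballE//; exact: measurable_obox.
rewrite (_ : nball r = set0)//; apply/seteqP; split => // x /=.
by rewrite /nball/= ltNge (le_trans r0).
Qed.

Lemma lebesgue_nball r : (0 < r)%R -> mu (nball r) = ((r *+ 2) ^+ n)%:E.
Proof.
move=> r0; rewrite nballE//; apply: etrans (lebesgue_obox _ _) _; congr EFin.
rewrite (eq_bigr (fun=> r *+ 2))%R ?prodr_const ?card_ord// => i _.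
by rewrite !mxE opprK -mulr2n max_r// mulrn_wge0// ltW.
Qed.

Lemma measurable_axpy (c : R) : measurable_fun setT (fun z : X * X => z.1 + c *: z.2)%R.
Proof.
apply/measurable_fun_rVP => i.
rewrite (_ : _ \o _ = fun z : X * X => z.1 ord0 i + c * z.2 ord0 i)%R; last first.
  by apply/funext => z /=; rewrite /rV_coord !mxE.
apply: measurable_funD; first exact: measurableT_comp (@measurable_rV_coord _ R n i) measurable_fst.
apply: measurable_funM => //; exact: measurableT_comp (@measurable_rV_coord _ R n i) measurable_snd.
Qed.

Lemma measurable_affine2 x (c : R) : measurable_fun setT (fun w : X => x + c *: w)%R.
Proof. exact: measurableT_comp (measurable_axpy c) (measurable_pair1 x). Qed.

(** Up to a factor depending on [r] alone, the mean of [H] over the sup-norm ball of radius [s * r]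
    about [x]: rescaling the variable replaces division by [s ^+ n]. *)
Definition nint s r H x : \bar R := \int[mu]_(w in nball r) H (x + s *: w)%R.

Section nonneg.
Variable H : X -> \bar R.
Hypothesis mH : measurable_fun setT H.
Hypothesis H0 : forall x, 0 <= H x.

Lemma nint_ge0 s r x : 0 <= nint s r H x.
Proof. exact: integral_ge0. Qed.

Lemma measurable_shifted x s : measurable_fun setT (fun w => H (x + s *: w)%R).
Proof. exact: measurableT_comp mH (measurable_affine2 x s). Qed.

Lemma measurable_nint s r : measurable_fun setT (nint s r H).
Proof.
pose h (z : X * X) := H (z.1 + s *: z.2)%R * (\1_(nball r) z.2)%:E.
have mh : measurable_fun setT h.
  apply: emeasurable_funM; first exact: measurableT_comp mH (measurable_axpy s).
  apply/measurable_EFinP; apply: (measurableT_comp (f := \1_(nball r) : X -> R)); last exact: measurable_snd.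
  by apply: measurable_indic; exact: measurable_nball.
rewrite (_ : nint s r H = fun x => \int[mu]_w h (x, w)); first exact: (measurable_integral2 mu h mh).
apply/funext => x; rewrite /nint integral_mkcond; apply: eq_integral => w _.
by rewrite patchE /h indicE; case: ifP => _; rewrite ?mule1 ?mule0.
Qed.

Lemma nint_le s r r' x : (r <= r')%R -> nint s r H x <= nint s r' H x.
Proof.
move=> rr'; apply: ge0_subset_integral; [exact: measurable_nball|exact: measurable_nball| | |].
- by apply: measurable_funTS; exact: measurable_shifted.
- by move=> w _.
- by move=> w; rewrite /nball/= => /lt_le_trans; exact.
Qed.

Lemma nint_scale s r x : (0 < s)%R -> (s ^+ n)%:E * nint s r H x = nint 1 (s * r) H x.
Proof.
move=> s0; rewrite /nint [in RHS]integral_mkcond [in LHS]integral_mkcond.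
have mF : measurable_fun setT ((fun w => H (x + 1%R *: w)%R) \_ (nball (s * r))).
  apply: measurable_restr; first exact: measurable_nball.
  exact: measurable_shifted.
have F0 : forall v, 0 <= ((fun w => H (x + 1%R *: w)%R) \_ (nball (s * r))) v.
  by move=> v; rewrite patchE; case: ifP.
rewrite (ge0_integral_affine 0%R s0 mF F0); congr (_ * _); apply: eq_integral => w _.
rewrite !patchE add0r scale1r.
have -> : (w \in nball r) = (s *: w \in nball (s * r))%R.
  by apply/idP/idP; rewrite !inE /nball /= normrZ gtr0_norm// ltr_pM2l.
by [].
Qed.

Lemma nint_shift_le s r r' v x : (`|v| <= r')%R ->
  \int[mu]_(w in nball r) H (x + s *: (w + v))%R <= nint s (r + r') H x.
Proof.
move=> vr; rewrite integral_mkcond /nint [leRHS]integral_mkcond.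
rewrite -[leRHS](ge0_integral_shift v); last 2 first.
- apply: measurable_restr; first exact: measurable_nball.
  exact: measurable_shifted.
- by move=> w; rewrite patchE; case: ifP.
apply: ge0_le_integral => //.
- by move=> w _; rewrite patchE; case: ifP.
- apply: measurable_restr; first exact: measurable_nball.
  apply: (measurableT_comp (f := fun w => H (x + s *: w)%R)).
    exact: measurable_shifted.
  exact: measurable_shiftr.
- apply: (measurableT_comp (f := _ \_ _)); last exact: measurable_shift.
  apply: measurable_restr; first exact: measurable_nball.
  exact: measurable_shifted.
- move=> w _; rewrite !patchE; case: ifPn => wr; last by case: ifP.
  rewrite mem_set; first by rewrite [(v + w)%R]addrC.
  move: wr; rewrite inE /nball /= addrC => wr.
  by apply: le_lt_trans (ler_normD _ _) _; rewrite ltr_leD.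
Qed.

(** A displacement at the smaller scale is a bounded shift at the larger one, so it is absorbed by
    enlarging the radius to [r + r']. *)
Lemma nint_nint s s' r r' x : (0 < s)%R -> (0 < s')%R -> (0 < r)%R -> (0 < r')%R ->
  nint s r (nint s' r' H) x <= mu (nball (r + r')) * nint (Num.max s s') (r + r') H x.
Proof.
move=> s0 s'0 r0 r'0.
have mK : measurable_fun setT (fun z : X * X => H ((x + s *: z.1) + s' *: z.2)%R).
  apply: (measurableT_comp mH).
  have m12 : measurable_fun setT (fun z : X * X => (x + s *: z.1, z.2)%R).
    apply/measurable_fun_pairP; split; last exact: measurable_snd.
    exact: measurableT_comp (measurable_affine2 x s) measurable_fst.
  exact: (measurableT_comp (measurable_axpy s') m12).
pose K (z : X * X) := H ((x + s *: z.1) + s' *: z.2)%R * (\1_(nball r) z.1)%:E * (\1_(nball r') z.2)%:E.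
have mi (rr : R) : measurable_fun setT (fun z : X => (\1_(nball rr) z)%:E : \bar R).
  by apply/measurable_EFinP; apply: measurable_indic; exact: measurable_nball.
have mKK : measurable_fun setT K.
  apply: emeasurable_funM; first apply: emeasurable_funM => //.
    exact: measurableT_comp (mi r) measurable_fst.
  exact: measurableT_comp (mi r') measurable_snd.
have K0 (z : X * X) : 0 <= K z by rewrite /K !mule_ge0// lee_fin.
have mrr : 0 <= mu (nball (r + r')) by [].
have LHS : nint s r (nint s' r' H) x = \int[mu]_w \int[mu]_w' K (w, w').
  rewrite /nint integral_mkcond; apply: eq_integral => w _; rewrite patchE /K /= indicE.
  case: ifP => _; last by rewrite integral0_eq// => w' _; rewrite mule0 mul0e.
  rewrite integral_mkcond; apply: eq_integral => w' _; rewrite patchE indicE.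
  by case: ifP => _; rewrite !mule1 ?mule0.
(* The larger scale must be integrated first; when it is the outer one, Tonelli exchanges the
   order. *)
have [ss'|ss'] := leP s' s.
  rewrite LHS; have -> := fubini_tonelli (m1 := mu) (m2 := mu) K mKK K0.
  apply: (@le_trans _ _ (\int[mu]_(w' in nball r') nint s (r + r') H x)).
    rewrite [leRHS]integral_mkcond; apply: ge0_le_integral; first exact: measurableT.
    - by move=> w' _; exact: integral_ge0.
    - exact: (measurable_fun_fubini_tonelli_G K mKK).
    - apply: measurable_restr; [exact: measurable_nball|exact: measurable_cst].
    - move=> w' _; rewrite patchE /K /= indicE; case: ifPn => w'r; last first.
        by rewrite integral0_eq// => w _; rewrite mule0.
      have vr : (`|(s' / s) *: w'| <= r')%R.
        rewrite normrZ ger0_norm; last by rewrite divr_ge0 ?ltW.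
        move: w'r; rewrite inE /nball /= => /ltW; apply: le_trans.
        by rewrite ler_piMl// ler_pdivrMr// mul1r.
      have := nint_shift_le s r x vr; apply: le_trans.
      rewrite [leRHS]integral_mkcond le_eqVlt; apply/orP; left; apply/eqP.
      apply: eq_integral => w _; rewrite mule1 patchE indicE; case: ifP => _; rewrite ?mule0// mule1.
      by rewrite scalerDr scalerA mulrC divfK ?gt_eqF// addrA.
  rewrite integral_cst; last exact: measurable_nball.
  rewrite muleC; apply: lee_wpmul2r; first exact: nint_ge0.
  apply: le_measure; rewrite ?inE; [exact: measurable_nball|exact: measurable_nball|].
  by move=> w; rewrite /nball /= => /lt_le_trans; apply; rewrite lerDr ltW.
apply: (@le_trans _ _ (\int[mu]_(w in nball r) nint s' (r + r') H x)).
  apply: ge0_le_integral.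
  - exact: measurable_nball.
  - by move=> w _; exact: integral_ge0.
  - by apply: measurable_funTS; exact: measurableT_comp (measurable_nint s' r') (measurable_affine2 x s).
  - exact: measurable_cst.
  - move=> w wr.
    have vr : (`|(s / s') *: w| <= r)%R.
      rewrite normrZ ger0_norm; last by rewrite divr_ge0 ?ltW.
      move: wr; rewrite /nball /= => /ltW; apply: le_trans.
      by rewrite ler_piMl// ler_pdivrMr// mul1r ltW.
    have := nint_shift_le s' r' x vr; rewrite addrC; apply: le_trans.
    rewrite le_eqVlt; apply/orP; left; apply/eqP; apply: eq_integral => w' _.
    by rewrite scalerDr scalerA mulrC divfK ?gt_eqF// -addrA [(s *: w + _)%R]addrC.
rewrite integral_cst; last exact: measurable_nball.
rewrite muleC; apply: lee_wpmul2r; first exact: nint_ge0.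
apply: le_measure; rewrite ?inE; [exact: measurable_nball|exact: measurable_nball|].
by move=> w; rewrite /nball /= => /lt_le_trans; apply; rewrite lerDl ltW.
Qed.

End nonneg.

Lemma le_nint s r F G x : measurable_fun setT F -> measurable_fun setT G ->
  (forall y, 0 <= F y) -> (forall y, F y <= G y) -> nint s r F x <= nint s r G x.
Proof.
move=> mF mG F0 FG; apply: ge0_le_integral => //; first exact: measurable_nball.
- by apply: measurable_funTS; exact: measurable_shifted.
- by apply: measurable_funTS; exact: measurable_shifted.
Qed.

Definition avg r j : (X -> \bar R) -> X -> \bar R := nint (2^-1 ^+ j)%R r.

(* A dyadic Riesz potential of order [k] truncated at distance [r]: [H (x + w)]
   enters with a weight comparable to [|w| ^ (k - n)], for [k < n]. *)
Definition pot k r H x : \bar R := \sum_(0 <= j <oo) ((2^-1 ^+ k) ^+ j)%:E * avg r j H x.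

Lemma half_gt0 j : (0 < 2^-1 ^+ j :> R)%R. Proof. by rewrite exprn_gt0// invr_gt0. Qed.

Lemma half_lt1 j : (0 < j)%N -> (2^-1 ^+ j <= 2^-1 :> R)%R.
Proof.
by case: j => // j _; rewrite exprS ler_piMr ?invr_ge0// exprn_ile1 ?invr_ge0// invf_le1// ler1n.
Qed.

Lemma half_anti j k : (j <= k)%N -> (2^-1 ^+ k <= 2^-1 ^+ j :> R)%R.
Proof. by move=> jk; rewrite ler_wiXn2l ?invr_ge0// invf_le1// ler1n. Qed.

Lemma measurable_avg r j H : measurable_fun setT H -> measurable_fun setT (avg r j H).
Proof. by move=> mH; exact: measurable_nint. Qed.

Lemma pot_ge0 k r H x : (forall y, 0 <= H y) -> 0 <= pot k r H x.
Proof.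
move=> H0; apply: nneseries_ge0 => j _ _; apply: mule_ge0; last exact: nint_ge0.
by rewrite lee_fin exprn_ge0// ltW// half_gt0.
Qed.

Lemma measurable_pot k r H : measurable_fun setT H -> (forall x, 0 <= H x) ->
  measurable_fun setT (pot k r H).
Proof.
move=> mH H0; apply: measurable_nneseries => j.
  by apply: emeasurable_funM => //; exact: measurable_avg.
by move=> x; apply: mule_ge0; [rewrite lee_fin exprn_ge0// ltW// half_gt0|exact: nint_ge0].
Qed.

Lemma le_pot k r F G x : measurable_fun setT F -> measurable_fun setT G ->
  (forall y, 0 <= F y) -> (forall y, F y <= G y) -> pot k r F x <= pot k r G x.
Proof.
move=> mF mG F0 FG; apply: lee_nneseries => j _.
  by move=> _; apply: mule_ge0; [rewrite lee_fin exprn_ge0// ltW// half_gt0|exact: nint_ge0].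
by apply: lee_wpmul2l; [rewrite lee_fin exprn_ge0// ltW// half_gt0|exact: le_nint].
Qed.

Lemma avg_avg r r' j j' H x : measurable_fun setT H -> (forall y, 0 <= H y) -> (0 < r)%R -> (0 < r')%R ->
  avg r j (avg r' j' H) x <= mu (nball (r + r')) * avg (r + r') (minn j j') H x.
Proof.
move=> mH H0 r0 r'0; apply: le_trans (nint_nint mH H0 x (half_gt0 j) (half_gt0 j') r0 r'0) _.
suff -> : (Num.max (2^-1 ^+ j) (2^-1 ^+ j') = 2^-1 ^+ minn j j' :> R)%R by [].
case: (leqP j j') => jj'; first by rewrite max_l// half_anti.
by rewrite max_r// half_anti// ltnW.
Qed.

(** An iterated average is bounded by one at the coarser scale, so in the double series the finer
    index only occurs in a geometric series. Summing it leaves the weight [2 ^ (- (k + 1) j)];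
    [0 < k] keeps its ratio at most 1/2. *)
Lemma pot_pot k r r' H x : measurable_fun setT H -> (forall y, 0 <= H y) -> (0 < k)%N ->
  (0 < r)%R -> (0 < r')%R ->
  pot k r (pot 1 r' H) x <= 4%:E * mu (nball (r + r')) * pot k.+1 (r + r') H x.
Proof.
move=> mH H0 k0 r0 r'0; set q := (2^-1 ^+ k : R)%R.
have q0 : (0 < q)%R by exact: half_gt0.
have q2 : (q <= 2^-1)%R by exact: half_lt1.
have qj0 j : (0 <= q ^+ j)%R by rewrite exprn_ge0// ltW.
have h0 j : (0 <= (2^-1 : R) ^+ j)%R by rewrite ltW// half_gt0.
have M0 : 0 <= mu (nball (r + r')) by [].
set M := mu (nball (r + r')) in M0 *.
pose A j := avg (r + r') j H x.
have A0 j : 0 <= A j by exact: nint_ge0.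
have aa0 j j' : 0 <= avg r j (avg r' j' H) x by apply: nint_ge0 => y; exact: nint_ge0.
have step1 : pot k r (pot 1 r' H) x =
    \sum_(0 <= j <oo) \sum_(0 <= j' <oo) (q ^+ j)%:E * ((2^-1 ^+ j')%:E * avg r j (avg r' j' H) x).
  apply: eq_eseriesr => j _; rewrite nneseriesZl; last first.
    by move=> i _; apply: mule_ge0; rewrite ?lee_fin.
  congr (_ * _); rewrite /avg /nint integral_nneseries.
  - apply: eq_eseriesr => i _; rewrite expr1 ge0_integralZl//; [exact: measurable_nball| |].
      apply: measurable_funTS; apply: measurable_shifted; exact: measurable_nint.
    by move=> w _; exact: nint_ge0.
  - exact: measurable_nball.
  - move=> i; apply: measurable_funTS; apply: emeasurable_funM => //.
    apply: measurable_shifted; exact: measurable_nint.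
  - by move=> i w _; apply: mule_ge0; rewrite ?lee_fin ?expr1//; exact: nint_ge0.
rewrite step1.
pose B j j' := (q ^+ j)%:E * (2^-1 ^+ j')%:E * A j.
pose C j j' := (q ^+ j)%:E * (2^-1 ^+ j')%:E * A j'.
(* The two triangles overlap on the diagonal, which is harmless for an upper bound. *)
pose S1 := \sum_(0 <= j <oo) \sum_(0 <= j' <oo) (if (j <= j')%N then B j j' else 0).
pose S2 := \sum_(0 <= j <oo) \sum_(0 <= j' <oo) (if (j' <= j)%N then C j j' else 0).
have B0 j j' : 0 <= B j j' by rewrite /B !mule_ge0// lee_fin.
have C0 j j' : 0 <= C j j' by rewrite /C !mule_ge0// lee_fin.
have if0 (b : bool) (u : \bar R) : 0 <= u -> 0 <= (if b then u else 0) by case: b.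
have h01 : (0 <= (2^-1 : R) < 1)%R by apply/andP; split; lra.
have q01 : (0 <= q < 1)%R by rewrite (ltW q0)/= (le_lt_trans q2)// invf_lt1// ltr1n.
have e1 : S1 <= 2%:E * pot k.+1 (r + r') H x.
  rewrite /pot -nneseriesZl => [|j _]; last by rewrite mule_ge0 ?lee_fin ?exprn_ge0//; exact: nint_ge0.
  apply: lee_nneseries => [j _ _|j _]; first by apply: nneseries_ge0 => j' _ _; exact: if0.
  rewrite (_ : \sum_(0 <= j' <oo) _ = (q ^+ j)%:E * A j * \sum_(0 <= j' <oo) (if (j <= j')%N then (2^-1 ^+ j')%:E else 0)); last first.
    rewrite -ge0_nneseriesZl; [|by rewrite mule_ge0// lee_fin|by move=> j'; apply: if0; rewrite lee_fin].
    by apply: eq_eseriesr => j' _; case: ifP => _; rewrite ?mule0// /B muleAC.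
  rewrite nneseries_geometric_tail// exprS exprMn -/q muleAC [leRHS]muleA -EFinM.
  apply: lee_wpmul2r => //; rewrite -!EFinM lee_fin le_eqVlt; apply/orP; left; apply/eqP.
  by field.
have e2 : S2 <= 2%:E * pot k.+1 (r + r') H x.
  rewrite /S2 nneseries_interchange; last by move=> i j; exact: if0.
  rewrite /pot -nneseriesZl => [|j _]; last by rewrite mule_ge0 ?lee_fin ?exprn_ge0//; exact: nint_ge0.
  apply: lee_nneseries => [j _ _|j _]; first by apply: nneseries_ge0 => j' _ _; exact: if0.
  rewrite (_ : \sum_(0 <= j' <oo) _ = (2^-1 ^+ j)%:E * A j * \sum_(0 <= j' <oo) (if (j <= j')%N then (q ^+ j')%:E else 0)); last first.
    rewrite -ge0_nneseriesZl; [|by rewrite mule_ge0// lee_fin|by move=> j'; apply: if0; rewrite lee_fin].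
    by apply: eq_eseriesr => j' _; case: ifP => _; rewrite ?mule0// /C muleAC [X in X * _]muleC muleAC; congr (_ * _); exact: muleC.
  rewrite nneseries_geometric_tail// exprS exprMn -/q muleAC [leRHS]muleA -EFinM.
  have i2 : ((1 - q)^-1 <= 2)%R.
    by rewrite -[leRHS]invrK lef_pV2 ?posrE ?invr_gt0// ?subr_gt0; move: q2; lra.
  apply: lee_wpmul2r => //; rewrite -!EFinM lee_fin.
  have := ler_wpM2l (mulr_ge0 (h0 j) (qj0 j)) i2; move: (1 - q)^-1%R (q ^+ j)%R ((2^-1 : R) ^+ j)%R => a b c.
  by move=> h; nra.
apply: (@le_trans _ _ (M * (S1 + S2))).
  rewrite -nneseriesD; last 2 first.
  - by move=> j _ _; apply: nneseries_ge0 => j' _ _; exact: if0.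
  - by move=> j _ _; apply: nneseries_ge0 => j' _ _; exact: if0.
  rewrite -ge0_nneseriesZl//; last first.
    by move=> j; apply: adde_ge0; apply: nneseries_ge0 => j' _ _; exact: if0.
  apply: lee_nneseries => [j _ _|j _].
    by apply: nneseries_ge0 => j' _ _; rewrite !mule_ge0 ?lee_fin//; exact: nint_ge0.
  rewrite -nneseriesD; [|by move=> j' _ _; exact: if0|by move=> j' _ _; exact: if0].
  rewrite -ge0_nneseriesZl//; last by move=> j'; apply: adde_ge0; exact: if0.
  apply: lee_nneseries => [j' _ _|j' _].
    by rewrite !mule_ge0 ?lee_fin//; exact: nint_ge0.
  apply: (@le_trans _ _ ((q ^+ j)%:E * ((2^-1 ^+ j')%:E * (M * A (minn j j'))))).
    by do 2 (apply: lee_wpmul2l; first by rewrite lee_fin); exact: avg_avg.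
  rewrite muleA [X in X * _]muleC muleCA -muleA; apply: lee_wpmul2l => //.
  rewrite muleA [X in X * _]muleC.
  case: (leqP j j') => jj'.
    by rewrite -[leLHS]/(B j j') leeDl//; exact: if0.
  by rewrite -[leLHS]/(C j j') (ltnW jj') add0e.
rewrite -muleA muleCA; apply: lee_wpmul2l => //.
apply: le_trans (leeD e1 e2) _; rewrite -ge0_muleDl ?lee_fin// -EFinD.
by rewrite (_ : 2 + 2 = 4 :> R)%R// -natrD.
Qed.

End averages.

(** * Pointwise bounds from the cone condition *)

Section cone_estimate.
Context {R : realType} {n : nat}.
Notation X := 'rV[R]_n.
Notation mu := (lebesgue_rV n).
Notation leb := (@lebesgue_measure R).
Implicit Types (x y z u v w : X) (r s t q : R) (j k : nat).
Local Open Scope ereal_scope.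
Implicit Types (f g : X -> R) (F G H : X -> \bar R) (Omega : set X).

Lemma dir_weak_deriv_any Omega f (G : 'I_n -> X -> R) w : locint f -> (forall i, locint (G i)) ->
  (forall i, dir_weak_deriv Omega (delta_mx ord0 i) f (G i)) ->
  dir_weak_deriv Omega w f (fun x => \sum_i w ord0 i * G i x)%R.
Proof.
move=> lf lG d phi tphi; have [sphi _ _] := tphi.
have If i := test_integrable lf (test_partial i tphi).
have IG i := test_integrable (lG i) tphi.
transitivity (\int[mu]_x \sum_i ((w ord0 i)%:E * (f x * partial i phi x)%:E)).
  apply: eq_integral => x _; rewrite derive_coordsum; last exact: smooth_differentiable.
  by rewrite mulr_sumr -sumEFin; apply: eq_bigr => i _; rewrite -EFinM mulrCA.
rewrite integral_sum//; last by move=> i; exact: integrableZl.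
transitivity (- \int[mu]_x \sum_i ((w ord0 i)%:E * (G i x * phi x)%:E)); last first.
  congr (- _); apply: eq_integral => x _; rewrite mulr_suml -sumEFin.
  by apply: eq_bigr => i _; rewrite -EFinM mulrA.
rewrite integral_sum//; last by move=> i; exact: integrableZl.
under eq_bigr => i _ do rewrite integralZl//.
under [X in _ = - X]eq_bigr => i _ do rewrite integralZl//.
rewrite -sumeN => [|i k _ _]; last first.
  by apply: fin_num_adde_defr; rewrite fin_numM//; exact: integrable_fin_num.
by apply: eq_bigr => i _; rewrite -muleN; congr (_ * _); exact: d.
Qed.

Lemma locint_sum (I : Type) (L : seq I) (E : I -> X -> R) : (forall a : I, locint (E a)) ->
  locint (fun x => \sum_(k <- L) E k x)%R.
Proof.
move=> lE; elim: L => [|l L IH]; first by under eq_fun do rewrite big_nil; exact: locint0.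
by under eq_fun do rewrite big_cons; exact: locintD.
Qed.

Definition segments Omega : set (X * X) :=
  [set z | forall t, (0 <= t <= 1)%R -> Omega (z.1 + t *: z.2)%R].

Lemma segment_tube Omega x w : open Omega -> segments Omega (x, w) ->
  exists2 d : R, (0 < d)%R & forall t y, (0 <= t <= 1)%R -> (`|y - (x + t *: w)| < d)%R -> Omega y.
Proof.
move=> oO S; pose l (t : R) : X := (x + t *: w)%R.
have cl : continuous l by move=> t; apply: (@continuousD _ _ _ (cst x) (fun t : R => t *: w)%R); [exact: cst_continuous|exact: scalel_continuous].
have cK : compact (l @` `[0%R, 1%R]%classic).
  by apply: continuous_compact; [exact: continuous_subspaceT|exact: segment_compact].
have KO : l @` `[0%R, 1%R]%classic `<=` Omega by move=> _ [t /= t01 <-]; apply: S; rewrite in_itv/= in t01.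
have [d d0 Hd] := compact_tube cK oO KO; exists d => // t y t01; apply: Hd.
by exists t => //=; rewrite in_itv.
Qed.

Lemma open_segments Omega w : open Omega -> open [set x | segments Omega (x, w)].
Proof.
move=> oO; rewrite openE => x /= S; have [d d0 Hd] := segment_tube oO S.
apply/nbhs_ballP; exists d => //= y; rewrite -ball_normE/= => yx t t01; apply: (Hd t) => //=.
by rewrite opprD addrACA subrr addr0 distrC.
Qed.

(** By compactness a segment inside [Omega] keeps a distance [1 / (k + 1)] from the complement; for
    a fixed distance rational parameters suffice, because they approximate a point where the segment
    would leave [Omega]. *)
Lemma measurable_segments Omega : open Omega -> measurable (segments Omega).
Proof.
move=> oO.
pose e k : R := (k.+1%:R^-1)%R.
have e0 k : (0 < e k)%R by rewrite invr_gt0 ltr0n.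
pose bad k : set X := \bigcup_(y in ~` Omega) ball y (e k).
have obad k : open (bad k) by apply: bigcup_open => y _; exact: ball_open.
pose B k (q : rat) : set (X * X) :=
  if (0 <= (ratr q : R) <= 1)%R then (fun z : X * X => z.1 + ratr q *: z.2)%R @^-1` bad k else set0.
have mB k (q : rat) : measurable (B k q).
  rewrite /B; case: ifP => // _; rewrite -[X in measurable X]setTI.
  by apply: measurable_axpy => //; exact: open_measurable_rV.
rewrite (_ : segments Omega = \bigcup_k ~` \bigcup_q B k q); last first.
  apply/seteqP; split => [[x w] S|[x w] [k _ nB] t /andP[t0 t1]].
    have [d d0 Hd] := segment_tube oO S.
    exists (Num.truncn d^-1) => // -[q _]; rewrite /B; case: ifP => // q01 [y ny].
    rewrite -ball_normE/= => yl; apply: ny; apply: (Hd (ratr q)) => //.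
    apply: lt_trans yl _; rewrite /e invf_plt ?posrE// .
    exact: truncnS_gt.
  apply: contrapT => nO; apply: nB.
  pose h : R := (e k / (`|w| + 1))%R.
  have w1 : (0 < `|w| + 1)%R by rewrite ltr_wpDl.
  have h0 : (0 < h)%R by rewrite divr_gt0.
  have uv : (Num.max 0 (t - h) < Num.min 1 (t + h))%R.
    by rewrite gt_max !lt_min ltr01/=; apply/andP; split; [|apply/andP; split]; lra.
  have [q] := rat_in_itvoo uv; rewrite in_itv/= gt_max lt_min => /andP[/andP[q0 tq] /andP[q1 qt]].
  exists q => //; rewrite /B !ltW//=; exists (x + t *: w)%R => //.
  rewrite -ball_normE/= opprD addrACA subrr add0r -scalerBl normrZ.
  have : (`|t - ratr q| < h)%R by rewrite ltr_norml; apply/andP; split; lra.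
  rewrite /h ltr_pdivlMr//; apply: le_lt_trans; rewrite ler_wpM2l//; lra.
apply: bigcup_measurable => k _; apply: measurableC.
exact: bigcupT_measurable_rat.
Qed.

Lemma ae_affine (P : X -> Prop) x s : (0 < s)%R ->
  {ae mu, forall y, P y} -> {ae mu, forall w, P (x + s *: w)%R}.
Proof.
move=> s0 [N [mN N0 PN]]; exists (affine x s @^-1` N); split.
- by rewrite -[X in measurable X]setTI; exact: measurable_affine.
- have : (s ^+ n)%:E * mu (affine x s @^-1` N) = 0 by rewrite -lebesgue_affine.
  by move=> /eqP; rewrite mule_eq0 eqe expf_eq0 (gt_eqF s0) andbF /= => /eqP.
- by move=> w /= nP; exact: PN.
Qed.

Lemma ae_le_nint s r F G x : (0 < s)%R -> measurable_fun setT F -> measurable_fun setT G ->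
  (forall y, 0 <= F y) -> (forall y, 0 <= G y) -> {ae mu, forall y, F y <= G y} ->
  nint s r F x <= nint s r G x.
Proof.
move=> s0 mF mG F0 G0 FG; apply: ae_ge0_le_integral => //; first exact: measurable_nball.
- by apply: measurable_funTS; exact: measurable_shifted.
- by apply: measurable_funTS; exact: measurable_shifted.
- by apply: filterS (ae_affine x s0 FG) => w h _.
Qed.

Lemma ae_le_pot k r F G x : measurable_fun setT F -> measurable_fun setT G ->
  (forall y, 0 <= F y) -> (forall y, 0 <= G y) -> {ae mu, forall y, F y <= G y} ->
  pot k r F x <= pot k r G x.
Proof.
move=> mF mG F0 G0 FG; apply: lee_nneseries => j _.
  by move=> _; apply: mule_ge0; [rewrite lee_fin exprn_ge0// ltW// half_gt0|exact: nint_ge0].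
apply: lee_wpmul2l; first by rewrite lee_fin exprn_ge0// ltW// half_gt0.
by apply: ae_le_nint => //; exact: half_gt0.
Qed.

Lemma potZ k r (c : R) F x : (0 <= c)%R -> measurable_fun setT F -> (forall y, 0 <= F y) ->
  pot k r (fun y => c%:E * F y) x = c%:E * pot k r F x.
Proof.
move=> c0 mF F0; rewrite /pot -nneseriesZl => [|j _]; last first.
  by apply: mule_ge0; [rewrite lee_fin exprn_ge0// ltW// half_gt0|exact: nint_ge0].
apply: eq_eseriesr => j _; rewrite muleCA; congr (_ * _).
rewrite /avg /nint ge0_integralZl_EFin//; first exact: measurable_nball.
by apply: measurable_funTS; exact: measurable_shifted.
Qed.

Lemma pot_le_r k r r' F x : (r <= r')%R -> measurable_fun setT F -> (forall y, 0 <= F y) ->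
  pot k r F x <= pot k r' F x.
Proof.
move=> rr' mF F0; apply: lee_nneseries => j _.
  by move=> _; apply: mule_ge0; [rewrite lee_fin exprn_ge0// ltW// half_gt0|exact: nint_ge0].
by apply: lee_wpmul2l; [rewrite lee_fin exprn_ge0// ltW// half_gt0|exact: nint_le].
Qed.

Lemma avg0_le_pot k r F x : (forall y, 0 <= F y) -> avg r 0 F x <= pot k r F x.
Proof.
move=> F0; have := nneseries_lim_ge (m := 0) 1 (u_ := fun j => ((2^-1 ^+ k) ^+ j)%:E * avg r j F x) (P := predT).
rewrite big_nat1 expr0 mul1e; apply=> j _ _.
by apply: mule_ge0; [rewrite lee_fin exprn_ge0// ltW// half_gt0|exact: nint_ge0].
Qed.

(** Dyadic decomposition of []0, 1]]: for [t] between [2 ^ (- j - 1)] and [2 ^ (- j)] the ball is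
    enlarged to the scale [2 ^ (- j)], which costs [2 ^ n], and the length of the interval supplies
    the weight of a potential of order 1. *)
Lemma integral_nint_le r H x : (0 < r)%R -> measurable_fun setT H -> (forall y, 0 <= H y) ->
  \int[leb]_(t in seg 1) nint t r H x <= (2 ^+ n)%:E * pot 1 r H x.
Proof.
move=> r0 mH H0.
pose I j : set (measurableTypeR R) := `](2^-1 ^+ j.+1)%R, (2^-1 ^+ j)%R]%classic.
have mI j : measurable (I j) by exact: measurable_itv.
pose c j := (2 ^+ n)%:E * avg r j H x.
have a0 j : 0 <= avg r j H x by exact: nint_ge0.
have c0 j : 0 <= c j by rewrite mule_ge0// lee_fin exprn_ge0.
have mn : measurable_fun (setT : set (measurableTypeR R)) (fun t => nint t r H x).
  pose h (z : measurableTypeR R * X) := ((fun z : measurableTypeR R * X => H (x + z.1 *: z.2)%R) \_ (snd @^-1` nball r)) z.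
  have mh : measurable_fun setT h.
    apply: measurable_restr.
      by rewrite -[X in measurable X]setTI; apply: measurable_snd => //; exact: measurable_nball.
    apply: (measurableT_comp mH); apply/measurable_fun_rVP => i.
    rewrite (_ : _ \o _ = fun z : measurableTypeR R * X => x ord0 i + z.1 * z.2 ord0 i)%R; last first.
      by apply/funext => z /=; rewrite /rV_coord !mxE.
    apply: measurable_funD => //; apply: measurable_funM => //.
    exact: measurableT_comp (@measurable_rV_coord _ R n i) measurable_snd.
  rewrite (_ : (fun t => _) = fun t => \int[mu]_w h (t, w)); first exact: (measurable_integral2 mu h mh).
  apply/funext => t; rewrite /nint integral_mkcond; apply: eq_integral => w _; rewrite /h !patchE.
  by congr (if _ then _ else _); apply/idP/idP; rewrite !inE.
rewrite /seg -integral_itv_obnd_cbnd; last exact: measurable_funTS.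
have pw t : (`]0%R, 1%R]%classic : set (measurableTypeR R)) t -> nint t r H x <= \sum_(0 <= j <oo) (c j * (\1_(I j) t)%:E).
  rewrite /= in_itv/= => /andP[t0 t1].
  have ex : exists k, (2^-1 ^+ k < t)%R.
    exists (Num.truncn t^-1).+1; rewrite exprVn invf_plt ?posrE ?exprn_gt0//.
    apply: lt_le_trans (truncnS_gt _) _; rewrite -natrX ler_nat ltnW//; exact: ltn_expl.
  have [k tk kmin] := ex_minnP ex.
  case: k tk kmin => [|k] tk kmin; first by move: tk; rewrite expr0 ltNge t1.
  have tk' : (t <= 2^-1 ^+ k)%R by rewrite leNgt; apply/negP => /kmin; rewrite ltnn.
  apply: (@le_trans _ _ (c k)); last first.
    have := nneseries_lim_ge (m := 0) k.+1 (u_ := fun j => c j * (\1_(I j) t)%:E) (P := predT).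
    move=> /(_ (fun j _ _ => _)) h; apply: le_trans (h _) => [|j]; last by rewrite mule_ge0// lee_fin.
    rewrite big_nat_recr//= indicE mem_set ?mule1; last by rewrite /I /= in_itv/= tk tk'.
    by rewrite leeDr//; apply: sume_ge0 => j _; rewrite mule_ge0// lee_fin.
  have tn : (0 < t ^+ n)%R by rewrite exprn_gt0.
  have -> : nint t r H x = (t ^+ n)^-1%:E * nint 1 (t * r) H x.
    by rewrite -(nint_scale mH H0 r x t0) muleA -EFinM mulVf ?mul1e// gt_eqF.
  apply: (@le_trans _ _ ((t ^+ n)^-1%:E * nint 1 (2^-1 ^+ k * r) H x)).
    by apply: lee_wpmul2l; [rewrite lee_fin invr_ge0 ltW|apply: nint_le => //; rewrite ler_wpM2r// ltW].
  rewrite -(nint_scale mH H0 r x (half_gt0 k)) muleA -EFinM.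
  rewrite /c; apply: lee_wpmul2r => //; first exact: nint_ge0.
  rewrite lee_fin mulrC -expr_div_n.
  apply: lerXn2r; rewrite ?nnegrE ?divr_ge0 ?ltW ?half_gt0// .
  rewrite ltr_pdivrMr//; move: tk; rewrite exprS; move: (2^-1 ^+ k)%R => a; clear; lra.
apply: (@le_trans _ _ (\int[leb]_t \sum_(0 <= j <oo) (c j * (\1_(I j) t)%:E))).
  rewrite integral_mkcond; apply: ge0_le_integral => //.
  - by move=> t _; rewrite patchE; case: ifP => // _; exact: nint_ge0.
  - by apply: measurable_restr => //; exact: measurable_itv.
  - apply: measurable_nneseries => j; last by move=> t; rewrite mule_ge0// lee_fin.
    by apply: emeasurable_funM => //; apply/measurable_EFinP; exact: measurable_indic.
  - move=> t _; rewrite patchE; case: ifPn => [/set_mem/pw//|_].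
    by apply: nneseries_ge0 => j _ _; rewrite mule_ge0// lee_fin.
rewrite integral_nneseries; last 3 first.
- exact: measurableT.
- by move=> j; apply: emeasurable_funM => //; apply/measurable_EFinP; exact: measurable_indic.
- by move=> j t _; rewrite mule_ge0// lee_fin.
rewrite /pot -nneseriesZl => [|j _]; last by rewrite mule_ge0// lee_fin exprn_ge0// ltW// half_gt0.
apply: lee_nneseries => [j _ _|j _].
  by apply: integral_ge0 => t _; rewrite mule_ge0// lee_fin.
rewrite ge0_integralZl//; last by apply/measurable_EFinP; exact: measurable_indic.
rewrite integral_indic// setIT expr1 muleCA [leRHS]muleC; apply: lee_wpmul2l => //.
rewrite [leLHS](lebesgue_measure_itv `](2^-1 ^+ j.+1)%R, (2^-1 ^+ j)%R])/= lte_fin; case: ifP => _; last by rewrite lee_fin ltW// half_gt0.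
by rewrite -EFinB lee_fin gerBl// ltW// half_gt0.
Qed.

Lemma lebesgue_ball z r : (0 < r)%R -> mu [set w | `|w - z| < r]%R = mu (nball r).
Proof.
move=> r0.
have mQ : measurable [set w : X | `|w - z| < r]%R.
  apply: open_measurable_rV; rewrite (_ : mkset _ = ball z r); first exact: ball_open.
  by apply/seteqP; split => w; rewrite -ball_normE /= distrC.
have := lebesgue_affine z ltr01 mQ; rewrite expr1n mul1e => E; apply: etrans E _.
congr (mu _); apply/seteqP; split => w; rewrite /nball /affine /= scale1r addrC addKr//.
Qed.

Section pointwise.
Variables (Omega : set X) (rho e : R).
Hypothesis oO : open Omega.
Hypothesis rho0 : (0 < rho)%R.
Hypothesis e0 : (0 < e)%R.
Hypothesis rhoe : (rho + e <= 1)%R.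
Hypothesis cubes : forall x, Omega x -> exists2 z, (`|z| <= e)%R &
  forall y t, (`|y - z| < rho)%R -> (0 <= t <= 1)%R -> Omega (x + t *: y)%R.

Definition abse_fun f : X -> \bar R := fun x => `|f x|%:E.

(** [|f x|] is at most [|f (x + w)|] plus the integral of the derivatives along the segment. This is
    averaged over the directions [w] in the cube attached to [x]; then the cube is enlarged to a
    ball independent of [x]. *)
Lemma cone_pointwise f (G : 'I_n -> X -> R) : locint f -> (forall i, locint (G i)) ->
  (forall i, dir_weak_deriv Omega (delta_mx ord0 i) f (G i)) ->
  {ae mu, forall x, Omega x -> mu (nball rho) * `|f x|%:E <=
    avg (rho + e) 0 (abse_fun f) x + (2 ^+ n)%:E * pot 1 (rho + e) (fun y => \sum_i abse_fun (G i) y) x}.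
Proof.
move=> lf lG d; set r := (rho + e)%R; set g := (X in pot _ _ X).
have r0 : (0 < r)%R by rewrite addr_gt0.
have mG i : measurable_fun setT (abse_fun (G i)).
  by apply/measurable_EFinP; apply: measurableT_comp => //; exact: (lG i).1.
have mf : measurable_fun setT (abse_fun f).
  by apply/measurable_EFinP; apply: measurableT_comp => //; exact: lf.1.
have mg : measurable_fun setT g by exact: emeasurable_sum.
have g0 y : 0 <= g y by apply: sume_ge0 => i _; rewrite lee_fin.
pose gl (z : X * X) := \int[leb]_(t in seg 1) g (z.1 + t *: z.2)%R.
have mgl : measurable_fun setT gl.
  pose h (zt : (X * X) * measurableTypeR R) := ((fun zt : (X * X) * measurableTypeR R => g (zt.1.1 + zt.2 *: zt.1.2)%R) \_ (snd @^-1` seg 1)) zt.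
  have mh : measurable_fun setT h.
    apply: measurable_restr.
      by rewrite -[X in measurable X]setTI; apply: measurable_snd => //; exact: measurable_seg.
    apply: (measurableT_comp mg); apply/measurable_fun_rVP => i.
    rewrite (_ : _ \o _ = fun zt : (X * X) * measurableTypeR R => zt.1.1 ord0 i + zt.2 * zt.1.2 ord0 i)%R; last first.
      by apply/funext => zt /=; rewrite /rV_coord !mxE.
    have mc : measurable_fun setT (fun v : X => v ord0 i) := @measurable_rV_coord _ R n i.
    apply: measurable_funD.
      exact: measurableT_comp mc (measurableT_comp measurable_fst measurable_fst).
    apply: measurable_funM => //.
    exact: measurableT_comp mc (measurableT_comp measurable_snd measurable_fst).
  rewrite (_ : gl = fun z : X * X => \int[leb]_t h (z, t)); first exact: (measurable_integral2 leb h mh).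
  apply/funext => z; rewrite /gl integral_mkcond; apply: eq_integral => t _; rewrite /h !patchE.
  by congr (if _ then _ else _); apply/idP/idP; rewrite !inE.
have gl0 (z : X * X) : 0 <= gl z by apply: integral_ge0.
(* [weak_FTC] treats one direction at a time, while the cube of directions depends on [x]; hence a
   condition on all pairs and an exchange of the two quantifiers. *)
pose D : set (X * X) := [set z | segments Omega z -> (`|z.2| <= 1)%R ->
  `|f z.1|%:E <= `|f (z.1 + z.2)%R|%:E + gl z].
have mD : measurable D.
  rewrite (_ : D = ~` segments Omega `|` ~` (snd @^-1` [set w : X | `|w| <= 1]%R) `|`
    [set z | `|f z.1|%:E <= `|f (z.1 + z.2)%R|%:E + gl z]); last first.
    apply/seteqP; split => [z Dz|z].
      have [S|] := pselect (segments Omega z); last by left; left.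
      have [w1|nw] := pselect ((`|z.2| <= 1)%R); last by left; right.
      by right; exact: Dz.
    by move=> [[nS /nS//|nw _ /nw//]|h _ _]; exact: h.
  apply: measurableU; first apply: measurableU; apply: measurableC || idtac.
  - exact: measurable_segments.
  - rewrite -[X in measurable X]setTI; apply: measurable_snd => //; apply: closed_measurable_rV.
    apply: (@closed_comp _ _ (fun w : X => `|w|%R) [set t | t <= 1]%R); last exact: closed_le.
    by move=> w _; exact: norm_continuous.
  - rewrite -[X in measurable X]setTI; have m1 : measurable_fun setT (fun z : X * X => `|f z.1|%:E : \bar R) by exact: measurableT_comp mf measurable_fst.
    have m2 : measurable_fun setT (fun z : X * X => `|f (z.1 + z.2)%R|%:E + gl z : \bar R).
      apply: emeasurable_funD => //; apply: (measurableT_comp mf).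
      by under eq_fun do rewrite -[_.2]scale1r; exact: measurable_axpy.
    by apply: measurable_lee m1 m2.
have aeD : {ae mu, forall x, {ae mu, forall w, D (x, w)}}.
  apply: (ae_swap (m1 := mu) (m2 := mu) mD); apply: aeW => w.
  have [w1|nw] := leP `|w|%R 1%R; last first.
    by apply: aeW => x _ /=; rewrite leNgt nw.
  have dw := dir_weak_deriv_any w lf lG d.
  have lGw : locint (fun x => \sum_i w ord0 i * G i x)%R by apply: locint_sum => i; exact: locintZ.
  have r01 : (0 <= (1 : R))%R && ((1 : R) <= 1)%R by rewrite ler01 lexx.
  have := weak_FTC (@open_segments Omega w oO) lf lGw dw r01 (fun x t S => S t); apply: filterS => x FTC S _ /=.
  have := FTC S; rewrite scale1r => E.
  have : (`|f x| <= `|f (x + w)| + `|line_int (fun x => \sum_i w ord0 i * G i x) w 1 x|)%R.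
    by rewrite -[f x](addrK (line_int (fun x => \sum_i w ord0 i * G i x)%R w 1 x)) -E; exact: ler_normB.
  rewrite -lee_fin EFinD => /le_trans; apply; apply: leeD2l.
  apply: le_trans (line_int_le w 1 x lGw.1) _; rewrite /gl.
  apply: ge0_le_integral => //=; first exact: measurable_seg.
  - apply/measurable_EFinP; apply: measurableT_comp => //; apply: measurable_funTS; apply: (measurableT_comp lGw.1).
    exact: (measurableT_comp (measurable_line w) (measurable_pair1 x)).
  - apply: measurable_funTS; apply: (measurableT_comp mg).
    exact: (measurableT_comp (measurable_line w) (measurable_pair1 x)).
  - move=> t _; rewrite /g /abse_fun sumEFin lee_fin; apply: le_trans (ler_norm_sum _ _ _) _.
    apply: ler_sum => i _; rewrite normrM ler_piMl//; exact: le_trans (coord_le_norm w i) w1.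
apply: filterS aeD => x Dx Ox; have [z ze Hz] := cubes Ox.
pose Q : set X := [set w | `|w - z| < rho]%R.
have Qr : Q `<=` nball r.
  move=> w; rewrite /Q /nball /= => wz; rewrite -[w](subrK z).
  by apply: le_lt_trans (ler_normD _ _) _; rewrite ltr_leD.
have mQ : measurable Q.
  apply: open_measurable_rV; rewrite (_ : Q = ball z rho); first exact: ball_open.
  by apply/seteqP; split => w; rewrite -ball_normE /Q /= distrC.
rewrite -(lebesgue_ball z rho0) muleC -/Q -integral_cst//.
apply: (@le_trans _ _ (\int[mu]_(w in nball r) (abse_fun f (x + w)%R + gl (x, w)))).
  apply: (@le_trans _ _ (\int[mu]_(w in Q) (abse_fun f (x + w)%R + gl (x, w)))).
    apply: ae_ge0_le_integral => //.
    - by move=> w _; rewrite lee_fin.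
    - by move=> w _; apply: adde_ge0; rewrite ?lee_fin.
    - apply: measurable_funTS; apply: emeasurable_funD.
        by apply: (measurableT_comp mf); exact: measurable_shift.
      exact: (measurableT_comp mgl (measurable_pair1 x)).
    - apply: filterS Dx => w Dxw Qw; apply: Dxw.
        by move=> t t01; exact: Hz.
      by apply: ltW; apply: lt_le_trans rhoe; exact: Qr.
  apply: ge0_subset_integral => //; first exact: measurable_nball.
  - apply: measurable_funTS; apply: emeasurable_funD.
      by apply: (measurableT_comp mf); exact: measurable_shift.
    exact: (measurableT_comp mgl (measurable_pair1 x)).
  - by move=> w _; apply: adde_ge0; rewrite ?lee_fin.
rewrite ge0_integralD//; last 4 first.
- exact: measurable_nball.
- by move=> w _; rewrite lee_fin.
- by apply: measurable_funTS; apply: (measurableT_comp mf); exact: measurable_shift.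
- by apply: measurable_funTS; exact: (measurableT_comp mgl (measurable_pair1 x)).
apply: leeD.
  by rewrite le_eqVlt; apply/orP; left; apply/eqP; apply: eq_integral => w _; rewrite expr0 scale1r.
apply: le_trans (integral_nint_le x r0 mg g0).
rewrite le_eqVlt; apply/orP; left; apply/eqP.
(* Tonelli: the average over directions of integrals along segments becomes an integral over [t] of
   averages at scale [t]. *)
pose K (z : X * measurableTypeR R) := ((fun z : X * measurableTypeR R => g (x + z.2 *: z.1)%R) \_ (fst @^-1` nball r `&` snd @^-1` seg 1)) z.
have mK : measurable_fun setT K.
  apply: measurable_restr.
    apply: measurableI; rewrite -[X in measurable X]setTI.
      by apply: measurable_fst => //; exact: measurable_nball.
    by apply: measurable_snd => //; exact: measurable_seg.
  apply: (measurableT_comp mg); apply/measurable_fun_rVP => i.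
  rewrite (_ : _ \o _ = fun z : X * measurableTypeR R => x ord0 i + z.2 * z.1 ord0 i)%R; last first.
    by apply/funext => zt /=; rewrite /rV_coord !mxE.
  apply: measurable_funD => //; apply: measurable_funM => //.
  exact: measurableT_comp (@measurable_rV_coord _ R n i) measurable_fst.
have K0 (y : X * measurableTypeR R) : 0 <= K y by rewrite /K patchE; case: ifP.
have inK w t : ((w, t) \in fst @^-1` nball r `&` snd @^-1` seg 1) = (w \in nball r) && (t \in seg 1).
  by apply/idP/andP; rewrite !inE.
transitivity (\int[mu]_w \int[leb]_t K (w, t)).
  rewrite integral_mkcond; apply: eq_integral => w _; rewrite patchE; case: ifPn => wr; last first.
    by rewrite integral0_eq// => t _; rewrite /K patchE inK (negbTE wr).
  rewrite /gl integral_mkcond; apply: eq_integral => t _; rewrite /K !patchE inK wr /=.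
  by case: ifP.
have -> := fubini_tonelli (m1 := mu) (m2 := leb) K mK K0.
rewrite [RHS]integral_mkcond; apply: eq_integral => t _; rewrite patchE; case: ifPn => tr; last first.
  by rewrite integral0_eq// => w _; rewrite /K patchE inK (negbTE tr) andbF.
rewrite /nint [RHS]integral_mkcond; apply: eq_integral => w _; rewrite /K !patchE inK tr andbT.
by case: ifP.
Qed.

End pointwise.

End cone_estimate.

(** * Potentials of the derivatives of top order *)

Section jets.
Context {R : realType} {n : nat}.
Notation X := 'rV[R]_n.
Notation mu := (lebesgue_rV n).
Notation mindices := ('I_n -> nat).
Implicit Types (x y z u v w : X) (r s t q : R) (j k m : nat) (b : mindices).
Implicit Types (Omega : set X) (D : mindices -> X -> R).
Local Open Scope ereal_scope.

Definition weak_jet m Omega D : Prop :=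
  [/\ forall b, (mlength b <= m)%N -> locint (D b),
      forall b i, (mlength b < m)%N -> dir_weak_deriv Omega (delta_mx ord0 i) (D b) (D (incr b i)) &
      forall b x, (mlength b <= m)%N -> ~ Omega x -> D b x = 0%R].

(** The index type depends on [m] and not on [i], so that sums of different orders range over one
    finite type. *)
Definition jet_sum m D (i : nat) x : \bar R :=
  \sum_(b : {ffun 'I_n -> 'I_m.+1} | (mlength (mindex b) <= i)%N) `|D (mindex b) x|%:E.

Lemma le_mlength b i : (b i <= mlength b)%N.
Proof. by rewrite /mlength (bigD1 i)//= leq_addr. Qed.

Lemma mindex_surj m b : (mlength b <= m)%N -> exists c : {ffun 'I_n -> 'I_m.+1}, mindex c = b.
Proof.
move=> bm; exists [ffun i => inord (b i)]; apply/funext => i.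
by rewrite /mindex ffunE inordK// ltnS (leq_trans (le_mlength b i)).
Qed.

Lemma jet_sum_ge0 m D i x : 0 <= jet_sum m D i x.
Proof. by apply: sume_ge0 => b _; rewrite lee_fin. Qed.

Lemma le_jet_sum m D i b x : (i <= m)%N -> (mlength b <= i)%N -> `|D b x|%:E <= jet_sum m D i x.
Proof.
move=> im bi; have [c cE] := mindex_surj (leq_trans bi im).
by rewrite -cE /jet_sum (bigD1 c) ?cE//= leeDl//; apply: sume_ge0 => b' _; rewrite lee_fin.
Qed.

Lemma measurable_jet_sum m Omega D i : weak_jet m Omega D -> (i <= m)%N ->
  measurable_fun setT (jet_sum m D i).
Proof.
move=> [lD _ _] im.
rewrite (_ : jet_sum m D i = fun x => \sum_(b <- [seq b <- index_enum _ | (mlength (@mindex n m b) <= i)%N]) `|(if (mlength (mindex b) <= i)%N then D (mindex b) else cst 0%R) x|%:E); last first.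
  by apply/funext => x; rewrite big_filter /jet_sum; apply: eq_bigr => b ->.
apply: emeasurable_sum => b; apply/measurable_EFinP; apply: measurableT_comp => //.
by case: ifPn => // bi; apply: (lD _ (leq_trans bi im)).1.
Qed.

Section cone.
Variables (Omega : set X) (rho e : R) (m : nat).
Hypothesis oO : open Omega.
Hypothesis rho0 : (0 < rho)%R.
Hypothesis e0 : (0 < e)%R.
Hypothesis rhoe : (rho + e <= 1)%R.
Hypothesis cubes : forall x, Omega x -> exists2 z, (`|z| <= e)%R &
  forall y t, (`|y - z| < rho)%R -> (0 <= t <= 1)%R -> Omega (x + t *: y)%R.
Notation r := (rho + e)%R.

Let r0 : (0 < r)%R. Proof. by rewrite addr_gt0. Qed.

(** [cone_pointwise] for every derivative of order at most [i]; its zero-order term is the coarsest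
    average, which the potential contains. Outside [Omega] the jet vanishes. *)
Lemma jet_sum_base : exists2 C : R, (0 < C)%R & forall D, weak_jet m Omega D -> forall i, (i < m)%N ->
  {ae mu, forall x, jet_sum m D i x <= C%:E * pot 1 r (jet_sum m D i.+1) x}.
Proof.
pose c0 := ((rho *+ 2) ^+ n)%R; have c00 : (0 < c0)%R by rewrite exprn_gt0// pmulrn_lgt0.
pose c1 := (c0^-1 * (1 + 2 ^+ n * n%:R))%R.
have c10 : (0 < c1)%R by rewrite mulr_gt0 ?invr_gt0// ltr_wpDr// mulr_ge0// exprn_ge0.
pose N := #|{: {ffun 'I_n -> 'I_m.+1}}|.
exists (N.+1%:R * c1)%R; first by rewrite mulr_gt0.
move=> D jD i im; have [lD dD oD] := jD.
have mF := measurable_jet_sum jD im.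
set F := jet_sum m D i.+1 in mF *.
have F0 y : 0 <= F y by exact: jet_sum_ge0.
have P0 x : 0 <= pot 1 r F x by exact: pot_ge0.
have one b : (mlength b <= i)%N -> {ae mu, forall x, `|D b x|%:E <= c1%:E * pot 1 r F x}.
  move=> bi; have bm : (mlength b < m)%N by exact: leq_ltn_trans im.
  have lG a : locint (D (incr b a)) by apply: lD; rewrite mlength_incr.
  have := cone_pointwise oO rho0 e0 rhoe cubes (lD _ (ltnW bm)) lG (fun a => dD b a bm).
  apply: filterS => x Hx; have [Ox|nO] := pselect (Omega x); last first.
    by rewrite (oD _ _ (ltnW bm) nO) normr0 mule_ge0// lee_fin ltW.
  have mg : measurable_fun setT (fun y => \sum_a abse_fun (D (incr b a)) y).
    apply: emeasurable_sum => a; apply/measurable_EFinP; apply: measurableT_comp => //; exact: (lG a).1.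
  have gF y : \sum_a abse_fun (D (incr b a)) y <= n%:R%:E * F y.
    apply: (@le_trans _ _ (\sum_(a < n) F y)).
      by apply: lee_sum => a _; apply: le_jet_sum => //; rewrite mlength_incr.
    by rewrite sumr_const card_ord mule_natl.
  have g0 y : 0 <= \sum_a abse_fun (D (incr b a)) y by apply: sume_ge0 => a _; rewrite lee_fin.
  have e1 : avg r 0 (abse_fun (D b)) x <= pot 1 r F x.
    apply: le_trans (avg0_le_pot 1 r x F0).
    apply: le_nint => //; first by apply/measurable_EFinP; apply: measurableT_comp => //; exact: (lD _ (ltnW bm)).1.
    - by move=> y; rewrite lee_fin.
    - by move=> y; apply: le_jet_sum => //; rewrite (leq_trans bi).
  have e2 : pot 1 r (fun y => \sum_a abse_fun (D (incr b a)) y) x <= n%:R%:E * pot 1 r F x.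
    rewrite -potZ//; apply: le_pot => //; exact: measurable_funeM.
  have := Hx Ox; rewrite lebesgue_nball// -/c0 => H.
  have : c0%:E * `|D b x|%:E <= (1 + 2 ^+ n * n%:R)%:E * pot 1 r F x.
    apply: le_trans H _; rewrite EFinD ge0_muleDl ?lee_fin ?mulr_ge0 ?exprn_ge0// mul1e.
    by apply: leeD => //; rewrite EFinM -muleA lee_wpmul2l// lee_fin exprn_ge0.
  have ci : 0 <= c0^-1%:E by rewrite lee_fin invr_ge0 ltW.
  move=> /(lee_wpmul2l ci); rewrite !muleA -!EFinM mulVf ?gt_eqF// mul1r /c1; exact.
have all_one : {ae mu, forall x, forall c : {ffun 'I_n -> 'I_m.+1}, (mlength (mindex c) <= i)%N ->
    `|D (mindex c) x|%:E <= c1%:E * pot 1 r F x}.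
  apply: filter_forall => c; have [ci|nci] := boolP (mlength (mindex c) <= i)%N.
    by apply: filterS (one _ ci) => x.
  by apply: aeW => x.
apply: filterS all_one => x Hx; rewrite /jet_sum.
apply: (@le_trans _ _ (\sum_(c : {ffun 'I_n -> 'I_m.+1}) (c1%:E * pot 1 r F x))).
  rewrite [leLHS]big_mkcond; apply: lee_sum => c _; case: ifP => [/Hx//|_].
  by rewrite mule_ge0// lee_fin ltW.
rewrite (_ : \sum_(c : {ffun 'I_n -> 'I_m.+1}) _ = N%:R%:E * (c1%:E * pot 1 r F x)); last by rewrite sumr_const mule_natl.
have cP : 0 <= c1%:E * pot 1 r F x by rewrite mule_ge0// lee_fin ltW.
rewrite [in leRHS]EFinM -[leRHS]muleA; apply: (lee_wpmul2r cP).
by rewrite lee_fin ler_nat.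
Qed.

(** Each application of [jet_sum_base] raises the order of the potential by one, through [pot_pot],
    and its radius by [r]. *)
Lemma jet_sum_iter k : exists2 C : R, (0 < C)%R & forall D, weak_jet m Omega D -> forall i,
  (i + k.+1 <= m)%N ->
  {ae mu, forall x, jet_sum m D i x <= C%:E * pot k.+1 (k.+1%:R * r) (jet_sum m D (i + k.+1)) x}.
Proof.
have [C C0 HC] := jet_sum_base.
elim: k => [|k [C' C'0 IH]].
  by exists C => // D jD i; rewrite addn1 mul1r => im; exact: HC.
pose V := ((k.+2%:R * r *+ 2) ^+ n)%R.
have V0 : (0 < V)%R by rewrite exprn_gt0// pmulrn_lgt0// mulr_gt0.
exists (C' * C * (4 * V))%R; first by rewrite !mulr_gt0.
move=> D jD i im.
have im' : (i + k.+1 < m)%N by rewrite -addnS.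
have mF := measurable_jet_sum jD im.
have F0 y : 0 <= jet_sum m D (i + k.+2) y by exact: jet_sum_ge0.
have kr0 : (0 < k.+1%:R * r)%R by rewrite mulr_gt0.
have := HC D jD _ im'; rewrite -addnS => Hk.
apply: filterS (IH D jD i (ltnW im')) => x /le_trans; apply.
rewrite -!mulrA EFinM -muleA; apply: lee_wpmul2l; first by rewrite lee_fin ltW.
have m1 := measurable_pot 1 r mF F0.
apply: (@le_trans _ _ (pot k.+1 (k.+1%:R * r) (fun y => C%:E * pot 1 r (jet_sum m D (i + k.+2)) y) x)).
  apply: ae_le_pot => //.
  - exact: measurable_jet_sum jD (ltnW im').
  - exact: measurable_funeM.
  - by move=> y; exact: jet_sum_ge0.
  - by move=> y; apply: mule_ge0; [rewrite lee_fin ltW|exact: pot_ge0].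
rewrite potZ//; [|exact: ltW|by move=> y; exact: pot_ge0].
rewrite EFinM -muleA; apply: lee_wpmul2l; first by rewrite lee_fin ltW.
apply: le_trans (pot_pot x mF F0 _ kr0 r0) _ => //.
have -> : (k.+1%:R * r + r = k.+2%:R * r)%R by rewrite [in RHS]mulrS; ring.
rewrite lebesgue_nball ?mulr_gt0// EFinM muleA//.
Qed.

(** The constants of the finitely many orders are added up, and all radii are enlarged to
    [m%:R * r]. *)
Lemma jet_sum_pot : exists2 C : R, (0 < C)%R & forall D, weak_jet m Omega D -> forall i, (i < m)%N ->
  {ae mu, forall x, jet_sum m D i x <= C%:E * pot (m - i) (m%:R * r) (jet_sum m D m) x}.
Proof.
have H K : exists2 C : R, (0 < C)%R & forall k, (k < K)%N -> forall D, weak_jet m Omega D -> forall i,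
    (i + k.+1 <= m)%N ->
    {ae mu, forall x, jet_sum m D i x <= C%:E * pot k.+1 (k.+1%:R * r) (jet_sum m D (i + k.+1)) x}.
  elim: K => [|K [C C0 HC]]; first by exists 1%R.
  have [C' C'0 HC'] := jet_sum_iter K; exists (C + C')%R; first by rewrite addr_gt0.
  move=> k; rewrite ltnS leq_eqVlt => /predU1P[->|kK] D jD i im.
    apply: filterS (HC' D jD i im) => x /le_trans; apply; apply: lee_wpmul2r.
      by apply: pot_ge0 => y; exact: jet_sum_ge0.
    by rewrite lee_fin lerDr ltW.
  apply: filterS (HC k kK D jD i im) => x /le_trans; apply; apply: lee_wpmul2r.
    by apply: pot_ge0 => y; exact: jet_sum_ge0.
  by rewrite lee_fin lerDl ltW.
have [C C0 HC] := H m; exists C => // D jD i im.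
have [k kE] : exists k, (m - i = k.+1)%N by exists (m - i).-1; rewrite prednK// subn_gt0.
have mE : (i + k.+1 = m)%N by rewrite -kE subnKC// ltnW.
have km : (k < m)%N by rewrite -mE ltn_addl.
have le : (i + k.+1 <= m)%N by rewrite mE.
rewrite kE; apply: filterS (HC k km D jD i le) => x /le_trans; apply.
rewrite mE; apply: lee_wpmul2l; first by rewrite lee_fin ltW.
apply: pot_le_r; last by move=> y; exact: jet_sum_ge0.
  by apply: ler_wpM2r; [exact: ltW r0|rewrite ler_nat].
exact: measurable_jet_sum jD _.
Qed.

End cone.

End jets.

(** * The bilinear estimate *)

Section singular.
Context {R : realType} {n : nat}.
Notation X := 'rV[R]_n.
Notation mu := (lebesgue_rV n).
Implicit Types (x y z u v w : X) (r s t q b : R) (j k : nat).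
Local Open Scope ereal_scope.

(* Equal to 0 at the origin when [b] is positive. *)
Definition riesz b y : R := ((`|y| `^ b)^-1)%R.

Lemma riesz_ge0 b y : (0 <= riesz b y)%R.
Proof. by rewrite invr_ge0 powR_ge0. Qed.

Lemma measurable_norm_rV : measurable_fun setT (fun x : X => `|x|%R).
Proof. by apply: continuous_measurable_rV => x; exact: norm_continuous. Qed.

Lemma measurable_riesz b : measurable_fun setT (riesz b).
Proof.
rewrite (_ : riesz b = fun y => `|y| `^ (- b))%R; last by apply/funext => y; rewrite powRN.
exact: measurableT_comp (measurable_powR _) measurable_norm_rV.
Qed.

Lemma exprn_powR (a b : R) k : (0 <= a)%R -> ((a ^+ k) `^ b = (a `^ b) ^+ k)%R.
Proof.
move=> a0; elim: k => [|k IH]; first by rewrite !expr0 powR1.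
by rewrite !exprS powRM ?exprn_ge0// IH.
Qed.

Lemma half_powR_lt1 (c : R) : (0 < c)%R -> (0 <= (2^-1 : R) `^ c < 1)%R.
Proof.
move=> c0; rewrite powR_ge0/= -[ltRHS](_ : (1 : R) `^ c = 1)%R; last by rewrite powR1.
by apply: gt0_ltr_powR => //; rewrite ?nnegrE//; lra.
Qed.

Lemma rieszZ b (c : R) y : (0 <= c)%R -> riesz b (c *: y) = ((c `^ b)^-1 * riesz b y)%R.
Proof. by move=> c0; rewrite /riesz normrZ ger0_norm// powRM// invfM. Qed.

Lemma riesz_le b y t : (0 <= b)%R -> (0 < t)%R -> (t <= `|y|)%R -> (riesz b y <= (t `^ b)^-1)%R.
Proof.
move=> b0 t0 ty; rewrite /riesz lef_pV2 ?posrE ?powR_gt0//; last exact: lt_le_trans ty.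
by apply: ge0_ler_powR; rewrite ?nnegrE// ltW.
Qed.

(** Dyadic shells: the value [2 ^ (j b)] against the volume [2 ^ (- j n)] gives a geometric series
    exactly for [b < n]. *)
Lemma riesz_integral b r : (0 < n)%N -> (0 <= b)%R -> (b < n%:R)%R -> (0 < r)%R ->
  \int[mu]_(w in nball r) (riesz b w)%:E < +oo.
Proof.
move=> n0 b0 bn r0.
pose c j := ((2^-1 ^+ j.+1 * r) `^ b)^-1%R.
have h0 j : (0 < 2^-1 ^+ j * r :> R)%R by rewrite mulr_gt0// half_gt0.
have c0 j : (0 <= c j)%R by rewrite invr_ge0 powR_ge0.
pose B j : set X := nball (2^-1 ^+ j * r)%R.
have mB j : measurable (B j) by exact: measurable_nball.
have t0 j w : 0 <= (c j * \1_(B j) w)%:E by rewrite lee_fin mulr_ge0.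
apply: (@le_lt_trans _ _ (\int[mu]_w (\sum_(0 <= j <oo) (c j * \1_(B j) w)%:E))).
  rewrite integral_mkcond; apply: ge0_le_integral => //.
  - by move=> w _; rewrite patchE; case: ifP => // _; rewrite lee_fin riesz_ge0.
  - apply: measurable_restr; first exact: measurable_nball.
    by apply/measurable_EFinP; exact: measurable_riesz.
  - apply: measurable_nneseries => // j; apply/measurable_EFinP; exact: measurable_funM.
  - move=> w _; rewrite patchE; case: ifPn => [/set_mem wr|_]; last by apply: nneseries_ge0 => j *; exact: t0.
    (* At the origin [riesz] equals 1 or 0, according to whether [b] vanishes; the first term
       suffices. *)
    have [w0|w0] := eqVneq w 0%R.
      have := nneseries_lim_ge (m := 0) 1 (u_ := fun j => (c j * \1_(B j) w)%:E) (P := predT) (fun j _ _ => t0 j w).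
      apply: le_trans; rewrite big_nat1 indicE mem_set; last by rewrite /B /nball /= w0 normr0.
      rewrite mulr1 lee_fin w0 /riesz normr0 /c expr1.
      have [->|bn0] := eqVneq b 0%R; first by rewrite !powRr0.
      by rewrite powR0// invr0 invr_ge0 powR_ge0.
    have wn : (0 < `|w| / r)%R by rewrite divr_gt0// normr_gt0.
    have ex : exists k, (2^-1 ^+ k <= `|w| / r)%R.
      exists (Num.truncn (`|w| / r)^-1).+1; rewrite exprVn invf_ple ?posrE ?exprn_gt0//.
      apply: le_trans (ltW (truncnS_gt _)) _; rewrite -natrX ler_nat ltnW//; exact: ltn_expl.
    have [k wk kmin] := ex_minnP ex.
    case: k wk kmin => [|k] wk kmin.
      by move: wk; rewrite expr0 ler_pdivlMr// mul1r leNgt; move: wr; rewrite /nball /= => ->.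
    have wk' : (`|w| / r < 2^-1 ^+ k)%R by rewrite ltNge; apply/negP => /kmin; rewrite ltnn.
    have := nneseries_lim_ge (m := 0) k.+1 (u_ := fun j => (c j * \1_(B j) w)%:E) (P := predT) (fun j _ _ => t0 j w).
    apply: le_trans; rewrite big_nat_recr//= -[leLHS]add0e; apply: leeD; first by apply: sume_ge0 => j _; exact: t0.
    have -> : \1_(B k) w = 1%R :> R.
      by rewrite indicE mem_set// /B /nball /= -ltr_pdivrMr.
    rewrite mulr1 lee_fin; apply: riesz_le => //.
    by rewrite -ler_pdivlMr.
rewrite integral_nneseries//; last first.
  by move=> j; apply/measurable_EFinP; apply: measurable_funM => //.
pose K := (((2^-1 * r) `^ b)^-1 * (r *+ 2) ^+ n)%R.
pose q := (2^-1 `^ (n%:R - b))%R.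
have q01 : (0 <= q < 1)%R by apply: half_powR_lt1; rewrite subr_gt0.
have E j : \int[mu]_w (c j * \1_(B j) w)%:E = K%:E * (q ^+ j)%:E.
  under eq_integral do rewrite EFinM.
  rewrite ge0_integralZl_EFin//; last by apply/measurable_EFinP.
  have -> : \int[mu]_x (\1_(B j) x)%:E = ((2^-1 ^+ j * r *+ 2) ^+ n)%:E.
    by rewrite integral_indic// setIT; exact: lebesgue_nball.
  rewrite -!EFinM; congr EFin; rewrite /c /K /q.
  rewrite powRB; last by apply/implyP => _; rewrite invr_eq0.
  rewrite powR_mulrn ?invr_ge0// exprMn exprVn -!exprVn exprSr -mulrA powRM; last 2 first.
  - by rewrite exprn_ge0// invr_ge0.
  - by rewrite mulr_ge0 ?invr_ge0// ltW.
  rewrite exprn_powR ?invr_ge0// -!mulrnAr exprMn exprAC invfM.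
  by rewrite !exprVn; ring.
under eq_eseriesr do rewrite E.
rewrite nneseriesZl => [|j _]; last by rewrite lee_fin exprn_ge0//; have /andP[] := q01.
by rewrite nneseries_geometric// -EFinM ltry.
Qed.

(** The two bounds serve the two factors of a product: the one by the scale at the coarser scale,
    the one by [|x|] at the finer. *)
Lemma riesz_nint b r : (0 < n)%N -> (0 <= b)%R -> (b < n%:R)%R -> (0 < r)%R ->
  exists2 C : R, (0 < C)%R & forall s x, (0 < s)%R ->
    nint s r (EFin \o riesz b) x <= (C * (s `^ b)^-1)%:E /\
    (x != 0%R -> nint s r (EFin \o riesz b) x <= (C * (`|x| `^ b)^-1)%:E).
Proof.
move=> n0 b0 bn r0.
set I0 := \int[mu]_(w in nball r) (riesz b w)%:E.
have I0oo : I0 < +oo by exact: riesz_integral.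
have I00 : 0 <= I0 by apply: integral_ge0 => w _; rewrite lee_fin riesz_ge0.
have I0f : I0 \is a fin_num by rewrite ge0_fin_numE.
pose V := ((r *+ 2) ^+ n)%R.
have V0 : (0 < V)%R by rewrite exprn_gt0// pmulrn_lgt0.
pose C1 := (fine I0 + (r `^ b)^-1 * V)%R.
have C10 : (0 < C1)%R.
  by rewrite /C1 ltr_wpDl ?fine_ge0// mulr_gt0// invr_gt0 powR_gt0.
have mr := measurable_riesz b.
have mB : measurable (nball r : set X) by exact: measurable_nball.
have P1 s x : (0 < s)%R -> nint s r (EFin \o riesz b) x <= (C1 * (s `^ b)^-1)%:E.
  (* By homogeneity the estimate reduces to unit scale, with centre [a]. *)
  move=> s0; pose a := (s^-1 *: x)%R.
  have -> : nint s r (EFin \o riesz b) x = ((s `^ b)^-1)%:E * \int[mu]_(w in nball r) (riesz b (a + w))%:E.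
    rewrite -ge0_integralZl_EFin//.
    - apply: eq_integral => w _ /=.
      have -> : (x + s *: w = s *: (a + w))%R by rewrite scalerDr scalerA divff ?gt_eqF// scale1r.
      by rewrite (rieszZ b (a + w) (ltW s0)) EFinM.
    - by move=> w _; rewrite lee_fin riesz_ge0.
    - apply: measurable_funTS; apply/measurable_EFinP; exact: measurableT_comp mr (measurable_shift a).
    - by rewrite invr_ge0 powR_ge0.
  rewrite mulrC EFinM; apply: lee_wpmul2l; first by rewrite lee_fin invr_ge0 powR_ge0.
  pose F1 := (EFin \o riesz b) \_ (nball r).
  have mF1 : measurable_fun setT F1 by apply: measurable_restr => //; exact/measurable_EFinP.
  have F10 w : 0 <= F1 w by rewrite /F1 patchE; case: ifP => // _; rewrite lee_fin riesz_ge0.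
  have mI : measurable_fun setT (fun w : X => (\1_(nball r) w)%:E : \bar R) by apply/measurable_EFinP.
  (* Within distance [r] of the origin the singular integral is used, elsewhere the kernel is at
     most [r ^ (- b)]. *)
  apply: (@le_trans _ _ (\int[mu]_w (F1 (a + w)%R + ((r `^ b)^-1)%:E * (\1_(nball r) w)%:E))).
    rewrite integral_mkcond; apply: ge0_le_integral; first exact: measurableT.
    - by move=> w _; rewrite patchE; case: ifP => // _; rewrite lee_fin riesz_ge0.
    - by apply: measurable_restr => //; apply/measurable_EFinP; exact: measurableT_comp mr (measurable_shift a).
    - apply: emeasurable_funD; first exact: measurableT_comp mF1 (measurable_shift a).
      exact: measurable_funeM.
    - move=> w _; rewrite patchE; case: ifPn => wr; last first.
        by apply: adde_ge0 => //; rewrite mule_ge0// lee_fin// invr_ge0 powR_ge0.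
      rewrite indicE wr mule1 /F1 patchE; case: ifPn => awr /=.
        by rewrite leeDl// lee_fin invr_ge0 powR_ge0.
      rewrite add0e lee_fin; apply: riesz_le => //; rewrite leNgt.
      by apply: contra awr => h; rewrite inE.
  rewrite ge0_integralD; last 5 first.
  - exact: measurableT.
  - by move=> w _; exact: F10.
  - exact: measurableT_comp mF1 (measurable_shift a).
  - by move=> w _; rewrite mule_ge0// lee_fin// invr_ge0 powR_ge0.
  - exact: measurable_funeM.
  rewrite (ge0_integral_shift a mF1 F10) ge0_integralZl_EFin//; last by rewrite invr_ge0 powR_ge0.
  rewrite integral_indic// setIT [X in _ + _ * X](_ : _ = V%:E); last exact: lebesgue_nball.
  by rewrite -integral_mkcond -/I0 /C1 EFinD fineK// EFinM.
pose C := (C1 + C1 * (2 * r) `^ b + 2 `^ b * V)%R.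
have b2 : (0 <= C1 * (2 * r) `^ b)%R by rewrite mulr_ge0 ?powR_ge0// ltW.
have b3 : (0 <= 2 `^ b * V)%R by rewrite mulr_ge0 ?powR_ge0// ltW.
exists C; first by rewrite /C -addrA ltr_wpDr// addr_ge0.
move=> s x s0; split.
  apply: le_trans (P1 s x s0) _; rewrite lee_fin ler_wpM2r ?invr_ge0 ?powR_ge0//.
  by rewrite /C -addrA lerDl addr_ge0.
move=> x0; have nx : (0 < `|x|)%R by rewrite normr_gt0.
have nxb : (0 < `|x| `^ b)%R by rewrite powR_gt0.
(* If [|x| < 2 s r], the first bound is already as good; otherwise the whole ball stays at distance
   [|x| / 2] from the origin. *)
have [le|gt] := leP (2 * (s * r))%R `|x|%R; last first.
  apply: le_trans (P1 s x s0) _; rewrite lee_fin.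
  apply: (@le_trans _ _ (C1 * (2 * r) `^ b * (`|x| `^ b)^-1))%R; last first.
    rewrite ler_wpM2r ?invr_ge0 ?powR_ge0//; rewrite /C -addrA addrCA; rewrite lerDl addr_ge0// ltW//.
  rewrite -mulrA; apply: ler_wpM2l; first exact: ltW.
  rewrite ler_pdivlMr// mulrC ler_pdivrMr ?powR_gt0//.
  rewrite -powRM; [|by apply: mulr_ge0 => //; exact: ltW|exact: ltW].
  apply: ge0_ler_powR => //; rewrite ?nnegrE.
  - exact: normr_ge0.
  - by do 2 (apply: mulr_ge0; last exact: ltW).
  - by move: (ltW gt); rewrite -mulrA [(r * s)%R]mulrC.
apply: (@le_trans _ _ (\int[mu]_(w in nball r) (((`|x| / 2) `^ b)^-1)%:E)).
  apply: ge0_le_integral => //.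
  - by move=> w _; rewrite lee_fin riesz_ge0.
  - by apply: measurable_funTS; apply/measurable_EFinP; exact: measurableT_comp mr (measurable_affine2 x s).
  - move=> w wr; rewrite lee_fin; apply: riesz_le => //; first by rewrite divr_gt0.
    have : (`|x| <= `|x + s *: w| + `|s *: w|)%R by rewrite -{1}[x](addrK (s *: w)) ler_normB.
    rewrite normrZ gtr0_norm//; move: wr; rewrite /nball /= => wr.
    have : (s * `|w| <= s * r)%R by rewrite ler_wpM2l ?ltW.
    move: le; move: (s * r)%R (s * `|w|)%R `|x|%R (`|x + s *: w|)%R => A B Y Z; clear; lra.
rewrite integral_cst//= [X in _ * X](_ : _ = V%:E); last exact: lebesgue_nball.
rewrite -EFinM lee_fin powRM ?invr_ge0//.
apply: (@le_trans _ _ (2 `^ b * V * (`|x| `^ b)^-1))%R; last first.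
  by rewrite ler_wpM2r ?invr_ge0 ?powR_ge0// /C lerDr addr_ge0// ltW.
rewrite le_eqVlt; apply/orP; left; apply/eqP; rewrite invfM.
have h : (2^-1 `^ b * 2 `^ b = 1 :> R)%R by rewrite -powRM ?invr_ge0// mulVf// powR1.
have -> : ((2^-1 `^ b)^-1 = 2 `^ b :> R)%R.
  have hx : (2^-1 `^ b : R)%R != 0%R by rewrite gt_eqF// powR_gt0// invr_gt0.
  by apply: (mulfI hx); rewrite h mulfV.
ring.
Qed.

Lemma null_point (z : X) : (0 < n)%N -> mu [set z] = 0.
Proof.
case: n z => // k z _.
rewrite (_ : [set z] = [set v | forall i, [set z ord0 i] (v ord0 i)]); last first.
  by apply/seteqP; split => [v ->//|v vz] /=; apply/rowP.
rewrite (lebesgue_rV_box (A := fun i => [set z ord0 i])); last by move=> i; exact: measurable_set1.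
rewrite big_ord_recl; apply/eqP; rewrite mule_eq0; apply/orP; left; apply/eqP.
exact: lebesgue_measure_set1.
Qed.

Section holder.
Variables (p beta r : R).
Hypothesis n0 : (0 < n)%N.
Hypothesis p1 : (1 < p)%R.
Hypothesis beta0 : (0 <= beta)%R.
Hypothesis r0 : (0 < r)%R.
Notation p' := (p / (p - 1))%R.
Hypothesis betan : (beta * p' < n%:R)%R.

Let p0 : (0 < p)%R. Proof. exact: lt_trans p1. Qed.
Let p'0 : (0 < p')%R. Proof. by rewrite divr_gt0// subr_gt0. Qed.
Let pp' : (p^-1 + p'^-1 = 1)%R.
Proof. by rewrite invf_div; field; rewrite gt_eqF. Qed.

Definition weighted (F : X -> R) y : R := ((F y * `|y| `^ beta) `^ p)%R.

Lemma weighted_ge0 F y : (0 <= weighted F y)%R. Proof. exact: powR_ge0. Qed.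

Lemma measurable_weighted F : measurable_fun setT F -> measurable_fun setT (weighted F).
Proof.
move=> mF; apply: (measurableT_comp (measurable_powR p)); apply: measurable_funM => //.
exact: measurableT_comp (measurable_powR beta) measurable_norm_rV.
Qed.

(** [F] is written as [(F |y| ^ beta)] times [riesz beta]; this fails at most at the origin, a null
    set since [0 < n]. *)
Lemma nint_holder (F : X -> R) s x : measurable_fun setT F -> (forall y, (0 <= F y)%R) -> (0 < s)%R ->
  nint s r (EFin \o F) x <=
  nint s r (EFin \o weighted F) x `^ p^-1 * nint s r (EFin \o riesz (beta * p')) x `^ p'^-1.
Proof.
move=> mF F0 s0.
pose i w : R := \1_(nball r) w.
have mi : measurable_fun setT i by apply: measurable_indic; exact: measurable_nball.
pose f w := (F (x + s *: w) * `|x + s *: w| `^ beta * i w)%R.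
pose g w := (riesz beta (x + s *: w) * i w)%R.
have ma := measurable_affine2 x s.
have mf : measurable_fun setT f.
  apply: measurable_funM => //; apply: measurable_funM; first exact: measurableT_comp mF ma.
  exact: measurableT_comp (measurable_powR beta) (measurableT_comp measurable_norm_rV ma).
have mg : measurable_fun setT g by apply: measurable_funM => //; exact: measurableT_comp (measurable_riesz beta) ma.
have f0 w : (0 <= f w)%R by rewrite !mulr_ge0// powR_ge0.
have g0 w : (0 <= g w)%R by rewrite mulr_ge0// riesz_ge0.
have := hoelder mu mf mg p0 p'0 pp'.
rewrite Lnorm1 !ge0_LnormE ?gt_eqF//.
congr (_ <= _ `^ _ * _ `^ _).
- rewrite /nint [RHS]integral_mkcond; apply: ae_eq_integral => //.
  + apply: measurableT_comp => //; apply/measurable_EFinP; exact: measurable_funM.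
  + apply: measurable_restr; first exact: measurable_nball.
    by apply/measurable_EFinP; exact: measurableT_comp mF ma.
  + exists [set (s^-1 *: - x)%R]; split; first exact: closed_measurable_rV (compact_closed (@norm_hausdorff _ _) (@compact_set1 _ _)).
    - exact: null_point.
    - move=> w /= nw; apply: contrapT => wz; apply: nw => _.
      have xw : (x + s *: w != 0)%R.
        apply/eqP => /eqP; rewrite addrC addr_eq0 => /eqP h; apply: wz.
        by rewrite -h scalerA mulVf ?gt_eqF// scale1r.
      rewrite patchE /f /g /i indicE; case: ifP => _; last by rewrite !mulr0 normr0.
      rewrite !mulr1 /riesz mulfK; first by rewrite /= ger0_norm.
      by rewrite powR_eq0 normr_eq0 (negbTE xw).
- rewrite /nint [RHS]integral_mkcond; apply: eq_integral => w _.
  rewrite patchE /= /f /i indicE; case: ifP => _; rewrite ?mulr1 ?mulr0//.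
  by rewrite powR0// gt_eqF.
- rewrite /nint [RHS]integral_mkcond; apply: eq_integral => w _.
  rewrite patchE /= /g /i indicE; case: ifP => _; rewrite ?mulr1 ?mulr0//.
    by rewrite /riesz -!powRN -powRrM mulNr.
  by rewrite powR0// gt_eqF.
Qed.

End holder.

End singular.

(** * Products of potentials in [L^p] *)

Section bilinear.
Context {R : realType} {n : nat}.
Notation X := 'rV[R]_n.
Notation mu := (lebesgue_rV n).
Implicit Types (x y z u v w : X) (s t q : R) (j k : nat).
Local Open Scope ereal_scope.
Implicit Types (H G : X -> \bar R).

Lemma half_powR_inv (b : R) : ((2^-1 `^ b)^-1 = 2 `^ b :> R)%R.
Proof.
have h : (2^-1 `^ b * 2 `^ b = 1 :> R)%R by rewrite -powRM ?invr_ge0// mulVf// powR1.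
have hx : (2^-1 `^ b : R)%R != 0%R by rewrite gt_eqF// powR_gt0// invr_gt0.
by apply: (mulfI hx); rewrite h mulfV.
Qed.

Section averages_L1.
Variable r : R.
Hypothesis r0 : (0 < r)%R.

Lemma avg_sup j H x : measurable_fun setT H -> (forall y, 0 <= H y) ->
  avg r j H x <= ((2 ^+ n) ^+ j)%:E * \int[mu]_y H y.
Proof.
move=> mH H0; set s := (2^-1 ^+ j : R)%R.
have s0 : (0 < s)%R by exact: half_gt0.
have sn : (0 < s ^+ n)%R by rewrite exprn_gt0.
have E : avg r j H x = (s ^+ n)^-1%:E * nint 1 (s * r) H x.
  by rewrite -(nint_scale mH H0 r x s0) muleA -EFinM mulVf ?mul1e// gt_eqF.
rewrite E /s -exprVn -exprVn invrK exprAC.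
apply: lee_wpmul2l; first by rewrite lee_fin !exprn_ge0.
rewrite -(ge0_integral_shift x mH H0) /nint.
apply: (@le_trans _ _ (\int[mu]_w H (x + 1 *: w)%R)).
  apply: ge0_subset_integral => //; first exact: measurable_nball.
  exact: measurable_shifted.
by under eq_integral do rewrite scale1r.
Qed.

Lemma avg_L1 j H : measurable_fun setT H -> (forall y, 0 <= H y) ->
  \int[mu]_x avg r j H x <= mu (nball r) * \int[mu]_y H y.
Proof.
move=> mH H0; set s := (2^-1 ^+ j : R)%R.
pose K (z : X * X) := ((fun z : X * X => H (z.1 + s *: z.2)%R) \_ (snd @^-1` nball r)) z.
have mK : measurable_fun setT K.
  apply: measurable_restr.
    by rewrite -[X in measurable X]setTI; apply: measurable_snd => //; exact: measurable_nball.
  exact: measurableT_comp mH (measurable_axpy s).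
have K0 (z : X * X) : 0 <= K z by rewrite /K patchE; case: ifP.
have inK x w : ((x, w) \in snd @^-1` nball r) = (w \in nball r) by apply/idP/idP; rewrite !inE.
have -> : \int[mu]_x avg r j H x = \int[mu]_x \int[mu]_w K (x, w).
  apply: eq_integral => x _; rewrite /avg /nint integral_mkcond; apply: eq_integral => w _.
  by rewrite /K !patchE inK.
have -> := fubini_tonelli (m1 := mu) (m2 := mu) K mK K0.
rewrite muleC -integral_cst; last exact: measurable_nball.
rewrite [leRHS]integral_mkcond; apply: ge0_le_integral => //.
- by move=> w _; exact: integral_ge0.
- exact: (measurable_fun_fubini_tonelli_G K mK).
- by apply: measurable_restr; [exact: measurable_nball|exact: measurable_cst].
- move=> w _; rewrite patchE; case: ifPn => wr; last first.
    by rewrite integral0_eq// => x _; rewrite /K patchE inK (negbTE wr).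
  rewrite -(ge0_integral_shift (s *: w) mH H0) le_eqVlt; apply/orP; left; apply/eqP.
  by apply: eq_integral => x _; rewrite /K patchE inK wr addrC.
Qed.

(* The factor with exponent [eta] interpolates between 1, from the total mass of
   the average at the finer scale, and its supremum times the measure of [E]. *)
Lemma avg_product (E : set X) (e eta : R) j k H G : measurable E -> (0 < e)%R -> mu E <= e%:E ->
  (0 <= eta <= 1)%R ->
  measurable_fun setT H -> measurable_fun setT G -> (forall y, 0 <= H y) -> (forall y, 0 <= G y) ->
  \int[mu]_(x in E) (avg r j H x * avg r k G x) <=
    ((1 + (r *+ 2) ^+ n) * (2 ^+ n) ^+ minn j k * (e * (2 ^+ n) ^+ maxn j k) `^ eta)%:E *
    (\int[mu]_y H y * \int[mu]_y G y).
Proof.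
move=> mE e0 Ee /andP[eta0 eta1] mH mG H0 G0.
set V := ((r *+ 2) ^+ n)%R; have V0 : (0 < V)%R by rewrite exprn_gt0// pmulrn_lgt0.
set N := (2 ^+ n : R)%R; have N0 : (0 < N)%R by rewrite exprn_gt0.
have Nj0 i : (0 <= N ^+ i)%R by rewrite exprn_ge0// ltW.
set U := \int[mu]_y H y; set W := \int[mu]_y G y.
have U0 : 0 <= U by exact: integral_ge0.
have W0 : 0 <= W by exact: integral_ge0.
have a0 j' H' x : (forall y, 0 <= H' y) -> 0 <= avg r j' H' x by move=> h; apply: nint_ge0.
have mA j' H' : measurable_fun setT H' -> measurable_fun setT (avg r j' H') by exact: measurable_avg.
have mu_r : mu (nball r) = V%:E by exact: lebesgue_nball.
(* One average is replaced by its supremum and the other by its total mass. The coarser one has the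
   smaller supremum, whence [minn]. *)
have one j' k' H' G' : measurable_fun setT H' -> measurable_fun setT G' ->
    (forall y, 0 <= H' y) -> (forall y, 0 <= G' y) ->
    \int[mu]_(x in E) (avg r j' H' x * avg r k' G' x) <= (N ^+ j' * V)%:E * (\int[mu]_y H' y * \int[mu]_y G' y).
  move=> mH' mG' H'0 G'0.
  have U'0 : 0 <= \int[mu]_y H' y by exact: integral_ge0.
  apply: (@le_trans _ _ (\int[mu]_x (((N ^+ j')%:E * \int[mu]_y H' y) * avg r k' G' x))).
    rewrite integral_mkcond; apply: ge0_le_integral => //.
    - by move=> x _; rewrite patchE; case: ifP => // _; apply: mule_ge0; exact: a0.
    - by apply: measurable_restr => //; apply: emeasurable_funM; exact: mA.
    - by apply: measurable_funeM; exact: mA.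
    - move=> x _; rewrite patchE; case: ifP => _.
        by apply: lee_wpmul2r; [exact: a0|exact: avg_sup].
      by rewrite !mule_ge0// ?lee_fin//; exact: a0.
  rewrite ge0_integralZl//; [|exact: mA|by move=> x _; exact: a0|by rewrite mule_ge0// lee_fin].
  apply: (@le_trans _ _ (((N ^+ j')%:E * \int[mu]_y H' y) * (V%:E * \int[mu]_y G' y))).
    by apply: lee_wpmul2l; [rewrite mule_ge0// lee_fin|rewrite -mu_r; exact: avg_L1].
  by rewrite EFinM -!muleA lee_wpmul2l ?lee_fin// muleCA.
have bnd_a : \int[mu]_(x in E) (avg r j H x * avg r k G x) <= (N ^+ minn j k * V)%:E * (U * W).
  case: (leqP j k) => jk; first exact: one.
  by under eq_integral do rewrite muleC; rewrite [U * W]muleC; exact: one.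
have bnd_b : \int[mu]_(x in E) (avg r j H x * avg r k G x) <= (e * N ^+ j * N ^+ k)%:E * (U * W).
  apply: (@le_trans _ _ (\int[mu]_(x in E) (((N ^+ j)%:E * U) * ((N ^+ k)%:E * W)))).
    apply: ge0_le_integral => //.
    - by move=> x _; apply: mule_ge0; exact: a0.
    - by apply: measurable_funTS; apply: emeasurable_funM; exact: mA.
    - by move=> x _; apply: lee_pmul; [exact: a0|exact: a0|exact: avg_sup|exact: avg_sup].
  rewrite integral_cst// muleC.
  apply: (@le_trans _ _ (e%:E * ((N ^+ j)%:E * U * ((N ^+ k)%:E * W)))).
    by apply: lee_wpmul2r => //; rewrite !mule_ge0// lee_fin.
  rewrite le_eqVlt; apply/orP; left; apply/eqP.
  by rewrite (muleACA (N ^+ j)%:E) -EFinM (muleA e%:E) -EFinM mulrA.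
have UW0 : 0 <= U * W by exact: mule_ge0.
set a := (e * N ^+ maxn j k)%R; have a00 : (0 < a)%R by rewrite mulr_gt0// exprn_gt0.
(* The two bounds differ by the factor [a] up to constants, and the minimum of 1 and [a] is at most
   [a ^ eta]. *)
have [ale|agt] := leP a 1%R.
  apply: le_trans bnd_b _; apply: lee_wpmul2r => //; rewrite lee_fin.
  have -> : (e * N ^+ j * N ^+ k = N ^+ minn j k * a)%R.
    rewrite /a -mulrA -exprD mulrCA -exprD; congr (_ * _ ^+ _)%R.
    by case: (leqP j k) => // _; rewrite addnC.
  apply: (@le_trans _ _ (N ^+ minn j k * a `^ eta)%R).
    by rewrite ler_wpM2l// ger1_powR// a00.
  by rewrite -mulrA ler_peMl ?mulr_ge0 ?powR_ge0// lerDl ltW.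
apply: le_trans bnd_a _; apply: lee_wpmul2r => //; rewrite lee_fin.
rewrite [leLHS]mulrC; apply: (@le_trans _ _ ((1 + V) * N ^+ minn j k)%R).
  by rewrite ler_wpM2r// lerDr.
apply: ler_peMr; first by apply: mulr_ge0 => //; apply: addr_ge0 => //; exact: ltW.
by rewrite -[X in (X <= _)%R](powRr0 a); apply: ler_powR => //; exact: ltW.
Qed.

End averages_L1.

Section weighted_averages.
Variables (p beta r : R).
Hypothesis n0 : (0 < n)%N.
Hypothesis p1 : (1 < p)%R.
Hypothesis beta0 : (0 <= beta)%R.
Hypothesis r0 : (0 < r)%R.
Hypothesis betan : (beta * (p / (p - 1)) < n%:R)%R.

Let p0 : (0 < p)%R. Proof. exact: lt_trans p1. Qed.

(** [riesz_nint] with exponent [beta * p'], raised to the power [1 / p'], controls the second factor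
    in [nint_holder]. *)
Lemma avg_weighted : exists2 C : R, (0 < C)%R & forall (F : X -> R) j x,
  measurable_fun setT F -> (forall y, (0 <= F y)%R) ->
  avg r j (EFin \o F) x <= (C * (2 `^ beta) ^+ j)%:E * avg r j (EFin \o weighted p beta F) x `^ p^-1 /\
  (forall t, (0 < t)%R -> (t <= `|x|)%R ->
    avg r j (EFin \o F) x <= (C * (t `^ beta)^-1)%:E * avg r j (EFin \o weighted p beta F) x `^ p^-1).
Proof.
have betan' := betan; set p' := (p / (p - 1))%R in betan'.
have p'0 : (0 < p')%R by rewrite divr_gt0// subr_gt0.
have b0 : (0 <= beta * p')%R by rewrite mulr_ge0// ltW.
have [C C0 HC] := riesz_nint n0 b0 betan' r0.
exists (C `^ p'^-1)%R; first exact: powR_gt0.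
move=> F j x mF F0; set s := (2^-1 ^+ j : R)%R; have s0 : (0 < s)%R by exact: half_gt0.
have HH := nint_holder beta r n0 p1 x mF F0 s0.
have [H1 H2] := HC s x s0.
have A0 : 0 <= avg r j (EFin \o weighted p beta F) x.
  by apply: nint_ge0 => y; rewrite lee_fin weighted_ge0.
have K0 : 0 <= nint s r (EFin \o riesz (beta * p')) x.
  by apply: nint_ge0 => y; rewrite lee_fin riesz_ge0.
have pw (a : R) : (0 <= a)%R -> ((C * (a `^ (beta * p'))^-1) `^ p'^-1 = C `^ p'^-1 * (a `^ beta)^-1)%R.
  move=> a0; rewrite powRM ?invr_ge0 ?powR_ge0 ?ltW//; congr (_ * _)%R.
  by rewrite -!powRN -powRrM mulNr mulrK// unitfE gt_eqF.
split=> [|t t0 tx].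
  apply: le_trans HH _; rewrite muleC; apply: lee_wpmul2r; first exact: poweR_ge0.
  rewrite -half_powR_inv exprVn -exprn_powR ?invr_ge0// -/s -pw; last exact: ltW.
  rewrite -poweR_EFin; by apply: ge0_le_poweR => //; rewrite invr_ge0 ltW.
have x0 : x != 0%R by rewrite -normr_gt0 (lt_le_trans t0).
apply: le_trans HH _; rewrite muleC; apply: lee_wpmul2r; first exact: poweR_ge0.
apply: (@le_trans _ _ (C `^ p'^-1 * (`|x| `^ beta)^-1)%:E).
  rewrite -pw// -poweR_EFin; apply: ge0_le_poweR => //; first by rewrite invr_ge0 ltW.
  exact: H2.
rewrite lee_fin ler_wpM2l ?powR_ge0//; exact: riesz_le.
Qed.

(** At scale [2 ^ (- j)] the weight costs [2 ^ (j beta)] and the supremum of the average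
    [2 ^ (j n / p)]; the order [m] leaves a convergent geometric series. *)
Lemma pot_sup m : (beta + n%:R / p < m%:R)%R -> exists2 C : R, (0 < C)%R & forall (F : X -> R) x,
  measurable_fun setT F -> (forall y, (0 <= F y)%R) ->
  pot m r (EFin \o F) x <= C%:E * (\int[mu]_y (weighted p beta F y)%:E) `^ p^-1.
Proof.
move=> gm; have [C C0 HC] := avg_weighted.
pose q := (2^-1 `^ (m%:R - (beta + n%:R / p)))%R.
have q01 : (0 <= q < 1)%R by apply: half_powR_lt1; rewrite subr_gt0.
have /andP[q0 q1] := q01.
exists (C * (1 - q)^-1)%R; first by rewrite mulr_gt0// invr_gt0 subr_gt0.
move=> F x mF F0; set U := \int[mu]_y _.
have mW : measurable_fun setT (EFin \o weighted p beta F).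
  by apply/measurable_EFinP; exact: measurable_weighted.
have W0 y : 0 <= (EFin \o weighted p beta F) y by rewrite lee_fin weighted_ge0.
have U0 : 0 <= U by apply: integral_ge0 => y _; exact: W0.
rewrite mulrC EFinM -muleA muleC -(nneseries_geometric q01) -ge0_nneseriesZl; last 2 first.
- by rewrite mule_ge0 ?poweR_ge0// lee_fin ltW.
- by move=> j; rewrite lee_fin exprn_ge0.
apply: lee_nneseries => j _.
  by move=> _; rewrite mule_ge0 ?lee_fin ?exprn_ge0 ?invr_ge0//; apply: nint_ge0 => y; rewrite lee_fin.
have [H1 _] := HC F j x mF F0.
apply: (@le_trans _ _ (((2^-1 ^+ m) ^+ j)%:E * ((C * (2 `^ beta) ^+ j)%:E * (((2 ^+ n) ^+ j)%:E * U) `^ p^-1))).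
  apply: lee_wpmul2l; first by rewrite lee_fin !exprn_ge0// invr_ge0.
  apply: le_trans H1 _; apply: lee_wpmul2l; first by rewrite lee_fin mulr_ge0 ?exprn_ge0 ?powR_ge0// ltW.
  apply: ge0_le_poweR; first by rewrite invr_ge0 ltW.
    by apply: nint_ge0.
  exact: avg_sup.
rewrite poweRM ?lee_fin ?exprn_ge0// poweR_EFin !muleA -!EFinM [leRHS]muleC muleA -EFinM.
apply: lee_wpmul2r; first exact: poweR_ge0.
rewrite lee_fin le_eqVlt; apply/orP; left; apply/eqP.
have -> : (((2 ^+ n) ^+ j) `^ p^-1 = (2 `^ (n%:R / p)) ^+ j :> R)%R.
  by rewrite exprn_powR ?exprn_ge0// -[(2 ^+ n)%R]powR_mulrn// -powRrM.
rewrite /q powRB; last by apply/implyP => _; rewrite invr_eq0.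
rewrite powR_mulrn ?invr_ge0// half_powR_inv powRD; last by apply/implyP.
by rewrite !exprMn; ring.
Qed.

(** With [c = g / m < 1], the loss [g min (i, j)] is at most the fraction [c] of the gain
    [k i + l j], because [m <= k + l]. The fraction [1 - c] that remains is at least
    [(1 - c) (i + j)], as [k] and [l] are positive. *)
Lemma kernel_exponent m k l i j (g d : R) : (0 < m)%N -> (0 < k)%N -> (0 < l)%N -> (m <= k + l)%N ->
  (0 <= g)%R -> (g < m%:R)%R -> (0 <= d)%R ->
  ((2^-1 ^+ k) ^+ i * (2^-1 ^+ l) ^+ j * (2 `^ g) ^+ minn i j * (2 `^ d) ^+ maxn i j <=
   (2^-1 `^ (1 - g / m%:R - d)) ^+ i * (2^-1 `^ (1 - g / m%:R - d)) ^+ j :> R)%R.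
Proof.
move=> m0 k0 l0 kl g0 gm d0; set a := (1 - g / m%:R - d)%R.
have h2 (c : R) : (2^-1 `^ c = 2 `^ (- c) :> R)%R.
  by rewrite powRN -half_powR_inv invrK.
have e1 (c : nat) i' : ((2^-1 ^+ c) ^+ i' = 2 `^ (- (c%:R * i'%:R)) :> R)%R.
  by rewrite -exprM -[LHS]powR_mulrn ?invr_ge0// h2 natrM.
have e2 (c : R) i' : ((2 `^ c) ^+ i' = 2 `^ (c * i'%:R) :> R)%R.
  by rewrite -powR_mulrn ?powR_ge0// powRrM.
have D (x y : R) : (2 `^ x * 2 `^ y = 2 `^ (x + y) :> R)%R.
  by rewrite powRD//; apply/implyP.
rewrite !e1 !h2 !e2 !D; apply: ler_powR; first by rewrite ler1n.
have mR : (0 < m%:R :> R)%R by rewrite ltr0n.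
set mn := minn i j; set mx := maxn i j.
have hi : (mn%:R <= i%:R :> R)%R by rewrite ler_nat geq_minl.
have hj : (mn%:R <= j%:R :> R)%R by rewrite ler_nat geq_minr.
have hx : (mx%:R <= i%:R + j%:R :> R)%R by rewrite -natrD ler_nat geq_max leq_addr leq_addl.
have hk : (1 <= k%:R :> R)%R by rewrite ler1n.
have hl : (1 <= l%:R :> R)%R by rewrite ler1n.
have hkl : (m%:R <= k%:R + l%:R :> R)%R by rewrite -natrD ler_nat.
have hd : (d * mx%:R <= d * (i%:R + j%:R))%R by rewrite ler_wpM2l.
set c := (g / m%:R)%R.
have c0 : (0 <= c)%R by rewrite divr_ge0// ltW.
have c1 : (c < 1)%R by rewrite /c ltr_pdivrMr// mul1r.
have gE : (g = c * m%:R)%R by rewrite /c divfK// gt_eqF.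
rewrite /a -/c gE.
have i0 : (0 <= mn%:R :> R)%R by [].
move: hi hj hk hl hkl hd i0 c0 c1 mR; clear.
move: (mn%:R)%R (mx%:R)%R (i%:R)%R (j%:R)%R (k%:R)%R (l%:R)%R (m%:R)%R => M X' I J K L m0.
move=> hi hj hk hl hkl hd i0 c0 c1 mR.
have h1 : (c * m0 * M <= c * (K * I + L * J))%R.
  rewrite -mulrA ler_wpM2l//; apply: (@le_trans _ _ ((K + L) * M)%R); first by rewrite ler_wpM2r.
  by rewrite mulrDl lerD// ler_wpM2l//; lra.
have h2 : ((1 - c) * (I + J) <= (1 - c) * (K * I + L * J))%R.
  apply: ler_wpM2l; first lra.
  by apply: lerD; apply: ler_peMl => //; lra.
lra.
Qed.

Lemma lee_scaled_pmul (c a b : R) (x1 x2 y1 y2 : \bar R) : (0 <= c)%R -> (0 <= a)%R -> (0 <= b)%R ->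
  0 <= x1 -> 0 <= x2 -> 0 <= y1 -> 0 <= y2 -> x1 <= a%:E * y1 -> x2 <= b%:E * y2 ->
  c%:E * (x1 * x2) <= (c * (a * b))%:E * (y1 * y2).
Proof.
move=> c0 a0 b0 x10 x20 y10 y20 h h'; rewrite EFinM -muleA; apply: lee_wpmul2l; first by rewrite lee_fin.
by rewrite EFinM muleACA; apply: lee_pmul.
Qed.

(** Minkowski over the double series of scales, with each product of averages estimated by
    [avg_product] after Hoelder. The last hypothesis is what makes the common ratio [T] less than
    1. *)
Lemma pot_bilinear m (eta : R) : (0 < m)%N -> (beta + n%:R / p < m%:R)%R -> (0 <= eta <= 1)%R ->
  (eta * (n%:R / p) + (beta + n%:R / p) / m%:R < 1)%R ->
  exists2 C : R, (0 < C)%R & forall k l (F G : X -> R) (E : set X) (e s : R),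
    (0 < k)%N -> (0 < l)%N -> (m <= k + l)%N ->
    measurable_fun setT F -> measurable_fun setT G ->
    (forall y, (0 <= F y)%R) -> (forall y, (0 <= G y)%R) ->
    measurable E -> (0 < e)%R -> mu E <= e%:E -> (0 < s)%R ->
    (forall x, E x -> (s <= `|x|)%R) \/ beta = 0%R ->
    'N[mu]_p%:E[(fun x => pot k r (EFin \o F) x * pot l r (EFin \o G) x) \_ E] <=
    (C * ((s `^ beta)^-1 * e `^ (eta / p)))%:E *
    ((\int[mu]_y (weighted p beta F y)%:E) `^ p^-1 * (\int[mu]_y (weighted p beta G y)%:E) `^ p^-1).
Proof.
move=> m0 gm eta01 h1; have [C C0 HC] := avg_weighted.
have /andP[eta0 eta1] := eta01.
set g := (beta + n%:R / p)%R in gm h1; set d := (eta * (n%:R / p))%R in h1.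
have np0 : (0 <= n%:R / p)%R by rewrite divr_ge0// ltW.
have g0 : (0 <= g)%R by rewrite addr_ge0.
have d0 : (0 <= d)%R by rewrite mulr_ge0.
pose T := (2^-1 `^ (1 - g / m%:R - d) : R)%R.
have T01 : (0 <= T < 1)%R by apply: half_powR_lt1; lra.
have /andP[T0 T1] := T01.
set V := (1 + (r *+ 2) ^+ n)%R.
have V0 : (0 < V)%R by rewrite addr_gt0// exprn_gt0// pmulrn_lgt0.
have p0' : (0 <= p^-1)%R by rewrite invr_ge0 ltW.
have one_T : (0 < (1 - T)^-1)%R by rewrite invr_gt0 subr_gt0.
exists (C * C * V `^ p^-1 * ((1 - T)^-1 * (1 - T)^-1))%R.
  by rewrite !mulr_gt0// powR_gt0.
move=> k l F G E e s k0 l0 kl mF mG F0 G0 mE e0 Ee s0 Es.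
set U := (\int[mu]_y (weighted p beta F y)%:E) `^ p^-1.
set W := (\int[mu]_y (weighted p beta G y)%:E) `^ p^-1.
have UW0 : 0 <= U * W by rewrite mule_ge0 ?poweR_ge0.
have mwF : measurable_fun setT (EFin \o weighted p beta F).
  by apply/measurable_EFinP; exact: measurable_weighted.
have mwG : measurable_fun setT (EFin \o weighted p beta G).
  by apply/measurable_EFinP; exact: measurable_weighted.
have wF0 y : 0 <= (EFin \o weighted p beta F) y by rewrite lee_fin weighted_ge0.
have wG0 y : 0 <= (EFin \o weighted p beta G) y by rewrite lee_fin weighted_ge0.
have aw0 j H x : (forall y, 0 <= H y) -> 0 <= avg r j H x by move=> h; apply: nint_ge0.
have mEF (f : X -> R) : measurable_fun setT f -> measurable_fun setT (EFin \o f).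
  by move=> mf; apply/measurable_EFinP.
have F0' y : 0 <= (EFin \o F) y by rewrite lee_fin.
have G0' y : 0 <= (EFin \o G) y by rewrite lee_fin.
have sb0 : (0 < (s `^ beta)^-1)%R by rewrite invr_gt0 powR_gt0.
have [c cE] : {c : nat -> nat -> R | c = fun i j => ((2^-1 ^+ k) ^+ i * (2^-1 ^+ l) ^+ j)%R} by exists (fun i j => ((2^-1 ^+ k) ^+ i * (2^-1 ^+ l) ^+ j)%R).
have c0 i j : (0 <= c i j)%R by rewrite cE mulr_ge0// !exprn_ge0// invr_ge0.
have B0 i : (0 <= (2 `^ beta : R) ^+ i)%R by rewrite exprn_ge0// powR_ge0.
pose A i j x := avg r i (EFin \o weighted p beta F) x * avg r j (EFin \o weighted p beta G) x.
have A0 i j x : 0 <= A i j x by rewrite mule_ge0// aw0.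
pose f i j := (fun x => (c i j)%:E * (avg r i (EFin \o F) x * avg r j (EFin \o G) x)) \_ E.
have f0 i j x : 0 <= f i j x.
  by rewrite /f patchE; case: ifP => // _; rewrite !mule_ge0 ?lee_fin// aw0.
have mf i j : measurable_fun setT (f i j).
  apply: measurable_restr => //; apply: measurable_funeM; apply: emeasurable_funM; apply: measurable_avg => //;
  exact: mEF.
have fA i j x : E x -> f i j x <= (c i j * (C * C) * (2 `^ beta) ^+ minn i j * (s `^ beta)^-1)%:E * A i j x `^ p^-1.
  move=> Ex; rewrite /f patchE mem_set// /A poweRM ?aw0//.
  have [HF1 HF2] := HC F i x mF F0; have [HG1 HG2] := HC G j x mG G0.
  have HF : avg r i (EFin \o F) x <= (C * (s `^ beta)^-1)%:E * avg r i (EFin \o weighted p beta F) x `^ p^-1.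
    case: Es => [/(_ _ Ex)/(HF2 _ s0)//|b0].
    by move: HF1; rewrite b0 !powRr0 expr1n invr1.
  have HG : avg r j (EFin \o G) x <= (C * (s `^ beta)^-1)%:E * avg r j (EFin \o weighted p beta G) x `^ p^-1.
    case: Es => [/(_ _ Ex)/(HG2 _ s0)//|b0].
    by move: HG1; rewrite b0 !powRr0 expr1n invr1.
  have C0' : (0 <= C)%R by exact: ltW.
  have s0' := ltW sb0.
  (* Only the finer average is charged to the distance [s] from the origin. The coarser one takes
     the bound by its scale, so [(s ^ beta)^-1] occurs once and [2 ^ beta] carries the exponent
     [minn i j]. *)
  case: (leqP i j) => ij.
    rewrite (_ : (c i j * _ * _ * _)%R = (c i j * (C * (2 `^ beta) ^+ i * (C * (s `^ beta)^-1)))%R); last first.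
      by move: (2 `^ beta ^+ i)%R (s `^ beta)^-1%R (c i j); clear => *; ring.
    exact: (lee_scaled_pmul (c0 i j) (mulr_ge0 C0' (B0 i)) (mulr_ge0 C0' s0') (aw0 _ _ _ F0') (aw0 _ _ _ G0') (poweR_ge0 _ _) (poweR_ge0 _ _) HF1 HG).
  rewrite (_ : (c i j * _ * _ * _)%R = (c i j * (C * (s `^ beta)^-1 * (C * (2 `^ beta) ^+ j)))%R); last first.
    by move: (2 `^ beta ^+ j)%R (s `^ beta)^-1%R (c i j); clear => *; ring.
  exact: (lee_scaled_pmul (c0 i j) (mulr_ge0 C0' s0') (mulr_ge0 C0' (B0 j)) (aw0 _ _ _ F0') (aw0 _ _ _ G0') (poweR_ge0 _ _) (poweR_ge0 _ _) HF HG1).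
pose K := (C * C * V `^ p^-1 * ((s `^ beta)^-1 * e `^ (eta / p)))%R.
have K0 : (0 <= K)%R by rewrite !mulr_ge0 ?powR_ge0// ltW.
have fN i j : 'N[mu]_p%:E[f i j] <= (K * (T ^+ i * T ^+ j))%:E * (U * W).
  set t := (c i j * (C * C) * (2 `^ beta) ^+ minn i j * (s `^ beta)^-1)%R in fA *.
  have t0 : (0 <= t)%R by rewrite !mulr_ge0// ltW.
  have mA : measurable_fun setT (A i j) by apply: emeasurable_funM; apply: measurable_avg.
  have le1 : 'N[mu]_p%:E[f i j] <= t%:E * (\int[mu]_(x in E) A i j x) `^ p^-1.
    apply: (@le_trans _ _ 'N[mu]_p%:E[(fun x => t%:E * ((A i j) \_ E) x `^ p^-1)]).
      apply: le_Lnorm => //.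
      - apply: measurable_funeM; apply: measurable_poweRT; exact: measurable_restr.
      - move=> x; rewrite patchE; case: ifPn => [|nE]; first by rewrite inE => /fA.
        by rewrite /f patchE (negbTE nE) mule_ge0 ?poweR_ge0// lee_fin.
    rewrite ge0_LnormZ//; last 2 first.
    - by apply: measurable_poweRT; exact: measurable_restr.
    - by move=> x; exact: poweR_ge0.
    rewrite ge0_LnormE ?gt_eqF//; last by move=> x; exact: poweR_ge0.
    rewrite [in leRHS]integral_mkcond.
    rewrite (eq_integral ((A i j) \_ E))// => x _.
    by rewrite poweRVK ?gt_eqF// patchE; case: ifP.
  apply: le_trans le1 _.
  have H := @avg_product r r0 E e eta i j _ _ mE e0 Ee eta01 mwF mwG wF0 wG0.
  have I0 : 0 <= \int[mu]_(x in E) A i j x by apply: integral_ge0 => x _; exact: A0.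
  apply: (@le_trans _ _ (t%:E * (((V * (2 ^+ n) ^+ minn i j * (e * (2 ^+ n) ^+ maxn i j) `^ eta)%:E *
     (\int[mu]_y (weighted p beta F y)%:E * \int[mu]_y (weighted p beta G y)%:E)) `^ p^-1))).
    by apply: lee_wpmul2l; [rewrite lee_fin|exact: ge0_le_poweR].
  have iF0 : 0 <= \int[mu]_y (weighted p beta F y)%:E by apply: integral_ge0 => y _; exact: wF0.
  have iG0 : 0 <= \int[mu]_y (weighted p beta G y)%:E by apply: integral_ge0 => y _; exact: wG0.
  have N0 i' : (0 <= ((2 ^+ n) ^+ i' : R))%R by rewrite !exprn_ge0.
  have VN0 : 0 <= (V * (2 ^+ n) ^+ minn i j * (e * (2 ^+ n) ^+ maxn i j) `^ eta)%:E.
    by rewrite lee_fin; apply: mulr_ge0; [apply: mulr_ge0; [exact: ltW|exact: N0]|exact: powR_ge0].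
  rewrite (poweRM _ VN0 (mule_ge0 iF0 iG0)).
  have UWE : (\int[mu]_y (weighted p beta F y)%:E * \int[mu]_y (weighted p beta G y)%:E) `^ p^-1 = U * W.
    exact: (poweRM _ iF0 iG0).
  rewrite UWE muleA; apply: lee_wpmul2r; first exact: UW0.
  rewrite poweR_EFin -EFinM lee_fin.
  have Np a : (((2 ^+ n) ^+ a) `^ p^-1 = (2 `^ (n%:R / p)) ^+ a :> R)%R.
    by rewrite exprn_powR ?exprn_ge0// -[(2 ^+ n)%R]powR_mulrn// -powRrM.
  have -> : ((V * (2 ^+ n) ^+ minn i j * (e * (2 ^+ n) ^+ maxn i j) `^ eta) `^ p^-1 =
      V `^ p^-1 * (2 `^ (n%:R / p)) ^+ minn i j * (e `^ (eta / p) * (2 `^ d) ^+ maxn i j))%R.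
    rewrite powRM; [|by rewrite mulr_ge0// ltW|exact: powR_ge0].
    rewrite powRM//; last exact: ltW.
    rewrite Np -powRrM powRM//; last exact: ltW.
    congr (_ * (_ * _))%R; rewrite mulrC powRrM Np -exprn_powR ?powR_ge0// -powRrM.
    by rewrite exprn_powR// /d [(eta * _)%R]mulrC.
  (* All powers of two are collected: the weights of the potentials, [beta + n / p] at the coarser
     scale and [eta n / p] at the finer. *)
  apply: (@le_trans _ _ (K * ((2^-1 ^+ k) ^+ i * (2^-1 ^+ l) ^+ j * (2 `^ g) ^+ minn i j * (2 `^ d) ^+ maxn i j))%R); last first.
    by apply: ler_wpM2l => //; exact: kernel_exponent.
  rewrite le_eqVlt; apply/orP; left; apply/eqP.
  rewrite /g powRD; last by apply/implyP.
  rewrite exprMn /t cE /K; clear.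
  by move: (V `^ _)%R ((2 `^ (n%:R / p)) ^+ _)%R ((2 `^ beta) ^+ _)%R ((2 `^ d) ^+ _)%R (e `^ _)%R ((s `^ _)^-1)%R ((2^-1 ^+ k) ^+ i)%R ((2^-1 ^+ l) ^+ j)%R => *; ring.
have potE k' H x : pot k' r H x = \sum_(0 <= i <oo) (((2^-1 ^+ k') ^+ i)%:E * avg r i H x) by [].
have -> : (fun x => pot k r (EFin \o F) x * pot l r (EFin \o G) x) \_ E =
    fun x => \sum_(0 <= i <oo) (fun x => \sum_(0 <= j <oo) f i j x) x.
  apply/funext => x; rewrite patchE /f; case: ifPn => xE; last first.
    rewrite eseries0// => i _ _; rewrite eseries0// => j _ _.
    by rewrite patchE (negbTE xE).
  rewrite [pot k r _ x]potE muleC -ge0_nneseriesZl; last 2 first.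
  - exact: pot_ge0.
  - by move=> i; rewrite mule_ge0 ?aw0// lee_fin !exprn_ge0// invr_ge0.
  apply: eq_eseriesr => i _; rewrite potE muleC -ge0_nneseriesZl; last 2 first.
  - by rewrite mule_ge0 ?aw0// lee_fin !exprn_ge0// invr_ge0.
  - by move=> j; rewrite mule_ge0 ?aw0// lee_fin !exprn_ge0// invr_ge0.
  by apply: eq_eseriesr => j _; rewrite patchE xE muleACA -EFinM cE.
apply: (@le_trans _ _ (\sum_(0 <= i <oo) (\sum_(0 <= j <oo) 'N[mu]_p%:E[f i j]))).
  apply: le_trans (Lnorm_nneseries_le _ (ltW p1) _ _) _.
  - by move=> i; apply: measurable_nneseries.
  - by move=> i x; apply: nneseries_ge0 => j _ _.
  apply: lee_nneseries => i _; first by move=> _; exact: Lnorm_ge0.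
  by apply: Lnorm_nneseries_le => //; exact: ltW.
apply: (@le_trans _ _ (\sum_(0 <= i <oo) (((K%:E * (U * W) * ((1 - T)^-1)%:E) * (T ^+ i)%:E)))).
  apply: lee_nneseries => i _; first by move=> _; apply: nneseries_ge0 => j _ _; exact: Lnorm_ge0.
  apply: (@le_trans _ _ (\sum_(0 <= j <oo) ((K * T ^+ i)%:E * (U * W) * (T ^+ j)%:E))).
    apply: lee_nneseries => j _; first by move=> _; exact: Lnorm_ge0.
    by apply: le_trans (fN i j) _; rewrite mulrA EFinM muleAC.
  rewrite ge0_nneseriesZl; last 2 first.
  - by rewrite mule_ge0// lee_fin mulr_ge0// exprn_ge0.
  - by move=> j; rewrite lee_fin exprn_ge0.
  rewrite nneseries_geometric// EFinM.
  by rewrite [leRHS]muleAC; rewrite (muleAC K%:E).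
rewrite ge0_nneseriesZl; last 2 first.
- by apply: mule_ge0; [apply: mule_ge0 => //; rewrite lee_fin|rewrite lee_fin ltW].
- by move=> j; rewrite lee_fin exprn_ge0.
rewrite nneseries_geometric// -muleA -EFinM muleAC -EFinM; apply: lee_wpmul2r => //.
rewrite lee_fin le_eqVlt; apply/orP; left; apply/eqP; rewrite /K; clear.
by move: (V `^ _)%R (e `^ _)%R ((s `^ _)^-1)%R ((1 - T)^-1)%R => *; ring.
Qed.

End weighted_averages.

End bilinear.

(** * Norms over a system of shells *)

Section herz_system.
Context {R : realType} {n : nat}.
Notation X := 'rV[R]_n.
Notation mu := (lebesgue_rV n).
Implicit Types (x y w : X) (k l j c : nat).
Local Open Scope ereal_scope.

Lemma pot_local (B : set X) (F : X -> R) k (r : R) x : (0 < r)%R ->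
  (forall w, (`|w| < r)%R -> B (x + w)%R) ->
  pot k r (EFin \o F) x = pot k r (EFin \o (F \_ B)) x.
Proof.
move=> r0 Bx; apply: eq_eseriesr => j _; congr (_ * _).
apply: eq_integral => w; rewrite inE /nball /= => wr; rewrite patchE mem_set//; apply: Bx.
rewrite normrZ ger0_norm ?exprn_ge0 ?invr_ge0//; apply: le_lt_trans wr.
by rewrite ler_piMl// exprn_ile1// ?invr_ge0// invf_le1// ler1n.
Qed.

Lemma le_sum4 (a b c d : R) : (0 < a)%R -> (0 <= b)%R -> (0 < c)%R -> (0 <= d)%R ->
  [/\ (a + b <= a + b + c + d)%R, (c <= a + b + c + d)%R & (d <= a + b + c + d)%R].
Proof. by move=> *; split; lra. Qed.

Variables (E : nat -> set X) (W : nat -> R) (p q : R).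
Hypothesis mE : forall k, measurable (E k).
Hypothesis W0 : forall k, (0 < W k)%R.
Hypothesis p1 : (1 < p)%R.
Hypothesis q1 : (1 <= q)%R.

Let p0 : (0 < p)%R. Proof. exact: lt_trans p1. Qed.
Let q0 : (0 < q)%R. Proof. exact: lt_le_trans q1. Qed.

(** With dyadic shells and [W k] a power of two this is the homogeneous Herz norm; the inhomogeneous
    one is only equivalent to it, since there the unit ball is added outside the root. *)
Definition hn (F : X -> \bar R) : \bar R :=
  ell q (fun k => (W k)%:E * 'N[mu]_p%:E[F \_ (E k)]).

Let W0' k : 0 <= (W k)%:E. Proof. by rewrite lee_fin ltW. Qed.

Let term_ge0 F k : 0 <= (W k)%:E * 'N[mu]_p%:E[F \_ (E k)].
Proof. by apply: mule_ge0 => //; exact: Lnorm_ge0. Qed.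

Lemma hn_ge0 F : 0 <= hn F. Proof. exact: ell_ge0. Qed.

Lemma shell_le_hn F k : (W k)%:E * 'N[mu]_p%:E[F \_ (E k)] <= hn F.
Proof. by rewrite /hn; exact: (ell_ub (x := fun k => (W k)%:E * 'N[mu]_p%:E[F \_ (E k)])). Qed.

Lemma ae_le_hn F G : measurable_fun setT F -> measurable_fun setT G ->
  (forall x, 0 <= F x) -> (forall x, 0 <= G x) -> {ae mu, forall x, F x <= G x} -> hn F <= hn G.
Proof.
move=> mF mG F0 G0 FG; apply: le_ell => // k; apply: lee_wpmul2l => //.
apply: ae_le_Lnorm => //; [exact: measurable_restr|exact: measurable_restr| | |].
- by move=> x; rewrite patchE; case: ifP.
- by move=> x; rewrite patchE; case: ifP.
- by apply: filterS FG => x Fx; rewrite !patchE; case: ifP.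
Qed.

Lemma le_hn F G : measurable_fun setT F -> measurable_fun setT G ->
  (forall x, 0 <= F x) -> (forall x, F x <= G x) -> hn F <= hn G.
Proof.
move=> mF mG F0 FG; apply: ae_le_hn => //; first by move=> x; exact: le_trans (FG x).
exact: aeW.
Qed.

Lemma hnZ F (c : \bar R) : measurable_fun setT F -> (forall x, 0 <= F x) -> 0 <= c ->
  hn (fun x => c * F x) = c * hn F.
Proof.
move=> mF F0 c0; rewrite -ellZ//; congr (ell q _); apply/funext => k.
rewrite muleCA; congr (_ * _); rewrite -ge0_LnormZ//.
- by congr Lnorm; apply/funext => x; rewrite !patchE; case: ifP => //; rewrite mule0.
- exact: measurable_restr.
- by move=> x; rewrite patchE; case: ifP.
Qed.

Lemma hnD F G : measurable_fun setT F -> measurable_fun setT G ->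
  (forall x, 0 <= F x) -> (forall x, 0 <= G x) -> hn (fun x => F x + G x) <= hn F + hn G.
Proof.
move=> mF mG F0 G0; apply: le_trans (ellD q1 (term_ge0 F) (term_ge0 G)).
apply: le_ell => // k; rewrite -muleDr//; last exact: ge0_adde_def (Lnorm_ge0 _ _ _) (Lnorm_ge0 _ _ _).
apply: lee_wpmul2l => //.
have f0 H x : (forall x, 0 <= H x) -> 0 <= (H \_ (E k)) x by move=> H0; rewrite patchE; case: ifP.
apply: le_trans (@ge0_minkowski _ _ _ mu p (F \_ (E k)) (G \_ (E k)) (ltW p1) _ _ _ _); last 4 first.
- exact: measurable_restr.
- exact: measurable_restr.
- by move=> x; exact: f0.
- by move=> x; exact: f0.
rewrite le_eqVlt; apply/orP; left; apply/eqP; congr Lnorm; apply/funext => x.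
by rewrite !patchE; case: ifP; rewrite ?adde0.
Qed.

(* Translates by less than [r] of an outer shell [E k] meet only the three shells
   [E (sg c k)]. The inner shells accumulate at the origin; their translates stay
   in [B], on which the norm controls a weight [|y| ^ beta], and [inner_shell]
   turns this weight into a summable factor [t k]. *)
Section multiplication.
Variables (beta eta c0 r CB Ct : R) (m : nat) (outer : pred nat) (sg : nat -> nat -> nat).
Variables (B : set X) (s e t : nat -> R).
Hypothesis n0 : (0 < n)%N.
Hypothesis m0 : (0 < m)%N.
Hypothesis r0 : (0 < r)%R.
Hypothesis beta0 : (0 <= beta)%R.
Hypothesis betan : (beta * (p / (p - 1)) < n%:R)%R.
Hypothesis gm : (beta + n%:R / p < m%:R)%R.
Hypothesis eta01 : (0 <= eta <= 1)%R.
Hypothesis etam : (eta * (n%:R / p) + (beta + n%:R / p) / m%:R < 1)%R.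
Hypothesis Efin : forall k, mu (E k) < +oo.
Hypothesis c00 : (0 < c0)%R.
Hypothesis CB0 : (0 <= CB)%R.
Hypothesis sg_ell : forall c a, (c < 3)%N -> (forall k, 0 <= a k) -> ell q (a \o sg c) <= 2%:E * ell q a.
Hypothesis sg_W : forall c k, outer k -> (c < 3)%N -> (W k <= c0 * W (sg c k))%R.
Hypothesis outer_W : forall k, outer k -> (1 <= W k)%R.
Hypothesis outer_nbh : forall k x w, outer k -> E k x -> (`|w| < r)%R ->
  exists2 c, (c < 3)%N & E (sg c k) (x + w)%R.
Hypothesis mB : measurable B.
Hypothesis weighted_hn : forall F : X -> R, measurable_fun setT F -> (forall x, (0 <= F x)%R) ->
  (\int[mu]_y (weighted p beta (F \_ B) y)%:E) `^ p^-1 <= CB%:E * hn (EFin \o F).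
Hypothesis t0 : forall k, (0 <= t k)%R.
Hypothesis t_ell : ell q (EFin \o t) <= Ct%:E.
Hypothesis inner_nbh : forall k x w, ~~ outer k -> E k x -> (`|w| < r)%R -> B (x + w)%R.
Hypothesis inner_shell : forall k, ~~ outer k ->
  [/\ (0 < s k)%R, (0 < e k)%R, forall x, E k x -> (s k <= `|x|)%R, mu (E k) <= (e k)%:E &
      (W k * ((s k `^ beta)^-1 * e k `^ (eta / p)) <= t k)%R].

Let nbh k : set X := \bigcup_(c in [set c | (c < 3)%N]) E (sg c k).

Let nsum (F : X -> R) k : \bar R := \sum_(c < 3) 'N[mu]_p%:E[(EFin \o F) \_ (E (sg c k))].

Let nb (F : X -> R) k : \bar R :=
  \sum_(c < 3) ((W (sg c k))%:E * 'N[mu]_p%:E[(EFin \o F) \_ (E (sg c k))]).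

Let mnbh k : measurable (nbh k).
Proof. by apply: bigcup_measurable. Qed.

Let nsum_ge0 F k : 0 <= nsum F k.
Proof. by apply: sume_ge0 => c _; exact: Lnorm_ge0. Qed.

Let nb_ge0 F k : 0 <= nb F k.
Proof. by apply: sume_ge0. Qed.

Let W_nsum F k : outer k -> (W k)%:E * nsum F k <= c0%:E * nb F k.
Proof.
move=> ok; rewrite /nsum /nb ge0_sume_distrr; last by move=> c _; exact: Lnorm_ge0.
rewrite ge0_sume_distrr//; apply: lee_sum => c _.
by rewrite muleA -EFinM; apply: lee_wpmul2r; [exact: Lnorm_ge0|rewrite lee_fin sg_W].
Qed.

Let nb_le F k : nb F k <= 3%:R%:E * hn (EFin \o F).
Proof.
rewrite (_ : 3%:R%:E * _ = \sum_(c < 3) hn (EFin \o F)); last by rewrite sumr_const card_ord mule_natl.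
by apply: lee_sum => c _; exact: shell_le_hn.
Qed.

Let ell_nb F : ell q (nb F) <= 6%:R%:E * hn (EFin \o F).
Proof.
pose a k := (W k)%:E * 'N[mu]_p%:E[(EFin \o F) \_ (E k)].
have a0 k : 0 <= a k by exact: term_ge0.
have h c : (c < 3)%N -> ell q (a \o sg c) <= 2%:E * hn (EFin \o F) by move=> c3; exact: sg_ell.
rewrite (_ : nb F = fun k => (a \o sg 0) k + ((a \o sg 1) k + (a \o sg 2) k)); last first.
  by apply/funext => k; rewrite /nb !big_ord_recl big_ord0 addr0.
rewrite (_ : 6%:R%:E * hn (EFin \o F) = 2%:E * hn (EFin \o F) + (2%:E * hn (EFin \o F) + 2%:E * hn (EFin \o F))); last first.
  by rewrite -!ge0_muleDl ?lee_fin// -!EFinD; congr (_%:E * _); ring.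
apply: le_trans (ellD q1 _ _) _ => [k|k|].
- exact: a0.
- by apply: adde_ge0; exact: a0.
apply: leeD; first exact: h.
apply: le_trans (ellD q1 _ _) _ => [k|k|]; [exact: a0|exact: a0|].
by apply: leeD; exact: h.
Qed.

Let restrR (F : X -> R) (A : set X) : EFin \o (F \_ A) = (EFin \o F) \_ A.
Proof. by apply/funext => x /=; rewrite !patchE; case: ifP. Qed.

Let weighted_nbh (F : X -> R) k : measurable_fun setT F -> (forall x, (0 <= F x)%R) ->
  (\int[mu]_y (weighted p 0 (F \_ (nbh k)) y)%:E) `^ p^-1 <= nsum F k.
Proof.
move=> mF F0.
have mEF : measurable_fun setT (EFin \o F) by apply/measurable_EFinP.
have F0' x : 0 <= (EFin \o F) x by rewrite lee_fin.
rewrite [X in X `^ _ <= _](_ : _ = \int[mu]_y (((EFin \o F) \_ (nbh k)) y `^ p)); last first.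
  by apply: eq_integral => y _; rewrite /weighted powRr0 mulr1 -restrR.
rewrite -ge0_LnormE ?gt_eqF//; last by move=> x; rewrite patchE; case: ifP.
pose h c := (EFin \o F) \_ (E (sg c k)).
have h0 c x : 0 <= h c x by rewrite /h patchE; case: ifP.
have mh c : measurable_fun setT (h c) by exact: measurable_restr.
apply: (@le_trans _ _ 'N[mu]_p%:E[(fun x => \sum_(c < 3) h c x)]).
  apply: le_Lnorm => //; [exact: measurable_restr|exact: emeasurable_sum| |].
  - by move=> x; rewrite patchE; case: ifP.
  - move=> x; rewrite patchE; case: ifPn => [|_]; last by apply: sume_ge0.
    rewrite inE => -[c /= c3 Ex]; rewrite (bigD1 (Ordinal c3))//= {1}/h patchE mem_set//.
    by rewrite leeDl//; apply: sume_ge0.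
have := @Lnorm_sum_le _ _ _ mu p h 3 (ltW p1) mh h0; rewrite big_mkord.
by under eq_Lnorm do rewrite big_mkord.
Qed.

(** [pot_bilinear] and [pot_sup] are each used twice: with exponent 0 on outer shells, where the
    potentials only see three shells, and with [beta] on inner shells, where they see [B]. *)
Lemma herz_mult : exists2 C : R, (0 < C)%R & forall F G : X -> R,
  measurable_fun setT F -> measurable_fun setT G ->
  (forall x, (0 <= F x)%R) -> (forall x, (0 <= G x)%R) ->
  (forall k l, (0 < k)%N -> (0 < l)%N -> (m <= k + l)%N ->
    hn (fun x => pot k r (EFin \o F) x * pot l r (EFin \o G) x) <=
      C%:E * (hn (EFin \o F) * hn (EFin \o G))) /\
  (forall j x, E j x -> pot m r (EFin \o G) x <= C%:E * hn (EFin \o G)).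
Proof.
have bn0 : (0 * (p / (p - 1)) < n%:R)%R by rewrite mul0r ltr0n.
have gm0 : (0 + n%:R / p < m%:R)%R by apply: le_lt_trans gm; rewrite lerD2r.
have et0 : (0 <= (0 : R) <= 1)%R by rewrite lexx ler01.
have em0 : (0 * (n%:R / p) + (0 + n%:R / p) / m%:R < 1)%R.
  by rewrite mul0r add0r add0r ltr_pdivrMr ?ltr0n// mul1r; move: gm0; rewrite add0r.
have [C1 C10 H1] := pot_bilinear n0 p1 (lexx 0%R) r0 bn0 m0 gm0 et0 em0.
have [C2 C20 H2] := pot_bilinear n0 p1 beta0 r0 betan m0 gm eta01 etam.
have [C3 C30 H3] := pot_sup n0 p1 (lexx 0%R) r0 bn0 gm0.
have [C4 C40 H4] := pot_sup n0 p1 beta0 r0 betan gm.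
pose K1 := (C1 * (c0 * c0) * 3%:R * 6%:R)%R.
pose K2 := (C2 * (CB * CB) * `|Ct|)%R.
pose K3 := (C3 * (c0 * 3%:R))%R.
pose K4 := (C4 * CB)%R.
have K10 : (0 < K1)%R by rewrite !mulr_gt0.
have K20 : (0 <= K2)%R by rewrite !mulr_ge0// ltW.
have K30 : (0 < K3)%R by rewrite !mulr_gt0.
have K40 : (0 <= K4)%R by rewrite !mulr_ge0// ltW.
exists (K1 + K2 + K3 + K4)%R; first by rewrite ltr_wpDr// addr_gt0// ltr_wpDr.
move=> F G mF mG F0 G0.
have hF0 := hn_ge0 (EFin \o F); have hG0 := hn_ge0 (EFin \o G).
have mR (H : X -> R) A : measurable A -> measurable_fun setT H -> measurable_fun setT (H \_ A).
  by move=> mA mH; exact: measurable_restrR.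
have R0 (H : X -> R) A x : (forall x, (0 <= H x)%R) -> (0 <= (H \_ A) x)%R.
  by move=> H0; rewrite patchE; case: ifP.
have nsum_hn H k : outer k -> nsum H k <= (c0 * 3%:R)%:E * hn (EFin \o H).
  move=> ok; apply: (@le_trans _ _ ((W k)%:E * nsum H k)).
    by rewrite -{1}[nsum H k]mul1e; apply: lee_wpmul2r => //; rewrite lee_fin outer_W.
  apply: le_trans (W_nsum _ ok) _; rewrite EFinM -muleA.
  by apply: lee_wpmul2l; [rewrite lee_fin ltW|exact: nb_le].
split=> [k l k0 l0 kl|j x Ejx]; last first.
  have [oj|nj] := boolP (outer j).
    rewrite (@pot_local (nbh j))//; last by move=> w wr; exact: outer_nbh oj Ejx wr.
    apply: le_trans (H3 _ x (mR _ _ (mnbh j) mG) (fun x => R0 _ _ x G0)) _.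
    apply: (@le_trans _ _ (C3%:E * ((c0 * 3%:R)%:E * hn (EFin \o G)))).
      apply: lee_wpmul2l; first by rewrite lee_fin ltW.
      by apply: le_trans (weighted_nbh _ mG G0) _; exact: nsum_hn.
    rewrite muleA -EFinM; apply: lee_wpmul2r => //; rewrite lee_fin -/K3.
    by have [] := le_sum4 K10 K20 K30 K40.
  rewrite (@pot_local B)//; last by move=> w wr; exact: inner_nbh nj Ejx wr.
  apply: le_trans (H4 _ x (mR _ _ mB mG) (fun x => R0 _ _ x G0)) _.
  apply: (@le_trans _ _ (C4%:E * (CB%:E * hn (EFin \o G)))).
    by apply: lee_wpmul2l; [rewrite lee_fin ltW|exact: weighted_hn].
  rewrite muleA -EFinM; apply: lee_wpmul2r => //; rewrite lee_fin -/K4.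
  by have [] := le_sum4 K10 K20 K30 K40.
pose P x := pot k r (EFin \o F) x * pot l r (EFin \o G) x.
pose a1 := C1%:E * (c0%:E * ((c0 * 3%:R)%:E * hn (EFin \o G))).
have a10 : 0 <= a1 by rewrite !mule_ge0// lee_fin// ltW// mulr_gt0.
pose a2 := C2%:E * (CB%:E * hn (EFin \o F) * (CB%:E * hn (EFin \o G))).
have a20 : 0 <= a2 by rewrite !mule_ge0// lee_fin// ltW.
have Plocal j (A : set X) : (forall x w, E j x -> (`|w| < r)%R -> A (x + w)%R) ->
    P \_ (E j) = (fun x => pot k r (EFin \o (F \_ A)) x * pot l r (EFin \o (G \_ A)) x) \_ (E j).
  move=> HA; apply/eq_restrictP => x; rewrite inE => Ex; rewrite /P.
  by congr (_ * _); apply: pot_local => [//|w]; exact: HA.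
(* On outer shells [F] stays in the [\ell^q] sum and [G] is bounded uniformly, because [W] is at
   least 1 there; on inner shells both are bounded by their norms and [t] is summed. *)
have bnd j : (W j)%:E * 'N[mu]_p%:E[P \_ (E j)] <= a1 * nb F j + a2 * (t j)%:E.
  have [oj|nj] := boolP (outer j).
    apply: (@le_trans _ _ (a1 * nb F j)); last by rewrite leeDl// mule_ge0// lee_fin.
    rewrite (Plocal j (nbh j)); last by move=> x w Ex wr; exact: outer_nbh oj Ex wr.
    (* With [eta = 0] any finite bound of the measure will do; adding 1 makes it positive. *)
    have [e' e'0 Ee'] : exists2 e' : R, (0 < e')%R & mu (E j) <= e'%:E.
      exists (1 + fine (mu (E j)))%R; first by rewrite ltr_pwDl// fine_ge0.
      by rewrite EFinD fineK ?leeDr ?lee_fin// ge0_fin_numE.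
    have := H1 k l _ _ (E j) e' 1%R k0 l0 kl (mR _ _ (mnbh j) mF) (mR _ _ (mnbh j) mG)
      (fun x => R0 _ _ x F0) (fun x => R0 _ _ x G0) (mE j) e'0 Ee' ltr01 (or_intror erefl).
    rewrite mul0r !powRr0 invr1 !mulr1 => h.
    apply: (@le_trans _ _ ((W j)%:E * (C1%:E * (nsum F j * nsum G j)))).
      apply: lee_wpmul2l => //; apply: le_trans h _; apply: lee_wpmul2l; first by rewrite lee_fin ltW.
      by apply: lee_pmul; rewrite ?poweR_ge0//; exact: weighted_nbh.
    have -> : (W j)%:E * (C1%:E * (nsum F j * nsum G j)) = C1%:E * ((W j)%:E * nsum F j * nsum G j).
      by rewrite muleCA (muleA (W j)%:E).
    have -> : a1 * nb F j = C1%:E * (c0%:E * nb F j * ((c0 * 3%:R)%:E * hn (EFin \o G))).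
      by rewrite /a1 -!(muleA _ _ (nb F j)) -(muleA c0%:E) (muleC (nb F j)) -(muleA (c0 * 3%:R)%:E).
    apply: lee_wpmul2l; first by rewrite lee_fin ltW.
    by apply: lee_pmul; [exact: mule_ge0|exact: nsum_ge0|exact: W_nsum|exact: nsum_hn].
  apply: (@le_trans _ _ (a2 * (t j)%:E)); last by rewrite leeDr// mule_ge0.
  have [s0 e0 sE Ee Wt] := inner_shell nj.
  rewrite (Plocal j B); last by move=> x w Ex wr; exact: inner_nbh nj Ex wr.
  have h := H2 k l _ _ (E j) (e j) (s j) k0 l0 kl (mR _ _ mB mF) (mR _ _ mB mG)
    (fun x => R0 _ _ x F0) (fun x => R0 _ _ x G0) (mE j) e0 Ee s0 (or_introl sE).
  apply: (@le_trans _ _ ((W j)%:E * ((C2 * ((s j `^ beta)^-1 * e j `^ (eta / p)))%:E *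
      (CB%:E * hn (EFin \o F) * (CB%:E * hn (EFin \o G)))))).
    apply: lee_wpmul2l => //; apply: le_trans h _; apply: lee_wpmul2l.
      by rewrite lee_fin !mulr_ge0 ?invr_ge0 ?powR_ge0// ltW.
    by apply: lee_pmul; rewrite ?poweR_ge0//; exact: weighted_hn.
  rewrite muleA -EFinM mulrCA EFinM /a2 -muleA -[leRHS]muleA; apply: lee_wpmul2l; first by rewrite lee_fin ltW.
  rewrite [leRHS]muleC; apply: lee_wpmul2r; last by rewrite lee_fin.
  by rewrite !mule_ge0// lee_fin.
apply: (@le_trans _ _ (ell q (fun j => a1 * nb F j + a2 * (t j)%:E))); first exact: le_ell.
apply: le_trans (ellD q1 _ _) _ => [j|j|]; [exact: mule_ge0|by rewrite mule_ge0// lee_fin|].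
rewrite !ellZ//.
apply: (@le_trans _ _ (a1 * (6%:R%:E * hn (EFin \o F)) + a2 * `|Ct|%:E)).
  apply: leeD; first by apply: lee_wpmul2l => //; exact: ell_nb.
  by apply: lee_wpmul2l => //; apply: le_trans t_ell _; rewrite lee_fin ler_norm.
have -> : a1 * (6%:R%:E * hn (EFin \o F)) = K1%:E * (hn (EFin \o F) * hn (EFin \o G)).
  rewrite /a1 /K1; move: (hn (EFin \o F)) (hn (EFin \o G)) => x y.
  rewrite (EFinM c0 3%:R) !EFinM -!muleA; do 4 congr (_ * _).
  by rewrite muleCA (muleC y).
have -> : a2 * `|Ct|%:E = K2%:E * (hn (EFin \o F) * hn (EFin \o G)).
  rewrite /a2 /K2; move: (hn (EFin \o F)) (hn (EFin \o G)) => x y.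
  rewrite !EFinM -!muleA; do 2 congr (_ * _).
  by rewrite muleCA; congr (_ * _); rewrite muleA muleC.
rewrite -ge0_muleDl ?lee_fin; [|exact: ltW|exact: K20]; apply: lee_wpmul2r; first exact: mule_ge0.
by rewrite lee_fin; by have [] := le_sum4 K10 K20 K30 K40.
Qed.

End multiplication.
End herz_system.

Section finite_ell.
Context {R : realType} {I : finType}.
Implicit Types (a b : I -> \bar R) (s : R).
Local Open Scope ereal_scope.

(** Finite families are padded with zeros to sequences, so that they inherit Minkowski's inequality
    from [ell]. *)
Definition fin_seq a (i : nat) : \bar R := if insub i is Some j then a (enum_val (j : 'I_#|I|)) else 0.

Definition fell s a : \bar R := (\sum_i a i `^ s) `^ s^-1.

Lemma fin_seq_ge0 a i : (forall i, 0 <= a i) -> 0 <= fin_seq a i.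
Proof. by move=> a0; rewrite /fin_seq; case: insubP. Qed.

Lemma fellE s a : (0 < s)%R -> fell s a = ell s (fin_seq a).
Proof.
move=> s0; rewrite (@ell_finite _ s _ #|I|)//; last first.
  by move=> k Ik; rewrite /fin_seq insubN// -leqNgt.
congr (_ `^ _); rewrite (big_enum_val (A := I)); apply: eq_bigr => i _.
by rewrite /fin_seq valK.
Qed.

Lemma fell_ge0 s a : 0 <= fell s a. Proof. exact: poweR_ge0. Qed.

Lemma le_fell s a b : (0 < s)%R -> (forall i, 0 <= a i) -> (forall i, a i <= b i) -> fell s a <= fell s b.
Proof.
move=> s0 a0 ab; apply: ge0_le_poweR; first by rewrite invr_ge0 ltW.
  by apply: sume_ge0 => i _; exact: poweR_ge0.
by apply: lee_sum => i _; apply: ge0_le_poweR => //; exact: ltW.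
Qed.

Lemma fellZ s (c : \bar R) a : (0 < s)%R -> 0 <= c -> (forall i, 0 <= a i) ->
  fell s (fun i => c * a i) = c * fell s a.
Proof.
move=> s0 c0 a0; rewrite !fellE// -ellZ//; last by move=> k; exact: fin_seq_ge0.
by congr ell; apply/funext => k; rewrite /fin_seq; case: insubP => //; rewrite mule0.
Qed.

Lemma fellD s a b : (1 <= s)%R -> (forall i, 0 <= a i) -> (forall i, 0 <= b i) ->
  fell s (fun i => a i + b i) <= fell s a + fell s b.
Proof.
move=> s1 a0 b0; have s0 : (0 < s)%R by exact: lt_le_trans s1.
rewrite !fellE//; apply: le_trans (ellD s1 _ _) => [|k|k]; [|exact: fin_seq_ge0|exact: fin_seq_ge0].
rewrite le_eqVlt; apply/orP; left; apply/eqP.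
by congr ell; apply/funext => k; rewrite /fin_seq; case: insubP => //; rewrite adde0.
Qed.

Lemma fell_nneseries s (x : nat -> I -> \bar R) : (1 <= s)%R -> (forall j i, 0 <= x j i) ->
  fell s (fun i => \sum_(0 <= j <oo) x j i) <= \sum_(0 <= j <oo) fell s (x j).
Proof.
move=> s1 x0; have s0 : (0 < s)%R by exact: lt_le_trans s1.
rewrite !fellE//; under [leRHS]eq_eseriesr do rewrite fellE//.
apply: le_trans (ell_nneseries s1 _); last by move=> j k; exact: fin_seq_ge0.
rewrite le_eqVlt; apply/orP; left; apply/eqP.
by congr ell; apply/funext => k; rewrite /fin_seq; case: insubP => //; rewrite eseries0.
Qed.

Lemma fell_ub s a i : (0 < s)%R -> (forall i, 0 <= a i) -> a i <= fell s a.
Proof.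
move=> s0 a0; apply: (@le_of_poweR _ s) => //; first exact: fell_ge0.
rewrite /fell poweRVK ?gt_eqF//; last by apply: sume_ge0 => j _; exact: poweR_ge0.
by rewrite (bigD1 i)//= leeDl// sume_ge0// => j _; exact: poweR_ge0.
Qed.

(** Each power is split as [u * u ^ (s - 1)], and the last factor is monotone; infinite arguments
    are immediate. *)
Lemma poweR_superadditive s (x y : \bar R) : (1 <= s)%R -> 0 <= x -> 0 <= y ->
  x `^ s + y `^ s <= (x + y) `^ s.
Proof.
move=> s1; have s0 : (0 < s)%R by exact: lt_le_trans s1.
case: x => [x| |]//; case: y => [y| |]// x0 y0; last 3 first.
- by rewrite addey// [leRHS]poweRyr ?gt_eqF// leey.
- by rewrite addye// [leRHS]poweRyr ?gt_eqF// leey.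
- by rewrite addye// [leRHS]poweRyr ?gt_eqF// leey.
have -> : x%:E + y%:E = (x + y)%:E by [].
rewrite !poweR_EFin; change ((x `^ s + y `^ s)%:E <= ((x + y) `^ s)%:E).
rewrite lee_fin; rewrite !lee_fin in x0 y0.
rewrite -!(mulr_powRB1 _ s0) ?addr_ge0// mulrDl; apply: lerD; apply: ler_wpM2l => //;
  by apply: ge0_ler_powR; rewrite ?subr_ge0// ?nnegrE ?addr_ge0// ?lerDl ?lerDr.
Qed.

Lemma fell_le_sum s a : (1 <= s)%R -> (forall i, 0 <= a i) -> fell s a <= \sum_i a i.
Proof.
move=> s1 a0; have s0 : (0 < s)%R by exact: lt_le_trans s1.
have S0 : 0 <= \sum_i a i by exact: sume_ge0.
rewrite -[leRHS](@poweRK _ s) ?gt_eqF//; apply: ge0_le_poweR; first by rewrite invr_ge0 ltW.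
  by apply: sume_ge0 => i _; exact: poweR_ge0.
suff H (L : seq I) : \sum_(i <- L) a i `^ s <= (\sum_(i <- L) a i) `^ s by exact: H.
elim: L => [|i L IH]; first by rewrite !big_nil poweR0r// gt_eqF.
rewrite !big_cons; apply: le_trans (_ : a i `^ s + (\sum_(j <- L) a j) `^ s <= _).
  exact: leeD.
by apply: poweR_superadditive => //; exact: sume_ge0.
Qed.

End finite_ell.

Section jets.
Context {R : realType} {n : nat}.
Notation X := 'rV[R]_n.
Notation mu := (lebesgue_rV n).
Notation mindices := ('I_n -> nat).
Implicit Types (b : mindices) (k j : nat) (D : mindices -> X -> \bar R).
Variables (E : nat -> set X) (W : nat -> R) (p q : R) (m : nat).
Hypothesis mE : forall k, measurable (E k).
Hypothesis W0 : forall k, (0 < W k)%R.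
Hypothesis p1 : (1 < p)%R.
Hypothesis q1 : (1 <= q)%R.
Local Open Scope ereal_scope.

Let p0 : (0 < p)%R. Proof. exact: lt_trans p1. Qed.
Let q0 : (0 < q)%R. Proof. exact: lt_le_trans q1. Qed.
Let W0' k : 0 <= (W k)%:E. Proof. by rewrite lee_fin ltW. Qed.

Notation hn := (hn E W p q).

(** The index type also contains multi-indices longer than [m]; they are given the value 0. *)
Definition jet_shell D k (b : {ffun 'I_n -> 'I_m.+1}) : \bar R :=
  if (mlength (mindex b) <= m)%N then 'N[mu]_p%:E[D (mindex b) \_ (E k)] else 0.

Definition jn D : \bar R := ell q (fun k => (W k)%:E * fell p (jet_shell D k)).

Let jet_shell_ge0 D k (c : {ffun 'I_n -> 'I_m.+1}) : 0 <= jet_shell D k c.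
Proof. by rewrite /jet_shell; case: ifP => // _; exact: Lnorm_ge0. Qed.

Let term_ge0 D k : 0 <= (W k)%:E * fell p (jet_shell D k).
Proof. by apply: mule_ge0 => //; exact: fell_ge0. Qed.

Lemma jn_ge0 D : 0 <= jn D. Proof. exact: ell_ge0. Qed.

Lemma le_jn_shell D D' :
  (forall b k, (mlength b <= m)%N -> 'N[mu]_p%:E[D b \_ (E k)] <= 'N[mu]_p%:E[D' b \_ (E k)]) ->
  jn D <= jn D'.
Proof.
move=> DD'; apply: le_ell => // k; apply: lee_wpmul2l => //; apply: le_fell => // b.
by rewrite /jet_shell; case: ifP => // bm; exact: DD'.
Qed.

Definition jet_fun D := forall b, (mlength b <= m)%N ->
  measurable_fun setT (D b) /\ forall x, 0 <= D b x.

Let patch_ge0 (f : X -> \bar R) k : (forall x, 0 <= f x) -> forall x, 0 <= (f \_ (E k)) x.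
Proof. by move=> f0 x; rewrite patchE; case: ifP. Qed.

Lemma ae_le_jn D D' : jet_fun D -> jet_fun D' ->
  (forall b, (mlength b <= m)%N -> {ae mu, forall x, D b x <= D' b x}) -> jn D <= jn D'.
Proof.
move=> jD jD' DD'; apply: le_jn_shell => b k bm.
have [mD D0] := jD b bm; have [mD' D'0] := jD' b bm.
apply: ae_le_Lnorm => //; [exact: measurable_restr|exact: measurable_restr|exact: patch_ge0|exact: patch_ge0|].
by apply: filterS (DD' b bm) => x Dx; rewrite !patchE; case: ifP.
Qed.

Lemma ae_eq_jn D D' : jet_fun D -> jet_fun D' ->
  (forall b, (mlength b <= m)%N -> {ae mu, forall x, D b x = D' b x}) -> jn D = jn D'.
Proof.
move=> jD jD' DD'; apply/eqP; rewrite eq_le; apply/andP; split; apply: ae_le_jn => // b bm;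
  by apply: filterS (DD' b bm) => x ->.
Qed.

Lemma jnZ D (c : \bar R) : jet_fun D -> 0 <= c -> jn (fun b x => c * D b x) = c * jn D.
Proof.
move=> jD c0; rewrite -ellZ//; congr ell; apply/funext => k.
rewrite muleCA; congr (_ * _); rewrite -fellZ//; congr fell; apply/funext => b.
rewrite /jet_shell; case: ifP => [bm|_]; last by rewrite mule0.
have [mD D0] := jD _ bm; rewrite -ge0_LnormZ//; [|exact: measurable_restr|exact: patch_ge0].
by congr Lnorm; apply/funext => x; rewrite !patchE; case: ifP => //; rewrite mule0.
Qed.

Lemma jn_nneseries (D : nat -> mindices -> X -> \bar R) : (forall j, jet_fun (D j)) ->
  jn (fun b x => \sum_(0 <= j <oo) D j b x) <= \sum_(0 <= j <oo) jn (D j).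
Proof.
move=> jD; apply: le_trans (ell_nneseries q1 _); last by move=> j k.
apply: le_ell => // k; rewrite ge0_nneseriesZl//; last by move=> j; exact: fell_ge0.
apply: lee_wpmul2l => //; apply: le_trans (fell_nneseries (ltW p1) _) => //.
apply: le_fell => // b; rewrite /jet_shell; case: ifP => [bm|_]; last by apply: nneseries_ge0.
apply: le_trans (Lnorm_nneseries_le _ (ltW p1) _ _); last 2 first.
- by move=> j; apply: measurable_restr => //; have [] := jD j _ bm.
- by move=> j; apply: patch_ge0; have [] := jD j _ bm.
rewrite le_eqVlt; apply/orP; left; apply/eqP; congr Lnorm; apply/funext => x.
by rewrite patchE; case: ifPn => xE; [apply: eq_eseriesr => j _|rewrite eseries0// => j _ _]; rewrite patchE ?xE// (negbTE xE).
Qed.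

Lemma jnD D D' : jet_fun D -> jet_fun D' -> jn (fun b x => D b x + D' b x) <= jn D + jn D'.
Proof.
move=> jD jD'; apply: le_trans (ellD q1 _ _) => //.
apply: le_ell => // k; rewrite -ge0_muleDr; [|exact: fell_ge0|exact: fell_ge0].
apply: lee_wpmul2l => //; apply: le_trans (fellD (ltW p1) _ _) => //.
apply: le_fell => // b; rewrite /jet_shell; case: ifP => [bm|_]; last by rewrite adde0.
have [mD D0] := jD _ bm; have [mD' D'0] := jD' _ bm.
apply: le_trans (@ge0_minkowski _ _ _ mu p (D (mindex b) \_ (E k)) (D' (mindex b) \_ (E k)) (ltW p1) _ _ _ _);
  [|exact: measurable_restr|exact: measurable_restr|exact: patch_ge0|exact: patch_ge0].
rewrite le_eqVlt; apply/orP; left; apply/eqP; congr Lnorm; apply/funext => x.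
by rewrite !patchE; case: ifP; rewrite ?adde0.
Qed.

Lemma hn_le_jn D b : (mlength b <= m)%N -> hn (D b) <= jn D.
Proof.
move=> bm; apply: le_ell => // k; first by apply: mule_ge0 => //; exact: Lnorm_ge0.
apply: lee_wpmul2l => //; have [c cE] := mindex_surj bm.
have -> : 'N[mu]_p%:E[D b \_ (E k)] = jet_shell D k c by rewrite /jet_shell cE bm.
exact: fell_ub.
Qed.

(** Together with [hn_le_jn], this makes the norm of a jet equivalent to the sum of the norms of its
    entries. *)
Lemma jn_le_hn D : jet_fun D ->
  jn D <= \sum_(b : {ffun 'I_n -> 'I_m.+1} | (mlength (mindex b) <= m)%N) hn (D (mindex b)).
Proof.
move=> jD.
have H (L : seq {ffun 'I_n -> 'I_m.+1}) : ell q (fun k => \sum_(b <- L) (W k)%:E * jet_shell D k b) <=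
    \sum_(b <- L) ell q (fun k => (W k)%:E * jet_shell D k b).
  elim: L => [|b L IH].
    rewrite big_nil; under [X in ell q X]eq_fun do rewrite big_nil.
    by rewrite /ell eseries0 ?poweR0r ?invr_eq0 ?gt_eqF// => k _ _; rewrite poweR0r// gt_eqF.
  rewrite big_cons; under [X in ell q X]eq_fun do rewrite big_cons.
  apply: le_trans (ellD q1 _ _) _ => [k|k|].
  - exact: mule_ge0.
  - by apply: sume_ge0 => c _; exact: mule_ge0.
  - exact: leeD.
apply: le_trans (_ : _ <= \sum_b ell q (fun k => (W k)%:E * jet_shell D k b)) _.
  apply: le_trans (H _); apply: le_ell => // k.
  rewrite -ge0_sume_distrr//; apply: lee_wpmul2l => //.
  exact: fell_le_sum (ltW p1) _.
rewrite [leRHS]big_mkcond; apply: lee_sum => b _; rewrite /jet_shell; case: ifP => // _.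
by rewrite /ell eseries0 ?poweR0r ?invr_eq0 ?gt_eqF// => k _ _; rewrite mule0 poweR0r// gt_eqF.
Qed.

End jets.

(** * Limits of weak derivatives *)

Section weak_derivative_uniqueness.
Context {R : realType} {n : nat}.
Notation X := 'rV[R]_n.
Notation mu := (lebesgue_rV n).
Notation mindices := ('I_n -> nat).
Implicit Types (x y w : X) (k j : nat) (b : mindices) (Omega U K : set X) (f g : X -> R).
Local Open Scope ereal_scope.

(** [K k] consists of the points of norm at most [k] at distance at least [1 / (k + 1)] from the
    complement, and [U k] is its interior. *)
Lemma open_exhaustion Omega : open Omega -> exists U K : nat -> set X,
  (forall k, [/\ open (U k), compact (K k), U k `<=` K k & K k `<=` Omega]) /\ Omega `<=` \bigcup_k U k.
Proof.
move=> oO; pose K k := [set x : X | `|x| <= k%:R]%R `&` ~` \bigcup_(y in ~` Omega) ball y (k.+1%:R^-1 : R).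
exists (fun k => interior (K k)), K; split=> [k|x Ox].
  split; [exact: open_interior| |exact: interior_subset|].
    apply: bounded_closed_compact.
      exists k%:R; split; first exact: num_real.
      by move=> M kM x [/= xk _]; exact: le_trans xk (ltW kM).
    apply: closedI; first by apply: closed_comp (@closed_le _ k%:R) => x _; exact: norm_continuous.
    by apply: open_closedC; apply: bigcup_open => y _; exact: ball_open.
  move=> x [_ nb]; apply: contrapT => nO; apply: nb; exists x => //.
  by apply: ballxx; rewrite invr_gt0.
have [d /= d0 Bd] := (nbhs_ballP _ _).1 (open_nbhs_nbhs (conj oO Ox)).
(* If a ball of radius [d] about [x] lies in [Omega], the one of radius [d / 2] lies in [K k] once
   [1 / (k + 1) < d / 2]. *)
pose k := (Num.bound (2 / d) + Num.bound (`|x| + d))%N.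
have k1 : (2 / d < k.+1%:R)%R.
  by apply: lt_le_trans (archi_boundP _) _; [exact: divr_ge0 (ltW d0)|rewrite ler_nat ltnW// ltnS leq_addr].
have k2 : (`|x| + d <= k%:R)%R.
  by apply: le_trans (ltW (archi_boundP _)) _; [rewrite addr_ge0// ltW|rewrite ler_nat leq_addl].
exists k => //; apply/nbhs_ballP; exists (d / 2)%R => /=; first exact: divr_gt0.
move=> y; rewrite -ball_normE /= => xy; split => /=.
  apply: le_trans k2; rewrite -[y](subrK x) addrC; apply: le_trans (ler_normD _ _) _.
  by rewrite lerD2l distrC; apply: le_trans (ltW xy) _; rewrite ler_pdivrMr// ler_peMr ?ler1n// ltW.
move=> [z nz]; rewrite -ball_normE /= => zy; apply: nz; apply: Bd; rewrite -ball_normE /=.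
have h : (k.+1%:R^-1 < d / 2 :> R)%R by rewrite -[(d / 2)%R]invrK ltf_pV2 ?posrE ?invr_gt0 ?divr_gt0// invf_div.
have D := ler_distD y x z; rewrite (distrC x z) (distrC y z) in D.
rewrite (distrC x z); move: D xy zy h; move: (`|x - y|)%R (`|z - y|)%R (`|z - x|)%R (k.+1%:R^-1)%R => a b' c e; clear; lra.
Qed.

Lemma Lp_loc_locint Omega U K g : open Omega -> Lp_loc 1 Omega g -> open U -> compact K ->
  U `<=` K -> K `<=` Omega -> locint (g \_ U).
Proof.
move=> oO [mg gK] oU cK UK KO; have mO := open_measurable_rV oO; have mU := open_measurable_rV oU.
have mK : measurable K by apply: closed_measurable_rV; apply: compact_closed => //; exact: norm_hausdorff.
have mres A : measurable A -> A `<=` Omega -> measurable_fun setT (g \_ A).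
  by move=> mA AO; apply: (measurable_restrictT g mA).1; exact: measurable_funS mg.
split=> [|k]; first by apply: mres => //; exact: subset_trans KO.
apply: le_lt_trans (gK K cK KO); rewrite /Lp_norm Lnorm1.
rewrite [leLHS]integral_mkcond.
apply: ge0_le_integral => //.
- by move=> x _; rewrite patchE; case: ifP.
- apply: measurable_restr; first exact: measurable_cube.
  by apply/measurable_EFinP; apply: measurableT_comp => //; apply: mres => //; exact: subset_trans KO.
- by apply: measurableT_comp => //; apply/measurable_EFinP; exact: mres.
- move=> x _; rewrite patchE; case: ifP => //= _; rewrite lee_fin !patchE.
  by case: ifPn => [/set_mem/UK Kx|_]; [rewrite mem_set|rewrite normr0 normr_ge0].
  exact: normr_ge0.
Qed.

(** The fundamental lemma requires integrability up to the boundary, so it is applied on each set of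
    an exhaustion, to functions cut off there. *)
Lemma is_weak_deriv_unique Omega b f g h : open Omega ->
  is_weak_deriv Omega b f g -> is_weak_deriv Omega b f h -> {ae mu, forall x, Omega x -> g x = h x}.
Proof.
move=> oO [_ lg Hg] [_ lh Hh]; have [U [K [UK cov]]] := open_exhaustion oO.
have N k : {ae mu, forall x, U k x -> (g \_ (U k)) x = (h \_ (U k)) x}.
  have [oU cK sUK sKO] := UK k.
  have l1 := Lp_loc_locint oO lg oU cK sUK sKO; have l2 := Lp_loc_locint oO lh oU cK sUK sKO.
  have l : locint (fun x => (g \_ (U k)) x + (-1) * (h \_ (U k)) x)%R by apply: locintD => //; exact: locintZ.
  suff : {ae mu, forall x, U k x -> ((g \_ (U k)) x + (-1) * (h \_ (U k)) x = 0)%R}.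
    by apply: filterS => x /[apply] /eqP; rewrite mulN1r subr_eq0 => /eqP.
  apply: (fundamental_lemma oU l) => phi tphi.
  have tO : test_function Omega phi by case: tphi => s c sub; split => //; apply: subset_trans sub _; exact: subset_trans sKO.
  have [_ _ sub] := tphi.
  have ig := test_integrable l1 tphi; have ih := test_integrable l2 tphi.
  have E (u : X -> R) : \int[mu]_(x in Omega) (u x * phi x)%:E = \int[mu]_x ((u \_ (U k)) x * phi x)%:E.
    rewrite integral_mkcond; apply: eq_integral => x _; rewrite !patchE.
    case: ifPn => [_|nO]; case: ifPn => [_|nU] //.
    - by rewrite (supp_out (f := phi)) ?mulr0// => /sub; move: nU; rewrite notin_setE.
    - by rewrite (supp_out (f := phi)) ?mulr0// => /sub/sUK/sKO; move: nO; rewrite notin_setE.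
    - by rewrite mul0r.
  have EE : \int[mu]_x ((g \_ (U k)) x * phi x)%:E = \int[mu]_x ((h \_ (U k)) x * phi x)%:E.
    rewrite -(fineK (integrable_fin_num measurableT ig)) -(fineK (integrable_fin_num measurableT ih)) -!E; congr EFin.
    have s1 : ((-1) ^+ mlength b * (-1) ^+ mlength b = 1 :> R)%R by rewrite -exprMn mulrNN mulr1 expr1n.
    have := Hg _ tO; rewrite (Hh _ tO) => /(congr1 (fun z : R => (-1) ^+ mlength b * z)%R).
    by rewrite !mulrA s1 !mul1r.
  transitivity (\int[mu]_x (((g \_ (U k)) x * phi x)%:E - ((h \_ (U k)) x * phi x)%:E)).
    by apply: eq_integral => x _; rewrite -EFinB; congr EFin; ring.
  by rewrite integralB// EE subee//; exact: integrable_fin_num.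
have : {ae mu, forall x k, U k x -> (g \_ (U k)) x = (h \_ (U k)) x} by exact/ae_foralln.
apply: filterS => x H /cov[k _ Ux]; have := H k Ux.
by rewrite !patchE mem_set.
Qed.

End weak_derivative_uniqueness.

(** The increments telescope and their series converges absolutely; its tails bound the distance to
    the limit. *)
Lemma summable_increments {R : realType} (d : nat -> R) :
  (\sum_(0 <= j <oo) `|d j.+1 - d j|%:E < +oo)%E ->
  exists2 l : R, d @ \oo --> l &
    forall J, (`|l - d J|%:E <= \sum_(0 <= j <oo) `|d (J + j).+1 - d (J + j)%N|%:E)%E.
Proof.
move=> doo.
have ctel : cvgn (series (fun j => d j.+1 - d j)).
  apply: normed_cvg; have : cvgn (fun N => \sum_(0 <= j < N) `|d j.+1 - d j|).
    apply: nondecreasing_is_cvgn; first exact: nondecreasing_series.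
    exists (fine (\sum_(0 <= j <oo) `|d j.+1 - d j|%:E)%E) => _ [N _ <-].
    rewrite -lee_fin fineK; last by rewrite ge0_fin_numE// nneseries_ge0.
    by rewrite -sumEFin; apply: nneseries_lim_ge.
  by [].
have dE N : d N = d 0%N + series (fun j => d j.+1 - d j) N.
  by rewrite /series /= telescope_sumr// addrC subrK.
have cd : d @ \oo --> d 0%N + limn (series (fun j => d j.+1 - d j)).
  rewrite [X in X @ _](_ : d = fun N => d 0%N + series (fun j => d j.+1 - d j) N); last by apply/funext.
  by apply: cvgD => //; exact: cvg_cst.
exists (d 0%N + limn (series (fun j => d j.+1 - d j))) => // J.
set l := _ + _ in cd *.
have cJ : (fun N => `|d (N + J)%N - d J|) @ \oo --> `|l - d J|.
  by apply: cvg_norm; apply: cvgB; [rewrite (cvg_shiftn J d)|exact: cvg_cst].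
have cJ' : (fun N => `|d (N + J)%N - d J|%:E)%E @ \oo --> (`|l - d J|%:E)%E by apply: cvg_EFin => //; exact: nearW.
rewrite -(cvg_lim _ cJ')//; apply: lime_le; first by apply/cvg_ex; eexists; exact: cJ'.
apply: nearW => N; apply: (@le_trans _ _ (\sum_(0 <= j < N) `|d (J + j).+1 - d (J + j)%N|%:E)%E).
  rewrite sumEFin lee_fin; apply: le_trans (ler_norm_sum _ _ _).
  have := telescope_sumr (fun j => d (J + j)%N) (leq0n N); rewrite addn0 addnC => <-.
  by rewrite le_eqVlt; apply/orP; left; apply/eqP; congr (`| _ |); apply: eq_bigr => j _; rewrite addnS.
exact: nneseries_lim_ge.
Qed.

Lemma le0_of_geometric {R : realType} (t c : R) : (forall j, t <= c * 2^-1 ^+ j) -> t <= 0.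
Proof.
move=> H; have : (fun j => c * 2^-1 ^+ j) @ \oo --> c * 0.
  apply: cvgM; first exact: cvg_cst.
  by apply: cvg_expr; rewrite ger0_norm ?invr_ge0// invf_lt1// ltr1n.
rewrite mulr0 => cv; rewrite -(cvg_lim _ cv)//; apply: limr_ge; first by apply/cvg_ex; exists 0.
exact: nearW.
Qed.

Section weak_limit.
Context {R : realType} {n : nat}.
Notation X := 'rV[R]_n.
Notation mu := (lebesgue_rV n).
Notation mindices := ('I_n -> nat).
Implicit Types (x y w : X) (k j : nat) (b : mindices) (Omega U K : set X) (f g : X -> R).
Local Open Scope ereal_scope.

(** The cube and the bound depend on [phi] alone, so they can be fixed before an index tends to
    infinity. *)
Lemma test_integral_close Omega f g phi : test_function Omega phi -> exists k, exists2 M : R, (0 <= M)%R &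
  forall f g, locint f -> locint g ->
  (`|fine (\int[mu]_x (f x * phi x)%:E) - fine (\int[mu]_x (g x * phi x)%:E)|%:E <=
    M%:E * \int[mu]_(x in cube k) `|f x - g x|%:E).
Proof.
move=> tphi; have [k Hk] := test_cube tphi; have [M M0 HM] := test_bounded tphi.
exists k, M => // {}f {}g lf lg.
have If := test_integrable lf tphi; have Ig := test_integrable lg tphi.
have lfg : locint (fun x => f x + (-1) * g x)%R by apply: locintD => //; exact: locintZ.
have mfg := lfg.1; have mphi : measurable_fun setT phi by apply: continuous_measurable_rV; apply: smooth_continuous; case: tphi.
set A := \int[mu]_x (f x * phi x)%:E; set B := \int[mu]_x (g x * phi x)%:E.
have fA : A \is a fin_num by exact: integrable_fin_num.
have fB : B \is a fin_num by exact: integrable_fin_num.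
have -> : (`|fine A - fine B|%:E = `|\int[mu]_x ((f x * phi x)%:E - (g x * phi x)%:E)|).
  by rewrite integralB// -/A -/B -{2}(fineK fA) -{2}(fineK fB).
have mE : measurable_fun setT (fun x => (f x * phi x)%:E - (g x * phi x)%:E).
  by apply: emeasurable_funB; [have /integrableP[] := If|have /integrableP[] := Ig].
apply: le_trans (le_abse_integral mu measurableT mE) _.
rewrite -ge0_integralZl_EFin//; [|exact: measurable_cube|]; last first.
  apply/measurable_EFinP; apply: measurable_funTS; apply: measurableT_comp => //.
  by apply: measurable_funB; [exact: lf.1|exact: lg.1].
rewrite [leRHS]integral_mkcond; apply: ge0_le_integral => //.
- exact: measurableT_comp.
- apply: measurable_restr; first exact: measurable_cube.
  apply/measurable_EFinP; apply: measurable_funM => //; apply: measurableT_comp => //.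
  by apply: measurable_funB; [exact: lf.1|exact: lg.1].
- move=> x _; rewrite patchE; case: ifPn => [_|]; last first.
    by rewrite notin_setE => /Hk ->; rewrite !mulr0 subee// abse0.
  by rewrite -EFinB -mulrBl abse_EFin normrM mulrC -EFinM lee_fin ler_wpM2r.
Qed.

(** Both sides of the defining identity are within a constant times [2 ^ (- j)] of those for index
    [j], where it holds exactly. *)
Lemma wderiv_limit Omega b (f0 g0 : X -> R) (f g : nat -> X -> R) (c : nat -> R) :
  locint f0 -> locint g0 -> (forall j, locint (f j)) -> (forall j, locint (g j)) ->
  (forall j, wderiv Omega b (f j) (g j)) ->
  (forall k j, \int[mu]_(x in cube k) `|f0 x - f j x|%:E <= (c k * 2^-1 ^+ j)%:E) ->
  (forall k j, \int[mu]_(x in cube k) `|g0 x - g j x|%:E <= (c k * 2^-1 ^+ j)%:E) ->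
  wderiv Omega b f0 g0.
Proof.
move=> lf lg lfj lgj H Hf Hg phi tphi; have tb := test_mpartial b tphi.
have [k1 [M1 M10 H1]] := test_integral_close f0 f0 tb.
have [k2 [M2 M20 H2]] := test_integral_close f0 f0 tphi.
rewrite -(fineK (integrable_fin_num measurableT (test_integrable lf tb))).
rewrite -(fineK (integrable_fin_num measurableT (test_integrable lg tphi))) -EFinM; congr EFin.
apply/eqP; rewrite -subr_eq0 -normr_le0; apply: (@le0_of_geometric _ _ (M1 * c k1 + M2 * c k2)) => j.
have E : fine (\int[mu]_x (f j x * mpartial b phi x)%:E) = ((-1) ^+ mlength b * fine (\int[mu]_x (g j x * phi x)%:E))%R.
  by rewrite (H j _ tphi) fineM//; exact: (integrable_fin_num measurableT (test_integrable (lgj j) tphi)).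
have h1 := le_trans (H1 _ _ lf (lfj j)) (lee_wpmul2l _ (Hf k1 j)).
have h2 := le_trans (H2 _ _ lg (lgj j)) (lee_wpmul2l _ (Hg k2 j)).
have {}h1 := h1 (M10 : 0 <= M1%:E); have {}h2 := h2 (M20 : 0 <= M2%:E).
rewrite -EFinM lee_fin in h1; rewrite -EFinM lee_fin in h2.
move: h1 h2; rewrite E; set a := fine _; set s := ((-1) ^+ _)%R; set y := fine _; set z := fine _ => h1 h2.
have s1 : (`|s| = 1)%R by rewrite normrX normrN1 expr1n.
rewrite (_ : a - s * z = (a - s * y) + s * (y - z))%R; last by ring.
apply: le_trans (ler_normD _ _) _; rewrite normrM s1 mul1r distrC (distrC y).
by rewrite mulrDl -!mulrA; apply: lerD => //; rewrite distrC.
Qed.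

End weak_limit.

(** * Sobolev spaces over a system of shells *)

Section sobolev.
Context {R : realType} {n : nat}.
Notation X := 'rV[R]_n.
Notation mu := (lebesgue_rV n).
Notation mindices := ('I_n -> nat).
Implicit Types (x y w : X) (k j : nat) (b : mindices) (f g : X -> R) (D : mindices -> X -> R).
Variables (E : nat -> set X) (W : nat -> R) (p q : R) (m : nat) (Omega : set X).
Hypothesis n0 : (0 < n)%N.
Hypothesis mE : forall k, measurable (E k).
Hypothesis W0 : forall k, (0 < W k)%R.
Hypothesis p1 : (1 < p)%R.
Hypothesis q1 : (1 <= q)%R.
Hypothesis oO : open Omega.
Hypothesis E_cover : forall x, x != 0%R -> exists k, E k x.
Local Open Scope ereal_scope.
Notation hn := (hn E W p q).
Notation jn := (jn E W p q m).
Hypothesis hn_loc : forall K, exists2 C : R, (0 <= C)%R & forall F : X -> \bar R, measurable_fun setT F ->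
  (forall x, 0 <= F x) -> \int[mu]_(x in cube K) F x <= C%:E * hn F.

Let p0 : (0 < p)%R. Proof. exact: lt_trans p1. Qed.
Let q0 : (0 < q)%R. Proof. exact: lt_le_trans q1. Qed.
Let W0' k : 0 <= (W k)%:E. Proof. by rewrite lee_fin ltW. Qed.
Let mO : measurable Omega. Proof. exact: open_measurable_rV. Qed.

Notation absf f := (fun x => `|f x|%:E).
Notation absD D := (fun b x => `|D b x|%:E).
Notation zero := (fun=> 0%N : nat).

Definition herz_fun f := measurable_fun setT f /\ hn (absf f) < +oo.

Let mabs f : measurable_fun setT f -> measurable_fun setT (absf f).
Proof. by move=> mf; apply/measurable_EFinP; exact: measurableT_comp. Qed.

Let abs0 f x : 0 <= absf f x. Proof. by rewrite lee_fin. Qed.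

Lemma ae_eq_hn f g : measurable_fun setT f -> measurable_fun setT g ->
  {ae mu, forall x, f x = g x} -> hn (absf f) = hn (absf g).
Proof.
move=> mf mg fg; apply/eqP; rewrite eq_le; apply/andP; split; apply: ae_le_hn => //; do ?exact: mabs;
  by apply: filterS fg => x ->.
Qed.

Lemma herz_fun0 : herz_fun (cst 0%R).
Proof.
split; first exact: measurable_cst.
rewrite (_ : (fun x => _) = fun x : X => 0 * 0); last by apply/funext => x /=; rewrite normr0 mul0e.
by rewrite hnZ// ?mul0e//; exact: measurable_cst.
Qed.

Lemma hn_lin (a : R) f g : measurable_fun setT f -> measurable_fun setT g ->
  hn (fun x => `|a * f x + g x|%:E) <= `|a|%:E * hn (absf f) + hn (absf g).
Proof.
move=> mf mg; rewrite -hnZ//; last exact: mabs.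
have M1 : measurable_fun setT (fun x => `|a|%:E * `|f x|%:E) by apply: measurable_funeM; exact: mabs.
have P1 x : 0 <= `|a|%:E * `|f x|%:E by rewrite mule_ge0// lee_fin.
apply: le_trans (hnD mE W0 p1 q1 M1 (mabs mg) P1 (abs0 g)).
apply: le_hn => //.
- by apply: mabs; apply: measurable_funD => //; exact: measurable_funM.
- by apply: emeasurable_funD => //; exact: mabs.
- by move=> x; rewrite -EFinM -EFinD lee_fin -normrM; exact: ler_normD.
Qed.

Lemma herz_fun_lin (a : R) f g : herz_fun f -> herz_fun g -> herz_fun (fun x => a * f x + g x)%R.
Proof.
move=> [mf hf] [mg hg]; split; first by apply: measurable_funD => //; exact: measurable_funM.
apply: le_lt_trans (hn_lin a mf mg) _.
by rewrite lte_add_pinfty// lte_mul_pinfty.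
Qed.

Lemma herz_fun_locint f : herz_fun f -> locint f.
Proof.
move=> [mf hf]; split=> // K; have [C C0 HC] := hn_loc K.
by apply: le_lt_trans (HC _ (mabs mf) (abs0 f)) _; rewrite lte_mul_pinfty.
Qed.

Lemma hn_lty_ae (F : X -> \bar R) : measurable_fun setT F -> (forall x, 0 <= F x) -> hn F < +oo ->
  {ae mu, forall x, F x < +oo}.
Proof.
move=> mF F0 hF.
have N K : {ae mu, forall x, cube K x -> F x < +oo}.
  have [C C0 HC] := hn_loc K.
  have iF : mu.-integrable (cube K) F.
    apply/integrableP; split; first exact: measurable_funTS.
    under eq_integral do rewrite gee0_abs//.
    by apply: le_lt_trans (HC _ mF F0) _; rewrite lte_mul_pinfty.
  have := integrable_ae (measurable_cube K) iF.
  by apply: filterS => x /[apply]; rewrite ge0_fin_numE.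
have : {ae mu, forall x K, cube K x -> F x < +oo} by exact/ae_foralln.
apply: filterS => x H; have [K _ Kx] : (\bigcup_k cube k) x by rewrite cube_cover.
exact: H Kx.
Qed.

Lemma hn_eq0 f : measurable_fun setT f -> hn (absf f) = 0 -> {ae mu, forall x, f x = 0%R}.
Proof.
move=> mf hf.
have N k : {ae mu, forall x, E k x -> f x = 0%R}.
  have : (W k)%:E * 'N[mu]_p%:E[(absf f) \_ (E k)] <= 0 by rewrite -hf; exact: shell_le_hn.
  rewrite pmule_rle0 ?lte_fin// => h.
  have {}h : 'N[mu]_p%:E[(absf f) \_ (E k)] = 0 by apply/eqP; rewrite eq_le h Lnorm_ge0.
  have := Lnorm_eq0_eq0 (measurable_restr (mE k) (mabs mf)) _ h.
  rewrite lte_fin => /(_ p0); apply: filterS => x /(_ I) /=.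
  by rewrite patchE => + Ex; rewrite mem_set// => -[] /eqP; rewrite normr_eq0 => /eqP.
(* The shells may miss the origin, which is a null set because [0 < n]. *)
have H0 : {ae mu, forall x, x <> 0%R}.
  exists [set 0%R]; split; [|exact: null_point|].
    exact: closed_measurable_rV (compact_closed (@norm_hausdorff _ _) (@compact_set1 _ _)).
  by move=> x /=; apply: contra_notP => /[swap] ->.
have : {ae mu, forall x k, E k x -> f x = 0%R} by exact/ae_foralln.
move=> H; apply: filterS2 H0 H => x x0 H.
by have [k Ek] := E_cover (introN eqP x0); exact: H Ek.
Qed.

(** A full family of derivatives extended by zero. Jets are closed under linear combinations, limits
    and products, which avoids reasoning about the chosen [weak_deriv]. *)
Definition jet D := forall b, (mlength b <= m)%N ->
  [/\ wderiv Omega b (D zero) (D b), herz_fun (D b) & forall x, ~ Omega x -> D b x = 0%R].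

Definition sob f := herz_fun (f \_ Omega) /\
  forall b, (mlength b <= m)%N -> exists2 g, is_weak_deriv Omega b f g & herz_fun (g \_ Omega).

Definition sobN f : \bar R := jn (fun b x => `|(weak_deriv Omega b f \_ Omega) x|%:E).

Let patch_out f x : ~ Omega x -> (f \_ Omega) x = 0%R.
Proof. by move=> nO; rewrite patchE memNset. Qed.

Let patch_id f : (forall x, ~ Omega x -> f x = 0%R) -> f \_ Omega = f.
Proof.
move=> f0; apply/funext => x; rewrite patchE; case: ifPn => //.
by rewrite notin_setE => /f0.
Qed.

Lemma jet_jet_fun D : jet D -> jet_fun m (absD D).
Proof. by move=> jD b bm; have [_ [mD _] _] := jD b bm; split => //; exact: mabs. Qed.

(** [weak_deriv] picks some weak derivative because one exists, and by uniqueness it agrees with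
    [D b] almost everywhere on [Omega]; so any jet computes the norm. *)
Lemma jet_sob f D : D zero = f \_ Omega -> jet D -> sob f /\ sobN f = jn (absD D).
Proof.
move=> D0 jD; have m00 : (mlength (zero : mindices) <= m)%N by rewrite mlength0.
have [_ h0 _] := jD _ m00; rewrite D0 in h0.
have wd b : (mlength b <= m)%N -> is_weak_deriv Omega b f (D b).
  move=> bm; have [w hb out] := jD b bm.
  apply/is_weak_derivP => //; rewrite ?(patch_id out); do ?exact: herz_fun_locint.
  by rewrite -D0.
split; first by split=> // b bm; exists (D b); [exact: wd|have [_ hb out] := jD b bm; rewrite (patch_id out)].
have ae_eq b : (mlength b <= m)%N -> {ae mu, forall x, (weak_deriv Omega b f \_ Omega) x = D b x}.
  move=> bm; have H : is_weak_deriv Omega b f (weak_deriv Omega b f).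
    by apply: (@xgetPex _ (cst 0%R) [set g | is_weak_deriv Omega b f g]); exists (D b); exact: wd.
  have := is_weak_deriv_unique oO H (wd b bm); have [_ _ out] := jD b bm.
  apply: filterS => x h; rewrite patchE; case: ifPn => [/set_mem/h//|].
  by rewrite notin_setE => /out.
apply: ae_eq_jn => //; last by move=> b bm; apply: filterS (ae_eq b bm) => x ->.
  move=> b bm; split=> [|x]; last by rewrite lee_fin.
  apply: mabs; have H : is_weak_deriv Omega b f (weak_deriv Omega b f).
    by apply: (@xgetPex _ (cst 0%R) [set g | is_weak_deriv Omega b f g]); exists (D b); exact: wd.
  by have [_ [mw _] _] := H; exact: (measurable_restrictT _ mO).1.
exact: jet_jet_fun.
Qed.

Lemma sob_jet f : sob f -> exists2 D, D zero = f \_ Omega & jet D.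
Proof.
move=> [h0 H]; have [G HG] : exists G : mindices -> X -> R, forall b, (mlength b <= m)%N ->
    is_weak_deriv Omega b f (G b) /\ herz_fun (G b \_ Omega).
  have : forall b, exists g, (mlength b <= m)%N -> is_weak_deriv Omega b f g /\ herz_fun (g \_ Omega).
    move=> b; case: (boolP (mlength b <= m)%N) => [/H[g]|_]; [by exists g|by exists f].
  by move=> /choice[G HG]; exists G.
(* At order 0 the function itself is taken, so that the entry at [zero] is an equality and not only
   one almost everywhere. *)
exists (fun b => if mlength b == 0%N then f \_ Omega else G b \_ Omega); first by rewrite mlength0.
move=> b bm; rewrite mlength0 eqxx; case: ifPn => [b0|_].
  have -> : b = zero.
    by apply/funext => i; apply/eqP; rewrite -leqn0 -(eqP b0) le_mlength.
  by split; [exact: wderiv0|exact: h0|exact: patch_out].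
have [w hb] := HG b bm; split => //; last exact: patch_out.
by apply/is_weak_derivP => //; exact: herz_fun_locint.
Qed.

Lemma jet_lin (a : R) D D' : jet D -> jet D' -> jet (fun b x => a * D b x + D' b x)%R.
Proof.
move=> jD jD' b bm; have m00 : (mlength (zero : mindices) <= m)%N by rewrite mlength0.
have [w h o] := jD b bm; have [w' h' o'] := jD' b bm.
have [_ h0 _] := jD _ m00; have [_ h0' _] := jD' _ m00.
split; [|exact: herz_fun_lin|by move=> x nO; rewrite o// o'// mulr0 addr0].
apply: wderivD; do ?[exact: herz_fun_locint|exact: locintZ (herz_fun_locint _)] => //.
by apply: wderivZ => //; exact: herz_fun_locint.
Qed.

Lemma patch_lin (a : R) f g : (fun x => a * f x + g x)%R \_ Omega = (fun x => a * (f \_ Omega) x + (g \_ Omega) x)%R.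
Proof. by apply/funext => x; rewrite !patchE; case: ifP => // _; rewrite mulr0 addr0. Qed.

Lemma sob_lin (a : R) f g : sob f -> sob g -> sob (fun x => a * f x + g x)%R.
Proof.
move=> /sob_jet[D D0 jD] /sob_jet[D' D'0 jD'].
apply: (jet_sob (D := fun b x => a * D b x + D' b x)%R _ (jet_lin a jD jD')).1.
by rewrite patch_lin D0 D'0.
Qed.

Lemma sob0 : sob (cst 0%R).
Proof.
have E0 : (cst 0%R : X -> R) \_ Omega = cst 0%R by apply: patch_id.
apply: (jet_sob (D := fun _ => cst 0%R) _ _).1 => // b bm; split => //; last exact: herz_fun0.
move=> phi tphi; rewrite !integral0_eq ?mule0// => x _; by rewrite mul0r.
Qed.

Lemma sobN_ge0 f : 0 <= sobN f. Proof. exact: jn_ge0. Qed.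

Lemma jet_lty D : jet D -> jn (absD D) < +oo.
Proof.
move=> jD; apply: le_lt_trans (jn_le_hn E W0 p1 q1 (jet_jet_fun jD)) _.
by apply: lte_sum_pinfty => b bm; have [_ [_ h] _] := jD _ bm.
Qed.

Lemma sobN_lty f : sob f -> sobN f < +oo.
Proof.
by move=> /sob_jet[D D0 jD]; rewrite (jet_sob D0 jD).2; exact: jet_lty.
Qed.

Lemma sobNZ (a : R) f : sob f -> sobN (fun x => a * f x)%R = `|a|%:E * sobN f.
Proof.
move=> sf; have /sob_jet[D D0 jD] := sf.
have /sob_jet[Z Z0 jZ] := sob0.
have jaD : jet (fun b x => a * D b x)%R.
  move=> b bm; have m00 : (mlength (zero : mindices) <= m)%N by rewrite mlength0.
  have [w h o] := jD b bm; have [_ h0 _] := jD _ m00; split.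
  - by apply: wderivZ => //; exact: herz_fun_locint.
  - by rewrite [X in herz_fun X](_ : _ = fun x => a * D b x + cst 0 x)%R; [exact: herz_fun_lin herz_fun0|apply/funext => x; rewrite addr0].
  - by move=> x nO; rewrite o// mulr0.
rewrite (jet_sob D0 jD).2 (jet_sob (D := fun b x => a * D b x)%R _ jaD).2; last first.
  by rewrite D0; apply/funext => x; rewrite !patchE; case: ifP => // _; rewrite mulr0.
rewrite -jnZ//; last exact: jet_jet_fun.
by congr jn; apply/funext => b; apply/funext => x; rewrite normrM EFinM.
Qed.

Lemma sobND f g : sob f -> sob g -> sobN (fun x => f x + g x)%R <= sobN f + sobN g.
Proof.
move=> /sob_jet[D D0 jD] /sob_jet[D' D'0 jD'].
have H := jet_lin 1 jD jD'.
have -> : sobN (fun x => f x + g x)%R = jn (absD (fun b x => 1 * D b x + D' b x)%R).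
  have E1 : (fun b x => 1 * D b x + D' b x)%R zero = (fun x => 1 * f x + g x)%R \_ Omega.
    by rewrite patch_lin D0 D'0.
  rewrite -(jet_sob E1 H).2.
  by congr sobN; apply/funext => x; rewrite mul1r.
rewrite (jet_sob D0 jD).2 (jet_sob D'0 jD').2.
apply: le_trans (jnD mE W0 p1 q1 (jet_jet_fun jD) (jet_jet_fun jD')).
have jF := jet_jet_fun jD; have jF' := jet_jet_fun jD'.
apply: (ae_le_jn mE W0 p1 q1 (jet_jet_fun H)) => b bm.
  have [mD _] := jF b bm; have [mD' _] := jF' b bm.
  by split; [exact: emeasurable_funD|move=> x; rewrite -EFinD lee_fin addr_ge0].
by apply: aeW => x; rewrite mul1r -EFinD lee_fin ler_normD.
Qed.

Lemma sobN_eq0 f : sob f -> sobN f = 0 <-> {ae mu, forall x, Omega x -> f x = 0%R}.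
Proof.
move=> sf; have /sob_jet[D D0 jD] := sf; have m00 : (mlength (zero : mindices) <= m)%N by rewrite mlength0.
have [_ h0 _] := jD _ m00; rewrite D0 in h0.
split=> [N0|f0].
  have : hn (absf (D zero)) = 0.
    apply/eqP; rewrite eq_le hn_ge0 andbT -N0 (jet_sob D0 jD).2.
    exact: (hn_le_jn E W0 p1 q1 (absD D) m00).
  rewrite D0 => /(hn_eq0 h0.1); apply: filterS => x + Ox.
  by rewrite patchE mem_set.
have f0' : {ae mu, forall x, (f \_ Omega) x = 0%R}.
  by apply: filterS f0 => x h; rewrite patchE; case: ifPn => // /set_mem/h.
(* A function null on [Omega] has this jet, with all higher derivatives zero. *)
pose Z b := if mlength b == 0%N then f \_ Omega else cst 0%R.
have Z0 : Z zero = f \_ Omega by rewrite /Z mlength0.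
have aeZ b : {ae mu, forall x, Z b x = 0%R} by rewrite /Z; case: ifP => // _; exact: aeW.
have jZ : jet Z.
  move=> b bm; rewrite Z0; split.
  - rewrite /Z; case: ifPn => [b0|_].
      have -> : b = zero by apply/funext => i; apply/eqP; rewrite -leqn0 -(eqP b0) le_mlength.
      exact: wderiv0.
    move=> phi tphi; rewrite [X in _ = _ * X]integral0_eq ?mule0; last by move=> x _; rewrite mul0r.
    rewrite (ae_eq_integral (cst 0)) ?integral0//.
      apply/measurable_EFinP; apply: measurable_funM; first exact: h0.1.
      by apply: continuous_measurable_rV; apply: smooth_continuous; case: (test_mpartial b tphi).
    by apply: filterS f0' => x -> _; rewrite mul0r.
  - by rewrite /Z; case: ifP => // _; exact: herz_fun0.
  - by move=> x nO; rewrite /Z; case: ifP => // _; exact: patch_out.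
rewrite (jet_sob Z0 jZ).2; apply/eqP; rewrite eq_le jn_ge0 andbT.
apply: le_trans (jn_le_hn E W0 p1 q1 (jet_jet_fun jZ)) _.
rewrite big1// => b bm; have [_ [mZ _] _] := jZ _ bm.
have mc : measurable_fun setT (cst 0%R : X -> R) by exact: measurable_cst.
rewrite (ae_eq_hn mZ mc (aeZ _)).
rewrite (_ : (fun x => _) = fun x : X => 0 * 0); last by apply/funext => x /=; rewrite normr0 mul0e.
by rewrite hnZ// ?mul0e//; exact: measurable_cst.
Qed.

Lemma limn_esup_EFin (d : nat -> R) (l : R) : d @ \oo --> l -> limn_esup (EFin \o d) = l%:E.
Proof.
move=> dl; have c : EFin \o d @ \oo --> l%:E by apply: cvg_EFin => //; exact: nearW.
rewrite is_cvg_limn_esupE; first exact: (cvg_lim _ c).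
by apply/cvg_ex; exists l%:E.
Qed.

(** A fast Cauchy sequence of jets: the absolute increments have a sum of finite norm, hence finite
    almost everywhere, so every derivative converges pointwise with an explicit remainder. *)
Lemma sob_complete (u : nat -> X -> R) : (forall j, sob (u j)) ->
  (forall j, sobN (fun x => -1 * u j x + u j.+1 x)%R <= (2^-1 ^+ j)%:E) ->
  exists2 f, sob f & forall j, sobN (fun x => -1 * u j x + f x)%R <= (2 * 2^-1 ^+ j)%:E.
Proof.
move=> su Nu; have m00 : (mlength (zero : mindices) <= m)%N by rewrite mlength0.
have [D HD] : exists D : nat -> mindices -> X -> R, forall j, D j zero = u j \_ Omega /\ jet (D j).
  have : forall j, exists D, D zero = u j \_ Omega /\ jet D by move=> j; have [D D0 jD] := sob_jet (su j); exists D.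
  by move=> /choice[D HD]; exists D.
pose H j b x := (-1 * D j b x + D j.+1 b x)%R.
have jH j : jet (H j) by apply: jet_lin; [exact: (HD j).2|exact: (HD j.+1).2].
have NH j : jn (absD (H j)) <= (2^-1 ^+ j)%:E.
  apply: le_trans (Nu j).
  have E1 : H j zero = (fun x => -1 * u j x + u j.+1 x)%R \_ Omega.
    by rewrite patch_lin -(HD j).1 -(HD j.+1).1.
  by rewrite (jet_sob E1 (jH j)).2.
(* These tails dominate the distance from the limit to the entry of index [J], both pointwise and in
   norm. *)
pose T J b x := \sum_(0 <= j <oo) `|H (J + j)%N b x|%:E.
have jT J : jet_fun m (T J).
  move=> b bm; split=> [|x]; last by apply: nneseries_ge0.
  by apply: measurable_nneseries => // j; have [] := jet_jet_fun (jH (J + j)%N) bm.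
have h01 : (0 <= (2^-1 : R) < 1)%R by rewrite invr_ge0 ler0n invf_lt1 ?ltr1n.
have NT J : jn (T J) <= (2 * 2^-1 ^+ J)%:E.
  apply: le_trans (jn_nneseries mE W0 p1 q1 (fun j => jet_jet_fun (jH (J + j)%N))) _.
  apply: (@le_trans _ _ (\sum_(0 <= j <oo) ((2^-1 ^+ J)%:E * (2^-1 ^+ j)%:E))).
    apply: lee_nneseries => j _; first by move=> _; exact: jn_ge0.
    by rewrite -EFinM -exprD; exact: NH.
  rewrite ge0_nneseriesZl; [|by rewrite lee_fin exprn_ge0// invr_ge0|by move=> j; rewrite lee_fin exprn_ge0// invr_ge0].
  rewrite nneseries_geometric// -EFinM lee_fin mulrC.
  by rewrite (_ : (1 - 2^-1)^-1 = 2 :> R)%R//; field.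
(* An upper limit exists everywhere, is measurable, and vanishes outside [Omega]; almost everywhere
   it is the limit. *)
pose G b x := fine (limn_esup (EFin \o (fun j => D j b x))).
have NTb J b : (mlength b <= m)%N -> hn (T J b) <= (2 * 2^-1 ^+ J)%:E.
  by move=> bm; apply: le_trans (NT J); exact: (hn_le_jn E W0 p1 q1 (T J) bm).
have key b : (mlength b <= m)%N -> {ae mu, forall x, forall J, `|G b x - D J b x|%:E <= T J b x}.
  move=> bm; have [mT T0] := jT 0%N b bm.
  have := hn_lty_ae mT T0 (le_lt_trans (NTb 0%N b bm) (ltry _)).
  apply: filterS => x Tx.
  have E1 J : T J b x = \sum_(0 <= j <oo) `|D (J + j).+1 b x - D (J + j)%N b x|%:E.
    by apply: eq_eseriesr => j _; rewrite /H mulN1r addrC.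
  have [l dl Hl] : exists2 l : R, (fun j => D j b x) @ \oo --> l &
      forall J, `|l - D J b x|%:E <= \sum_(0 <= j <oo) `|D (J + j).+1 b x - D (J + j)%N b x|%:E.
    by apply: summable_increments; rewrite -(E1 0%N).
  by move=> J; rewrite E1 /G (limn_esup_EFin dl).
have mG b : (mlength b <= m)%N -> measurable_fun setT (G b).
  move=> bm; have mL : measurable_fun setT (fun x => limn_esup (fun j => (D j b x)%:E)).
    apply: (measurable_fun_limn_esup (f := fun j x => (D j b x)%:E)) => j; apply/measurable_EFinP.
    by have [_ [] ] := (HD j).2 b bm.
  exact: (measurableT_comp (fine_measurable measurableT) mL).
have outG b x : (mlength b <= m)%N -> ~ Omega x -> G b x = 0%R.
  move=> bm nO; rewrite /G (@limn_esup_EFin _ 0%R)//.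
  by rewrite (_ : (fun j => _) = cst 0%R); [exact: cvg_cst|apply/funext => j; have [_ _ ->] := (HD j).2 b bm].
have hG b : (mlength b <= m)%N -> herz_fun (G b).
  move=> bm; split; first exact: mG.
  have [_ [mD hD] _] := (HD 0%N).2 b bm; have [mT T0] := jT 0%N b bm.
  apply: (@le_lt_trans _ _ (hn (fun x => absf (D 0%N b) x + T 0%N b x))).
    apply: ae_le_hn => //; [exact: mabs (mG b bm)|exact: emeasurable_funD (mabs mD) mT| |].
      by move=> x; rewrite adde_ge0.
    apply: filterS (key b bm) => x /(_ 0%N) h; apply: le_trans (leeD (lexx _) h).
    by rewrite -EFinD lee_fin -{1}[G b x](subrK (D 0%N b x)) addrC; exact: ler_normD.
  apply: le_lt_trans (hnD mE W0 p1 q1 (mabs mD) mT (abs0 _) T0) _.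
  by rewrite lte_add_pinfty//; exact: le_lt_trans (NTb 0%N b bm) (ltry _).
have [c Hc] : exists c : nat -> R, forall k, (0 <= c k)%R /\ forall F : X -> \bar R, measurable_fun setT F ->
    (forall x, 0 <= F x) -> \int[mu]_(x in cube k) F x <= (c k)%:E * hn F.
  have : forall k, exists c : R, (0 <= c)%R /\ forall F : X -> \bar R, measurable_fun setT F ->
    (forall x, 0 <= F x) -> \int[mu]_(x in cube k) F x <= c%:E * hn F.
    by move=> k; have [c c0 h] := hn_loc k; exists c.
  by move=> /choice[c Hc]; exists c.
have close b k j : (mlength b <= m)%N ->
    \int[mu]_(x in cube k) `|G b x - D j b x|%:E <= ((c k * 2) * 2^-1 ^+ j)%:E.
  move=> bm; have [mT T0] := jT j b bm; have [c0 hc] := Hc k; have [_ [mD _] _] := (HD j).2 b bm.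
  apply: (@le_trans _ _ (\int[mu]_(x in cube k) T j b x)).
    apply: ae_ge0_le_integral => //; [exact: measurable_cube| | |].
    - by apply: measurable_funTS; apply: mabs; exact: measurable_funB (mG b bm) mD.
    - exact: measurable_funTS.
    - by apply: filterS (key b bm) => x h _; exact: h.
  apply: le_trans (hc _ mT T0) _; rewrite -mulrA EFinM; apply: lee_wpmul2l => //.
  exact: NTb.
have jG : jet G.
  move=> b bm; split; [|exact: hG|by move=> x; exact: outG].
  apply: (@wderiv_limit _ _ Omega b (G zero) (G b) (fun j => D j zero) (fun j => D j b) (fun k => c k * 2)%R).
  - exact: herz_fun_locint (hG _ m00).
  - exact: herz_fun_locint (hG _ bm).
  - by move=> j; have [_ h _] := (HD j).2 _ m00; exact: herz_fun_locint.
  - by move=> j; have [_ h _] := (HD j).2 b bm; exact: herz_fun_locint.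
  - by move=> j; have [] := (HD j).2 b bm.
  - by move=> k j; exact: close.
  - by move=> k j; exact: close.
have G0 : G zero = G zero \_ Omega by rewrite patch_id// => x; exact: outG.
exists (G zero) => [|j]; first exact: (jet_sob G0 jG).1.
have jGD : jet (fun b x => -1 * D j b x + G b x)%R by apply: jet_lin => //; exact: (HD j).2.
have E1 : (fun b x => -1 * D j b x + G b x)%R zero = (fun x => -1 * u j x + G zero x)%R \_ Omega.
  by rewrite patch_lin -(HD j).1 -G0.
rewrite (jet_sob E1 jGD).2; apply: le_trans (NT j).
apply: (ae_le_jn mE W0 p1 q1 (jet_jet_fun jGD) (jT j)) => b bm.
by apply: filterS (key b bm) => x /(_ j); rewrite mulN1r addrC.
Qed.

(** * The product estimate *)

Section product.
Variable r : R.
Hypothesis m0 : (0 < m)%N.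
Hypothesis r0 : (0 < r)%R.
Hypothesis mult_hn : exists2 C : R, (0 < C)%R & forall F G : X -> R,
  measurable_fun setT F -> measurable_fun setT G ->
  (forall x, (0 <= F x)%R) -> (forall x, (0 <= G x)%R) ->
  (forall k l, (0 < k)%N -> (0 < l)%N -> (m <= k + l)%N ->
    hn (fun x => pot k r (EFin \o F) x * pot l r (EFin \o G) x) <=
      C%:E * (hn (EFin \o F) * hn (EFin \o G))) /\
  (forall j x, E j x -> pot m r (EFin \o G) x <= C%:E * hn (EFin \o G)).
Hypothesis jet_pot : exists2 C : R, (0 < C)%R & forall D, weak_jet m Omega D -> forall i, (i < m)%N ->
  {ae mu, forall x, jet_sum m D i x <= C%:E * pot (m - i) r (jet_sum m D m) x}.

Lemma jet_weak_jet D : jet D -> weak_jet m Omega D.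
Proof.
move=> jD; split=> [b bm|b i bm|b x bm nO].
- by have [_ h _] := jD b bm; exact: herz_fun_locint.
- have [w _ _] := jD b (ltnW bm).
  have bi : (mlength (incr b i) <= m)%N by rewrite mlength_incr.
  by have [w' _ _] := jD _ bi; exact: wderiv_step w w'.
- by have [_ _ ->] := jD b bm.
Qed.

Let jetR D x : R := (\sum_(b : {ffun 'I_n -> 'I_m.+1} | (mlength (mindex b) <= m)%N) `|D (mindex b) x|)%R.

Let jetRE D : jet_sum m D m = EFin \o jetR D.
Proof. by apply/funext => x; rewrite /jet_sum /= sumEFin. Qed.

Let hn_jetR D : jet D -> hn (EFin \o jetR D) <= (#|{ffun 'I_n -> 'I_m.+1}|%:R)%:E * jn (absD D).
Proof.
move=> jD; pose P (b : {ffun 'I_n -> 'I_m.+1}) := (mlength (mindex b) <= m)%N.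
have jF := jet_jet_fun jD.
have H (L : seq {ffun 'I_n -> 'I_m.+1}) :
    hn (fun x => \sum_(b <- L | P b) absD D (mindex b) x) <= \sum_(b <- L | P b) hn (absf (D (mindex b))).
  elim: L => [|b L IH].
    rewrite big_nil; under [X in hn X]eq_fun do rewrite big_nil.
    rewrite (_ : (fun x => _) = fun x : X => 0 * 0); last by apply/funext => x /=; rewrite mul0e.
    by rewrite hnZ// ?mul0e//; exact: measurable_cst.
  rewrite big_cons; under [X in hn X]eq_fun do rewrite big_cons.
  case: ifPn => // Pb; apply: le_trans (hnD mE W0 p1 q1 _ _ _ _) _.
  - by have [] := jF _ Pb.
  - under eq_fun do rewrite big_mkcond.
    apply: emeasurable_sum => c; case: (boolP (P c)) => [Pc|_]; last exact: measurable_cst.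
    by have [] := jF _ Pc.
  - by move=> x; rewrite lee_fin.
  - by move=> x; apply: sume_ge0 => c _; rewrite lee_fin.
  - by apply: leeD.
rewrite -jetRE; apply: le_trans (H _) _.
rewrite (_ : _%:E * _ = \sum_(b : {ffun 'I_n -> 'I_m.+1}) jn (absD D)); last by rewrite sumr_const mule_natl.
rewrite big_mkcond; apply: lee_sum => b _; case: ifPn => [Pb|_]; last exact: jn_ge0.
exact: (hn_le_jn E W0 p1 q1 (absD D) Pb).
Qed.

(** The case in which [b] may have order [m], where no potential is available: the underived factor
    is bounded by its potential of order [m], uniformly off the origin. *)
Let hn_edge K C D D' b c : (0 < K)%R -> (0 < C)%R -> jet D -> jet D' -> (mlength b <= m)%N -> mlength c = 0%N ->
  (forall D, weak_jet m Omega D -> forall i, (i < m)%N ->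
    {ae mu, forall x, jet_sum m D i x <= K%:E * pot (m - i) r (jet_sum m D m) x}) ->
  (forall j x, E j x -> pot m r (EFin \o jetR D') x <= C%:E * hn (EFin \o jetR D')) ->
  hn (fun x => `|D b x * D' c x|%:E) <= (K * C)%:E * (hn (EFin \o jetR D) * hn (EFin \o jetR D')).
Proof.
move=> K0 C0 jD jD' bm c0 HK sup.
have wD := jet_weak_jet jD; have wD' := jet_weak_jet jD'.
have mJ : measurable_fun setT (EFin \o jetR D) by have := measurable_jet_sum wD (leqnn m); rewrite jetRE.
have J0 x : 0 <= (EFin \o jetR D) x by rewrite lee_fin; apply: sumr_ge0.
set hD := hn (EFin \o jetR D); set hD' := hn (EFin \o jetR D') in sup *.
have hD'0 : 0 <= hD' by exact: hn_ge0.
have KC0 : 0 <= (K * C)%:E * hD' by rewrite mule_ge0// lee_fin mulr_ge0// ltW.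
rewrite (muleC hD) muleA -hnZ//.
have [_ [mD _] _] := jD b bm; have cm : (mlength c <= m)%N by rewrite c0.
have [_ [mD' _] _] := jD' c cm.
apply: ae_le_hn => //.
- by apply/measurable_EFinP; apply: measurableT_comp => //; exact: measurable_funM.
- exact: measurable_funeM.
- by move=> x; exact: mule_ge0.
have H0 : {ae mu, forall x, x <> 0%R}.
  exists [set 0%R]; split; [|exact: null_point|].
    exact: closed_measurable_rV (compact_closed (@norm_hausdorff _ _) (@compact_set1 _ _)).
  by move=> x /=; apply: contra_notP => /[swap] ->.
apply: filterS2 H0 (HK _ wD' 0%N m0) => x /eqP/E_cover[j Ejx]; rewrite subn0 jetRE => h.
rewrite normrM EFinM muleC; apply: lee_pmul; [by rewrite lee_fin|by rewrite lee_fin| |].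
- apply: (@le_trans _ _ (jet_sum m D' 0 x)); first by apply: le_jet_sum => //; rewrite c0.
  apply: le_trans h _; rewrite EFinM -muleA; apply: lee_wpmul2l; first by rewrite lee_fin ltW.
  exact: sup Ejx.
- by rewrite -jetRE; exact: le_jet_sum.
Qed.

Let hn_product : exists2 C : R, (0 < C)%R & forall D D', jet D -> jet D' ->
  forall b c, (mlength b + mlength c <= m)%N ->
  hn (fun x => `|D b x * D' c x|%:E) <= C%:E * (jn (absD D) * jn (absD D')).
Proof.
have [C C0 HC] := mult_hn; have [K K0 HK] := jet_pot.
pose N := (#|{ffun 'I_n -> 'I_m.+1}|%:R : R)%R.
have N0 : (0 <= N)%R by exact: ler0n.
exists ((K * K + K) * C * (N * N + 1))%R.
  by apply: mulr_gt0; [rewrite mulr_gt0// addr_gt0// mulr_gt0|rewrite ltr_wpDl// mulr_ge0].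
move=> D D' jD jD' b c bcm.
have bm : (mlength b <= m)%N by apply: leq_trans bcm; rewrite leq_addr.
have cm : (mlength c <= m)%N by apply: leq_trans bcm; rewrite leq_addl.
have wD := jet_weak_jet jD; have wD' := jet_weak_jet jD'.
have mJ A : weak_jet m Omega A -> measurable_fun setT (jetR A).
  by move=> wA; have := measurable_jet_sum wA (leqnn m); rewrite jetRE => /measurable_EFinP.
have J0 A x : (0 <= jetR A x)%R by apply: sumr_ge0.
have [mul supD'] := HC _ _ (mJ _ wD) (mJ _ wD') (J0 D) (J0 D').
have [_ supD] := HC _ _ (mJ _ wD') (mJ _ wD) (J0 D') (J0 D).
have hD0 := hn_ge0 E W p q (EFin \o jetR D); have hD'0 := hn_ge0 E W p q (EFin \o jetR D').
have KC0 : (0 <= K * C)%R by rewrite mulr_ge0// ltW.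
have KKC0 : (0 <= K * K * C)%R by rewrite !mulr_ge0// ltW.
have main : hn (fun x => `|D b x * D' c x|%:E) <=
    ((K * K + K) * C)%:E * (hn (EFin \o jetR D) * hn (EFin \o jetR D')).
  have [b0|b0] := eqVneq (mlength b) 0%N.
    under [X in hn X]eq_fun do rewrite mulrC.
    apply: le_trans (hn_edge K0 C0 jD' jD cm b0 HK supD) _; rewrite [X in _ * X]muleC.
    apply: lee_wpmul2r; first exact: mule_ge0.
    by rewrite lee_fin mulrDl lerDr.
  have [c0|c0] := eqVneq (mlength c) 0%N.
    apply: le_trans (hn_edge K0 C0 jD jD' bm c0 HK supD') _.
    apply: lee_wpmul2r; first exact: mule_ge0.
    by rewrite lee_fin mulrDl lerDr.
  (* Both orders are now positive with sum at most [m], so both are below [m], and the potentials of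
     orders [m - |b|] and [m - |c|] have total order at least [m]. *)
  have bm' : (mlength b < m)%N by rewrite (leq_trans _ bcm)// -addn1 leq_add2l lt0n.
  have cm' : (mlength c < m)%N by rewrite (leq_trans _ bcm)// -add1n leq_add2r lt0n.
  pose P x := pot (m - mlength b) r (EFin \o jetR D) x * pot (m - mlength c) r (EFin \o jetR D') x.
  have mE' A : weak_jet m Omega A -> measurable_fun setT (EFin \o jetR A).
    by move=> wA; apply/measurable_EFinP; exact: mJ.
  have E0 A y : 0 <= (EFin \o jetR A) y by rewrite lee_fin.
  have P0 A k x : 0 <= pot k r (EFin \o jetR A) x by exact: pot_ge0.
  have mP : measurable_fun setT P by apply: emeasurable_funM; apply: measurable_pot => //; exact: mE'.
  have bnd : hn P <= C%:E * (hn (EFin \o jetR D) * hn (EFin \o jetR D')).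
    apply: mul; rewrite ?subn_gt0//.
    apply: (@leq_trans (m - mlength b + mlength b)); first by rewrite subnK.
    by rewrite leq_add2l leq_subRL// addnC.
  apply: (@le_trans _ _ ((K * K)%:E * hn P)); last first.
    apply: (@le_trans _ _ ((K * K * C)%:E * (hn (EFin \o jetR D) * hn (EFin \o jetR D')))).
      by rewrite [in leRHS]EFinM -[leRHS]muleA; apply: lee_wpmul2l => //; rewrite lee_fin mulr_ge0// ltW.
    by apply: lee_wpmul2r; [exact: mule_ge0|rewrite lee_fin mulrDl lerDl].
  have KK0 : 0 <= (K * K)%:E by rewrite lee_fin mulr_ge0// ltW.
  have PP0 x : 0 <= P x by apply: mule_ge0.
  rewrite -hnZ//.
  have [_ [mD _] _] := jD b bm; have [_ [mD' _] _] := jD' c cm.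
  apply: ae_le_hn => //.
  - by apply/measurable_EFinP; apply: measurableT_comp => //; exact: measurable_funM.
  - exact: measurable_funeM.
  - by move=> x; exact: mule_ge0.
  apply: filterS2 (HK _ wD _ bm') (HK _ wD' _ cm') => x h h'; rewrite !jetRE in h h'.
  rewrite normrM !EFinM /P muleACA; apply: lee_pmul; [by rewrite lee_fin|by rewrite lee_fin| |].
  - by apply: le_trans h; apply: le_jet_sum => //; exact: ltnW.
  - by apply: le_trans h'; apply: le_jet_sum => //; exact: ltnW.
apply: le_trans main _; rewrite [in leRHS]EFinM -[leRHS]muleA; apply: lee_wpmul2l.
  by rewrite lee_fin mulrDl addr_ge0.
have jj0 : 0 <= jn (absD D) * jn (absD D') by apply: mule_ge0; exact: jn_ge0.
apply: (@le_trans _ _ ((N * N)%:E * (jn (absD D) * jn (absD D')))); last first.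
  by apply: lee_wpmul2r => //; rewrite lee_fin lerDl.
by rewrite EFinM muleACA; apply: lee_pmul => //; exact: hn_jetR.
Qed.

(** The bilinear estimate first supplies the local integrability that the Leibniz rule requires,
    then bounds each of its at most [2 ^ m] terms. *)
Lemma sob_product : exists2 C : R, (0 < C)%R & forall f g, sob f -> sob g ->
  sob (fun x => f x * g x)%R /\ sobN (fun x => f x * g x)%R <= C%:E * sobN f * sobN g.
Proof.
have [C C0 HC] := hn_product.
pose N := (#|{ffun 'I_n -> 'I_m.+1}|%:R : R)%R.
have N0 : (0 <= N)%R by exact: ler0n.
exists ((N + 1) * (2 ^+ m * C))%R; first by rewrite !mulr_gt0// ltr_wpDl.
move=> f g /sob_jet[D D0 jD] /sob_jet[D' D'0 jD'].
set J := jn (absD D) * jn (absD D').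
have J0 : 0 <= J by apply: mule_ge0; exact: jn_ge0.
have Joo : J < +oo by apply: lte_mul_pinfty; [exact: jn_ge0| |exact: jet_lty]; rewrite ge0_fin_numE ?jn_ge0// jet_lty.
have [lD dD _] := jet_weak_jet jD; have [lD' dD' _] := jet_weak_jet jD'.
have md b : (mlength b <= m)%N -> measurable_fun setT (D b) by move=> bm; have [_ []] := jD b bm.
have md' b : (mlength b <= m)%N -> measurable_fun setT (D' b) by move=> bm; have [_ []] := jD' b bm.
have lel b (c : mindices) : (mlength b + mlength c <= m)%N -> (mlength b <= m)%N /\ (mlength c <= m)%N.
  by move=> h; split; apply: leq_trans h; [exact: leq_addr|exact: leq_addl].
have hp b c : (mlength b + mlength c <= m)%N -> herz_fun (fun x => D b x * D' c x)%R.
  move=> bcm; have [bm cm] := lel _ _ bcm.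
  split; first by apply: measurable_funM; [exact: md|exact: md'].
  by apply: le_lt_trans (HC _ _ jD jD' b c bcm) _; rewrite lte_mul_pinfty// lee_fin ltW.
have lp b c : (mlength b + mlength c <= m)%N -> locint (fun x => D b x * D' c x)%R.
  by move=> bcm; apply: herz_fun_locint; exact: hp.
have sumL (L : seq (mindices * mindices)) : all (fun z => mlength z.1 + mlength z.2 <= m)%N L ->
    herz_fun (fun x => \sum_(z <- L) (D z.1 x * D' z.2 x))%R /\
    hn (fun x => `|\sum_(z <- L) (D z.1 x * D' z.2 x)|%:E) <= (size L)%:R%:E * (C%:E * J).
  have CJ0 : 0 <= C%:E * J by rewrite mule_ge0// lee_fin ltW.
  elim: L => [_|k L IH /= /andP[kL /IH[IH1 IH2]]].
    have -> : (fun x : X => \sum_(z <- [::]) (D z.1 x * D' z.2 x))%R = cst 0%R by apply/funext => x; rewrite big_nil.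
    split; first exact: herz_fun0.
    rewrite mul0e (_ : (fun x => _) = fun x : X => 0 * 0); last by apply/funext => x /=; rewrite big_nil normr0 mul0e.
    by rewrite hnZ// ?mul0e//; exact: measurable_cst.
  have E1 : (fun x => \sum_(z <- k :: L) (D z.1 x * D' z.2 x))%R =
      (fun x => 1 * (D k.1 x * D' k.2 x) + \sum_(z <- L) (D z.1 x * D' z.2 x))%R.
    by apply/funext => x; rewrite big_cons mul1r.
  split; first by rewrite E1; apply: herz_fun_lin => //; exact: hp.
  rewrite (_ : (fun x => _) = absf (fun x => 1 * (D k.1 x * D' k.2 x) + \sum_(z <- L) (D z.1 x * D' z.2 x))%R); last first.
    by apply/funext => x; rewrite big_cons mul1r.
  apply: le_trans (hn_lin 1 (hp _ _ kL).1 IH1.1) _.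
  rewrite normr1 mul1e -natr1 EFinD addrC ge0_muleDl ?lee_fin// mul1e.
  by apply: leeD => //; exact: HC.
have [L HL] : exists L : mindices -> seq (mindices * mindices), forall b, (mlength b <= m)%N ->
    [/\ all (fun z => mlength z.1 + mlength z.2 == mlength b)%N (L b), size (L b) = (2 ^ mlength b)%N &
      wderiv Omega b (fun x => D zero x * D' zero x)%R (fun x => \sum_(z <- L b) (D z.1 x * D' z.2 x))%R].
  have : forall b, exists L : seq (mindices * mindices), (mlength b <= m)%N ->
    [/\ all (fun z => mlength z.1 + mlength z.2 == mlength b)%N L, size L = (2 ^ mlength b)%N &
      wderiv Omega b (fun x => D zero x * D' zero x)%R (fun x => \sum_(z <- L) (D z.1 x * D' z.2 x))%R].
    move=> b; case: (boolP (mlength b <= m)%N) => [bm|_]; last by exists [::].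
    by have [L HL] := weak_leibniz oO lD lD' dD dD' lp bm; exists L.
  by move=> /choice[L HL]; exists L.
have allL b : (mlength b <= m)%N -> all (fun z => mlength z.1 + mlength z.2 <= m)%N (L b).
  by move=> bm; have [aL _ _] := HL b bm; apply: sub_all aL => k /eqP ->.
(* The Leibniz list is not known explicitly at order 0, while the jet must start with the product
   itself. *)
pose P b : X -> R := if mlength b == 0%N then (fun x => D zero x * D' zero x)%R
  else (fun x => \sum_(z <- L b) (D z.1 x * D' z.2 x))%R.
have m00 : (mlength (zero : mindices) + mlength (zero : mindices) <= m)%N by rewrite mlength0.
have P0 : P zero = (fun x => D zero x * D' zero x)%R by rewrite /P mlength0.
have hP b : (mlength b <= m)%N -> herz_fun (P b) /\ hn (absf (P b)) <= (2 ^+ m)%:E * (C%:E * J).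
  move=> bm; rewrite /P; case: ifP => _.
    split; first exact: hp.
    apply: le_trans (HC _ _ jD jD' _ _ m00) _; rewrite -{1}[_ * _]mul1e.
    by apply: lee_wpmul2r; [rewrite mule_ge0// lee_fin ltW|rewrite lee_fin exprn_ege1// ler1n].
  have [H1 H2] := sumL _ (allL b bm); split => //; apply: le_trans H2 _.
  apply: lee_wpmul2r; first by rewrite mule_ge0// lee_fin ltW.
  by have [_ -> _] := HL b bm; rewrite lee_fin natrX ler_eXn2l// ltr1n.
have jP : jet P.
  move=> b bm; split; last 2 first.
  - exact: (hP b bm).1.
  - move=> x nO; rewrite /P; case: ifP => _.
      have [_ _ ->] := jD _ (lel _ _ m00).1 => //; exact: mul0r.
    rewrite big_seq big1// => k kL; have /allP/(_ _ kL)/lel[k1 k2] := allL b bm.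
    by have [_ _ ->] := jD _ k1 => //; rewrite mul0r.
  rewrite P0 /P; case: ifPn => [b0|_]; last by have [] := HL b bm.
  have -> : b = zero by apply/funext => i; apply/eqP; rewrite -leqn0 -(eqP b0) le_mlength.
  exact: wderiv0.
have P0' : P zero = (fun x => f x * g x)%R \_ Omega.
  by rewrite P0 D0 D'0; apply/funext => x; rewrite !patchE; case: ifP => // _; rewrite mul0r.
have [sP NP] := jet_sob P0' jP; split => //.
rewrite NP (jet_sob D0 jD).2 (jet_sob D'0 jD').2 -muleA -/J.
apply: le_trans (jn_le_hn E W0 p1 q1 (jet_jet_fun jP)) _.
apply: (@le_trans _ _ (\sum_(b : {ffun 'I_n -> 'I_m.+1}) ((2 ^+ m)%:E * (C%:E * J)))).
  rewrite big_mkcond; apply: lee_sum => b _; case: ifP => [bm|_]; first exact: (hP _ bm).2.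
  by apply: mule_ge0; [rewrite lee_fin exprn_ge0|rewrite mule_ge0// lee_fin ltW].
rewrite (_ : \sum_(b : _) _ = N%:E * ((2 ^+ m)%:E * (C%:E * J))); last by rewrite sumr_const mule_natl.
rewrite [(2 ^+ m)%:E * _]muleA -EFinM muleA -EFinM; apply: lee_wpmul2r => //.
by rewrite lee_fin ler_wpM2r ?lerDl// mulr_ge0 ?exprn_ge0// ltW.
Qed.

End product.

End sobolev.

(** * Quotients of seminormed function spaces *)

(* The quotient of a complete seminormed space of functions is realized by a
   choice of one representative in each class. *)
Record seminorm_space (R : realType) (T : Type) := SeminormSpace {
  sn_mem :> (T -> R) -> Prop;
  sn : (T -> R) -> R;
  sn_mem0 : sn_mem (cst 0);
  sn_lin : forall (a : R) f g, sn_mem f -> sn_mem g -> sn_mem (a *: f + g);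
  snZ : forall (a : R) f, sn_mem f -> sn (a *: f) = `|a| * sn f;
  snD : forall f g, sn_mem f -> sn_mem g -> sn (f + g) <= sn f + sn g;
  sn_complete : forall u : nat -> T -> R, (forall j, sn_mem (u j)) ->
    (forall j, sn (u j.+1 - u j) <= 2^-1 ^+ j) ->
    exists2 f, sn_mem f & forall j, sn (f - u j) <= 2 * 2^-1 ^+ j }.

Section quotient.
Context {R : realType} {T : Type} (S : seminorm_space R T).
Implicit Types (f g h : T -> R) (a : R).

Lemma sn_memZ a f : S f -> S (a *: f).
Proof. by move=> Sf; rewrite -[a *: f]addr0; apply: sn_lin => //; exact: sn_mem0. Qed.

Lemma sn_memD f g : S f -> S g -> S (f + g).
Proof. by move=> Sf Sg; rewrite -[f]scale1r; exact: sn_lin. Qed.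

Lemma sn_memN f : S f -> S (- f).
Proof. by move=> Sf; rewrite -scaleN1r; exact: sn_memZ. Qed.

Lemma sn_memB f g : S f -> S g -> S (f - g).
Proof. by move=> Sf Sg; apply: sn_memD => //; exact: sn_memN. Qed.

Lemma sn0 : sn S 0 = 0.
Proof. by rewrite -[0](scale0r 0) snZ ?normr0 ?mul0r//; exact: sn_mem0. Qed.

Lemma snN f : S f -> sn S (- f) = sn S f.
Proof. by move=> Sf; rewrite -scaleN1r snZ// normrN1 mul1r. Qed.

Lemma sn_ge0 f : S f -> 0 <= sn S f.
Proof.
move=> Sf; have := snD Sf (sn_memN Sf); rewrite subrr sn0 snN// -mulr2n.
by rewrite pmulrn_lge0.
Qed.

Definition sim f g := sn S (f - g) = 0.

Lemma sim_refl f : sim f f. Proof. by rewrite /sim subrr sn0. Qed.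

Lemma sim_sym f g : S f -> S g -> sim f g -> sim g f.
Proof. by move=> Sf Sg; rewrite /sim -(snN (sn_memB Sf Sg)) opprB. Qed.

Lemma simD f f' g g' : S f -> S f' -> S g -> S g' -> sim f f' -> sim g g' -> sim (f + g) (f' + g').
Proof.
move=> Sf Sf' Sg Sg'; rewrite /sim opprD addrACA => h h'.
apply/eqP; rewrite eq_le sn_ge0 ?andbT; last by apply: sn_memD; exact: sn_memB.
by have := snD (sn_memB Sf Sf') (sn_memB Sg Sg'); rewrite h h' addr0.
Qed.

Lemma sim_trans f g h : S f -> S g -> S h -> sim f g -> sim g h -> sim f h.
Proof.
move=> Sf Sg Sh; rewrite /sim => h1 h2; rewrite -[f](subrK g) -addrA.
apply/eqP; rewrite eq_le sn_ge0 ?andbT; last by apply: sn_memD; exact: sn_memB.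
by have := snD (sn_memB Sf Sg) (sn_memB Sg Sh); rewrite h1 h2 addr0.
Qed.

Lemma simZ a f g : S f -> S g -> sim f g -> sim (a *: f) (a *: g).
Proof. by move=> Sf Sg h; rewrite /sim -scalerBr snZ ?h ?mulr0//; exact: sn_memB. Qed.

Lemma sn_sim f g : S f -> S g -> sim f g -> sn S f = sn S g.
Proof.
move=> Sf Sg h; have h' := sim_sym Sf Sg h; apply/eqP; rewrite eq_le; apply/andP; split.
  by have := snD (sn_memB Sf Sg) Sg; rewrite h add0r subrK.
by have := snD (sn_memB Sg Sf) Sf; rewrite h' add0r subrK.
Qed.

(** Equivalent functions have the same set of candidates, so the choice is constant on classes and a
    class can be represented by a function fixed by [rep]. *)
Definition rep f : T -> R := xget (cst 0) [set g | S g /\ sim f g].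

Lemma repP f : S f -> S (rep f) /\ sim f (rep f).
Proof. by move=> Sf; apply: (@xgetPex _ (cst 0) [set g | S g /\ sim f g]); exists f; split => //; exact: sim_refl. Qed.

Lemma rep_sim f g : S f -> S g -> sim f g -> rep f = rep g.
Proof.
move=> Sf Sg fg; rewrite /rep; congr xget; apply/seteqP; split => h /= [Sh] H; split => //.
  by apply: (sim_trans Sg Sf Sh) => //; exact: sim_sym.
exact: (sim_trans Sf Sg Sh).
Qed.

Record quot := Quot { quot_val : T -> R; quotP : S quot_val /\ rep quot_val = quot_val }.

HB.instance Definition _ := gen_eqMixin quot.
HB.instance Definition _ := gen_choiceMixin quot.
Implicit Types p q : quot.

Lemma quot_mem p : S (quot_val p). Proof. by have [] := quotP p. Qed.

Lemma quot_val_inj p q : quot_val p = quot_val q -> p = q.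
Proof. by case: p q => [f Pf] [g Pg] /= fg; rewrite fg in Pf *; congr Quot; exact: Prop_irrelevance. Qed.

Definition cls f (Sf : S f) : quot.
Proof.
refine (@Quot (rep f) _); have [Sr fr] := repP Sf; split => //.
by rewrite -(rep_sim Sf Sr fr).
Defined.

Lemma cls_sim f (Sf : S f) : sim f (quot_val (cls Sf)). Proof. by have [] := repP Sf. Qed.

Lemma cls_eq f g (Sf : S f) (Sg : S g) : cls Sf = cls Sg <-> sim f g.
Proof.
split=> [E|fg]; last by apply: quot_val_inj; exact: rep_sim.
apply: (sim_trans Sf (quot_mem (cls Sf)) Sg); first exact: cls_sim.
by rewrite E; apply: sim_sym => //; [exact: quot_mem|exact: cls_sim].
Qed.

Lemma cls_val p : cls (quot_mem p) = p.
Proof. by apply: quot_val_inj; case: p => f [Sf fE]. Qed.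

Definition addq p q := cls (sn_memD (quot_mem p) (quot_mem q)).
Definition oppq p := cls (sn_memN (quot_mem p)).
Definition scaleq a p := cls (sn_memZ a (quot_mem p)).
Definition zeroq := cls (sn_mem0 S).

Lemma addq_cls f g (Sf : S f) (Sg : S g) : addq (cls Sf) (cls Sg) = cls (sn_memD Sf Sg).
Proof.
apply/cls_eq; apply: sim_sym; [exact: sn_memD|by apply: sn_memD; exact: quot_mem|].
by apply: simD => //; (exact: quot_mem || exact: cls_sim).
Qed.

Lemma scaleq_cls a f (Sf : S f) : scaleq a (cls Sf) = cls (sn_memZ a Sf).
Proof.
apply/cls_eq; apply: sim_sym; [exact: sn_memZ|by apply: sn_memZ; exact: quot_mem|].
by apply: simZ => //; [exact: quot_mem|exact: cls_sim].
Qed.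

Lemma cls_irr f g (Sf : S f) (Sg : S g) : f = g -> cls Sf = cls Sg.
Proof. by move=> fg; apply/cls_eq; rewrite fg; exact: sim_refl. Qed.

Lemma addqA : associative addq.
Proof.
move=> x y z; rewrite -[x]cls_val -[y]cls_val -[z]cls_val !addq_cls.
by apply: cls_irr; rewrite addrA.
Qed.

Lemma addqC : commutative addq.
Proof. by move=> x y; apply: cls_irr; rewrite addrC. Qed.

Lemma add0q : left_id zeroq addq.
Proof. by move=> x; rewrite -[x in LHS]cls_val addq_cls -[RHS]cls_val; apply: cls_irr; rewrite add0r. Qed.

Lemma addNq : left_inverse zeroq oppq addq.
Proof. by move=> x; rewrite -[x in X in addq _ X]cls_val addq_cls; apply: cls_irr; rewrite addNr. Qed.

HB.instance Definition _ := GRing.isZmodule.Build quot addqA addqC add0q addNq.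

Lemma scaleqA a b p : scaleq a (scaleq b p) = scaleq (a * b) p.
Proof. by rewrite scaleq_cls; apply: cls_irr; rewrite scalerA. Qed.

Lemma scale1q : left_id 1 scaleq.
Proof. by move=> p; rewrite -[RHS]cls_val; apply: cls_irr; rewrite scale1r. Qed.

Lemma scaleqDr : right_distributive scaleq +%R.
Proof. by move=> a p q; rewrite scaleq_cls [RHS]addq_cls; apply: cls_irr; rewrite scalerDr. Qed.

Lemma scaleqDl p a b : scaleq (a + b) p = scaleq a p + scaleq b p.
Proof. by rewrite [RHS]addq_cls; apply: cls_irr; rewrite scalerDl. Qed.

HB.instance Definition _ := GRing.Zmodule_isLmodule.Build R quot scaleqA scale1q scaleqDr scaleqDl.

Definition normq p := sn S (quot_val p).

Lemma normq_cls f (Sf : S f) : normq (cls Sf) = sn S f.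
Proof. by apply/esym/sn_sim => //; [exact: quot_mem|exact: cls_sim]. Qed.

Lemma ler_normqD p q : normq (p + q) <= normq p + normq q.
Proof. by rewrite [normq (p + q)]normq_cls; apply: snD; exact: quot_mem. Qed.

Lemma normqZ a p : normq (a *: p) = `|a| * normq p.
Proof. by rewrite [LHS]normq_cls snZ//; exact: quot_mem. Qed.

Lemma normq0_eq0 p : normq p = 0 -> p = 0.
Proof.
move=> p0; rewrite -[p]cls_val; apply/cls_eq; rewrite /sim.
by rewrite (_ : _ - _ = quot_val p)//; apply/funext => x /=; rewrite /GRing.add/= /GRing.opp/= subr0.
Qed.

HB.instance Definition _ := Lmodule_isNormed.Build R quot ler_normqD normqZ normq0_eq0.

(** The filter contains small balls whose centres form a fast Cauchy sequence; their limit, given by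
    [sn_complete], is the limit of the filter. *)
Lemma quot_complete (F : set_system quot) : ProperFilter F -> cauchy F -> cvg F.
Proof.
move=> PF /(@cauchyP _ _ F PF) cF.
(* Two balls in [F] meet, so radii divided by 4 keep consecutive centres within [2^-1 ^+ j]. *)
have [x Fx] : exists x : nat -> quot, forall j, F (ball (x j) (2^-1 ^+ j / 4)).
  have : forall j, exists y, F (ball y (2^-1 ^+ j / 4 : R)).
    by move=> j; apply: cF; rewrite divr_gt0// exprn_gt0// invr_gt0.
  by move=> /choice[x Fx]; exists x.
have dist p q : `|p - q| = sn S (quot_val p - quot_val q).
  have -> : p - q = cls (sn_memB (quot_mem p) (quot_mem q)).
    by rewrite -[p in LHS]cls_val [LHS]addq_cls; exact: cls_irr.
  exact: normq_cls.
have step j : sn S (quot_val (x j.+1) - quot_val (x j)) <= 2^-1 ^+ j.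
  rewrite -dist; have [z [z1 z2]] := filter_ex (filterI (Fx j) (Fx j.+1)).
  move: z1 z2; rewrite -!ball_normE /= => z1 z2.
  have := ler_distD z (x j.+1) (x j); rewrite (distrC z).
  have a0 : 0 < 2^-1 ^+ j :> R by rewrite exprn_gt0// invr_gt0.
  by move: z1 z2; rewrite exprS; lra.
have [f Sf Hf] := sn_complete (fun j => quot_mem (x j)) step.
apply/cvg_ex; exists (cls Sf); apply/(@cvg_ballP _ _ _ F _ id) => e e0.
have [j je] : exists j, 2^-1 ^+ j * 4 < e :> R.
  apply: contrapT => H; have : e <= 0; last by rewrite leNgt e0.
  apply: (@le0_of_geometric _ _ 4) => j; rewrite leNgt; apply/negP => h; apply: H; exists j.
  by rewrite mulrC.
apply: filterS (Fx j) => z; rewrite -!ball_normE /= => zj.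
have d : `|cls Sf - x j| <= 2 * 2^-1 ^+ j.
  have -> : cls Sf - x j = cls (sn_memB Sf (quot_mem (x j))).
    by rewrite [LHS](addq_cls Sf (sn_memN (quot_mem (x j)))); exact: cls_irr.
  by rewrite [leLHS]normq_cls.
have := ler_distD (x j) (cls Sf) z.
have a0 : 0 < 2^-1 ^+ j :> R by rewrite exprn_gt0// invr_gt0.
by move: zj d je; lra.
Qed.

HB.instance Definition _ := Uniform_isComplete.Build quot quot_complete.

End quotient.

Lemma banach_space_of_seminorm (R : realType) (T : Type) (A : set (T -> R))
    (eqv : (T -> R) -> (T -> R) -> Prop) (N : (T -> R) -> \bar R) :
  A (cst 0) ->
  (forall (a : R) f g, A f -> A g -> A (fun x => a * f x + g x)) ->
  (forall f, (0 <= N f)%E) -> (forall f, A f -> (N f < +oo)%E) ->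
  (forall (a : R) f, A f -> (N (fun x => (a * f x)%R) = `|a|%:E * N f)%E) ->
  (forall f g, A f -> A g -> (N (fun x => (f x + g x)%R) <= N f + N g)%E) ->
  (forall f g, A f -> A g -> N (fun x => -1 * g x + f x)%R = 0%E <-> eqv f g) ->
  (forall u : nat -> T -> R, (forall j, A (u j)) ->
    (forall j, (N (fun x => (-1 * u j x + u j.+1 x)%R) <= (2^-1 ^+ j)%:E)%E) ->
    exists2 f, A f & forall j, (N (fun x => (-1 * u j x + f x)%R) <= (2 * 2^-1 ^+ j)%:E)%E) ->
  banach_space_of A eqv N.
Proof.
move=> A0 Al N0 Noo NZ ND NE Nc.
have fN f : A f -> (fine (N f))%:E = N f by move=> Af; rewrite fineK// ge0_fin_numE// Noo.
have AB f g : A f -> A g -> A (fun x => -1 * g x + f x) by move=> Af Ag; exact: Al.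
have BE (f g : T -> R) : f - g = fun x => -1 * g x + f x.
  by apply/funext => x /=; rewrite /GRing.add/= /GRing.opp/= mulN1r addrC.
have sZ (a : R) f : A f -> fine (N (a *: f)) = `|a| * fine (N f).
  by move=> Af; rewrite [N (a *: f)]NZ// -(fN f)// -EFinM.
have sD f g : A f -> A g -> fine (N (f + g)) <= fine (N f) + fine (N g).
  move=> Af Ag; have Afg : A (f + g).
    have := Al 1 _ _ Af Ag; rewrite (_ : (fun x => 1 * f x + g x) = f + g)//.
    by apply/funext => x; rewrite mul1r.
  by rewrite -lee_fin EFinD !fN//; exact: ND.
have sC (u : nat -> T -> R) : (forall j, A (u j)) -> (forall j, fine (N (u j.+1 - u j)) <= 2^-1 ^+ j) ->
    exists2 f, A f & forall j, fine (N (f - u j)) <= 2 * 2^-1 ^+ j.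
  move=> Au Nu; have [|f Af Hf] := Nc u Au.
    by move=> j; rewrite -BE -fN ?BE; [rewrite lee_fin -BE; exact: Nu|exact: AB].
  exists f => // j; rewrite -lee_fin fN ?BE; [exact: Hf|exact: AB].
pose S := @SeminormSpace R T A (fun f => fine (N f)) A0 Al sZ sD sC.
split => //.
(* The class map is total; outside [A] it takes the default value 0. *)
exists (quot S), (fun f => if pselect (A f) is left Af then @cls R T S f Af else 0).
have clsE f (Af : A f) : (if pselect (A f) is left Af then @cls R T S f Af else 0) = @cls R T S f Af.
  by case: pselect => // Af'; exact: cls_irr.
split.
- move=> v; exists (quot_val v); first exact: (quot_mem v).
  by rewrite (clsE _ (quot_mem v)) cls_val.
- move=> f g Af Ag; rewrite (clsE _ Af) (clsE _ Ag); split.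
    move/cls_eq; rewrite /sim /= BE => h; apply/NE => //.
    by rewrite -fN ?h//; exact: AB.
  by move=> /(NE _ _ Af Ag) h; apply/cls_eq; rewrite /sim /= BE h.
- move=> a f g Af Ag; rewrite (clsE _ Af) (clsE _ Ag) (clsE _ (Al a f g Af Ag)).
  rewrite [X in X + _](scaleq_cls (S := S) a Af) [RHS](addq_cls (S := S)).
  exact: cls_irr.
- by move=> f Af; rewrite (clsE _ Af) [`|_|](normq_cls (S := S)) fN.
Qed.

(** * The Banach algebra over a system of shells *)

Section herz_bounds.
Context {R : realType} {n : nat}.
Notation X := 'rV[R]_n.
Notation mu := (lebesgue_rV n).
Implicit Types (x y w : X) (k j : nat) (A B : set X).
Variables (p : R).
Hypothesis p1 : (1 < p)%R.
Local Open Scope ereal_scope.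

Let p0 : (0 < p)%R. Proof. exact: lt_trans p1. Qed.
Notation p' := (p / (p - 1))%R.
Let p'0 : (0 < p')%R. Proof. by rewrite divr_gt0// subr_gt0. Qed.
Let pp' : (p^-1 + p'^-1 = 1)%R.
Proof. by rewrite invf_div -[X in (X + _)%R]mul1r -mulrDl addrC subrK mulfV// gt_eqF. Qed.

(** Hoelder against the indicator of [A], with extended values reduced to real ones as in
    Minkowski's inequality. *)
Lemma holder_set A (c : R) (F : X -> \bar R) : measurable A -> (0 < c)%R -> mu A `^ p'^-1 <= c%:E ->
  measurable_fun setT F -> (forall x, 0 <= F x) ->
  \int[mu]_(x in A) F x <= c%:E * 'N[mu]_p%:E[F \_ A].
Proof.
move=> mA c0 Ac mF F0.
have mFA : measurable_fun setT (F \_ A) by exact: measurable_restr.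
have FA0 x : 0 <= (F \_ A) x by rewrite patchE; case: ifP.
have [Noo|] := eqVneq 'N[mu]_p%:E[F \_ A] +oo; first by rewrite Noo gt0_muley ?lte_fin// leey.
rewrite -ltey => Noo; have Foo := Lnorm_lty_ae p0 mFA FA0 Noo.
pose f x := fine ((F \_ A) x).
have mf : measurable_fun setT f by exact: (measurableT_comp (fine_measurable measurableT) mFA).
have f0 x : (0 <= f x)%R by rewrite /f fine_ge0.
have fE : {ae mu, forall x, (f x)%:E = (F \_ A) x}.
  by apply: filterS Foo => x h; rewrite /f fineK// ge0_fin_numE.
pose i x : R := \1_A x.
have mi : measurable_fun setT i by exact: measurable_indic.
have i0 x : (0 <= i x)%R by rewrite /i indicE.
have := hoelder mu mf mi p0 p'0 pp'.
rewrite Lnorm1 !ge0_LnormE ?gt_eqF//.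
have -> : \int[mu]_x `|(EFin \o (f \* i)%R) x| = \int[mu]_(x in A) F x.
  rewrite [RHS]integral_mkcond; apply: ae_eq_integral => //.
    by apply: measurableT_comp => //; apply/measurable_EFinP; exact: measurable_funM.
  apply: filterS fE => x h _; rewrite /= -h /i indicE /f patchE.
  by case: ifP; rewrite ?mulr1 ?mulr0 /= ?normr0// ger0_norm// fine_ge0.
have -> : \int[mu]_x ((EFin \o f) x `^ p) = \int[mu]_x ((F \_ A) x `^ p).
  apply: ae_eq_integral => //; [by apply: measurable_poweRT; apply/measurable_EFinP|exact: measurable_poweRT|].
  by apply: filterS fE => x h _; rewrite -h.
have -> : \int[mu]_x ((EFin \o i) x `^ p') = mu A.
  rewrite -[RHS]mul1e -integral_cst// [RHS]integral_mkcond; apply: eq_integral => x _.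
  rewrite patchE /= /i indicE; case: ifP => _; first by rewrite powR1.
  by rewrite powR0// gt_eqF.
move=> h; apply: le_trans h _; rewrite muleC; apply: lee_wpmul2r => //.
exact: poweR_ge0.
Qed.

Variables (E : nat -> set X) (W : nat -> R) (q : R).
Hypothesis n0 : (0 < n)%N.
Hypothesis mE : forall k, measurable (E k).
Hypothesis W0 : forall k, (0 < W k)%R.
Hypothesis q1 : (1 <= q)%R.
Hypothesis E_cover : forall x, x != 0%R -> exists k, E k x.

(** Hoelder on each shell; [t k] is the conjugate norm of the indicator measured in units of the
    weight [W k], and has to be summable. *)
Lemma hn_local_integral A (C : R) (t : nat -> R) (F : X -> \bar R) : measurable A ->
  (forall k, (0 < t k)%R) -> (forall k, mu (E k `&` A) `^ p'^-1 <= (t k * W k)%:E) ->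
  \sum_(0 <= k <oo) (t k)%:E <= C%:E ->
  measurable_fun setT F -> (forall x, 0 <= F x) ->
  \int[mu]_(x in A) F x <= C%:E * hn E W p q F.
Proof.
move=> mA t0 At tC mF F0.
have hn0 : 0 <= hn E W p q F by exact: hn_ge0.
have mEA k : measurable (E k `&` A) by exact: measurableI.
have H0 : {ae mu, forall x, x <> 0%R}.
  exists [set 0%R]; split; [|exact: null_point|].
    exact: closed_measurable_rV (compact_closed (@norm_hausdorff _ _) (@compact_set1 _ _)).
  by move=> x /=; apply: contra_notP => /[swap] ->.
have r0 B x : 0 <= (F \_ B) x by rewrite patchE; case: ifP.
apply: (@le_trans _ _ (\int[mu]_x \sum_(0 <= k <oo) (F \_ (E k `&` A)) x)).
  rewrite integral_mkcond; apply: ae_ge0_le_integral => //.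
  - exact: measurable_restr.
  - by move=> x _; apply: nneseries_ge0.
  - by apply: measurable_nneseries => // k; exact: measurable_restr.
  apply: filterS H0 => x x0 _; rewrite patchE; case: ifPn => [/set_mem Ax|_]; last exact: nneseries_ge0.
  have [k Ek] := E_cover (introN eqP x0).
  apply: le_trans (nneseries_lim_ge k.+1 _) => //.
  rewrite big_nat_recr//= [X in _ <= _ + X](_ : _ = F x); last by rewrite patchE mem_set.
  by rewrite leeDr// sume_ge0.
rewrite integral_nneseries//; last by move=> k; exact: measurable_restr.
apply: (@le_trans _ _ (\sum_(0 <= k <oo) (hn E W p q F * (t k)%:E))); last first.
  rewrite ge0_nneseriesZl//; last by move=> k; rewrite lee_fin ltW.
  by rewrite muleC; apply: lee_wpmul2r.
apply: lee_nneseries => k _; first by move=> _; apply: integral_ge0.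
rewrite -integral_mkcond.
apply: le_trans (holder_set (mEA k) (mulr_gt0 (t0 k) (W0 k)) (At k) mF F0) _.
rewrite EFinM -muleA muleC; apply: lee_wpmul2r; first by rewrite lee_fin ltW.
have sh : (W k)%:E * 'N[mu]_p%:E[F \_ (E k)] <= hn E W p q F by exact: shell_le_hn.
apply: le_trans sh; apply: lee_wpmul2l; first by rewrite lee_fin ltW.
apply: le_Lnorm => //; [exact: measurable_restr|exact: measurable_restr|].
move=> x; rewrite !patchE; case: ifPn => [/set_mem[Ex _]|_]; first by rewrite mem_set.
by case: ifP.
Qed.

(** Minkowski over the shells, on which the power weight is at most [t k * W k]. At the origin the
    weight vanishes since [beta] is positive. *)
Lemma hn_weighted (beta C : R) B (t : nat -> R) (F : X -> R) : measurable B -> (0 < beta)%R ->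
  (forall k, (0 <= t k)%R) -> (forall k x, E k x -> B x -> (`|x| `^ beta <= t k * W k)%R) ->
  \sum_(0 <= k <oo) (t k)%:E <= C%:E ->
  measurable_fun setT F -> (forall x, (0 <= F x)%R) ->
  (\int[mu]_y (weighted p beta (F \_ B) y)%:E) `^ p^-1 <= C%:E * hn E W p q (EFin \o F).
Proof.
move=> mB b0 t0 Bt tC mF F0.
have hn0 : 0 <= hn E W p q (EFin \o F) by exact: hn_ge0.
have mEF : measurable_fun setT (EFin \o F) by apply/measurable_EFinP.
have r0 A x : 0 <= ((EFin \o F) \_ A) x by rewrite patchE; case: ifP => //= _; rewrite lee_fin.
pose H y := (((F \_ B) y) * `|y| `^ beta)%:E.
have mH : measurable_fun setT H.
  apply/measurable_EFinP; apply: measurable_funM; first exact: measurable_restrR.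
  exact: measurableT_comp (measurable_powR beta) measurable_norm_rV.
have FB0 y : (0 <= (F \_ B) y)%R by rewrite patchE; case: ifP.
have H0 y : 0 <= H y by rewrite lee_fin mulr_ge0// powR_ge0.
have -> : (\int[mu]_y (weighted p beta (F \_ B) y)%:E) `^ p^-1 = 'N[mu]_p%:E[H].
  by rewrite ge0_LnormE ?gt_eqF//.
pose h k y := (t k * W k)%:E * ((EFin \o F) \_ (E k)) y.
have tW k : (0 <= t k * W k)%R by rewrite mulr_ge0// ltW.
have h0 k y : 0 <= h k y by rewrite mule_ge0// lee_fin.
have mh k : measurable_fun setT (h k) by apply: measurable_funeM; exact: measurable_restr.
apply: (@le_trans _ _ 'N[mu]_p%:E[(fun y => \sum_(0 <= k <oo) h k y)]).
  apply: le_Lnorm => //; first exact: measurable_nneseries.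
  move=> y; have [->|y0] := eqVneq y 0%R.
    by rewrite /H normr0 powR0 ?gt_eqF// mulr0; exact: nneseries_ge0.
  rewrite /H patchE; case: ifPn => [/set_mem By|_]; last by rewrite mul0r; exact: nneseries_ge0.
  have [k Ek] := E_cover y0; apply: le_trans (nneseries_lim_ge k.+1 _) => //.
  rewrite big_nat_recr//=; apply: (@le_trans _ _ (h k y)); last by rewrite leeDr// sume_ge0.
  by rewrite /h patchE mem_set//= -EFinM lee_fin mulrC ler_wpM2r// Bt.
apply: le_trans (Lnorm_nneseries_le mu (ltW p1) mh h0) _.
apply: (@le_trans _ _ (\sum_(0 <= k <oo) (hn E W p q (EFin \o F) * (t k)%:E))); last first.
  rewrite ge0_nneseriesZl//.
  by rewrite muleC; apply: lee_wpmul2r.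
apply: lee_nneseries => k _; first by move=> _; exact: Lnorm_ge0.
rewrite /h ge0_LnormZ//; [|exact: measurable_restr|by rewrite lee_fin].
rewrite EFinM -muleA muleC; apply: lee_wpmul2r; first by rewrite lee_fin.
exact: shell_le_hn.
Qed.

Let W0' k : 0 <= (W k)%:E. Proof. by rewrite lee_fin ltW. Qed.

Lemma Lnorm_absR (f : X -> R) A : 'N[mu]_p%:E[(fun x => `|f x|%:E) \_ A] = Lp_norm p (f \_ A).
Proof.
rewrite /Lp_norm -[RHS]Lnorm_abse; congr Lnorm; apply/funext => x /=.
by rewrite !patchE; case: ifP => //; rewrite normr0.
Qed.

Let q0 : (0 < q)%R. Proof. exact: lt_le_trans q1. Qed.

Lemma hn_series (f : X -> R) : hn E W p q (fun x => `|f x|%:E) =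
  (\sum_(0 <= k <oo) ((W k `^ q)%:E * Lp_norm p (f \_ (E k)) `^ q)) `^ q^-1.
Proof.
rewrite /hn /ell; congr (_ `^ _); apply: eq_eseriesr => k _.
by rewrite poweRM//; [rewrite poweR_EFin Lnorm_absR|exact: Lnorm_ge0].
Qed.

Lemma sobN_series m Omega (f : X -> R) : sobN E W p q m Omega f =
  (\sum_(0 <= k <oo) ((W k `^ q)%:E * sobolev_sum p m Omega (E k) f `^ (q / p))) `^ q^-1.
Proof.
rewrite /sobN /jn /ell; congr (_ `^ _); apply: eq_eseriesr => k _.
rewrite poweRM//; last exact: fell_ge0.
rewrite poweR_EFin; congr (_ * _).
have S0 : 0 <= sobolev_sum p m Omega (E k) f by apply: sume_ge0 => b _; exact: poweR_ge0.
rewrite (_ : fell _ _ = sobolev_sum p m Omega (E k) f `^ p^-1); first by rewrite -poweRrM mulrC.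
rewrite /fell; congr (_ `^ _); rewrite /sobolev_sum [RHS]big_mkcond; apply: eq_bigr => b _.
rewrite /jet_shell; case: ifP => _; last by rewrite poweR0r// gt_eqF.
congr (_ `^ _); rewrite Lnorm_absR; congr Lp_norm.
apply/funext => x; rewrite !patchE; case: ifPn => [/set_mem Ex|nE].
  case: ifPn => [/set_mem Ox|nO]; first by rewrite mem_set.
  by rewrite memNset// => -[_ /mem_set]; rewrite (negbTE nO).
by rewrite memNset// => -[/mem_set]; rewrite (negbTE nE).
Qed.

(** A positive weight makes each shell norm finite, and finitely many shells cover [K]; this gives
    the local part of membership in a Herz space. *)
Lemma hn_compact_Lp (f : X -> R) K J : measurable K -> measurable_fun setT f ->
  hn E W p q (fun x => `|f x|%:E) < +oo -> K `<=` \bigcup_(k in [set k | (k < J)%N]) E k ->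
  Lp_norm p (f \_ K) < +oo.
Proof.
move=> mK mf hf KE; rewrite -Lnorm_absR.
have mabs : measurable_fun setT (fun x => `|f x|%:E) by apply/measurable_EFinP; exact: measurableT_comp.
pose h k := (fun x => `|f x|%:E) \_ (E k).
have h0 k x : 0 <= h k x by rewrite /h patchE; case: ifP => // _; rewrite lee_fin.
have mh k : measurable_fun setT (h k) by exact: measurable_restr.
apply: (@le_lt_trans _ _ 'N[mu]_p%:E[(fun x => \sum_(0 <= k < J) h k x)]).
  apply: le_Lnorm => //; [exact: measurable_restr|exact: emeasurable_sum| |].
  - by move=> x; rewrite patchE; case: ifP => // _; rewrite lee_fin.
  - move=> x; rewrite patchE; case: ifPn => [|_]; last exact: sume_ge0.
    rewrite inE => /KE[k /= kJ Ex]; rewrite big_mkord (bigD1 (Ordinal kJ))//= {1}/h patchE mem_set//.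
    by rewrite leeDl//; apply: sume_ge0.
apply: le_lt_trans (Lnorm_sum_le mu J (ltW p1) mh h0) _.
apply: lte_sum_pinfty => k _; rewrite ltNge leye_eq; apply/negP => /eqP Noo.
have : (W k)%:E * 'N[mu]_p%:E[h k] <= hn E W p q (fun x => `|f x|%:E) by exact: shell_le_hn.
by rewrite Noo gt0_muley ?lte_fin// leye_eq => /eqP hoo; rewrite hoo in hf.
Qed.

End herz_bounds.

Lemma ell_geometric {R : realType} (s c q : R) : (0 < s)%R -> (0 <= c)%R -> (0 <= q < 1)%R ->
  exists C : R, (ell s (fun j => (c * q ^+ j)%:E) <= C%:E)%E.
Proof.
move=> s0 c0 /andP[q0 q1].
have qs : 0 <= q `^ s < 1.
  rewrite powR_ge0 /=; have [->|qn0] := eqVneq q 0; first by rewrite powR0 ?ltr01// gt_eqF.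
  have := gt0_ltr_powR s0 q0 ler01 q1; rewrite [1 `^ s](_ : _ = 1)//; by rewrite powR1.
exists ((c `^ s * (1 - q `^ s)^-1) `^ s^-1); rewrite -poweR_EFin.
rewrite le_eqVlt; apply/orP; left; apply/eqP; rewrite /ell; congr (_ `^ _)%E.
rewrite (eq_eseriesr (g := fun j => (c `^ s)%:E * ((q `^ s) ^+ j)%:E)%E) => [|j _].
  rewrite ge0_nneseriesZl ?lee_fin ?powR_ge0//; last by move=> j; rewrite lee_fin exprn_ge0// powR_ge0.
  by rewrite nneseries_geometric.
by rewrite poweR_EFin -EFinM powRM ?exprn_ge0// exprn_powR.
Qed.

Section abstract_main.
Context {R : realType} {n : nat}.
Notation X := 'rV[R]_n.
Notation mu := (lebesgue_rV n).
Implicit Types (x y w : X) (k j : nat).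
Variables (E : nat -> set X) (W : nat -> R) (p q : R) (m : nat) (Omega : set X).
Hypothesis n0 : (0 < n)%N.
Hypothesis m0 : (0 < m)%N.
Hypothesis mE : forall k, measurable (E k).
Hypothesis W0 : forall k, (0 < W k)%R.
Hypothesis p1 : (1 < p)%R.
Hypothesis q1 : (1 <= q)%R.
Hypothesis oO : open Omega.
Hypothesis cone : cone_condition Omega.
Hypothesis E_cover : forall x, x != 0%R -> exists k, E k x.
Local Open Scope ereal_scope.
Hypothesis hn_loc : forall K, exists2 C : R, (0 <= C)%R & forall F : X -> \bar R, measurable_fun setT F ->
  (forall x, 0 <= F x) -> \int[mu]_(x in cube K) F x <= C%:E * hn E W p q F.
Variable r1 : R.
Hypothesis r10 : (0 < r1)%R.
Hypothesis mult : forall r : R, (0 < r)%R -> (r <= r1)%R ->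
  exists2 C : R, (0 < C)%R & forall F G : X -> R,
  measurable_fun setT F -> measurable_fun setT G ->
  (forall x, (0 <= F x)%R) -> (forall x, (0 <= G x)%R) ->
  (forall k l, (0 < k)%N -> (0 < l)%N -> (m <= k + l)%N ->
    hn E W p q (fun x => pot k r (EFin \o F) x * pot l r (EFin \o G) x) <=
      C%:E * (hn E W p q (EFin \o F) * hn E W p q (EFin \o G))) /\
  (forall j x, E j x -> pot m r (EFin \o G) x <= C%:E * hn E W p q (EFin \o G)).

Lemma sob_banach_algebra :
  banach_algebra_of (sob E W p q m Omega) (fun f g => f = g %[ae mu in Omega]) (sobN E W p q m Omega).
Proof.
(* As [rho] will be at most [e], this gives [rho + e <= 1] and a final radius [m (rho + e)] at most
   [r1]. *)
pose e : R := Num.min (r1 / (2 * m%:R))%R (2^-1)%R.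
have mR : (0 < m%:R :> R)%R by rewrite ltr0n.
have e0 : (0 < e)%R by rewrite lt_min invr_gt0 ltr0n andbT divr_gt0// mulr_gt0.
have [rho' rho'0 cubes'] := cone_condition_cube cone e0.
pose rho : R := Num.min rho' e.
have rho0 : (0 < rho)%R by rewrite lt_min rho'0.
have re : (rho <= e)%R by rewrite ge_min lexx orbT.
have eh : (e <= 2^-1)%R by rewrite ge_min lexx orbT.
have er : (e <= r1 / (2 * m%:R))%R by rewrite ge_min lexx.
have rhoe : (rho + e <= 1)%R by lra.
have cubes : forall x, Omega x -> exists2 z, (`|z| <= e)%R &
    forall y t, (`|y - z| < rho)%R -> (0 <= t <= 1)%R -> Omega (x + t *: y)%R.
  move=> x /cubes'[z ze H]; exists z => // y t yz; apply: H.
  by apply: lt_le_trans yz _; rewrite ge_min lexx.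
have jp := jet_sum_pot m oO rho0 e0 rhoe cubes.
set r := (m%:R * (rho + e))%R in jp.
have r0 : (0 < r)%R by rewrite mulr_gt0// addr_gt0.
have rr1 : (r <= r1)%R.
  apply: (@le_trans _ _ (m%:R * (2 * (r1 / (2 * m%:R))))%R); first by apply: ler_wpM2l; [exact: ltW|rewrite mulr_natl mulr2n; exact: lerD (le_trans re er) er].
  by rewrite le_eqVlt; apply/orP; left; apply/eqP; field; rewrite gt_eqF.
split; last first.
  exact: (sob_product n0 mE W0 p1 q1 oO E_cover hn_loc m0 (mult r0 rr1) jp).
apply: banach_space_of_seminorm.
- exact: sob0.
- by move=> a f g; exact: sob_lin.
- exact: sobN_ge0.
- by move=> f; exact: sobN_lty.
- by move=> a f; exact: sobNZ.
- by move=> f g; exact: sobND.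
- move=> f g sf sg; have sfg := sob_lin mE W0 p1 q1 oO hn_loc (-1)%R sg sf.
  have := sobN_eq0 n0 mE W0 p1 q1 oO E_cover hn_loc sfg.
  move=> [h1 h2]; split=> [/h1|h].
    by apply: filterS => x /[apply] /eqP; rewrite mulN1r addrC subr_eq0 => /eqP.
  by apply: h2; apply: filterS h => x /[apply] ->; rewrite mulN1r addNr.
- by move=> u su Nu; exact: (sob_complete mE W0 p1 q1 oO hn_loc su Nu).
Qed.

End abstract_main.

(** * Dyadic shells *)

Section dyadic.
Context {R : realType} {n : nat}.
Notation X := 'rV[R]_n.
Notation mu := (lebesgue_rV n).
Implicit Types (x y w : X) (z : int) (k j : nat).

Lemma dballE z x : dball z x = (enorm x < 2 `^ z%:~R).
Proof. by rewrite /dball /= powR_intmul. Qed.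

Lemma dshellE z x : dshell z x <-> (2 `^ (z%:~R - 1) <= enorm x) /\ (enorm x < 2 `^ z%:~R).
Proof.
rewrite /dshell /setD /= -[dball z x]/(is_true (enorm x < 2 ^ z)) -[dball _ x]/(is_true (enorm x < 2 ^ (z - 1))).
have -> : z%:~R - 1 = (z - 1)%:~R :> R by rewrite intrB.
by rewrite -!powR_intmul// [in X in _ <-> X]leNgt; split=> -[h1 h2]; split => //; exact/negP.
Qed.

Lemma measurable_dball z : measurable (dball z : set X).
Proof.
rewrite (_ : dball z = (fun x : X => edot x x) @^-1` `]-oo, ((2 `^ z%:~R : R) ^+ 2)[%classic); last first.
  apply/seteqP; split => x; rewrite /= dballE in_itv /= -sqr_enorm => h.
    by rewrite ltr_sqr ?nnegrE ?powR_ge0 ?enorm_ge0.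
  by move: h; rewrite ltr_sqr ?nnegrE ?powR_ge0 ?enorm_ge0.
rewrite -[X in measurable X]setTI.
have mf : measurable_fun setT (fun x : X => edot x x).
  by apply: measurable_sum => i; apply: measurable_funM; exact: (@measurable_rV_coord _ R).
exact: mf.
Qed.

Lemma measurable_dshell z : measurable (dshell z : set X).
Proof. by apply: measurableD; exact: measurable_dball. Qed.

Lemma lebesgue_dball z : (mu (dball z) <= (((2 `^ z%:~R : R) *+ 2) ^+ n)%:E)%E.
Proof.
rewrite -lebesgue_nball ?powR_gt0//; apply: le_measure; rewrite ?inE.
- exact: measurable_dball.
- exact: measurable_nball.
- by move=> x; rewrite dballE => h; exact: le_lt_trans (norm_le_enorm x) h.
Qed.

Lemma lebesgue_dshell z : (mu (dshell z) <= (((2 `^ z%:~R : R) *+ 2) ^+ n)%:E)%E.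
Proof.
apply: le_trans (lebesgue_dball z); apply: le_measure; rewrite ?inE.
- exact: measurable_dshell.
- exact: measurable_dball.
- by move=> x [].
Qed.

(** The index is one more than the integer part of the binary logarithm of the norm, as the shell of
    index [z] starts at [2 ^ (z - 1)]. *)
Lemma dshell_cover x : x != 0 -> exists z, dshell z x.
Proof.
move=> x0; have e0 : 0 < enorm x by rewrite enorm_gt0.
pose a := ln (enorm x) / ln 2.
have ln2 : 0 < ln 2 :> R by rewrite ln_gt0// ltr1n.
have aE : 2 `^ a = enorm x.
  by rewrite /powR pnatr_eq0 /= /a divfK ?gt_eqF// lnK// posrE.
exists (Num.floor a + 1); apply/dshellE; rewrite intrD addrK -aE; split.
  by apply: ler_powR; [rewrite ler1n|exact: floor_le].
rewrite /powR !pnatr_eq0 /= ltr_expR ltr_pM2r// -[1]/(1%:~R) -intrD.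
by have /andP[] := floor_itv a.
Qed.

Lemma dshell_hat_cover x : exists k, dshell_hat k x.
Proof.
have [h|h] := ltP (enorm x) 1; first by exists 0%N; rewrite /dshell_hat /= dballE powRr0.
have x0 : x != 0 by rewrite -enorm_gt0; exact: lt_le_trans h.
have [z zx] := dshell_cover x0; have [_ hz] := (dshellE _ _).1 zx.
have : 0 < z.
  rewrite ltNge; apply/negP => z0.
  have : 2 `^ z%:~R <= 1 :> R.
    by have := @ler_powR R 2 (ler1n _ 2) z%:~R 0; rewrite powRr0; apply; rewrite lerz0.
  by rewrite leNgt (le_lt_trans h hz).
by case: z zx {hz} => [[|k]|k]// zx _; exists k.+1.
Qed.

Lemma measurable_dshell_hat k : measurable (dshell_hat k : set X).
Proof. by rewrite /dshell_hat; case: ifP => _; [exact: measurable_dball|exact: measurable_dshell]. Qed.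

Lemma enorm_dist x w (d : R) : n%:R * `|w| <= d -> enorm x - d <= enorm (x + w) <= enorm x + d.
Proof.
move=> wd; have ew := le_trans (enorm_le_norm w) wd.
apply/andP; split; last by apply: le_trans (enormD _ _) _; rewrite lerD2l.
have := enormD (x + w) (- w); rewrite addrK enormN; lra.
Qed.

End dyadic.

Section integers.
(** The enumeration 0, -1, 1, -2, 2, and so on, so that absolute values grow like [j / 2]. *)
Definition int_of_nat (j : nat) : int := if odd j then Negz j./2 else Posz j./2.
Definition nat_of_int (z : int) : nat := match z with Posz k => k.*2 | Negz k => k.*2.+1 end.

Lemma int_of_natK : cancel int_of_nat nat_of_int.
Proof.
move=> j; rewrite /int_of_nat /nat_of_int -[RHS]odd_double_half; case: (odd j) => //.
Qed.

Lemma nat_of_intK : cancel nat_of_int int_of_nat.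
Proof. by case=> k; rewrite /int_of_nat /nat_of_int /= odd_double /= ?doubleK// uphalf_double. Qed.

(** An integer of the enumeration that is at most [K] is at most [2 K - j / 2]; so a power decaying
    towards minus infinity becomes geometric in the position [j]. *)
Lemma geometric_int {R : realType} (d : R) (K j : nat) : 0 <= d -> int_of_nat j <= K%:Z ->
  2 `^ ((int_of_nat j)%:~R * d) <= 2 `^ (2 * K%:R * d) * (2^-1 `^ (d / 2)) ^+ j.
Proof.
move=> d0; rewrite -[X in _ <= _ * X]powR_mulrn ?powR_ge0// -powRrM.
have -> (c : R) : 2^-1 `^ c = 2 `^ (- c) by rewrite powRN -half_powR_inv invrK.
rewrite -powRD; last by apply/implyP.
move=> jK; apply: ler_powR; first by rewrite ler1n.
have H : (int_of_nat j)%:~R <= 2 * K%:R - j%:R / 2 :> R.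
  have jE : j%:R = (odd j)%:R + 2 * (j./2)%:R :> R by rewrite -{1}(odd_double_half j) natrD -mul2n natrM.
  rewrite jE; move: jK; rewrite /int_of_nat; case: (odd j) => /=.
    move=> _; rewrite NegzE mulrNz -pmulrn -[(j./2.+1)%:R]natr1.
    have := ler0n R K; move: (K%:R) (j./2%:R) => a b; lra.
  rewrite lez_nat -(ler_nat R) -pmulrn.
  by move: (K%:R) (j./2%:R) => a b; lra.
have := ler_wpM2r d0 H; move: ((int_of_nat j)%:~R) (K%:R) (j%:R) => a b c; lra.
Qed.

End integers.

Section ell_shift.
Context {R : realType}.
Implicit Types (a : nat -> \bar R) (s : R).
Local Open Scope ereal_scope.

Lemma ell_succ s a : (0 < s)%R -> (forall k, 0 <= a k) -> ell s (a \o succn) <= ell s a.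
Proof.
move=> s0 a0; apply: ge0_le_poweR; first by rewrite invr_ge0 ltW.
  by apply: nneseries_ge0 => k _ _; exact: poweR_ge0.
rewrite [leRHS](nneseries_split 0 1)//; last by move=> k _; exact: poweR_ge0.
rewrite add0n -[leLHS]add0e; apply: leeD; first by apply: sume_ge0 => k _; exact: poweR_ge0.
by rewrite -(@nneseries_addn _ (fun k => a k `^ s) 1)//; [under eq_eseriesr do rewrite /= -addn1; exact: lexx|move=> k; exact: poweR_ge0].
Qed.

(** [predn] takes the value 0 twice, so the sequence is repeated with one extra term [a 0], itself
    at most the norm. *)
Lemma ell_pred s a : (1 <= s)%R -> (forall k, 0 <= a k) -> ell s (a \o predn) <= 2%:E * ell s a.
Proof.
move=> s1 a0; have s0 : (0 < s)%R by exact: lt_le_trans s1.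
apply: (@le_of_poweR _ s) => //; [exact: ell_ge0|by rewrite mule_ge0// ?ell_ge0|].
rewrite poweR_ell// (nneseries_split 0 1)//; last by move=> k _; exact: poweR_ge0.
rewrite add0n big_mkord big_ord_recl big_ord0 addr0 /=.
rewrite -(@nneseries_addn _ (fun k => a k.-1 `^ s) 1)//; last by move=> k; exact: poweR_ge0.
have -> : \sum_(0 <= k <oo) (a (k + 1).-1 `^ s) = ell s a `^ s.
  by rewrite poweR_ell//; apply: eq_eseriesr => k _; rewrite addn1.
apply: (@le_trans _ _ (ell s a `^ s + ell s a `^ s)).
  by apply: leeD => //; apply: ge0_le_poweR; [exact: ltW|exact: a0|exact: ell_ub].
apply: le_trans (poweR_superadditive s1 (ell_ge0 _ _) (ell_ge0 _ _)) _.
by rewrite -mule2n -mule_natl.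
Qed.

End ell_shift.

(** * The inhomogeneous space *)

Section inhomogeneous.
Context {R : realType} {n : nat}.
Notation X := 'rV[R]_n.
Notation mu := (lebesgue_rV n).
Implicit Types (x y w : X) (k j : nat) (g : X -> R).
Variables (alpha p q : R) (m : nat) (Omega : set X).
Hypothesis n0 : (0 < n)%N.
Hypothesis p1 : 1 < p.
Hypothesis q1 : 1 <= q.
Hypothesis alpha0 : 0 <= alpha.
Hypothesis hm : n%:R / p + alpha < m%:R.
Hypothesis oO : open Omega.
Hypothesis cone : cone_condition Omega.

Notation W := (fun k : nat => 2 `^ (k%:R * alpha) : R).
Notation E := (@dshell_hat R n).

Let p0 : 0 < p. Proof. exact: lt_trans p1. Qed.
Let q0 : 0 < q. Proof. exact: lt_le_trans q1. Qed.
Let W0 k : 0 < W k. Proof. by rewrite powR_gt0. Qed.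
Let W_ge1 k : 1 <= W k.
Proof. by have := @ler_powR R 2 (ler1n _ 2) 0 (k%:R * alpha); rewrite powRr0; apply; rewrite mulr_ge0. Qed.
Let np0 : 0 <= n%:R / p. Proof. by rewrite divr_ge0// ltW. Qed.
Let m0 : (0 < m)%N.
Proof. by rewrite -(ltr_nat R); apply: le_lt_trans hm; rewrite addr_ge0. Qed.

Lemma dshell_hat0 x : E 0 x <-> enorm x < 1.
Proof. by rewrite /dshell_hat /= dballE powRr0. Qed.

Lemma dshell_hatS k x : E k.+1 x <-> (2 ^+ k <= enorm x) /\ (enorm x < 2 ^+ k.+1).
Proof.
have E2 : 2 `^ (k.+1%:Z)%:~R = 2 ^+ k.+1 :> R by rewrite -powR_mulrn.
have E1 : 2 `^ ((k.+1%:Z)%:~R - 1) = 2 ^+ k :> R.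
  by rewrite -[RHS]powR_mulrn//; congr (_ `^ _); rewrite -pmulrn -[(k.+1)%:R]natr1 addrK.
by rewrite /dshell_hat /=; split=> [/dshellE|h]; [|apply/dshellE]; rewrite E1 E2.
Qed.

(** For [k.+1] the chain is [k < 2 ^ k <= enorm x <= n * |x| < n * K]; a crude bound is enough. *)
Lemma dshell_hat_bounded K k x : E k x -> cube K x -> (k <= n * K)%N.
Proof.
case: k => // k /dshell_hatS[h _]; case: (posnP K) => [->|K0].
  by move=> /(_ (Ordinal n0)); rewrite in_itv/= !mxE oppr0 => /andP[a b]; have := lt_trans a b; rewrite ltxx.
rewrite cubeE// => xK; rewrite -(ltr_nat R) natrM.
apply: (@lt_le_trans _ _ (2 ^+ k)); first by rewrite -natrX ltr_nat ltn_expl.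
apply: le_trans h _; apply: le_trans (enorm_le_norm x) _.
by rewrite ler_wpM2l// ltW.
Qed.

Let nbh k x w : E k x -> n%:R * `|w| <= 2^-1 ->
  exists2 c, (c < 3)%N & E (nth 0 [:: k.-1; k; k.+1] c) (x + w).
Proof.
move=> Ex /(enorm_dist x) /andP[]; set u := enorm (x + w); set t := enorm x => u1 u2.
case: k Ex => [/dshell_hat0|[/dshell_hatS[]|k /dshell_hatS[]]]; rewrite -/t ?expr0 ?expr1.
- move=> t1; have [h|h] := ltP u 1; first by exists 1%N => //=; apply/dshell_hat0.
  by exists 2%N => //=; apply/dshell_hatS; rewrite expr0 expr1 -/u; split => //; lra.
- move=> t1 t2; have [h|h] := ltP u 1; first by exists 0%N => //=; apply/dshell_hat0.
  have [h'|h'] := ltP u 2; first by exists 1%N => //=; apply/dshell_hatS; rewrite expr0 expr1.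
  by exists 2%N => //=; apply/dshell_hatS; rewrite expr1 expr2 -/u; split => //; lra.
- have P1 : 1 <= 2 ^+ k :> R by rewrite exprn_ege1// ler1n.
  rewrite (exprS _ k.+1) (exprS _ k) => t1 t2; have [h|h] := ltP u (2 * 2 ^+ k).
    by exists 0%N => //=; apply/dshell_hatS; rewrite exprS -/u; split => //; lra.
  have [h'|h'] := ltP u (2 * (2 * 2 ^+ k)).
    by exists 1%N => //=; apply/dshell_hatS; rewrite !exprS -/u.
  by exists 2%N => //=; apply/dshell_hatS; rewrite !exprS -/u; split => //; lra.
Qed.

Let loc K : exists2 C : R, 0 <= C & forall F : X -> \bar R, measurable_fun setT F ->
  (forall x, (0 <= F x)%E) -> (\int[mu]_(x in cube K) F x <= C%:E * hn E W p q F)%E.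
Proof.
have Vfin : (mu (cube K : set X) < +oo)%E.
  apply: le_lt_trans (ltry ((K%:R *+ 2) ^+ n)); rewrite le_eqVlt; apply/orP; left; apply/eqP.
  exact: lebesgue_cube.
pose c1 := 1 + fine (mu (cube K) `^ (p / (p - 1))^-1)%E.
have V0 : (0 <= mu (cube K) `^ (p / (p - 1))^-1)%E by exact: poweR_ge0.
have Vc : (mu (cube K) `^ (p / (p - 1))^-1 <= c1%:E)%E.
  by rewrite EFinD fineK ?leeDr ?lee_fin// ge0_fin_numE//; exact: poweR_lty.
have c10 : 0 < c1 by rewrite ltr_pwDl// fine_ge0.
(* At least [c1] for [k <= n * K], the only shells that can meet the cube; the decay only makes the
   series converge. *)
pose t k := c1 * 2 ^+ (n * K) * 2^-1 ^+ k.
have t0 k : 0 < t k by rewrite !mulr_gt0// exprn_gt0// invr_gt0.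
have h01 : 0 <= (2^-1 : R) < 1 by rewrite invr_ge0 ler0n invf_lt1 ?ltr1n.
exists (c1 * 2 ^+ (n * K) * (1 - 2^-1)^-1).
  by rewrite !mulr_ge0 ?exprn_ge0 ?invr_ge0 ?ltW// subr_gt0; case/andP: h01.
move=> F mF F0; apply: (hn_local_integral p1 n0 (E := E) (W := W) _ W0 q1 _ (measurable_cube K) t0) => //.
- exact: measurable_dshell_hat.
- by move=> x _; exact: dshell_hat_cover.
- move=> k; have [kK|Kk] := leqP k (n * K); last first.
    rewrite (_ : E k `&` cube K = set0); last first.
      by apply/seteqP; split => // x [Ex cx]; have := dshell_hat_bounded Ex cx; rewrite leqNgt Kk.
    by rewrite measure0 poweR0r ?lee_fin ?mulr_ge0 ?ltW// invr_eq0 gt_eqF// divr_gt0// subr_gt0.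
  apply: (@le_trans _ _ (mu (cube K) `^ (p / (p - 1))^-1)%E).
    apply: ge0_le_poweR => //; first by rewrite invr_ge0 divr_ge0 ?subr_ge0 ?ltW.
    by apply: le_measure; rewrite ?inE; [apply: measurableI; [exact: measurable_dshell_hat|exact: measurable_cube]|exact: measurable_cube|move=> x []].
  apply: le_trans Vc _; rewrite lee_fin -[leLHS]mulr1; apply: ler_pM => //; first exact: ltW.
  rewrite /t -mulrA ler_peMr//; first exact: ltW.
  rewrite exprVn -expfB_cond ?exprn_ege1 ?ler1n//.
  by rewrite pnatr_eq0.
- rewrite /t (eq_eseriesr (g := fun k => (c1 * 2 ^+ (n * K))%:E * (2^-1 ^+ k)%:E)%E) => [|k _]; last by rewrite -EFinM.
  rewrite ge0_nneseriesZl; last 2 first.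
  - by rewrite lee_fin mulr_ge0 ?exprn_ge0// ltW.
  - by move=> k; rewrite lee_fin exprn_ge0.
  by rewrite nneseries_geometric// -EFinM.
Qed.

Lemma inhomogeneous_sob_banach_algebra :
  banach_algebra_of (sob E W p q m Omega) (fun f g => f = g %[ae mu in Omega]) (sobN E W p q m Omega).
Proof.
have nR : 0 < n%:R :> R by rewrite ltr0n.
have r10 : 0 < (2 * n%:R)^-1 :> R by rewrite invr_gt0 mulr_gt0.
apply: (sob_banach_algebra n0 m0 _ W0 p1 q1 oO cone _ loc r10).
- exact: measurable_dshell_hat.
- by move=> x _; exact: dshell_hat_cover.
move=> r r0 rr1.
have h01 : (0 <= (0 : R) <= 1) by rewrite lexx ler01.
(* Every shell is outer here, the unit ball included, so [B] is empty and [beta], [eta] and the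
   inner data are zero. The neighbours of [k] are [k.-1], [k] and [k.+1]. *)
apply: (@herz_mult R n E W p q (@measurable_dshell_hat R n) W0 p1 q1 0 0 (2 `^ alpha) r 0 0 m xpredT
  (fun c k => nth 0%N [:: k.-1; k; k.+1] c) set0 (fun=> 0) (fun=> 0) (fun=> 0)) => //.
- by rewrite mul0r.
- by rewrite add0r; apply: le_lt_trans hm; rewrite lerDl.
- rewrite mul0r !add0r ltr_pdivrMr ?ltr0n// mul1r; apply: le_lt_trans hm; by rewrite lerDl.
- case=> [|k].
    by apply: le_lt_trans (lebesgue_dball 0) (ltry _).
  by apply: le_lt_trans (lebesgue_dshell k.+1) (ltry _).
- move=> [|[|[|//]]] a _ a0 /=.
  + exact: ell_pred.
  + rewrite -{1}[ell q _]mul1e; apply: lee_wpmul2r; [exact: ell_ge0|by rewrite lee_fin ler1n].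
  + apply: (@le_trans _ _ (ell q a)); first exact: ell_succ.
    rewrite -{1}[ell q _]mul1e; apply: lee_wpmul2r; [exact: ell_ge0|by rewrite lee_fin ler1n].
- move=> c k _ c3; rewrite -powRD; last by apply/implyP.
  apply: ler_powR; first by rewrite ler1n.
  rewrite -[X in _ <= X + _]mul1r -mulrDl ler_wpM2r// -(natrD _ 1) ler_nat add1n.
  by case: c c3 => [|[|[|//]]] _ /=; rewrite ?leqSpred// ltnW// leqW.
- move=> k x w _ Ex wr; apply: nbh => //.
  rewrite -(ler_pdivlMl _ _ nR); apply: le_trans (ltW wr) _; apply: le_trans rr1 _.
  by rewrite invfM mulrC.
- move=> F mF F0; rewrite mul0e integral0_eq ?poweR0r ?invr_eq0 ?gt_eqF// => x _.
  by rewrite /weighted patchE memNset// mul0r powR0// gt_eqF.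
- rewrite /ell eseries0; last by move=> k _ _; rewrite /= powR0// gt_eqF.
  by rewrite poweR0r// invr_eq0 gt_eqF.
Qed.

Let dweightE k : ((W k `^ q)%:E = dweight alpha q k%:Z)%E.
Proof. by rewrite /dweight -powRrM. Qed.

(** The two norms combine the unit ball with the series differently, so only their finiteness is
    compared; the Sobolev norms agree exactly. *)
Lemma herzP g : herz alpha p q g <-> herz_fun E W p q g.
Proof.
have mhat : forall k, measurable (E k) by exact: measurable_dshell_hat.
pose a k := (dweight alpha q k%:Z * Lp_norm p (g \_ (E k)) `^ q)%E.
have a0 k : (0 <= a k)%E by rewrite mule_ge0 ?poweR_ge0// lee_fin powR_ge0.
have hnE : hn E W p q (fun x => `|g x|%:E)%E = ((\sum_(0 <= k <oo) a k) `^ q^-1)%E.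
  have -> : a = (fun k => (W k `^ q)%:E * Lp_norm p (g \_ (E k)) `^ q)%E.
    by apply/funext => k; rewrite dweightE.
  exact: (hn_series p E q W0 g).
have split1 : (\sum_(0 <= k <oo) a k = Lp_norm p (g \_ (dball 0)) `^ q +
    \sum_(1 <= k <oo) (dweight alpha q k%:Z * Lp_norm p (g \_ (dshell k%:Z)) `^ q))%E.
  rewrite (nneseries_split 0 1)// add0n big_mkord big_ord_recl big_ord0 addr0; congr (_ + _)%E.
    by rewrite /a /dweight !mul0r powRr0 mul1e.
  congr (limn _); apply/funext => N; apply: eq_big_nat => k /andP[k1 _].
  by rewrite /a /dshell_hat gtn_eqF.
have S0 : (0 <= \sum_(1 <= k <oo) (dweight alpha q k%:Z * Lp_norm p (g \_ (dshell k%:Z)) `^ q))%E.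
  by apply: nneseries_ge0 => k _ _; rewrite mule_ge0 ?poweR_ge0// lee_fin powR_ge0.
have iq : q^-1 != 0 by rewrite invr_eq0 gt_eqF.
have fin : (herz_norm alpha p q g < +oo)%E <-> (hn E W p q (fun x => `|g x|%:E) < +oo)%E.
  rewrite hnE split1 /herz_norm; split=> h.
    apply: poweR_lty; apply: lte_add_pinfty.
      by apply: poweR_lty; apply: le_lt_trans h; rewrite leeDl// poweR_ge0.
    by apply: (lty_poweRy iq); apply: le_lt_trans h; rewrite leeDr// Lnorm_ge0.
  have h' := lty_poweRy iq h; apply: lte_add_pinfty.
    have q0' : q != 0 by rewrite gt_eqF.
    by apply: (lty_poweRy q0'); apply: le_lt_trans h'; rewrite leeDl.
  by apply: poweR_lty; apply: le_lt_trans h'; rewrite leeDr// poweR_ge0.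
split=> [[[mg _] /fin]|[mg h]]; first by split.
split; last exact/fin; split => // K cK _.
have mK : measurable K by apply: closed_measurable_rV; apply: compact_closed => //; exact: norm_hausdorff.
have [k0 Kk0] := supp_bounded cK.
apply: (hn_compact_Lp p1 (E := E) (W := W) mhat W0 q1 (J := (n * k0).+1) mK mg h) => x Kx.
have [k Ek] := dshell_hat_cover x; exists k => //=.
by rewrite ltnS; apply: dshell_hat_bounded Ek _; exact: Kk0.
Qed.

Theorem herz_sobolev_banach_algebra :
  banach_algebra_of (herz_sobolev alpha p q m Omega) (fun f g => f = g %[ae mu in Omega])
    (herz_sobolev_norm alpha p q m Omega).
Proof.
have -> : herz_sobolev alpha p q m Omega = sob E W p q m Omega.
  apply/funext => f; apply/propext; rewrite /herz_sobolev /sob.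
  split=> -[h0 H]; split; do ?exact/herzP.
    by move=> b /H[g w hg]; exists g => //; exact/herzP.
  by move=> b /H[g w hg]; exists g => //; exact/herzP.
have -> : herz_sobolev_norm alpha p q m Omega = sobN E W p q m Omega.
  apply/funext => f; apply: etrans (esym (sobN_series p1 E q W0 m Omega f)).
  pose a k := (dweight alpha q k%:Z * sobolev_sum p m Omega (E k) f `^ (q / p))%E.
  have aE : a = (fun k => (W k `^ q)%:E * sobolev_sum p m Omega (E k) f `^ (q / p))%E.
    by apply/funext => k; rewrite dweightE.
  by rewrite -[LHS]/((\sum_(0 <= k <oo) a k) `^ q^-1)%E aE.
exact: inhomogeneous_sob_banach_algebra.
Qed.

End inhomogeneous.

(** * The homogeneous space *)

(* Near the origin the weight [|y| ^ (alpha + eps)] replaces [|y| ^ alpha]: this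
   leaves a factor [2 ^ (z * eps)] on the shell of index [z], summable for
   [z <= 0]. *)
Lemma homogeneous_exponents {R : realType} (N p alpha M : R) : 0 < N -> 1 < p -> 0 <= alpha ->
  alpha < N - N / p -> N / p + alpha < M ->
  exists2 eps : R, 0 < eps & [/\ (alpha + eps) * (p / (p - 1)) < N, alpha + eps + N / p < M,
    0 <= 2 * eps * p / N <= 1 & 2 * eps * p / N * (N / p) + (alpha + eps + N / p) / M < 1].
Proof.
move=> N0 p1 a0 aN aM; have p0 : 0 < p by exact: lt_trans p1.
have Np0 : 0 < N / p by rewrite divr_gt0.
have M0 : 0 < M by apply: le_lt_trans aM; rewrite addr_ge0// ltW.
have d1 : 0 < N - N / p - alpha by rewrite subr_gt0.
have d2 : 0 < M - N / p - alpha by rewrite -addrA -opprD subr_gt0.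
have M2 : 0 < 2 * M + 2 by rewrite addr_gt0// mulr_gt0.
(* The first bound gives integrability of the conjugate weight, the second both conditions involving
   [M], the third [eta <= 1]. *)
exists (Num.min ((N - N / p - alpha) / 2) (Num.min ((M - N / p - alpha) / (2 * M + 2)) (N / p / 2))).
  by rewrite !lt_min !divr_gt0.
set eps := Num.min _ _.
have e1 : eps <= (N - N / p - alpha) / 2 by rewrite ge_min lexx.
have e2 : eps <= (M - N / p - alpha) / (2 * M + 2) by rewrite !ge_min lexx !orbT.
have e3 : eps <= N / p / 2 by rewrite !ge_min lexx !orbT.
have e0 : 0 < eps by rewrite !lt_min !divr_gt0.
rewrite ler_pdivlMr// in e2.
have eM : 0 < eps * M by rewrite mulr_gt0.
split.
- rewrite mulrA ltr_pdivrMr ?subr_gt0// -ltr_pdivlMr//.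
  have -> : N * (p - 1) / p = N - N / p by field; rewrite gt_eqF.
  by move: e1 d1; move: (N / p) => u; lra.
- by move: e2 e0 eM d2; move: (N / p) => u; nra.
- apply/andP; split; first by rewrite divr_ge0 ?mulr_ge0 ?ltW.
  have -> : 2 * eps * p / N = eps / (N / p / 2) by field; rewrite !gt_eqF.
  by rewrite ler_pdivrMr ?mul1r// divr_gt0.
- have -> : 2 * eps * p / N * (N / p) = 2 * eps by field; rewrite !gt_eqF.
  have -> : 2 * eps + (alpha + eps + N / p) / M = (2 * eps * M + (alpha + eps + N / p)) / M.
    by field; rewrite !gt_eqF.
  rewrite ltr_pdivrMr// mul1r.
  by move: e2 e0 eM d2; move: (N / p) => u; nra.
Qed.

Section homogeneous.
Context {R : realType} {n : nat}.
Notation X := 'rV[R]_n.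
Notation mu := (lebesgue_rV n).
Implicit Types (x y w : X) (k j : nat) (g : X -> R) (z : int).
Variables (alpha p q : R) (m : nat) (Omega : set X).
Hypothesis n0 : (0 < n)%N.
Hypothesis p1 : 1 < p.
Hypothesis q1 : 1 <= q.
Hypothesis alpha0 : 0 <= alpha.
Hypothesis alphan : alpha < n%:R - n%:R / p.
Hypothesis hm : n%:R / p + alpha < m%:R.
Hypothesis oO : open Omega.
Hypothesis cone : cone_condition Omega.

Notation W := (fun j : nat => 2 `^ ((int_of_nat j)%:~R * alpha) : R).
Notation E := (fun j : nat => dshell (int_of_nat j) : set X).

Let p0 : 0 < p. Proof. exact: lt_trans p1. Qed.
Let q0 : 0 < q. Proof. exact: lt_le_trans q1. Qed.
Let W0 j : 0 < W j. Proof. by rewrite powR_gt0. Qed.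
Let nR : 0 < n%:R :> R. Proof. by rewrite ltr0n. Qed.
Let np0 : 0 <= n%:R / p. Proof. by rewrite divr_ge0// ltW. Qed.
Let m0 : (0 < m)%N.
Proof. by rewrite -(ltr_nat R); apply: le_lt_trans hm; rewrite addr_ge0. Qed.
Let mE j : measurable (E j). Proof. exact: measurable_dshell. Qed.
Let E_cover x : x != 0 -> exists j, E j x.
Proof. by move=> /dshell_cover[z zx]; exists (nat_of_int z); rewrite nat_of_intK. Qed.

Let two (a b : R) : 2 `^ (a + b) = 2 `^ a * 2 `^ b :> R.
Proof. by rewrite powRD//; apply/implyP. Qed.

Let two_mono (a b : R) : a <= b -> 2 `^ a <= 2 `^ b :> R.
Proof. by apply: ler_powR; rewrite ler1n. Qed.

Let half01 (d : R) : 0 < d -> 0 <= (2^-1 `^ d : R) < 1.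
Proof.
move=> d0; rewrite powR_ge0 /=.
have h : (2^-1 : R) < 1 by rewrite invf_lt1 ?ltr1n.
have h0 : 0 <= (2^-1 : R) by rewrite invr_ge0.
by have := gt0_ltr_powR d0 h0 (@ler01 R) h; rewrite powR1.
Qed.

Lemma dshell_bounded K z x : dshell z x -> cube K x -> z <= (n * K)%:Z.
Proof.
move=> /dshellE[h _] xK; rewrite leNgt; apply/negP => zK.
case: (posnP K) xK => [->|K0].
  by move=> /(_ (Ordinal n0)); rewrite in_itv/= !mxE oppr0 => /andP[a b]; have := lt_trans a b; rewrite ltxx.
rewrite cubeE// => /= xK.
have : 2 `^ (n * K)%:R < (n * K)%:R :> R.
  apply: (@le_lt_trans _ _ (enorm x)).
    apply: le_trans h; apply: two_mono; rewrite lerBrDr pmulrn.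
    by rewrite -(intrD _ (n * K)%:Z 1) ler_int lezD1.
  by apply: le_lt_trans (enorm_le_norm x) _; rewrite natrM ltr_pM2l.
by rewrite powR_mulrn// -natrX ltr_nat ltnNge ltnW// ltn_expl.
Qed.

Let loc K : exists2 C : R, 0 <= C & forall F : X -> \bar R, measurable_fun setT F ->
  (forall x, (0 <= F x)%E) -> (\int[mu]_(x in cube K) F x <= C%:E * hn E W p q F)%E.
Proof.
pose s : R := (p / (p - 1))^-1.
have s0 : 0 <= s by rewrite invr_ge0 divr_ge0// ?subr_ge0 ltW.
(* On the shell of index [z] the conjugate norm of the indicator is of order [2 ^ (z n / p')]
   against the weight [2 ^ (z alpha)]. The quotient [2 ^ (z d)] is summable towards the origin
   exactly because [alpha < n - n / p]. *)
have [d dE] : {d | d = n%:R * s - alpha} by exists (n%:R * s - alpha).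
have d0 : 0 < d.
  rewrite dE subr_gt0; apply: lt_le_trans alphan _; rewrite /s invf_div le_eqVlt; apply/orP; left.
  by apply/eqP; field; rewrite gt_eqF.
have [c1 c1E] : {c | c = 2 `^ (n%:R * s) * 2 `^ (2 * (n * K)%:R * d) :> R} by eexists.
have c10 : 0 < c1 by rewrite c1E mulr_gt0 ?powR_gt0.
have [h hE] : {h | h = 2^-1 `^ (d / 2) :> R} by eexists.
have h0 : 0 < h by rewrite hE powR_gt0 ?invr_gt0.
have h01 : 0 <= h < 1 by rewrite hE half01 ?divr_gt0.
exists (c1 * (1 - h)^-1).
  by rewrite mulr_ge0 ?invr_ge0 ?ltW// subr_gt0; case/andP: h01.
move=> F mF F0.
apply: (hn_local_integral p1 n0 mE W0 q1 E_cover (measurable_cube K) (t := fun j => c1 * h ^+ j)) => //.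
- by move=> j; rewrite mulr_gt0// exprn_gt0.
- move=> j; have [jK|jK] := leP (int_of_nat j) (n * K)%:Z; last first.
    rewrite (_ : E j `&` cube K = set0); last first.
      by apply/seteqP; split => // x [Ex cx]; have := dshell_bounded Ex cx; rewrite leNgt jK.
    rewrite measure0 poweR0r ?lee_fin ?mulr_ge0 ?exprn_ge0 ?powR_ge0 ?ltW//.
    by rewrite invr_eq0 gt_eqF// divr_gt0// subr_gt0.
  apply: (@le_trans _ _ ((((2 `^ (int_of_nat j)%:~R : R) *+ 2) ^+ n)%:E `^ s)%E).
    apply: ge0_le_poweR => //; apply: le_trans (lebesgue_dshell (int_of_nat j)).
    by apply: le_measure; rewrite ?inE; [apply: measurableI; [exact: mE|exact: measurable_cube]|exact: mE|move=> x []].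
  rewrite poweR_EFin lee_fin -powR_mulrn ?mulrn_wge0 ?powR_ge0// -powRrM.
  rewrite -[X in X `^ _]mulr_natl powRM ?powR_ge0// -powRrM c1E.
  rewrite [leRHS](_ : _ = 2 `^ (n%:R * s) * (2 `^ (2 * (n * K)%:R * d) * h ^+ j * W j)); last by ring.
  apply: ler_wpM2l; first exact: powR_ge0.
  have := geometric_int (ltW d0) jK; rewrite -hE => H.
  apply: le_trans (ler_wpM2r (powR_ge0 _ _) H).
  by rewrite -two -mulrDr dE subrK.
- rewrite (eq_eseriesr (g := fun j => (c1)%:E * (h ^+ j)%:E)%E) => [|k _]; last by rewrite -EFinM.
  rewrite ge0_nneseriesZl; last 2 first.
  - by rewrite lee_fin ltW.
  - by move=> k; rewrite lee_fin exprn_ge0// ltW.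
  by rewrite nneseries_geometric// -EFinM.
Qed.

(** The integer index is shifted by -1, 0 or 1 for [c] below 3. Being a bijection, the shift
    preserves [ell]. *)
Let sg c j := nat_of_int (int_of_nat j + c%:Z - 1).

Let sgE c j : int_of_nat (sg c j) = int_of_nat j + c%:Z - 1.
Proof. exact: nat_of_intK. Qed.

Let sg_bij c : bijective (sg c).
Proof.
exists (fun j => nat_of_int (int_of_nat j - c%:Z + 1)) => j; rewrite /sg nat_of_intK.
  by rewrite (_ : _ - 1 - _ + 1 = int_of_nat j) ?int_of_natK//; ring.
by rewrite (_ : _ + 1 + _ - 1 = int_of_nat j) ?int_of_natK//; ring.
Qed.

Let nbh j x w : 0 < int_of_nat j -> E j x -> n%:R * `|w| <= 2^-1 ->
  exists2 c, (c < 3)%N & E (sg c j) (x + w).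
Proof.
move=> j0 /dshellE[x1 x2] /(enorm_dist x) /andP[u1 u2].
have P1 : 1 <= 2 `^ ((int_of_nat j)%:~R - 1) :> R.
  by have := @two_mono 0 ((int_of_nat j)%:~R - 1); rewrite powRr0; apply; rewrite subr_ge0 ler1z.
have T (a : R) : 2 `^ (a + 1) = 2 * 2 `^ a :> R by rewrite two powRr1// mulrC.
move: x2 x1 P1; rewrite -{1}[(int_of_nat j)%:~R](subrK 1) T.
set P := 2 `^ _; set t := enorm x in u1 u2 *; set u := enorm (x + w) in u1 u2 * => x2 x1 P1.
have cE (c : nat) : ((int_of_nat j + c%:Z - 1)%:~R : R) = (int_of_nat j)%:~R - 1 + c%:R.
  by rewrite intrB intrD -pmulrn addrAC.
have PD (a : R) : 2 `^ ((int_of_nat j)%:~R - 1 + a) = 2 `^ a * P by rewrite two mulrC.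
have [h|h] := ltP u P.
  exists 0%N => //; apply/dshellE; rewrite sgE cE -addrA !PD add0r powRr0 powRN powRr1//.
  by rewrite -/u; split; lra.
have [h'|h'] := ltP u (2 * P).
  by exists 1%N => //; apply/dshellE; rewrite sgE cE -addrA !PD subrr powRr0 powRr1// mul1r.
exists 2%N => //; apply/dshellE; rewrite sgE cE -addrA !PD -[X in X - 1](natrD _ 1 1) natrD addrK powRr1//.
by rewrite (two 1 1) powRr1// -/u; split; lra.
Qed.

Let E_norm j x : E j x -> (2 * n%:R)^-1 * 2 `^ (int_of_nat j)%:~R <= `|x|.
Proof.
move=> /dshellE[h _]; rewrite ler_pdivrMl ?mulr_gt0//.
have := le_trans h (enorm_le_norm x).
rewrite two powRN powRr1// ler_pdivrMr// => H; apply: le_trans H _.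
by rewrite mulrC mulrA.
Qed.

Lemma homogeneous_sob_banach_algebra :
  banach_algebra_of (sob E W p q m Omega) (fun f g => f = g %[ae mu in Omega]) (sobN E W p q m Omega).
Proof.
have r10 : 0 < (2 * n%:R)^-1 :> R by rewrite invr_gt0 mulr_gt0.
apply: (sob_banach_algebra n0 m0 mE W0 p1 q1 oO cone E_cover loc r10) => r r0 rr1.
have wr w : `|w| < r -> n%:R * `|w| <= 2^-1.
  move=> wr; rewrite -(ler_pdivlMl _ _ nR); apply: le_trans (ltW wr) _; apply: le_trans rr1 _.
  by rewrite invfM mulrC.
have [eps e0 [h1 h2 h3 h4]] := homogeneous_exponents nR p1 alpha0 alphan hm.
have b0 : 0 < alpha + eps by rewrite ltr_wpDl.
have [c1 c1E] : {c | c = 2 `^ (2 * 1 * eps) :> R} by eexists.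
have c10 : 0 < c1 by rewrite c1E powR_gt0.
have [h hE] : {h | h = 2^-1 `^ (eps / 2) :> R} by eexists.
have h0 : 0 < h by rewrite hE powR_gt0 ?invr_gt0.
have h01 : 0 <= h < 1 by rewrite hE half01 ?divr_gt0.
have [c2 c2E] : {c | c = (((2 * n%:R)^-1 `^ (alpha + eps))^-1 * 2 `^ (2 * eps)) :> R} by eexists.
have c20 : 0 < c2 by rewrite c2E mulr_gt0 ?invr_gt0 ?powR_gt0.
have [Ct tC] := ell_geometric q0 (ltW c20) h01.
have E_up j x : E j x -> enorm x < 2 `^ (int_of_nat j)%:~R by move=> /dshellE[].
(* Outer shells have positive index. The inner ones lie in the unit ball, so their translates stay
   in [dball 1], of radius 2. The last three functions are the distance to the origin, the measure
   and the summable factor. *)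
apply: (@herz_mult R n E W p q mE W0 p1 q1 (alpha + eps) (2 * eps * p / n%:R) (2 `^ alpha) r
  (c1 * (1 - h)^-1) Ct m (fun j => 0 < int_of_nat j) sg (dball 1)
  (fun j => (2 * n%:R)^-1 * 2 `^ (int_of_nat j)%:~R)
  (fun j => ((2 `^ (int_of_nat j)%:~R : R) *+ 2) ^+ n) (fun j => c2 * h ^+ j)) => //.
- exact: ltW.
- by move=> j; apply: le_lt_trans (lebesgue_dshell _) (ltry _).
- by rewrite mulr_ge0 ?invr_ge0 ?ltW// subr_gt0; case/andP: h01.
- move=> c a _ a0; rewrite reindex_ell//.
  by rewrite -{1}[ell q _]mul1e; apply: lee_wpmul2r; [exact: ell_ge0|rewrite lee_fin ler1n].
- move=> c j _ _; rewrite -two; apply: two_mono; rewrite sgE -[X in _ <= X + _]mul1r -mulrDl ler_wpM2r//.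
  by rewrite intrB intrD addrCA addrC addrA subrr add0r lerDl ler0z.
- move=> j j0; have := @two_mono 0 ((int_of_nat j)%:~R * alpha); rewrite powRr0; apply.
  by rewrite mulr_ge0// ler0z ltW.
- by move=> j x w j0 Ex /wr; exact: nbh.
- exact: measurable_dball.
- move=> F mF F0; apply: (hn_weighted p1 mE W0 q1 E_cover (t := fun j => c1 * h ^+ j)) => //.
  + exact: measurable_dball.
  + by move=> j; rewrite mulr_ge0 ?exprn_ge0 ?ltW.
  + move=> j x Ex; rewrite dballE => Bx.
    (* A shell meeting the ball of radius 2 has index at most 1, so [geometric_int] applies with
       [K = 1]; hence the constant [c1]. *)
    have j1 : int_of_nat j <= 1%:Z.
      rewrite leNgt; apply/negP => j2; have [/= h' _] := (dshellE _ _).1 Ex.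
      have : 2 `^ 1 < 2 `^ 1 :> R; last by rewrite ltxx.
      apply: le_lt_trans Bx; apply: le_trans h'; apply: two_mono.
      by rewrite lerBrDr -(intrD _ 1 1) ler_int lezD1.
    apply: (@le_trans _ _ ((2 `^ (int_of_nat j)%:~R) `^ (alpha + eps))).
      apply: ge0_ler_powR; rewrite ?nnegrE ?powR_ge0//; first exact: ltW.
      by apply: le_trans (norm_le_enorm x) _; exact/ltW/E_up.
    rewrite -powRrM mulrDr addrC two; apply: ler_wpM2r; first exact: powR_ge0.
    by rewrite c1E hE; exact: (geometric_int (ltW e0) j1).
  + rewrite (eq_eseriesr (g := fun j => (c1)%:E * (h ^+ j)%:E)%E) => [|k _]; last by rewrite -EFinM.
    rewrite ge0_nneseriesZl; last 2 first.
    - by rewrite lee_fin ltW.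
    - by move=> k; rewrite lee_fin exprn_ge0// ltW.
    by rewrite nneseries_geometric// -EFinM.
- by move=> j; rewrite mulr_ge0 ?exprn_ge0 ?ltW.
- move=> j x w; rewrite -leNgt => j0 Ex /wr /(enorm_dist x) /andP[_ u2]; rewrite dballE.
  have := @two_mono (int_of_nat j)%:~R 0; rewrite powRr0 lerz0 => /(_ j0) H.
  by have := lt_le_trans (E_up _ _ Ex) H; rewrite powRr1//; move: u2; lra.
- move=> j; rewrite -leNgt => j0; split.
  + by rewrite mulr_gt0 ?powR_gt0.
  + by rewrite exprn_gt0// mulrn_wgt0// powR_gt0.
  + by move=> x; exact: E_norm.
  + exact: lebesgue_dshell.
  (* The exponents of 2 add up to [z alpha - z (alpha + eps) + 2 eps z = z eps]; the factors free of
     [z] form [c2]. *)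
  + have H := @geometric_int R eps 0 j (ltW e0) j0.
    rewrite mulr0 mul0r powRr0 mul1r -hE in H.
    apply: le_trans (ler_wpM2l (ltW c20) H); rewrite le_eqVlt; apply/orP; left; apply/eqP.
    rewrite -powR_mulrn ?mulrn_wge0 ?powR_ge0// -powRrM.
    have -> : n%:R * (2 * eps * p / n%:R / p) = 2 * eps by field; rewrite !gt_eqF.
    rewrite -[X in X `^ (2 * eps)]mulr_natl !powRM ?powR_ge0 ?invr_ge0 ?mulr_ge0//.
    rewrite invfM -!powRrM c2E -[X in _ * (_ * X * _)]powRN.
    set A := (_ `^ _)^-1; set Z : R := (int_of_nat j)%:~R.
    rewrite [LHS](_ : _ = A * 2 `^ (2 * eps) * (2 `^ (Z * alpha) * 2 `^ (- (Z * (alpha + eps))) * 2 `^ (Z * (2 * eps)))).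
      by rewrite -!two; congr (_ * 2 `^ _); ring.
    by ring.
Qed.

Let int_bij : set_bij [set: nat] [set: int] int_of_nat.
Proof. by rewrite setTT_bijective; exists nat_of_int; [exact: int_of_natK|exact: nat_of_intK]. Qed.

Lemma esum_int (a : int -> \bar R) : (forall z, (0 <= a z)%E) ->
  (\esum_(z in [set: int]) a z = \sum_(0 <= j <oo) a (int_of_nat j))%E.
Proof. by move=> a0; rewrite nneseries_esumT// (reindex_esum [set: nat] [set: int] int_of_nat). Qed.

Let dweightE j : ((W j `^ q)%:E = dweight alpha q (int_of_nat j))%E.
Proof. by rewrite /dweight -powRrM. Qed.

Let dweight_ge0 z : (0 <= dweight alpha q z)%E.
Proof. by rewrite lee_fin powR_ge0. Qed.

Lemma hherz_norm_hn g : hherz_norm alpha p q g = hn E W p q (fun x => `|g x|%:E)%E.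
Proof.
apply: etrans (esym (hn_series p E q W0 g)).
rewrite /hherz_norm esum_int; last by move=> z; rewrite mule_ge0 ?poweR_ge0.
pose a j := (dweight alpha q (int_of_nat j) * Lp_norm p (g \_ (E j)) `^ q)%E.
have aE : a = (fun j => (W j `^ q)%:E * Lp_norm p (g \_ (E j)) `^ q)%E.
  by apply/funext => j; rewrite dweightE.
by rewrite -[LHS]/((\sum_(0 <= j <oo) a j) `^ q^-1)%E aE.
Qed.

(** A compact set avoiding the origin stays outside a ball about it, which bounds the shell indices
    from below as well. *)
Lemma compact_dshells (K : set X) : compact K -> K `<=` ~` [set 0] ->
  exists J, K `<=` \bigcup_(j in [set j | (j < J)%N]) E j.
Proof.
move=> cK K0; have [k0 Kk0] := supp_bounded cK.
have clK : closed K by apply: compact_closed => //; exact: norm_hausdorff.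
have /nbhs_ballP[e /= e0 eK] : nbhs (0 : X) (~` K).
  by apply: open_nbhs_nbhs; split; [exact: closed_openC|move=> /K0; exact].
have [M eM] : exists M, 2^-1 ^+ M <= e.
  exists (Num.truncn e^-1).+1; rewrite exprVn invf_ple ?posrE ?exprn_gt0//; apply: ltW.
  apply: lt_le_trans (truncnS_gt _) _; by rewrite -natrX ler_nat ltnW// ltn_expl.
(* Indices from [- M] to [n * k0] have positions in the enumeration below this number. *)
exists (M + n * k0).*2.+1 => x Kx.
have x0 : x != 0 by apply/eqP => x0; exact: (K0 x Kx).
have [z zx] := dshell_cover x0; exists (nat_of_int z); rewrite /= ?nat_of_intK//.
have := dshell_bounded zx (Kk0 x Kx).
case: z zx => k zx /=; first by rewrite lez_nat => kn; rewrite ltnS leq_double (leq_trans kn)// leq_addl.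
move=> _; rewrite ltnS ltn_double; apply: leq_trans (leq_addr _ _).
rewrite ltnNge; apply/negP => Mk; have [_ zx2] := (dshellE _ _).1 zx.
have : e < e; last by rewrite ltxx.
apply: (@le_lt_trans _ _ `|x|).
  rewrite leNgt; apply/negP => xe; apply: (eK x) Kx.
  by rewrite -ball_normE /= sub0r normrN.
apply: le_lt_trans (norm_le_enorm x) _; apply: lt_le_trans zx2 _; apply: le_trans eM.
rewrite -powR_mulrn ?invr_ge0// -[2^-1 `^ _]invrK half_powR_inv -powRN; apply: two_mono.
by rewrite NegzE mulrNz -pmulrn lerN2 ler_nat ltnW.
Qed.

(** Measurability off the origin extends to the whole space because a point is measurable; local
    [L^p] integrability away from 0 follows from finitely many shells. *)
Lemma hherzP g : hherz alpha p q g <-> herz_fun E W p q g.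
Proof.
rewrite /hherz hherz_norm_hn; split=> -[mg h]; split => //.
  rewrite -(setUv [set 0]); apply/measurable_funU.
  - exact: closed_measurable_rV (compact_closed (@norm_hausdorff _ _) (@compact_set1 _ _)).
  - apply: measurableC; exact: closed_measurable_rV (compact_closed (@norm_hausdorff _ _) (@compact_set1 _ _)).
  by split; [exact: measurable_fun_set1|case: mg].
split; first exact: measurable_funTS.
move=> K cK K0; have [J KJ] := compact_dshells cK K0.
have mK : measurable K by apply: closed_measurable_rV; apply: compact_closed => //; exact: norm_hausdorff.
exact: (hn_compact_Lp p1 mE W0 q1 mK mg h KJ).
Qed.

Theorem hherz_sobolev_banach_algebra :
  banach_algebra_of (hherz_sobolev alpha p q m Omega) (fun f g => f = g %[ae mu in Omega])
    (hherz_sobolev_norm alpha p q m Omega).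
Proof.
have -> : hherz_sobolev alpha p q m Omega = sob E W p q m Omega.
  apply/funext => f; apply/propext; rewrite /hherz_sobolev /sob.
  split=> -[h0 H]; split; do ?exact/hherzP.
    by move=> b /H[g w hg]; exists g => //; exact/hherzP.
  by move=> b /H[g w hg]; exists g => //; exact/hherzP.
have -> : hherz_sobolev_norm alpha p q m Omega = sobN E W p q m Omega.
  apply/funext => f; apply: etrans (esym (sobN_series p1 E q W0 m Omega f)).
  rewrite /hherz_sobolev_norm esum_int; last by move=> z; rewrite mule_ge0 ?poweR_ge0.
  pose a j := (dweight alpha q (int_of_nat j) * sobolev_sum p m Omega (E j) f `^ (q / p))%E.
  have aE : a = (fun j => (W j `^ q)%:E * sobolev_sum p m Omega (E j) f `^ (q / p))%E.
    by apply/funext => j; rewrite dweightE.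
  by rewrite -[LHS]/((\sum_(0 <= j <oo) a j) `^ q^-1)%E aE.
exact: homogeneous_sob_banach_algebra.
Qed.

End homogeneous.

Unset Implicit Arguments.
Set Strict Implicit.

Theorem theorem4p1 (R : realType) (n : nat) (Omega : set 'rV[R]_n) (m : nat)
    (p r alpha : R) (hn : (0 < n)%N)
    (hOmega : domain Omega) (hcone : cone_condition Omega)
    (hp : 1 < p) (hr : 1 <= r)
    (halpha : 0 <= alpha < n%:R - n%:R / p)
    (hm : n%:R / p + alpha < m%:R) :
  let ae_eq_Omega (f g : 'rV[R]_n -> R) :=
    f = g %[ae (lebesgue_rV n) in Omega] in
  banach_algebra_of (herz_sobolev alpha p r m Omega) ae_eq_Omega
    (herz_sobolev_norm alpha p r m Omega) /\
  banach_algebra_of (hherz_sobolev alpha p r m Omega) ae_eq_Omega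
    (hherz_sobolev_norm alpha p r m Omega).
Proof.
have [_ oO _] := hOmega; have [alpha0 alphan] := andP halpha.
by split; [exact: herz_sobolev_banach_algebra|exact: hherz_sobolev_banach_algebra].
Qed.
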